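(* Let $n\ge1$ and let $d\ge1$ be odd and square-free. Then the residue $\omega_{Q_{n,d}}:=\operatorname{Res}_{s=n}E_{Q_{n,d}}(s,g)$ equals $\omega_{Q_n}\prod_{p\mid d}\epsilon^{(p)}_n(n)$, where $$\omega_{Q_n}=\begin{cases}\frac{2^{\frac n2-1}-(1-(-1)^{\frac n4})2^{-1}}{1-2^{-1-\frac n2}}\frac{\Gamma(\frac{n+2}{4})^2}{\Gamma(\frac{n+1}{2})\Gamma(\frac12)}\frac{\xi(\frac n2)}{\xi(n)\xi(\frac n2+1)} & n\equiv0\ (4),\\ 2^{\frac n2}\frac{\Gamma(\frac n4)\Gamma(\frac n4+1)}{\Gamma(\frac{n+1}{2})\Gamma(\frac12)}\frac{L^*(\frac n2,\chi_{-4})}{\xi(n)L^*(\frac n2+1,\chi_{-4})} & n\equiv2\ (4),\\ \frac{2^{\frac{n-1}{2}}+(-1)^{\frac{n^2-1}{8}}}{1+(-1)^{\frac{n^2-1}{8}}2^{-\frac{n+1}{2}}}\frac{\Gamma(\frac{n+1}{4})\Gamma(\frac{n+3}{4})}{\Gamma(\frac{n+1}{2})\Gamma(\frac12)}\frac{1}{\xi(n+1)} & n\text{ odd},\ n>1,\\ \frac4\pi & n=1,\end{cases}$$ and for odd primes $p\mid d$: $\epsilon^{(p)}_n(s)=\frac{p^{n-1}-p^{\frac n2-1}+p^{n-s}-p^{2n-1-2s}}{1-p^{\frac n2-1-s}}$ if $n\equiv0\ (4)$; $\frac{p^{n-1}-\chi_{-4}(p)p^{\frac n2-1}+p^{n-s}-p^{2n-1-2s}}{1-p^{\frac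 n2-1-s}}$ if $n\equiv2\ (4)$; $\frac{\chi_{-4}(p)p^{\frac{n-1}{2}}+p^{n-1}+p^{n-s}-p^{2n-1-2s}}{1+\chi_{-4}(p)p^{\frac{n-1}{2}-s}}$ if $n\equiv1\ (4)$; $\frac{p^{\frac{n-1}{2}}+p^{n-1}+p^{n-s}-p^{2n-1-2s}}{1+p^{\frac{n-1}{2}-s}}$ if $n\equiv3\ (4)$.
   Context: $Q_{n,d}(\bm v)=\sum_{j=1}^{n+1}v_j^2-d^2v_{n+2}^2$, $G$ the identity component of $\mathrm{SO}_{Q_{n,d}}(\mathbb R)$ (right action on row vectors), $\mathcal V^+=\{\bm v\ne0:Q_{n,d}(\bm v)=0,v_{n+2}>0\}$. For $\Re s>n$, $E_{Q_{n,d}}(s,g)=(1+d^2)^{s/2}\sum_{\bm v\in\mathcal V^+\cap\mathbb Z^{n+2}_{\rm pr}}\|\bm vg\|^{-s}$ (Euclidean norm); it continues meromorphically with a simple pole at $s=n$ whose residue is a constant. $\xi(s)=\pi^{-s/2}\Gamma(s/2)\zeta(s)$, $L^*(s,\chi_{-4})=(\pi/4)^{-\frac{s+1}{2}}\Gamma(\frac{s+1}{2})L(s,\chi_{-4})$, $\chi_{-4}$ the nontrivial character mod 4.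
   Formalization: For n≡2 (mod 4) the denominator of ε_n^{(p)}(s) is corrected to 1−χ_{-4}(p)p^{n/2−1−s}; as printed, without χ_{-4}(p), the formula fails for p≡3 (mod 4): for n=2, d=3 the true factor is 21/5, not 21/4. *)

(* Defs.v *)
(* MathComp / MathComp-Analysis, over an arbitrary R : realType. *)
From mathcomp Require Export all_boot all_order all_algebra.
From mathcomp Require Export all_classical all_reals all_analysis.
From mathcomp Require Export complex.
From mathcomp Require summability.

Set Implicit Arguments.
Unset Strict Implicit.
Unset Printing Implicit Defensive.

Import Order.TTheory GRing.Theory Num.Theory.
Import numFieldNormedType.Exports.

Local Open Scope classical_set_scope.
Local Open Scope ring_scope.
Local Open Scope complex_scope.

Definition squarefree (d : nat) : Prop :=
  forall p : nat, prime p -> ~~ (p ^ 2 %| d)%N.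

Section ComplexAnalysis.
Variable R : realType.

(* x ^ s = exp (s ln x), for x > 0 and s complex. *)
Definition cpow (x : R) (s : R[i]) : R[i] :=
  let t := complex.Im s * ln x in
  (x `^ complex.Re s)%:C * (cos t +i* sin t).

(* R[i]^o is R[i] seen as a normed space over itself, so that [derivable]
   is complex differentiability.  The value of F at a pole is irrelevant. *)
Definition holomorphic_at (h : R[i]^o -> R[i]^o) (a : R[i]^o) : Prop :=
  \forall z \near a, derivable h z 1.

Definition meromorphic_at (F : R[i]^o -> R[i]^o) (a : R[i]^o) : Prop :=
  exists (k : nat) (h : R[i]^o -> R[i]^o),
    holomorphic_at h a /\ \forall z \near a^', F z = h z / (z - a) ^+ k.

Definition meromorphic (F : R[i]^o -> R[i]^o) : Prop :=
  forall a : R[i]^o, meromorphic_at F a.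

(* r is the coefficient of (z - a)^-1 in the Laurent expansion of F at a. *)
Definition is_residue (F : R[i]^o -> R[i]^o) (a : R[i]^o) (r : R[i]) : Prop :=
  exists (m : nat) (c : nat -> R[i]) (h : R[i]^o -> R[i]^o),
    holomorphic_at h a /\
    \forall z \near a^',
      F z = r / (z - a) + \sum_(2 <= k < m) c k / (z - a) ^+ k + h z.

End ComplexAnalysis.

Section Eisenstein.
Variables (R : realType) (n d : nat).

(* The coordinates v_1, ..., v_(n+2) have the indices 0, ..., n.+1. *)
Definition Qform (v : 'rV[R]_n.+2) : R :=
  \sum_(j < n.+1) v 0 (widen_ord (leqnSn n.+1) j) ^+ 2
  - d%:R ^+ 2 * v 0 ord_max ^+ 2.

Definition SO_Q : set 'M[R]_n.+2 :=
  [set g | \det g = 1 /\ forall v : 'rV[R]_n.+2, Qform (v *m g) = Qform v].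

Definition G_Q : set 'M[R]_n.+2 := connected_component SO_Q 1%:M.

Definition light_cone : set 'rV[R]_n.+2 :=
  [set v | [/\ v != 0, Qform v = 0 & 0 < v 0 ord_max]].

Definition primitive (v : 'rV[int]_n.+2) : bool :=
  \big[gcdn/0%N]_(j < n.+2) `|v 0%R j|%N == 1%N.

(* Points of Z^(n+2)_pr lying on V^+. *)
Definition cone_lattice : set 'rV[int]_n.+2 :=
  [set v | primitive v /\ light_cone (map_mx intr v)].

Definition eucl_norm (v : 'rV[R]_n.+2) : R :=
  Num.sqrt (\sum_(j < n.+2) v 0 j ^+ 2).

(* [summability.sum] is the unconditional sum, the limit of the partial sums
   along finite subsets ordered by inclusion. *)
Definition eisenstein_series (g : 'M[R]_n.+2) (s : R[i]) : R[i] :=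
  cpow (1 + d%:R ^+ 2) (s / 2%:R) *
  summability.sum (fun v : 'rV[int]_n.+2 =>
    (if v \in cone_lattice
     then cpow (eucl_norm (map_mx intr v *m g)) (- s) else 0) : R[i]^o).

(* F is the meromorphic continuation to the complex plane of s |-> E(s, g),
   initially given by the series for Re s > n. *)
Definition is_eisenstein_continuation (g : 'M[R]_n.+2)
    (F : R[i]^o -> R[i]^o) : Prop :=
  meromorphic F /\
  forall s : R[i], n%:R < complex.Re s -> F s = eisenstein_series g s.

End Eisenstein.

(* The special functions occur below at real points of convergence only:
   Gamma at x > 0, zeta at s > 1, and L(s, chi_(-4)) at s > 0 (with
   conditional convergence at s = 1, the case n = 2). *)
Section SpecialFunctions.
Variable R : realType.

Definition Gamma (x : R) : R :=
  \int[lebesgue_measure]_(t in `]0, +oo[) (t `^ (x - 1) * expR (- t)).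

Definition chi4 (k : nat) : R :=
  if (k %% 4 == 1)%N then 1 else if (k %% 4 == 3)%N then -1 else 0.

Definition zeta (s : R) : R :=
  limn (series (fun k : nat => (k.+1%:R : R) `^ (- s))).

Definition Lchi4 (s : R) : R :=
  limn (series (fun k : nat => chi4 k.+1 * (k.+1%:R : R) `^ (- s))).

Definition xi (s : R) : R := pi `^ (- s / 2) * Gamma (s / 2) * zeta s.

Definition Lstar_chi4 (s : R) : R :=
  (pi / 4) `^ (- ((s + 1) / 2)) * Gamma ((s + 1) / 2) * Lchi4 s.

Definition omegaQ (n : nat) : R :=
  let x : R := n%:R in
  if (n %% 4 == 0)%N then
    (2 `^ (x / 2 - 1) - (1 - (-1) ^+ (n %/ 4)) * 2^-1)
      / (1 - 2 `^ (- 1 - x / 2))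
    * (Gamma ((x + 2) / 4) ^+ 2 / (Gamma ((x + 1) / 2) * Gamma (1 / 2)))
    * (xi (x / 2) / (xi x * xi (x / 2 + 1)))
  else if (n %% 4 == 2)%N then
    2 `^ (x / 2)
    * (Gamma (x / 4) * Gamma (x / 4 + 1)
        / (Gamma ((x + 1) / 2) * Gamma (1 / 2)))
    * (Lstar_chi4 (x / 2) / (xi x * Lstar_chi4 (x / 2 + 1)))
  else if n == 1%N then 4 / pi
  else
    (2 `^ ((x - 1) / 2) + (-1) ^+ ((n ^ 2 - 1) %/ 8)%N)
      / (1 + (-1) ^+ ((n ^ 2 - 1) %/ 8)%N * 2 `^ (- ((x + 1) / 2)))
    * (Gamma ((x + 1) / 4) * Gamma ((x + 3) / 4)
        / (Gamma ((x + 1) / 2) * Gamma (1 / 2)))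
    * (1 / xi (x + 1)).

(* For n = 2 mod 4 the character chi_(-4)(p) belongs in the denominator as
   well as in the numerator.  With 1 - p^(n/2-1-s) there instead, the residue
   formula fails for p = 3 mod 4: for n = 2 and d = 3 the counting function of
   a^2 + b^2 + c^2 = 9 m^2 gives the factor 21/5, not 21/4. *)
Definition epsilon (n p : nat) (s : R) : R :=
  let x : R := n%:R in
  let q : R := p%:R in
  let common : R := q `^ (x - 1) + q `^ (x - s) - q `^ (2 * x - 1 - 2 * s) in
  if (n %% 4 == 0)%N then
    (common - q `^ (x / 2 - 1)) / (1 - q `^ (x / 2 - 1 - s))
  else if (n %% 4 == 2)%N then
    (common - chi4 p * q `^ (x / 2 - 1))
      / (1 - chi4 p * q `^ (x / 2 - 1 - s))
  else if (n %% 4 == 1)%N then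
    (common + chi4 p * q `^ ((x - 1) / 2))
      / (1 + chi4 p * q `^ ((x - 1) / 2 - s))
  else
    (common + q `^ ((x - 1) / 2)) / (1 + q `^ ((x - 1) / 2 - s)).

End SpecialFunctions.

(* Main.v *)
(* Since the continuation is meromorphic, its residue at n can be read off the
   limit of (s - n) E(s, g) along real s -> n+ (Goursat, Cauchy's formula and
   division by z - n show that this limit determines the polar part).

   Let c be the last column of g and w(v) = v c.  On the cone
   |vg| = (1 + d^2)^(1/2) w(v).  Multiplying by zeta(s) replaces primitive
   points by all integral points v = (a, x, m); with b = d m - x these
   correspond to the pairs (b, a), b >= 1, with 2db | |a|^2 + b^2, up to the
   points with b = 0, which do not contribute to the residue.  Completing the
   square gives w = (b / lam) (1 + |lam a / (2db) + mu|^2), so that E(s, g)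
   becomes a sum over b and over the solutions r of |r|^2 + b^2 = 0 modulo 2db
   of b^(-s) Phi_s(r / (2db)), where Phi_s is Z^n-periodic.  On average over b
   these r are equidistributed, because their exponential sums are small for
   nonzero frequencies; a Fejer kernel turns this into the statement that Phi_s
   may be replaced by its mean, an explicit integral.  What remains is the
   Dirichlet series of N(b) = #{r mod 2db : 2db | |r|^2 + b^2}.  It has an Euler
   product: the local factors at odd p follow from counting solutions of
   quadratic congruences and give zeta and L values together with epsilon^(p)
   for p | d, while the factor at 2 comes from counting modulo 8. *)

Require Import Defs.
From mathcomp Require Import ring lra zify measurable_realfun.
From mathcomp Require finfield.

Set Implicit Arguments.
Unset Strict Implicit.
Unset Printing Implicit Defensive.

Import Order.TTheory GRing.Theory Num.Theory.
Import numFieldNormedType.Exports.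

(** * Counting solutions of quadratic congruences *)

Section FfunSums.
Variable V : nmodType.
Local Open Scope ring_scope.

(** The case n = 1 shapes the limit statements. There the series of N(b) contains zeta(2s - 1)
    besides zeta(s - n + 1) and has a double pole at s = 1, while the division by zeta(s) that
    returns to primitive points cancels one order. Limits are therefore taken of (s - n) D(s) /
    zeta(s), and the contribution of the nonzero frequencies need only be O(zeta(s)), since the
    factor (s - n) / zeta(s) makes it vanish. For n = 1 the exponential sums modulo b prime to the
    frequency are at most 1. For n >= 2 it suffices to gain one factor p over the trivial bound
    modulo p itself: prime powers keep the trivial bound, and the Euler product of the bounds
    already converges at s = n. Sums over b and over lattice points have nonnegative terms and are
    taken in the extended reals, so rearrangements are free and finiteness comes from closed forms
    or majorants. The dependence on n modulo 4 comes at odd p from a recursion that adds two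
    coordinates at a time and brings in chi_(-4)(p), and at 2 from the powers of 1 + i. *)

Lemma sum_ffun_bij (I T U : finType) (h : T -> U) (F : (I -> U) -> V) :
  injective h -> (#|U| <= #|T|)%N ->
  \sum_(a : {ffun I -> U}) F a = \sum_(t : {ffun I -> T}) F (h \o t).
Proof.
move=> hi hc; have [g gh hg] := inj_card_bij hi hc.
rewrite (reindex (fun t : {ffun I -> T} => [ffun i => h (t i)])) /=.
  by apply: eq_bigr => t _; congr F; apply: funext => i; rewrite ffunE.
exists (fun a : {ffun I -> U} => [ffun i => g (a i)]) => t _; apply/ffunP => i;
  by rewrite !ffunE ?gh ?hg.
Qed.

Lemma sum_ffun_pair (I A B : finType) (F : (I -> A * B) -> V) :
  \sum_(t : {ffun I -> A * B}) F t =
  \sum_(x : {ffun I -> A}) \sum_(y : {ffun I -> B}) F (fun i => (x i, y i)).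
Proof.
rewrite pair_big /=.
rewrite (reindex (fun k : {ffun I -> A} * {ffun I -> B} => [ffun i => (k.1 i, k.2 i)])) /=.
  by apply: eq_bigr => t _; congr F; apply: funext => i; rewrite ffunE.
exists (fun t : {ffun I -> A * B} => ([ffun i => (t i).1], [ffun i => (t i).2])).
  by move=> [x y] _; congr (_, _); apply/ffunP => i; rewrite !ffunE.
by move=> t _; apply/ffunP => i; rewrite !ffunE; case: (t i).
Qed.

Definition finsert (T : Type) n (i0 : 'I_n.+1) (x : T) (a : 'I_n -> T) (i : 'I_n.+1) : T :=
  if unlift i0 i is Some j then a j else x.

Lemma sum_ffun_insert (T : finType) n (i0 : 'I_n.+1) (F : ('I_n.+1 -> T) -> V) :
  \sum_(a : {ffun 'I_n.+1 -> T}) F a =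
  \sum_(x : T) \sum_(a : {ffun 'I_n -> T}) F (finsert i0 x a).
Proof.
rewrite pair_big /=.
rewrite (reindex (fun k : T * {ffun 'I_n -> T} => [ffun i => finsert i0 k.1 k.2 i])) /=.
  by apply: eq_bigr => t _; congr F; apply: funext => i; rewrite ffunE.
exists (fun a : {ffun 'I_n.+1 -> T} => (a i0, [ffun i => a (lift i0 i)])).
  move=> [x a] _ /=; congr (_, _); first by rewrite ffunE /finsert unlift_none.
  by apply/ffunP => i; rewrite !ffunE /finsert liftK.
move=> a _; apply/ffunP => i; rewrite !ffunE /finsert /=.
by case: unliftP => [j ->|->]; rewrite ?ffunE.
Qed.

Lemma sum_ffun0 (T : finType) (F : ('I_0 -> T) -> V) (a0 : 'I_0 -> T) :
  \sum_(a : {ffun 'I_0 -> T}) F a = F a0.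
Proof.
rewrite (bigD1 [ffun i => a0 i]) //= big1 ?addr0.
  by congr F; apply: funext => -[].
by move=> a /eqP[]; apply/ffunP => -[].
Qed.

Lemma sum_ffun_lift n m q (F : ('I_n -> nat) -> V) :
  \sum_(a : {ffun 'I_n -> 'I_(m * q)}) F (fun i => a i) =
  \sum_(x : {ffun 'I_n -> 'I_m}) \sum_(y : {ffun 'I_n -> 'I_q})
    F (fun i => x i + m * y i)%N.
Proof.
have lt (k : 'I_m * 'I_q) : (k.1 + m * k.2 < m * q)%N.
  case: k => x y /=; apply: leq_trans (_ : m + m * y <= _)%N; first by rewrite ltn_add2r.
  by rewrite -mulnS leq_mul2l ltn_ord orbT.
pose h k := Ordinal (lt k).
have hi : injective h.
  move=> [x y] [x' y'] /(congr1 val) /= E; have m0 : (0 < m)%N by apply: leq_ltn_trans (ltn_ord x).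
  have Ex : x = x' :> nat.
    have := congr1 (modn^~ m) E; rewrite /= !(mulnC m) ![(_ + _ * m)%N]addnC !modnMDl.
    by rewrite !modn_small.
  have Ey : y = y' :> nat by apply/eqP; rewrite -(eqn_pmul2l m0) -(eqn_add2l x) {2}Ex E.
  by congr (_, _); apply: val_inj.
rewrite (@sum_ffun_bij _ _ _ h (fun a => F (fun i => a i))) //; last first.
  by rewrite card_prod !card_ord.
by rewrite (@sum_ffun_pair _ _ _ (fun t => F (fun i => h (t i)))).
Qed.

(** Residues are combined as q x + m y rather than with idempotents. The map stays linear, so sums
    of squares only pick up unit factors q^2 and m^2, and additive characters split without
    inverses. *)
Lemma sum_ffun_crt n m q (F : ('I_n -> nat) -> V) : coprime m q ->
  \sum_(a : {ffun 'I_n -> 'I_(m * q)}) F (fun i => a i) =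
  \sum_(x : {ffun 'I_n -> 'I_m}) \sum_(y : {ffun 'I_n -> 'I_q})
    F (fun i => (q * x i + m * y i) %% (m * q))%N.
Proof.
move=> mq.
have lt (k : 'I_m * 'I_q) : ((q * k.1 + m * k.2) %% (m * q) < m * q)%N.
  case: k => x y /=; rewrite ltn_mod muln_gt0.
  by rewrite (leq_ltn_trans _ (ltn_ord x)) // (leq_ltn_trans _ (ltn_ord y)).
pose h k := Ordinal (lt k).
have hi : injective h.
  move=> [x y] [x' y'] /(congr1 val) /= E.
  have Em := congr1 (modn^~ m) E; have Eq := congr1 (modn^~ q) E.
  rewrite !(modn_dvdm _ (dvdn_mulr _ (dvdnn m))) in Em.
  rewrite !(modn_dvdm _ (dvdn_mull _ (dvdnn q))) in Eq.
  rewrite !(mulnC m) !(addnC (q * _)%N) !modnMDl in Em.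
  rewrite !(mulnC q) !modnMDl in Eq.
  have cancel d u (a b : 'I_d) : coprime d u -> (u * a = u * b %[mod d])%N -> a = b :> nat.
    wlog ab : a b / (a <= b)%N.
      by move=> H; case/orP: (leq_total a b) => ab du E'; [exact: H|apply/esym; apply: H].
    move=> du /esym/eqP; rewrite eqn_mod_dvd ?leq_mul2l ?ab ?orbT // -mulnBr Gauss_dvdr //.
    move=> db; apply/eqP; rewrite eqn_leq ab /= -subn_eq0; apply: contraTT db => nz.
    by rewrite gtnNdvd // ?lt0n //; apply: leq_ltn_trans (ltn_ord b); exact: leq_subr.
  congr (_, _); apply: val_inj; first exact: (cancel m q).
  by apply: (cancel q m) => //; rewrite coprime_sym.
rewrite (@sum_ffun_bij _ _ _ h (fun a => F (fun i => a i))) //; last first.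
  by rewrite card_prod !card_ord.
by rewrite (@sum_ffun_pair _ _ _ (fun t => F (fun i => h (t i)))).
Qed.

Lemma scale_ord_subproof m u (k : 'I_m) : ((u * k) %% m < m)%N.
Proof. by rewrite ltn_mod (leq_ltn_trans _ (ltn_ord k)). Qed.

Definition scale_ord m u (k : 'I_m) : 'I_m := Ordinal (scale_ord_subproof u k).

Lemma scale_ord_inj m u : coprime m u -> injective (@scale_ord m u).
Proof.
move=> mu x y /(congr1 val) /= E; apply: val_inj.
have cancel d (a b : 'I_d) : coprime d u -> (u * a = u * b %[mod d])%N -> a = b :> nat.
  wlog ab : a b / (a <= b)%N.
    by move=> H; case/orP: (leq_total a b) => ab du E'; [exact: H|apply/esym; apply: H].
  move=> du /esym/eqP; rewrite eqn_mod_dvd ?leq_mul2l ?ab ?orbT // -mulnBr Gauss_dvdr //.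
  move=> db; apply/eqP; rewrite eqn_leq ab /= -subn_eq0; apply: contraTT db => nz.
  by rewrite gtnNdvd // ?lt0n //; apply: leq_ltn_trans (ltn_ord b); exact: leq_subr.
exact: cancel.
Qed.

Lemma sum_ffun_scale n m u (F : ('I_n -> nat) -> V) : coprime m u ->
  \sum_(a : {ffun 'I_n -> 'I_m}) F (fun i => a i) =
  \sum_(a : {ffun 'I_n -> 'I_m}) F (fun i => (u * a i) %% m)%N.
Proof.
by move=> mu; rewrite (@sum_ffun_bij _ _ _ _ (fun a : 'I_n -> 'I_m => F (fun i => a i)) (scale_ord_inj mu)).
Qed.

Lemma sum_ord_scale m u (F : nat -> V) : coprime m u ->
  \sum_(x < m) F x = \sum_(x < m) F ((u * x) %% m)%N.
Proof. by move=> mu; rewrite (reindex_inj (scale_ord_inj mu)). Qed.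

End FfunSums.

(** * Solutions of |a|^2 + c = 0 modulo m *)

Section QuadricCount.

Definition sqs n (a : 'I_n -> nat) : nat := \sum_i a i ^ 2.

Definition qcount n m c : nat :=
  \sum_(a : {ffun 'I_n -> 'I_m}) (m %| sqs (fun i => a i) + c).

Lemma sqs_mod n m (a b : 'I_n -> nat) : (forall i, a i = b i %[mod m]) ->
  sqs a = sqs b %[mod m].
Proof.
move=> ab; rewrite /sqs -modn_summ -[RHS]modn_summ; congr (_ %% m).
by apply: eq_bigr => i _; rewrite -modnXm ab modnXm.
Qed.

Lemma dvdn_mod m a b : a = b %[mod m] -> (m %| a) = (m %| b).
Proof. by rewrite /dvdn => ->. Qed.

Lemma qcount_mod n m c c' : c = c' %[mod m] -> qcount n m c = qcount n m c'.
Proof.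
move=> cc; apply: eq_bigr => a _; congr nat_of_bool; apply: dvdn_mod.
by rewrite -modnDmr cc modnDmr.
Qed.

Lemma qcount0 m c : qcount 0 m c = (m %| c).
Proof.
rewrite /qcount; have a0 : 'I_0 -> 'I_m by case.
rewrite (@sum_ffun0 _ _ (fun a : 'I_0 -> 'I_m => nat_of_bool (m %| sqs (fun i => a i) + c)) a0).
by rewrite /sqs big_ord0.
Qed.

Lemma qcountS n m c : qcount n.+1 m c = \sum_(x < m) qcount n m (x ^ 2 + c).
Proof.
rewrite /qcount (@sum_ffun_insert _ _ _ ord0 (fun a : 'I_n.+1 -> 'I_m => nat_of_bool (m %| sqs (fun i => a i) + c))).
apply: eq_bigr => x _; apply: eq_bigr => a _; congr (nat_of_bool (m %| _)).
rewrite /sqs big_ord_recl /finsert unlift_none addnA [in RHS](addnC _ (x ^ 2)).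
by congr (_ + _ + _); apply: eq_bigr => i _; rewrite liftK.
Qed.

Lemma count_shift m s : 0 < m -> \sum_(t < m) (m %| s + t) = 1.
Proof.
move=> m0; have lt : (m - s %% m) %% m < m by rewrite ltn_mod.
rewrite (bigD1 (Ordinal lt)) //= big1 ?addn0.
  rewrite /dvdn modnDmr -modnDml subnKC ?modnn //.
  by rewrite ltnW // ltn_mod.
move=> t /eqP tn; apply/eqP; rewrite eqb0; apply/negP => h; apply: tn.
apply: val_inj => /=; have tm := ltn_ord t.
move: h; rewrite /dvdn -modnDml; set r := s %% m.
have sm : r < m by rewrite ltn_mod.
have [->|s0] := posnP r.
  by rewrite add0n modn_small // => /eqP ->; rewrite subn0 modnn.
move=> h; rewrite (@modn_small (m - r)); last by lia.
have : r + t < m + m by lia.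
move: h; rewrite -/(m %| r + t) => /dvdnP[k E]; rewrite E.
case: k E => [|[|k]] E; lia.
Qed.

Lemma count_affine m s c : 0 < m -> coprime m c -> \sum_(t < m) (m %| s + c * t) = 1.
Proof.
move=> m0 mc; rewrite -(count_shift s m0) (sum_ord_scale (fun t => nat_of_bool (m %| s + t)) mc).
by apply: eq_bigr => t _; rewrite /dvdn modnDmr.
Qed.

Lemma qcount_total n m c : 0 < m -> \sum_(t < m) qcount n m (t + c) = m ^ n.
Proof.
move=> m0; rewrite exchange_big /= (eq_bigr (fun=> 1)); last first.
  move=> a _; rewrite -(count_shift (sqs (fun i => a i) + c) m0); apply: eq_bigr => t _.
  by rewrite addnAC addnA.
by rewrite sum1_card card_ffun !card_ord.
Qed.

Lemma eq_fun_mod n m (f g : 'I_n -> nat) c : (forall i, f i = g i %[mod m]) ->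
  (m %| sqs f + c) = (m %| sqs g + c).
Proof. by move=> fg; apply: dvdn_mod; rewrite -modnDml (sqs_mod fg) modnDml. Qed.

Lemma sqsZ n u (a : 'I_n -> nat) : sqs (fun i => u * a i) = u ^ 2 * sqs a.
Proof. by rewrite /sqs big_distrr; apply: eq_bigr => i _; rewrite expnMn. Qed.

Lemma qcount_scale n m u c : coprime m u ->
  \sum_(a : {ffun 'I_n -> 'I_m}) (m %| u ^ 2 * sqs (fun i => a i) + c) = qcount n m c.
Proof.
move=> mu; rewrite /qcount.
rewrite (@sum_ffun_scale _ n m u (fun a => nat_of_bool (m %| sqs a + c))) //.
apply: eq_bigr => a _; congr nat_of_bool; rewrite -sqsZ.
by apply: eq_fun_mod => i; rewrite modn_mod.
Qed.

(** Rescaling the solutions by the unit u absorbs the square factor of c. *)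
Lemma qcount_sqr_coprime n m u c : coprime m u -> qcount n m (u ^ 2 * c) = qcount n m c.
Proof.
move=> mu; rewrite -(qcount_scale n (u ^ 2 * c) mu); apply: eq_bigr => a _.
by rewrite -mulnDr Gauss_dvdr // coprimeXr.
Qed.

Lemma sqs_crt n m q c (x y : 'I_n -> nat) : coprime m q ->
  (m * q %| sqs (fun i => (q * x i + m * y i) %% (m * q)) + c) =
  (m %| q ^ 2 * sqs x + c) && (q %| m ^ 2 * sqs y + c).
Proof.
move=> mq; rewrite Gauss_dvd //; congr (_ && _); rewrite -sqsZ; apply: eq_fun_mod => i.
  by rewrite modn_dvdm ?dvdn_mulr // (mulnC m) addnC modnMDl.
by rewrite modn_dvdm ?dvdn_mull // (mulnC q) modnMDl.
Qed.

Lemma qcount_crt n m q c : coprime m q -> qcount n (m * q) c = qcount n m c * qcount n q c.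
Proof.
move=> mq; rewrite {1}/qcount.
rewrite (@sum_ffun_crt _ n m q (fun a => nat_of_bool (m * q %| sqs a + c))) //.
rewrite -(@qcount_scale n m q) // -(@qcount_scale n q m); last by rewrite coprime_sym.
rewrite big_distrlr /=; apply: eq_bigr => x _; apply: eq_bigr => y _.
by rewrite sqs_crt // mulnb.
Qed.

End QuadricCount.

(** * Primitive solutions and their lifting to higher prime powers *)

Section PrimitiveCounts.

Definition pcount n m p : nat :=
  \sum_(a : {ffun 'I_n -> 'I_m}) ((m %| sqs (fun i => a i)) && [exists i, ~~ (p %| a i)]).

Lemma sum_nat_lift n m q (F : ('I_n -> nat) -> nat) :
  \sum_(a : {ffun 'I_n -> 'I_(m * q)}) F (fun i => a i) =
  \sum_(x : {ffun 'I_n -> 'I_m}) \sum_(y : {ffun 'I_n -> 'I_q}) F (fun i => x i + m * y i).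
Proof. exact: sum_ffun_lift. Qed.

Lemma sum_nat_eqm n m m' (F : ('I_n -> nat) -> nat) : m = m' ->
  \sum_(a : {ffun 'I_n -> 'I_m}) F (fun i => a i) =
  \sum_(a : {ffun 'I_n -> 'I_m'}) F (fun i => a i).
Proof. by move=> ->. Qed.

Lemma sqs_lift n m (x y : 'I_n -> nat) :
  sqs (fun i => x i + m * y i) = sqs x + (2 * m) * (\sum_i x i * y i) + m ^ 2 * sqs y.
Proof.
rewrite /sqs !big_distrr -!big_split /=; apply: eq_bigr => i _; ring.
Qed.

Lemma lin_count n p s (c : 'I_n.+1 -> nat) i0 : prime p -> ~~ (p %| c i0) ->
  \sum_(t : {ffun 'I_n.+1 -> 'I_p}) (p %| s + \sum_i c i * t i) = p ^ n.
Proof.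
move=> pp pc.
rewrite (@sum_ffun_insert _ _ _ i0 (fun t : 'I_n.+1 -> 'I_p => nat_of_bool (p %| s + \sum_i c i * t i))).
rewrite exchange_big /= (eq_bigr (fun=> 1)) ?sum1_card ?card_ffun ?card_ord // => a _.
rewrite -(@count_affine p (s + \sum_i c (lift i0 i) * a i) (c i0)) ?prime_gt0 ?prime_coprime //.
apply: eq_bigr => x _; rewrite (bigD1_ord i0) //= /finsert unlift_none.
rewrite addnA addnAC; congr (nat_of_bool (_ %| _ + _ + _)).
by apply: eq_bigr => i _; rewrite liftK.
Qed.

Lemma pcount_prim_sum n m p (x : {ffun 'I_n -> 'I_m}) : [exists i, ~~ (p %| x i)] = ~~ [forall i, p %| x i].
Proof. by rewrite negb_forall. Qed.

(** Hensel lifting: if |x|^2 = k p^j, then x + p^j y is a solution modulo p^(j+1) exactly when p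
    divides k + 2 x.y. For odd p and primitive x this is a nonzero linear condition on y modulo p,
    with p^n solutions among n + 1 coordinates. *)
Lemma pcountS n p j : prime p -> odd p -> 0 < j ->
  pcount n.+1 (p ^ j.+1) p = p ^ n * pcount n.+1 (p ^ j) p.
Proof.
move=> pp podd j0; rewrite /pcount expnSr.
pose F (a : 'I_n.+1 -> nat) := nat_of_bool ((p ^ j * p %| sqs a) && [exists i, ~~ (p %| a i)]).
rewrite (@sum_nat_lift _ _ _ F) big_distrr /=; apply: eq_bigr => x _.
have pj : p %| p ^ j by rewrite dvdn_exp.
have exE (y : {ffun 'I_n.+1 -> 'I_p}) :
    [exists i, ~~ (p %| x i + p ^ j * y i)] = [exists i, ~~ (p %| x i)].
  by apply: eq_existsb => i; rewrite dvdn_addl // dvdn_mulr.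
under eq_bigr => y _ do rewrite /F exE.
have [/existsP[i0 pi0]|_] := boolP [exists i, ~~ (p %| x i)]; last first.
  by rewrite andbF muln0 big1 // => y _; rewrite andbF.
rewrite andbT; under eq_bigr => y _ do rewrite andbT sqs_lift.
have [/dvdnP[k kE]|nd] := boolP (p ^ j %| sqs (fun i => x i)); last first.
  rewrite muln0 big1 // => y _; apply/eqP; rewrite eqb0; apply: contra nd => h.
  have : p ^ j %| sqs (fun i => x i) + (2 * p ^ j) * (\sum_i x i * y i) + (p ^ j) ^ 2 * sqs (fun i => y i).
    by apply: dvdn_trans h; rewrite dvdn_mulr.
  have D1 : p ^ j %| 2 * p ^ j * \sum_i x i * y i by rewrite mulnAC dvdn_mull.
  have D2 : p ^ j %| (p ^ j) ^ 2 * sqs (fun i => y i) by rewrite -mulnn -mulnA dvdn_mulr.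
  by rewrite -addnA dvdn_addl // dvdn_add.
rewrite muln1 -(@lin_count n p k (fun i => 2 * x i) i0) //; last first.
  by rewrite Euclid_dvdM // negb_or pi0 andbT dvdn_prime2 //; apply/eqP => pE; rewrite pE in podd.
apply: eq_bigr => y _; rewrite kE; congr nat_of_bool.
have -> : k * p ^ j + 2 * p ^ j * (\sum_i x i * y i) + (p ^ j) ^ 2 * sqs (fun i => y i)
   = p ^ j * (k + \sum_i 2 * x i * y i + p ^ j * sqs (fun i => y i)).
  have -> : \sum_i 2 * x i * y i = 2 * \sum_i x i * y i.
    by rewrite big_distrr; apply: eq_bigr => i _; rewrite /= mulnA.
  ring.
rewrite dvdn_pmul2l ?expn_gt0 ?prime_gt0 // dvdn_addl // dvdn_mulr //.
Qed.

(** A solution that is not primitive is p y with p^j dividing |y|^2, where y matters modulo p^(j+1);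
    each class of y modulo p^j has p^n such lifts. *)
Lemma qcount_primitive n p j : 0 < p ->
  qcount n (p ^ j.+2) 0 = pcount n (p ^ j.+2) p + p ^ n * qcount n (p ^ j) 0.
Proof.
move=> p0.
have -> : qcount n (p ^ j.+2) 0 = pcount n (p ^ j.+2) p +
   \sum_(a : {ffun 'I_n -> 'I_(p ^ j.+2)}) ((p ^ j.+2 %| sqs (fun i => a i)) && [forall i, p %| a i]).
  rewrite /qcount /pcount -big_split /=; apply: eq_bigr => a _; rewrite addn0 pcount_prim_sum.
  by case: (_ %| _) => //=; case: [forall i, _].
congr addn.
have -> : p ^ j.+2 = p * p ^ j.+1 by rewrite expnS.
pose F (a : 'I_n -> nat) := nat_of_bool ((p * p ^ j.+1 %| sqs a) && [forall i, p %| a i]).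
rewrite (@sum_nat_lift _ _ _ F) (bigD1 [ffun i => Ordinal p0]) //= [X in _ + X = _]big1 ?addn0.
  have -> : \sum_(y : {ffun 'I_n -> 'I_(p ^ j.+1)}) F (fun i => [ffun=> Ordinal p0] i + p * y i)
     = \sum_(y : {ffun 'I_n -> 'I_(p ^ j.+1)}) (p ^ j %| sqs (fun i => y i)).
    apply: eq_bigr => y _; rewrite /F.
    have -> : (fun i : 'I_n => [ffun=> Ordinal p0] i + p * y i) = (fun i => p * y i).
      by apply: funext => i; rewrite ffunE.
    have -> : [forall i : 'I_n, p %| [ffun=> Ordinal p0] i + p * y i].
      by apply/forallP => i; rewrite ffunE dvdn_mulr.
    rewrite andbT sqsZ; move: (sqs (fun i => y i)) => T.
    by rewrite expnS mulnA mulnn dvdn_pmul2l // expn_gt0 p0.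
  rewrite (sum_nat_eqm (fun a => nat_of_bool (p ^ j %| sqs a)) (expnSr p j)).
  rewrite (@sum_nat_lift _ _ _ (fun a => nat_of_bool (p ^ j %| sqs a))) /qcount big_distrr /=.
  apply: eq_bigr => x _; rewrite addn0 (eq_bigr (fun=> (p ^ j %| sqs (fun i => x i)) : nat)).
    by rewrite sum_nat_const card_ffun !card_ord.
  move=> y _; rewrite sqs_lift; congr nat_of_bool.
  have D1 : p ^ j %| 2 * p ^ j * \sum_i x i * y i by rewrite mulnAC dvdn_mull.
  have D2 : p ^ j %| (p ^ j) ^ 2 * sqs (fun i => y i) by rewrite -mulnn -mulnA dvdn_mulr.
  by rewrite -addnA dvdn_addl // dvdn_add.
move=> x /eqP x0; apply: big1 => y _; apply/eqP; rewrite /F eqb0 negb_and; apply/orP; right.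
apply/negP => /forallP h; apply: x0; apply/ffunP => i; apply: val_inj; rewrite ffunE /=.
have := h i; rewrite dvdn_addl ?dvdn_mulr // => /dvdnP[k E].
have := ltn_ord (x i); rewrite E; case: (k) => [|k']; first by rewrite mul0n.
by rewrite mulSn ltnNge leq_addr.
Qed.

Lemma qcount_primitive1 n p : 1 < p -> qcount n p 0 = pcount n p p + 1.
Proof.
move=> p1; have p0 : 0 < p by exact: ltnW.
have -> : qcount n p 0 = pcount n p p +
   \sum_(a : {ffun 'I_n -> 'I_p}) ((p %| sqs (fun i => a i)) && [forall i, p %| a i]).
  rewrite /qcount /pcount -big_split /=; apply: eq_bigr => a _; rewrite addn0 pcount_prim_sum.
  by case: (_ %| _) => //=; case: [forall i, _].
congr addn; rewrite (bigD1 [ffun i => Ordinal p0]) //= big1 ?addn0.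
  have -> : [forall i : 'I_n, p %| [ffun=> Ordinal p0] i].
    by apply/forallP => i; rewrite ffunE.
  by rewrite /sqs big1 ?dvdn0 // => i _; rewrite ffunE.
move=> x /eqP x0; apply/eqP; rewrite eqb0 negb_and; apply/orP; right.
apply/negP => /forallP h; apply: x0; apply/ffunP => i; apply: val_inj; rewrite ffunE /=.
have := h i => /dvdnP[k E].
have := ltn_ord (x i); rewrite E; case: (k) => [|k']; first by rewrite mul0n.
by rewrite mulSn ltnNge leq_addr.
Qed.

(* Modulo 2^j with j >= 3, a residue x modulo 2^(j-1) already determines
   whether 2^j divides the sum of squares. *)
Lemma pcount2_half n j : 1 < j ->
  pcount n (2 ^ j) 2 = 2 ^ n * \sum_(x : {ffun 'I_n -> 'I_(2 ^ j.-1)})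
     ((2 ^ j %| sqs (fun i => x i)) && [exists i, ~~ (2 %| x i)]).
Proof.
case: j => [|[|j]] // _ /=; rewrite /pcount.
have E : 2 ^ j.+2 = 2 ^ j.+1 * 2 by rewrite expnSr.
pose F (a : 'I_n -> nat) := nat_of_bool ((2 ^ j.+2 %| sqs a) && [exists i, ~~ (2 %| a i)]).
rewrite -[LHS]/(\sum_(a : {ffun 'I_n -> 'I_(2 ^ j.+2)}) F (fun i => a i)) (sum_nat_eqm F E).
rewrite (@sum_nat_lift _ _ _ F) big_distrr /=; apply: eq_bigr => x _.
rewrite (eq_bigr (fun=> F (fun i => x i))) ?sum_nat_const ?card_ffun ?card_ord //.
move=> y _; rewrite /F sqs_lift; congr (nat_of_bool (_ && _)).
  have D2 : 2 ^ j.+2 %| (2 ^ j.+1) ^ 2 * sqs (fun i => y i).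
    by apply: dvdn_mulr; rewrite -expnM dvdn_exp2l // muln2 -addnn addSnnS leq_addl.
  have D1 : 2 ^ j.+2 %| 2 * 2 ^ j.+1 * \sum_i x i * y i by rewrite -expnS dvdn_mulr.
  by rewrite -addnA dvdn_addl // dvdn_add.
by apply: eq_existsb => i; rewrite dvdn_addl // dvdn_mulr // dvdn_exp.
Qed.

(** At 2 the derivative 2x vanishes, so lifting starts from x modulo 2^(j-1): the change x + 2^(j-1)
    y alters |x|^2 by 2^j x.y modulo 2^(j+1). The square of 2^(j-1) is divisible by 2^(j+1) only
    from j = 3 on. *)
Lemma pcount2S n j : 2 < j -> pcount n.+1 (2 ^ j.+1) 2 = 2 ^ n * pcount n.+1 (2 ^ j) 2.
Proof.
move=> j2; rewrite (@pcount2_half n.+1 j) //; last exact: ltnW.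
case: j j2 => [|j] // j2 /=; rewrite /pcount.
have E : 2 ^ j.+2 = 2 ^ j * (2 * 2) by rewrite !expnSr mulnA.
pose F (a : 'I_n.+1 -> nat) := nat_of_bool ((2 ^ j.+2 %| sqs a) && [exists i, ~~ (2 %| a i)]).
rewrite -[LHS]/(\sum_(a : {ffun 'I_n.+1 -> 'I_(2 ^ j.+2)}) F (fun i => a i)) (sum_nat_eqm F E).
rewrite (@sum_nat_lift _ _ _ F) !big_distrr /=; apply: eq_bigr => x _.
have exE (y : 'I_n.+1 -> nat) :
    [exists i, ~~ (2 %| x i + 2 ^ j * y i)] = [exists i, ~~ (2 %| x i)].
  by apply: eq_existsb => i; rewrite dvdn_addl // dvdn_mulr // dvdn_exp //; move: j2; case: (j).
have [/existsP[i0 pi0]|ne] := boolP [exists i, ~~ (2 %| x i)]; last first.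
  by rewrite andbF !muln0 big1 // => y _; rewrite /F exE (negbTE ne) andbF.
rewrite andbT.
have FE (y : 'I_n.+1 -> nat) : F (fun i => x i + 2 ^ j * y i) =
    (2 ^ j.+2 %| sqs (fun i => x i) + 2 ^ j.+1 * (\sum_i x i * y i)) :> nat.
  rewrite /F exE; have -> : [exists i, ~~ (2 %| x i)] by apply/existsP; exists i0.
  rewrite andbT sqs_lift -expnS dvdn_addl // dvdn_mulr // -expnM dvdn_exp2l //.
  by move: j2; lia.
have [/dvdnP[k kE]|nd] := boolP (2 ^ j.+1 %| sqs (fun i => x i)); last first.
  rewrite !muln0 big1 // => y _; rewrite (FE (fun i => y i)); apply/eqP; rewrite eqb0; apply: contra nd => h.
  have : 2 ^ j.+1 %| sqs (fun i => x i) + 2 ^ j.+1 * (\sum_i x i * y i).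
    by apply: dvdn_trans h; rewrite dvdn_exp2l.
  by rewrite dvdn_addl // dvdn_mulr.
pose G (y : 'I_n.+1 -> nat) := nat_of_bool (2 %| k + \sum_i x i * y i).
have FG (y : 'I_n.+1 -> nat) : F (fun i => x i + 2 ^ j * y i) = G y.
  rewrite FE kE (mulnC k) -mulnDr [2 ^ j.+2]expnSr dvdn_pmul2l ?expn_gt0 //.
rewrite (eq_bigr (fun y : {ffun 'I_n.+1 -> 'I_(2 * 2)} => G (fun i => y i))); last by move=> y _; rewrite FG.
rewrite (@sum_nat_lift _ _ _ G) !muln1.
rewrite (eq_bigr (fun y : {ffun 'I_n.+1 -> 'I_2} => 2 ^ n.+1 * G (fun i => y i))).
  rewrite -big_distrr /= mulnC; congr (_ * _).
  by rewrite /G (@lin_count n 2 k (fun i => x i) i0).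
move=> y _; rewrite (eq_bigr (fun=> G (fun i => y i))) ?sum_nat_const ?card_ffun ?card_ord //.
move=> z _; rewrite /G; congr nat_of_bool; apply: dvdn_mod; rewrite -modnDmr -[RHS]modnDmr.
congr ((_ + _) %% _); rewrite -modn_summ -[RHS]modn_summ; congr (_ %% _); apply: eq_bigr => i _.
by rewrite mulnDr mulnCA (mulnC 2) addnC modnMDl.
Qed.

End PrimitiveCounts.

(** * Sums of two squares over a prime field *)

Section SumsOfTwoSquares.
Local Open Scope ring_scope.
Variables (p : nat) (F : finFieldType).
Hypotheses (pp : prime p) (podd : odd p) (card_F : #|F| = p) (charF : p \in [pchar F]).

Definition norm2 (t : F) : nat := #|[set z : F * F | z.1 ^+ 2 + z.2 ^+ 2 == t]|.

Lemma nat_Fp_eq0 m : (m%:R == 0 :> F) = (p %| m)%N.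
Proof. by rewrite -(dvdn_pcharf charF). Qed.

Lemma two_Fp_neq0 : 2%:R != 0 :> F.
Proof. by rewrite nat_Fp_eq0 dvdn_prime2 //; apply/eqP => pE; move: podd; rewrite pE. Qed.

Lemma sum_norm2 : (\sum_t norm2 t = p ^ 2)%N.
Proof.
have <- : #|{: F * F}| = (p ^ 2)%N by rewrite card_prod card_F mulnn.
rewrite -sum1_card (partition_big (fun z : F * F => z.1 ^+ 2 + z.2 ^+ 2) predT) //=.
apply: eq_bigr => t _; rewrite /norm2 -sum1_card; apply: eq_bigl => z.
by rewrite inE.
Qed.

(** With a square root i of -1 the form becomes the product (x + i y)(x - i y), so the task is to
    count the solutions of u v = t. *)
Lemma norm2_split (i : F) : i ^+ 2 = -1 ->
  forall t, norm2 t = (if t == 0%R then 2 * p - 1 else p - 1)%N.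
Proof.
move=> i2 t.
have i0 : i != 0 by apply: contra_eq_neq i2 => ->; rewrite expr0n /= eq_sym oppr_eq0 oner_eq0.
pose h (z : F * F) := (z.1 + i * z.2, z.1 - i * z.2).
have hK : bijective h.
  apply: injF_bij => -[x y] [x' y'] [E1 E2].
  have Ex : 2%:R * x = 2%:R * x' by rewrite !mulr_natl !mulr2n; have E3 := f_equal2 +%R E1 E2; rewrite !(addrACA _ (i * _)) !subrr !addr0 in E3.
  have {}Ex := mulfI two_Fp_neq0 Ex; subst x'.
  by congr (_, _); apply: (mulfI i0); exact: (addrI x E1).
have -> : norm2 t = #|[set z : F * F | z.1 * z.2 == t]|.
  rewrite /norm2 -(card_imset _ (bij_inj hK)); congr #|pred_of_set _|.
  have [g gh hg] := hK.
  apply/setP => z; apply/imsetP/idP => [[w + ->]|].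
    rewrite !inE /h /= => /eqP <-.
    by apply/eqP; rewrite mulrC -subr_sqr exprMn i2 mulN1r opprK.
  have [w ->] : exists w, z = h w by exists (g z); rewrite hg.
  rewrite !inE /h /= mulrC -subr_sqr exprMn i2 mulN1r opprK => wt.
  by exists w; rewrite ?inE.
have [->|t0] := eqVneq t 0.
  have -> : [set z : F * F | z.1 * z.2 == 0] =
      [set z | z.1 == 0] :|: [set z | z.2 == 0].
    by apply/setP => z; rewrite !inE mulf_eq0.
  have c1 : #|[set z : F * F | z.1 == 0]| = p.
    have -> : [set z : F * F | z.1 == 0] = finset.setX [set 0] [set: F].
      by apply/setP => z; rewrite !inE andbT.
    by rewrite cardsX cards1 cardsT mul1n card_F.
  have c2 : #|[set z : F * F | z.2 == 0]| = p.
    have -> : [set z : F * F | z.2 == 0] = finset.setX [set: F] [set 0].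
      by apply/setP => z; rewrite !inE.
    by rewrite cardsX cards1 cardsT muln1 card_F.
  rewrite cardsU c1 c2 addnn mul2n.
  have -> : [set z : F * F | z.1 == 0] :&: [set z | z.2 == 0] = [set (0, 0)].
    by apply/setP => -[a b]; rewrite !inE /= -pair_eqE.
  by rewrite cards1.
have -> : [set z : F * F | z.1 * z.2 == t] = [set (x, t / x) | x in [set~ 0]].
  apply/setP => -[a b]; rewrite inE /=; apply/eqP/imsetP => [abt|[x x0 [-> ->]]].
    have a0 : a != 0 by apply: contra_neq t0 => a0; rewrite -abt a0 mul0r.
    by exists a; rewrite ?inE // -abt mulrAC divff // mul1r.
  by rewrite !inE in x0; rewrite mulrC divfK.
rewrite card_imset; last by move=> x y [].
by rewrite cardsC1 card_F subn1.
Qed.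

(** The numbers 0, ..., (p - 1) / 2 have pairwise distinct squares. *)
Lemma squares_card : (p.+1 <= 2 * #|[set x ^+ 2 | x : F]|)%N.
Proof.
pose f (k : 'I_(p./2.+1)) : F := (k%:R) ^+ 2.
have pE : p = (p./2.*2.+1)%N by rewrite -[LHS]odd_double_half podd.
have fi : injective f.
  move=> k l; wlog kl : k l / (k <= l)%N.
    by move=> H E; case/orP: (leq_total k l) => kl; [exact: H|apply/esym/H].
  move=> E; apply: val_inj => /=; apply/eqP; rewrite eqn_leq kl /=.
  have : (l%:R ^+ 2 - k%:R ^+ 2 == 0 :> F) by rewrite subr_eq0 -[_ == _]/(f l == f k) E.
  rewrite subr_sqr mulf_eq0 -natrB // -natrD !nat_Fp_eq0.
  have := ltn_ord k; have := ltn_ord l => h1 h2.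
  case/orP => h.
    rewrite -subn_eq0; apply: contraTT h => nz; rewrite gtnNdvd // ?lt0n //.
    move: h1 h2 pE; set q := p./2; rewrite -muln2; lia.
  have [lk0|nz] := eqVneq (l + k)%N 0%N; first by move: lk0; clear; lia.
  move: h; rewrite gtnNdvd // ?lt0n //; move: h1 h2 pE nz; set q := p./2; rewrite -muln2; lia.
have : (p./2.+1 <= #|[set x ^+ 2 | x : F]|)%N.
  rewrite -{1}(card_ord p./2.+1) -(card_imset _ fi); apply: subset_leq_card.
  by apply/fintype.subsetP => _ /imsetP[k _ ->]; apply/imsetP; exists (k%:R).
by move=> h; rewrite {1}pE; move: h; set q := p./2; rewrite -muln2; lia.
Qed.

(** Pigeonhole: the squares and their reflections t - y^2 each fill more than half of the field. *)
Lemma norm2_gt0 (t : F) : exists a b : F, a ^+ 2 + b ^+ 2 = t.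
Proof.
pose A := [set x ^+ 2 | x : F]; pose B := [set t - y | y in A].
have cB : #|B| = #|A| by apply: card_imset => x y /addrI /oppr_inj.
have : (0 < #|A :&: B|)%N.
  have := cardsUI A B; have := max_card (mem (A :|: B)); have := squares_card.
  rewrite card_F cB -/A mul2n -addnn => h1 h2 h3.
  have : (#|A| + #|A| <= p + #|A :&: B|)%N by rewrite -h3 leq_add2r.
  by lia.
rewrite card_gt0 => /set0Pn[z]; rewrite inE => /andP[/imsetP[a _ ->] /imsetP[_ /imsetP[b _ ->] E]].
by exists a, b; rewrite E subrK.
Qed.

(** The form is anisotropic, and multiplication by a + b i of norm t maps the solutions of norm 1
    bijectively to those of norm t. All nonzero values are therefore equally frequent, and the p^2 -
    1 nonzero points are shared among p - 1 values. *)
Lemma norm2_inert : (forall i : F, i ^+ 2 != -1) ->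
  forall t, norm2 t = (if t == 0%R then 1 else p.+1)%N.
Proof.
move=> ni.
have set0E : [set z : F * F | z.1 ^+ 2 + z.2 ^+ 2 == 0] = [set (0, 0)].
  apply/setP => -[x y]; rewrite !inE /=.
  apply/idP/eqP => [|[-> ->]]; last by rewrite expr0n addr0.
  have [->|y0] := eqVneq y 0; first by rewrite expr0n addr0 sqrf_eq0 => /eqP ->.
  rewrite addr_eq0 => /eqP E; case/eqP: (ni (x / y)).
  by rewrite exprMn exprVn E mulNr divff // expf_neq0.
have n0 : norm2 0 = 1%N by rewrite /norm2 set0E cards1.
have nt t : t != 0 -> norm2 t = norm2 1.
  move=> t0; have [a [b ab]] := norm2_gt0 t.
  pose h (z : F * F) := (a * z.1 - b * z.2, a * z.2 + b * z.1).
  have hN z : (h z).1 ^+ 2 + (h z).2 ^+ 2 = t * (z.1 ^+ 2 + z.2 ^+ 2).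
    by rewrite /h /= -ab; ring.
  have hi : injective h.
    move=> [x y] [x' y'] E.
    have : h (x - x', y - y') = (0, 0).
      move: E; rewrite /h /= => -[E1 E2]; congr (_, _).
        by apply/eqP; rewrite -(subrr (a * x' - b * y')) -{1}E1; apply/eqP; ring.
      by apply/eqP; rewrite -(subrr (a * y' + b * x')) -{1}E2; apply/eqP; ring.
    move=> hE; have := hN (x - x', y - y'); rewrite hE /= expr0n addr0 => /esym/eqP.
    rewrite mulf_eq0 (negbTE t0) /= => /eqP H.
    have : (x - x', y - y') \in [set z : F * F | z.1 ^+ 2 + z.2 ^+ 2 == 0] by rewrite inE H eqxx.
    by rewrite set0E inE => /eqP[/subr0_eq -> /subr0_eq ->].
  rewrite /norm2 -[RHS](card_imset _ hi); congr #|pred_of_set _|; have [g gh hg] := injF_bij hi.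
  apply/setP => z; apply/idP/imsetP => [zt|[w + ->]].
    exists (g z); last by rewrite hg.
    move: zt; rewrite !inE -{1 2}(hg z) hN.
    by rewrite -{2}[t]mulr1 => /eqP/(mulfI t0) ->.
  by rewrite !inE hN => /eqP ->; rewrite mulr1.
move=> t; case: eqVneq => [->//|t0]; rewrite nt //.
have := sum_norm2; rewrite (bigD1 0) //= n0 (eq_bigr (fun=> norm2 1)); last by move=> s; exact: nt.
rewrite sum_nat_const cardC1 card_F => E.
have p1 := prime_gt1 pp.
apply/eqP; rewrite -(@eqn_pmul2l p.-1); last by case: (p) p1 => [|[]].
apply/eqP; move: E; case: (p) p1 => // q _; rewrite -mulnn /=; lia.
Qed.

End SumsOfTwoSquares.

(** * Solution counts modulo an odd prime *)

Section OddPrimeCounts.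
Variable p : nat.
Hypotheses (pp : prime p) (podd : odd p).
Local Open Scope ring_scope.
Notation F := ('F_p).

Let card_F : #|F| = p. Proof. exact: card_Fp. Qed.
Let charF : p \in [pchar F]. Proof. exact: pchar_Fp. Qed.

Definition chi4z (m : nat) : int :=
  if (m %% 4 == 1)%N then 1 else if (m %% 4 == 3)%N then -1 else 0.

Lemma fermat_Fp (x : F) : x != 0 -> x ^+ p.-1 = 1.
Proof.
move=> x0; have E := finfield.expf_card x; rewrite card_F in E.
by apply: (mulfI x0); rewrite -exprS prednK ?prime_gt0 // E mulr1.
Qed.

Lemma sqrt_m1_split : (p %% 4 = 1)%N -> exists i : F, i ^+ 2 = -1.
Proof.
move=> p4; have p1 := prime_gt1 pp.
pose h := (p %/ 4)%N; have pE : p = (4 * h).+1 by rewrite [LHS](divn_eq p 4) p4 addn1 mulnC.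
have h0 : (0 < h)%N by move: p1; rewrite pE; case: (h).
have /existsP[x /andP[x0 xh]] : [exists x : F, (x != 0) && (x ^+ (2 * h) != 1)].
  apply: contraT; rewrite negb_exists => /forallP H.
  have := @max_poly_roots F ('X^(2 * h) - 1) (enum [set~ (0 : F)%R]).
  rewrite -size_poly_eq0 size_XnsubC ?muln_gt0 //= => /(_ isT) H1.
  have : (size (enum [set~ (0 : F)%R]) < (2 * h).+1)%N.
    apply: H1; last exact: enum_uniq.
    apply/allP => x; rewrite mem_enum !inE => x0; have := H x; rewrite negb_and x0 /= negbK => /eqP xh.
    by rewrite /root !hornerE xh subrr.
  rewrite -cardE cardsC1 card_F pE /=; lia.
have x1 : x ^+ (4 * h) = 1.
  have <- : p.-1 = (4 * h)%N by move: pE; clear; lia.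
  exact: fermat_Fp.
exists (x ^+ h); rewrite -exprM mulnC.
have : (x ^+ (2 * h) - 1) * (x ^+ (2 * h) + 1) = 0.
  by rewrite -subr_sqr expr1n -exprM mulnAC x1 subrr.
move/eqP; rewrite mulf_eq0 subr_eq0 (negbTE xh) /= addr_eq0 => /eqP //.
Qed.

Lemma sqrt_m1_inert : (p %% 4 = 3)%N -> forall i : F, i ^+ 2 != -1.
Proof.
move=> p4 i; apply/eqP => i2.
pose h := (p %/ 4)%N; have pE : p = (2 * (2 * h).+1).+1.
  rewrite [LHS](divn_eq p 4) p4 -/h; lia.
have i0 : i != 0 by apply: contra_eq_neq i2 => ->; rewrite expr0n /= eq_sym oppr_eq0 oner_eq0.
have : i ^+ (2 * (2 * h).+1) = 1.
  have <- : p.-1 = (2 * (2 * h).+1)%N by move: pE; clear; lia.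
  exact: fermat_Fp.
rewrite exprM i2 exprS exprM sqrrN expr1n expr1n mulr1 => /eqP; rewrite eq_sym -subr_eq0 opprK.
by rewrite -(natrD F 1 1) (negbTE (two_Fp_neq0 pp podd charF)).
Qed.

Lemma sum_F_ord (f : F -> nat) : (\sum_(x : F) f x = \sum_(k < p) f (k : nat)%:R)%N.
Proof.
rewrite (reindex (fun k : 'I_p => ((k : nat)%:R : F))) //=.
apply: onW_bij; apply: inj_card_bij; last by rewrite card_F card_ord.
move=> k l E; apply: val_inj => /=; move: k l E => [k kp] [l lp] /=.
wlog kl : k l kp lp / (k <= l)%N.
  by move=> H E; case/orP: (leq_total k l) => kl; [exact: H|apply/esym/H].
move=> E; apply/eqP; rewrite eqn_leq kl /=.
have : ((l - k)%:R == 0 :> F) by rewrite natrB // E subrr.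
rewrite (nat_Fp_eq0 charF) -subn_eq0; apply: contraTT => nz; rewrite gtnNdvd // ?lt0n //.
by apply: leq_ltn_trans lp; exact: leq_subr.
Qed.

(* Two coordinates at a time: x^2 + y^2 takes every nonzero value equally often. *)
Lemma qcountSS n c (A B : nat) :
  (forall t : F, norm2 t = if t == 0 then B else A) ->
  (qcount n.+2 p c + A * qcount n p c = A * p ^ n + B * qcount n p c)%N.
Proof.
move=> N2; have p0 := prime_gt0 pp.
pose G (t : F) := (qcount n p (val t + c))%N.
have GE (m : nat) : G m%:R = qcount n p (m + c).
  apply: qcount_mod; rewrite -modnDml -[RHS]modnDml; congr ((_ + _) %% _)%N.
  by rewrite /= val_Fp_nat // modn_mod.
have -> : qcount n.+2 p c = (\sum_(t : F) norm2 t * G t)%N.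
  rewrite qcountS; under eq_bigr do rewrite qcountS.
  have -> : (\sum_(t : F) norm2 t * G t = \sum_(z : F * F) G (z.1 ^+ 2 + z.2 ^+ 2)%R)%N.
    rewrite (partition_big (fun z : F * F => z.1 ^+ 2 + z.2 ^+ 2) predT) //=.
    apply: eq_bigr => t _; rewrite /norm2 -sum1_card big_distrl /=.
    by apply: eq_big => [z|z /=]; rewrite inE // => /eqP ->; rewrite mul1n.
  rewrite -(pair_big predT predT (fun x y : F => G (x ^+ 2 + y ^+ 2))) /=.
  rewrite sum_F_ord; apply: eq_bigr => x _; rewrite sum_F_ord; apply: eq_bigr => y _.
  by rewrite -!natrX -natrD GE; congr qcount; rewrite addnCA addnA.
have sG : (\sum_(t : F) G t = p ^ n)%N.
  by rewrite -(qcount_total n c p0) sum_F_ord; apply: eq_bigr => t _; rewrite GE.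
rewrite (bigD1 0) //= (eq_bigr (fun t => A * G t)%N); last by move=> t t0; rewrite N2 (negbTE t0).
rewrite N2 eqxx -big_distrr /= -sG [in RHS](bigD1 0) //=.
have -> : G 0 = qcount n p c by rewrite (GE 0%N).
ring.
Qed.

(** Split and inert primes become one formula: in [qcountSS] the two cases give A = p - chi and B -
    A = chi p with chi = chi_(-4)(p). *)
Lemma qcount_odd_rec n c :
  (qcount n.+2 p c)%:Z = (p%:Z - chi4z p) * p%:Z ^+ n + chi4z p * p%:Z * (qcount n p c)%:Z.
Proof.
have p0 := prime_gt0 pp.
have pm : (p %% 4 = 1 \/ p %% 4 = 3)%N.
  have := ltn_pmod p (isT : 0 < 4)%N; move: podd; rewrite {1}(divn_eq p 4) oddD oddM andbF /=.
  by case: (p %% 4)%N => [|[|[|[|]]]] //; auto.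
have pX : (p ^ n)%N%:Z = p%:Z ^+ n by rewrite -!natz natrX.
rewrite -pX /chi4z; case: pm => pm; rewrite pm /=.
  have [i i2] := sqrt_m1_split pm.
  have := qcountSS n c (norm2_split pp podd card_F charF i2).
  move: (qcount _ _ _) (qcount n p c) (p ^ n)%N => X Y T E.
  have : (X + (p - 1) * Y)%N%:Z = ((p - 1) * T + (2 * p - 1) * Y)%N%:Z by rewrite E.
  by rewrite !PoszD !PoszM -!subzn ?muln_gt0 //; lia.
have := qcountSS n c (norm2_inert pp podd card_F charF (sqrt_m1_inert pm)).
move: (qcount _ _ _) (qcount n p c) (p ^ n)%N => X Y T E.
have : (X + p.+1 * Y)%N%:Z = (p.+1 * T + 1 * Y)%N%:Z by rewrite E.
by rewrite !PoszD !PoszM; lia.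
Qed.

(** The second value is read off from two computations of the solutions of x^2 + y^2 = 0: fibring
    over x, where each nonzero x contributes the wanted number, and the recursion started at 0
    coordinates. *)
Lemma qcount_odd1 : (qcount 1 p 0 = 1)%N /\ (qcount 1 p 1)%:Z = 1 + chi4z p.
Proof.
have p0 := prime_gt0 pp; have p1 := prime_gt1 pp.
have q0 : (qcount 1 p 0 = 1)%N.
  rewrite qcountS (bigD1 (Ordinal p0)) //= qcount0 big1 ?dvdn0 // => k k0.
  rewrite qcount0 addn0 Euclid_dvdX // andbT gtnNdvd ?ltn_ord // lt0n.
  by apply: contra_neq k0 => k0; exact: val_inj.
split=> //.
have E : (qcount 2 p 0 = 1 + p.-1 * qcount 1 p 1)%N.
  rewrite qcountS (bigD1 (Ordinal p0)) //= q0; congr (_ + _)%N.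
  rewrite (eq_bigr (fun=> qcount 1 p 1)) ?sum_nat_const ?cardC1 ?card_ord // => k k0.
  rewrite addn0 -[X in qcount 1 p X]muln1 qcount_sqr_coprime // prime_coprime //.
  rewrite gtnNdvd ?ltn_ord // lt0n.
  by apply: contra_neq k0 => k0; exact: val_inj.
have := qcount_odd_rec 0 0; rewrite E qcount0 dvdn0 expr0 mulr1 PoszD PoszM.
have -> : p.-1%:Z = p%:Z - 1 by rewrite -subn1 -subzn.
move=> H.
apply: (@mulfI _ (p%:Z - 1)); first by rewrite subr_eq0 eqz_nat; lia.
by move: H; lia.
Qed.

End OddPrimeCounts.

Local Open Scope classical_set_scope.
Local Open Scope ring_scope.

(** * Euler products and local factors *)

Section EsumTools.
Variable R : realType.
Local Open Scope ereal_scope.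

Lemma esum_fsum_le (T : choiceType) (I : set T) (a : T -> \bar R) (y : \bar R) :
  (forall X : set T, finite_set X -> X `<=` I -> \sum_(i \in X) a i <= y) ->
  \esum_(i in I) a i <= y.
Proof. by move=> h; apply: ge_ereal_sup => _ [X [fX XI]] <-; exact: h. Qed.

Lemma fsum_le_esum (T : choiceType) (I X : set T) (a : T -> \bar R) :
  finite_set X -> X `<=` I -> \sum_(i \in X) a i <= \esum_(i in I) a i.
Proof. by move=> fX XI; apply: ereal_sup_ubound; exists X. Qed.

Lemma le_esum_term (T : choiceType) (I : set T) (a : T -> \bar R) t :
  I t -> a t <= \esum_(i in I) a i.
Proof.
move=> It; have -> : a t = \sum_(i \in [set t]) a i by rewrite fsbig_set1.
apply: fsum_le_esum => //.
by move=> _ ->.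
Qed.

Lemma esum_subset (T : choiceType) (I J : set T) (a : T -> \bar R) :
  I `<=` J -> \esum_(i in I) a i <= \esum_(i in J) a i.
Proof.
by move=> IJ; apply: esum_fsum_le => X fX XI; apply: fsum_le_esum => // i /XI /IJ.
Qed.

Lemma le_esumZl (T : choiceType) (I : set T) (a : T -> \bar R) (c : R) :
  (forall i, 0 <= a i) -> (0 <= c)%R ->
  \esum_(i in I) (c%:E * a i) <= c%:E * \esum_(i in I) a i.
Proof.
move=> a0 c0; apply: esum_fsum_le => X fX XI.
rewrite -ge0_mule_fsumr //; apply: lee_wpmul2l; rewrite ?lee_fin //.
exact: fsum_le_esum.
Qed.

Lemma esumZl_fin (T : choiceType) (I : set T) (a : T -> \bar R) (c : R) :
  (forall i, 0 <= a i) -> (0 <= c)%R ->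
  \esum_(i in I) (c%:E * a i) = c%:E * \esum_(i in I) a i.
Proof.
move=> a0; rewrite le_eqVlt => /predU1P[<-|c0].
  by rewrite mul0e esum1 // => i _; rewrite mul0e.
apply/eqP; rewrite eq_le le_esumZl ?(ltW c0) //=.
have ci0 : (0 <= c^-1)%R by rewrite invr_ge0 ltW.
have := @le_esumZl T I (fun i => c%:E * a i) c^-1 _ ci0.
have E i : (c^-1)%:E * (c%:E * a i) = a i.
  by rewrite muleA -EFinM mulVf ?gt_eqF // mul1e.
under eq_esum do rewrite E.
move=> h; rewrite -(@lee_pmul2l _ (c^-1)%:E) ?lte_fin ?invr_gt0 //.
rewrite muleA -EFinM mulVf ?gt_eqF // mul1e; apply: h => i.
by apply: mule_ge0; rewrite ?lee_fin ?(ltW c0).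
Qed.

Lemma esumZl (T : choiceType) (I : set T) (a : T -> \bar R) (c : \bar R) :
  (forall i, 0 <= a i) -> 0 <= c ->
  \esum_(i in I) (c * a i) = c * \esum_(i in I) a i.
Proof.
move=> a0; case: c => [c|_|//]; first by rewrite lee_fin; exact: esumZl_fin.
have [H|/existsNP[i /not_implyP[Ii ai]]] := pselect (forall i, I i -> a i = 0).
  rewrite !esum1 ?mule0 // => i Ii; by rewrite H // mule0.
have ai0 : 0 < a i by rewrite lt_def a0 andbT; apply/eqP.
rewrite gt0_mulye; last by apply: lt_le_trans ai0 _; exact: le_esum_term.
by apply/eqP; rewrite -leye_eq; apply: le_trans (@le_esum_term _ I _ i Ii); rewrite gt0_mulye.
Qed.

Lemma esum_pair (T1 T2 : choiceType) (A : set T1) (B : set T2)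
    (f : T1 -> \bar R) (g : T2 -> \bar R) :
  (forall i, 0 <= f i) -> (forall j, 0 <= g j) ->
  \esum_(k in A `*` B) (f k.1 * g k.2) = (\esum_(i in A) f i) * (\esum_(j in B) g j).
Proof.
move=> f0 g0.
have -> : A `*` B = A `*`` (fun=> B) by [].
rewrite -(@esum_esum _ _ _ A (fun=> B) (fun i j => f i * g j)) //; last first.
  by move=> i j _ _; exact: mule_ge0.
under eq_esum do rewrite esumZl //.
under eq_esum do rewrite muleC.
by rewrite esumZl // 1?muleC //; exact: esum_ge0.
Qed.

Lemma reindex_partn (pi : nat_pred) (A A' : set nat) (f : nat -> \bar R) :
  (forall b, A b -> (0 < b)%N) -> (forall y, A' y -> (pi^')%N.-nat y) ->
  (forall x y, pi.-nat x -> (pi^')%N.-nat y -> (A (x * y)%N <-> A' y)) ->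
  \esum_(b in A) f b = \esum_(k in [set x | pi.-nat x] `*` A') f (k.1 * k.2)%N.
Proof.
move=> A0 A'pi AA'; apply: (@reindex_esum _ _ _ _ _ (fun k => (k.1 * k.2)%N)); split.
- by move=> [x y] /= [px /[dup] A'y /A'pi py]; apply/AA'.
- move=> [x y] [x' y']; rewrite !inE /= => -[px /A'pi py] [px' /A'pi py'] E.
  have x0 := part_gt0 pi x; have [x00 y00 x00' y00'] : [/\ 0 < x, 0 < y, 0 < x' & 0 < y']%N.
    by move: (px) (py) (px') (py'); rewrite /pnat => /andP[-> _] /andP[-> _] /andP[-> _] /andP[-> _].
  have xE : x = x'.
    have := congr1 (partn^~ pi) E; rewrite !partnM // !(part_pnat_id px) !(part_pnat_id px').
    by rewrite !(part_p'nat py) !(part_p'nat py') !muln1.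
  by move: E; rewrite xE => /eqP; rewrite eqn_pmul2l // => /eqP ->.
- move=> b Ab; have b0 := A0 b Ab; exists (b`_pi, b`_(pi^')%N)%N; last by rewrite /= partnC.
  split => /=; first exact: part_pnat.
  have := AA' _ _ (part_pnat pi b) (part_pnat (pi^')%N b).
  by rewrite partnC // => -[/(_ Ab)].
Qed.

Lemma esum_partn (pi : nat_pred) (A A' : set nat) (f F G : nat -> \bar R) :
  (forall b, A b -> (0 < b)%N) -> (forall y, A' y -> (pi^')%N.-nat y) ->
  (forall x y, pi.-nat x -> (pi^')%N.-nat y -> (A (x * y)%N <-> A' y)) ->
  (forall x, 0 <= F x) -> (forall y, 0 <= G y) ->
  (forall x y, pi.-nat x -> A' y -> f (x * y)%N = F x * G y) ->
  \esum_(b in A) f b = (\esum_(x in [set x | pi.-nat x]) F x) * (\esum_(y in A') G y).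
Proof.
move=> A0 A'pi AA' F0 G0 fE; rewrite (reindex_partn _ A0 A'pi AA') -esum_pair //.
by apply: eq_esum => -[x y] [/= px A'y]; exact: fE.
Qed.

Lemma le_esum_partn (pi : nat_pred) (A A' : set nat) (f F G : nat -> \bar R) :
  (forall b, A b -> (0 < b)%N) -> (forall y, A' y -> (pi^')%N.-nat y) ->
  (forall x y, pi.-nat x -> (pi^')%N.-nat y -> (A (x * y)%N <-> A' y)) ->
  (forall x, 0 <= F x) -> (forall y, 0 <= G y) ->
  (forall x y, pi.-nat x -> A' y -> f (x * y)%N <= F x * G y) ->
  \esum_(b in A) f b <= (\esum_(x in [set x | pi.-nat x]) F x) * (\esum_(y in A') G y).
Proof.
move=> A0 A'pi AA' F0 G0 fE; rewrite (reindex_partn _ A0 A'pi AA') -esum_pair //.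
by apply: le_esum => -[x y] [/= px A'y]; exact: fE.
Qed.

Lemma esum_ppow (p : nat) (F : nat -> \bar R) : prime p ->
  \esum_(x in [set x | p.-nat x]) F x = \esum_(j in [set: nat]) F (p ^ j)%N.
Proof.
move=> pp; apply: (@reindex_esum _ _ _ _ _ (fun j => p ^ j)%N); split.
- by move=> j _ /=; rewrite pnatX pnat_id // orTb.
- by move=> i j _ _ /eqP; rewrite eqn_exp2l ?prime_gt1 // => /eqP.
- by move=> x /= /p_natP[j ->]; exists j.
Qed.

End EsumTools.

(** * Euler products of nonnegative multiplicative functions *)

Section Euler.
Variable R : realType.

Definition smooth (P : nat) : set nat :=
  [set b | (0 < b)%N /\ forall p, prime p -> (p %| b)%N -> (p < P)%N].

Lemma smooth_total (P : nat) (b : nat) : (0 < b < P)%N -> smooth P b.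
Proof.
move=> /andP[b0 bP]; split=> // p pp pb; apply: leq_ltn_trans bP.
exact: dvdn_leq.
Qed.

Lemma smoothS (P x y : nat) : prime P -> P.-nat x -> (P^')%N.-nat y ->
  (smooth P.+1 (x * y)%N <-> smooth P y).
Proof.
move=> pP px py; have x0 : (0 < x)%N by case/andP: px.
have y0 : (0 < y)%N by case/andP: py.
split=> -[h1 h2]; split=> //.
- move=> p pp pb; have := h2 p pp (dvdn_mull _ pb); rewrite ltnS leq_eqVlt => /predU1P[pE|//].
  have := pnatP _ y0 py p pp pb; by rewrite pE !inE eqxx.
- by rewrite muln_gt0 x0.
- move=> p pp; rewrite Euclid_dvdM // => /orP[pb|/(h2 p pp)]; last exact: ltnW.
  by have := pnatP _ x0 px p pp pb; rewrite inE => /eqP ->.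
Qed.

(* Partial Euler products of a nonnegative multiplicative function are sums
   over smooth numbers, so they increase to the full sum. *)
Section Nonneg.
Variables (f : nat -> R) (Z : nat -> R).
Hypothesis f0 : forall b, 0 <= f b.
Hypothesis f1 : f 1%N = 1.
Hypothesis fM : forall x y, (0 < x)%N -> (0 < y)%N -> coprime x y -> f (x * y)%N = f x * f y.
Hypothesis fZ : forall p, prime p -> (\esum_(j in [set: nat]) (f (p ^ j)%N)%:E = (Z p)%:E)%E.

Lemma euler_smooth P :
  (\esum_(b in smooth P) (f b)%:E = (\prod_(p < P | prime p) Z p)%:E)%E.
Proof.
elim: P => [|P IH].
  rewrite big_ord0; rewrite (_ : smooth 0 = [set 1%N]) ?esum_set1 ?f1 //.
  apply/seteqP; split=> [b [b0 h]|_ ->]; last by split=> // p pp; rewrite dvdn1 => /eqP pE; rewrite pE in pp.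
  have [b1|b1] := leqP b 1; first by apply/eqP; rewrite eqn_leq b1 b0.
  by have := h _ (pdiv_prime b1) (pdiv_dvd b).
rewrite big_mkcond big_ord_recr /= -big_mkcond /=; case: ifPn => pP; last first.
  rewrite mulr1 -IH; congr esum; apply/seteqP; split=> b [b0 h]; split=> // p pp pb.
    have := h p pp pb; rewrite ltnS leq_eqVlt => /predU1P[pE|//].
    by rewrite -pE pp in pP.
  exact: ltnW (h p pp pb).
rewrite (@esum_partn R P (smooth P.+1) (smooth P) _ (fun b => (f b)%:E) (fun b => (f b)%:E)).
- by rewrite IH esum_ppow // fZ // -EFinM mulrC.
- by move=> b [].
- move=> y [y0 h]; apply/pnatP => // p pp pb; rewrite !inE.
  by have := h p pp pb; rewrite ltn_neqAle => /andP[].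
- by move=> x y; exact: smoothS.
- by move=> x; rewrite lee_fin.
- by move=> x; rewrite lee_fin.
- move=> x y px [y0 h]; rewrite -EFinM fM //; first by case/andP: px.
  apply: (pnat_coprime px); apply/pnatP => // p pp pb; rewrite !inE.
  by have := h p pp pb; rewrite ltn_neqAle => /andP[].
Qed.

Lemma euler_smooth_le P :
  ((\prod_(p < P | prime p) Z p)%:E <= \esum_(b in [set b | (0 < b)%N]) (f b)%:E)%E.
Proof. by rewrite -euler_smooth; apply: esum_subset => b []. Qed.

Lemma euler_le (M : R) : (forall P, \prod_(p < P | prime p) Z p <= M) ->
  (\esum_(b in [set b | (0 < b)%N]) (f b)%:E <= M%:E)%E.
Proof.
move=> ZM; apply: esum_fsum_le => X fX X0.
have [P XP] : exists P, X `<=` smooth P.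
  have /finite_seqP[s sE] := fX; exists (\max_(b <- s) b).+1 => b Xb.
  apply: smooth_total; rewrite (X0 b Xb) /= ltnS; apply: leq_bigmax_seq => //.
  by move: Xb; rewrite sE.
apply: le_trans (fsum_le_esum _ fX XP) _; rewrite euler_smooth lee_fin //.
Qed.

Lemma euler_cvg (L : R) : \prod_(p < P | prime p) Z p @[P --> \oo] --> L ->
  (\esum_(b in [set b | (0 < b)%N]) (f b)%:E = L%:E)%E.
Proof.
move=> ZL.
have Z1 p : prime p -> 1 <= Z p.
  move=> pp; rewrite -lee_fin -fZ //.
  have -> : 1%E = (f (p ^ 0)%N)%:E :> \bar R by rewrite expn0 f1.
  exact: (@le_esum_term _ _ [set: nat] (fun j => (f (p ^ j)%N)%:E) 0%N).
have mono : nondecreasing_seq (fun P => \prod_(p < P | prime p) Z p).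
  apply/nondecreasing_seqP => P; rewrite [leRHS]big_mkcond big_ord_recr /= -big_mkcond /=.
  case: ifPn => pP; last by rewrite mulr1.
  rewrite ler_peMr ?Z1 //; apply: prodr_ge0 => i pi; apply: le_trans (Z1 _ pi) => //.
apply/eqP; rewrite eq_le; apply/andP; split.
  apply: euler_le => P; have := nondecreasing_cvgn_le mono (cvgP _ ZL) P.
  by rewrite (cvg_lim _ ZL).
have lo P := euler_smooth_le P; move: lo; set S := (\esum_(b in _) _)%E.
have : (0 <= S)%E by apply: esum_ge0 => b _; rewrite lee_fin.
case: S => [S _ lo|_ _|//]; last by rewrite leey.
rewrite lee_fin -(cvg_lim _ ZL) //; apply: limr_le; first exact: cvgP ZL.
by apply: nearW => P; rewrite -lee_fin.
Qed.

End Nonneg.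
End Euler.

(** * The local series of the solution counts *)

Section LocalSeries.
Variable R : realType.
Implicit Types (f g : nat -> R).

Lemma esum_series f (l : R) : (forall j, 0 <= f j) ->
  series f @ \oo --> l -> (\esum_(j in [set: nat]) (f j)%:E = l%:E)%E.
Proof.
move=> f0 fl; rewrite -nneseries_esumT; last by move=> j; rewrite lee_fin.
apply: cvg_lim => //.
rewrite (_ : (fun n => _) = EFin \o series f); last first.
  by apply/funext => n; rewrite /= /series /= -sumEFin.
by apply: cvg_EFin => //; exact: nearW.
Qed.

Lemma series_esum f (l : R) : (forall j, 0 <= f j) ->
  (\esum_(j in [set: nat]) (f j)%:E = l%:E)%E -> series f @ \oo --> l.
Proof.
move=> f0 fl.
have ub N : series f N <= l.
  rewrite -lee_fin -fl -nneseries_esumT; last by move=> j; rewrite lee_fin.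
  rewrite /series /= -sumEFin; apply: nneseries_lim_ge => j _.
  by rewrite lee_fin.
have nd : nondecreasing_seq (series f).
  by apply/nondecreasing_seqP => N; rewrite /series /= big_nat_recr //= lerDl.
have cv : cvgn (series f).
  by apply: nondecreasing_is_cvgn => //; exists l => _ [N _ <-].
have := esum_series f0 cv; rewrite fl => -[->]; exact: cv.
Qed.

(** The partial sums satisfy S(N+2) = f 0 + f 1 + G(N) + c S(N). Nonnegativity and c < 1 bound them,
    and the limit then solves the fixed point equation. *)
Lemma series_two_step f g (c A : R) : (forall j, 0 <= f j) -> (forall j, 0 <= g j) ->
  0 <= c < 1 -> (forall j, f j.+2 = g j + c * f j) -> series g @ \oo --> A ->
  series f @ \oo --> (f 0%N + f 1%N + A) / (1 - c).
Proof.
move=> f0 g0 /andP[c0 c1] fE gA.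
have sS (h : nat -> R) N : series h N.+1 = series h N + h N.
  by rewrite /series /= big_nat_recr.
have E N : series f N.+2 = f 0%N + f 1%N + series g N + c * series f N.
  elim: N => [|N IH].
    by rewrite !sS /series /= !big_geq //; ring.
  by rewrite sS IH fE !sS; ring.
have gub N : series g N <= A.
  rewrite -(cvg_lim (@Rhausdorff R) gA); apply: (nondecreasing_cvgn_le _ (cvgP _ gA) N).
  by apply/nondecreasing_seqP => m; rewrite sS lerDl.
have nd : nondecreasing_seq (series f).
  by apply/nondecreasing_seqP => N; rewrite /series /= big_nat_recr //= lerDl.
have c10 : 0 < 1 - c by rewrite subr_gt0.
have cv : cvgn (series f).
  apply: nondecreasing_is_cvgn => //; exists ((f 0%N + f 1%N + A) / (1 - c)) => _ [N _ <-].
  rewrite ler_pdivlMr // mulrBr mulr1 lerBlDr.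
  apply: le_trans (nd _ _ (leq_trans (leqnSn _) (leqnSn _))) _.
  by rewrite E [_ * c]mulrC lerD2r lerD2l.
have lE : limn (series f) = f 0%N + f 1%N + A + c * limn (series f).
  have h1 : series f N.+2 @[N --> \oo] --> limn (series f).
    by rewrite (cvg_shiftS (fun N => series f N.+1)) cvg_shiftS.
  have h2 : series f N.+2 @[N --> \oo] --> f 0%N + f 1%N + A + c * limn (series f).
    under eq_cvg do rewrite E.
    by apply: cvgD; [apply: cvgD => //; exact: cvg_cst|apply: cvgM => //; exact: cvg_cst].
  rewrite -[RHS](cvg_lim (@Rhausdorff R) h2) //.
  by apply/esym; exact: (cvg_lim (@Rhausdorff R) h1).
suff <- : limn (series f) = (f 0%N + f 1%N + A) / (1 - c) by exact: cv.
apply/(mulIf (lt0r_neq0 c10)); rewrite divfK ?lt0r_neq0 //.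
by rewrite mulrBr mulr1 {1}lE; ring.
Qed.

Lemma series_geometric (a z : R) : 0 <= z < 1 ->
  series (fun j => a * z ^+ j) @ \oo --> a / (1 - z).
Proof.
move=> /andP[z0 z1]; have := @cvg_geometric_series R a z.
by rewrite ger0_norm //; apply.
Qed.

(* sum_j #{a mod p^j : |a|^2 = 0} y^j, from the count of primitive solutions
   modulo p and its growth by p^(n-1) per step. *)
Definition Lodd (n p : nat) (y : R) : R :=
  (1 + y + (pcount n p p)%:R * y / (1 - p%:R ^+ n.-1 * y)) / (1 - p%:R ^+ n * y ^+ 2).

Lemma Lodd_esum n p (y : R) : prime p -> odd p -> (0 < n)%N ->
  0 <= y -> p%:R ^+ n.-1 * y < 1 -> p%:R ^+ n * y ^+ 2 < 1 ->
  (\esum_(j in [set: nat]) ((qcount n (p ^ j) 0)%:R * y ^+ j)%:E = (Lodd n p y)%:E)%E.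
Proof.
move=> pp podd n0 y0 y1 y2.
have pc j : (pcount n (p ^ j.+1) p)%:R = (pcount n p p)%:R * p%:R ^+ n.-1 ^+ j :> R.
  elim: j => [|j IH]; first by rewrite expn1 expr0 mulr1.
  case: n n0 {y1 y2} IH => // n _ IH.
  by rewrite pcountS // natrM natrX IH exprS; ring.
have q1 : (qcount n 1 0)%:R = 1 :> R.
  rewrite /qcount (eq_bigr (fun=> 1%N)) => [|a _]; last by rewrite dvd1n.
  by rewrite sum1_card card_ffun !card_ord exp1n.
apply: esum_series; first by move=> j; rewrite mulr_ge0 // exprn_ge0.
have := @series_two_step (fun j => (qcount n (p ^ j) 0)%:R * y ^+ j)
  (fun j => ((pcount n p p)%:R * p%:R ^+ n.-1 * y ^+ 2) * (p%:R ^+ n.-1 * y) ^+ j)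
  (p%:R ^+ n * y ^+ 2) ((pcount n p p)%:R * p%:R ^+ n.-1 * y ^+ 2 / (1 - p%:R ^+ n.-1 * y)).
move=> H; rewrite (_ : Lodd n p y = (1 * y ^+ 0 + (pcount n p p + 1)%:R * y ^+ 1 + (pcount n p p)%:R * p%:R ^+ n.-1 * y ^+ 2 / (1 - p%:R ^+ n.-1 * y)) / (1 - p%:R ^+ n * y ^+ 2)).
  move: H; rewrite /= expn0 expn1 q1 qcount_primitive1 ?prime_gt1 //; apply.
  - by move=> j; rewrite mulr_ge0 // exprn_ge0.
  - by move=> j; rewrite !mulr_ge0 // ?exprn_ge0 // mulr_ge0 // exprn_ge0.
  - by rewrite y2 mulr_ge0 ?exprn_ge0.
  - move=> j; rewrite qcount_primitive ?prime_gt0 // natrD pc natrM natrX.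
    by rewrite !exprS exprMn; ring.
  - by apply: series_geometric; rewrite y1 mulr_ge0 ?exprn_ge0.
rewrite /Lodd; congr (_ / _).
have d0 : 1 - p%:R ^+ n.-1 * y != 0 by rewrite gt_eqF // subr_gt0.
by rewrite natrD expr0 expr1; field.
Qed.

(* The same sum for p = 2, where the count of primitive solutions becomes
   regular only from 8 on. *)
Definition Ltwo (n : nat) (y : R) : R :=
  (1 + y + (pcount n 2 2)%:R * y + (pcount n 4 2)%:R * y ^+ 2
     + (pcount n 8 2)%:R * y ^+ 3 / (1 - 2 ^+ n.-1 * y)) / (1 - 2 ^+ n * y ^+ 2).

Lemma Ltwo_esum n (y : R) : (0 < n)%N ->
  0 <= y -> 2 ^+ n.-1 * y < 1 -> 2 ^+ n * y ^+ 2 < 1 ->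
  (\esum_(j in [set: nat]) ((qcount n (2 ^ j) 0)%:R * y ^+ j)%:E = (Ltwo n y)%:E)%E.
Proof.
move=> n0 y0 y1 y2.
have pc j : (pcount n (2 ^ j.+3) 2)%:R = (pcount n 8 2)%:R * 2 ^+ n.-1 ^+ j :> R.
  elim: j => [|j IH]; first by rewrite expr0 mulr1.
  case: n n0 {y1 y2} IH => // n _ IH.
  by rewrite pcount2S // natrM natrX IH exprS; ring.
have q1 : (qcount n 1 0)%:R = 1 :> R.
  rewrite /qcount (eq_bigr (fun=> 1%N)) => [|a _]; last by rewrite dvd1n.
  by rewrite sum1_card card_ffun !card_ord exp1n.
apply: esum_series; first by move=> j; rewrite mulr_ge0 // exprn_ge0.
pose g j : R := if j is j'.+1 then ((pcount n 8 2)%:R * y ^+ 3) * (2 ^+ n.-1 * y) ^+ j' else (pcount n 4 2)%:R * y ^+ 2.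
pose A : R := (pcount n 4 2)%:R * y ^+ 2 + (pcount n 8 2)%:R * y ^+ 3 / (1 - 2 ^+ n.-1 * y).
have gA : series g @ \oo --> A.
  rewrite -(@cvg_shiftS R^o (series g)).
  have -> : (fun N => series g N.+1) = (fun N => (pcount n 4 2)%:R * y ^+ 2
      + series (fun j => ((pcount n 8 2)%:R * y ^+ 3) * (2 ^+ n.-1 * y) ^+ j) N).
    by apply/funext => N; rewrite /series /= big_nat_recl.
  apply: cvgD; first exact: cvg_cst.
  by apply: series_geometric; rewrite y1 mulr_ge0 ?exprn_ge0.
have := @series_two_step (fun j => (qcount n (2 ^ j) 0)%:R * y ^+ j) g (2 ^+ n * y ^+ 2) A.
move=> H; rewrite (_ : Ltwo n y = (1 * y ^+ 0 + (pcount n 2 2 + 1)%:R * y ^+ 1 + A) / (1 - 2 ^+ n * y ^+ 2)).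
  move: H; rewrite /= expn0 expn1 q1 qcount_primitive1 //; apply => //.
  - by move=> j; rewrite mulr_ge0 // exprn_ge0.
  - by case=> [|j]; rewrite /g !mulr_ge0 // ?exprn_ge0 // mulr_ge0 // exprn_ge0.
  - by rewrite y2 mulr_ge0 ?exprn_ge0.
  - move=> [|j]; rewrite qcount_primitive // natrD natrM natrX /g.
      by rewrite (_ : (2 ^ 2)%N = 4%N) // expn0 q1; ring.
    by rewrite pc !exprS exprMn; ring.
rewrite /Ltwo /A; congr (_ / _).
by rewrite natrD expr0 expr1; ring.
Qed.

End LocalSeries.

(** * Local factors at odd primes and the factors epsilon *)

Section LocalFactors.
Variable R : realType.

Lemma chi4E p : chi4 R p = (chi4z p)%:~R.
Proof. by rewrite /chi4 /chi4z; case: ifP => // _; case: ifP. Qed.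

Lemma chi4_odd_sqr p : odd p -> chi4 R p ^+ 2 = 1.
Proof.
rewrite /chi4 => podd; have : (p %% 4 = 1 \/ p %% 4 = 3)%N by lia.
by case=> ->; rewrite /= ?expr1n ?sqrrN ?expr1n.
Qed.

Section OddPrime.
Variable p : nat.
Hypotheses (pp : prime p) (podd : odd p).
Let q : R := p%:R.
Let chi : R := chi4 R p.

Lemma odd_prime_ge3 : 3 <= q.
Proof. by rewrite /q ler_nat; have := prime_gt1 pp; lia. Qed.

Lemma qcount_recR n c :
  (qcount n.+2 p c)%:R = (q - chi) * q ^+ n + chi * q * (qcount n p c)%:R :> R.
Proof.
have /(congr1 (fun z : int => z%:~R : R)) := qcount_odd_rec pp podd n c.
by rewrite /chi chi4E /q rmorphD !rmorphM rmorphB rmorphXn /= -!pmulrn.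
Qed.

(** Both sides carry an extra factor q so that the closed form also makes sense for m = 0. *)
Lemma qcount_even m :
  q * (qcount m.*2 p 0)%:R = q ^+ m.*2 + chi ^+ m * (q - 1) * q ^+ m /\
  q * (qcount m.*2 p 1)%:R = q ^+ m.*2 - chi ^+ m * q ^+ m.
Proof.
have p1 : (p %| 1)%N = false by rewrite dvdn1; have := prime_gt1 pp; lia.
elim: m => [|m [IH0 IH1]]; first by rewrite !qcount0 dvdn0 p1 /= !expr0; split; ring.
by rewrite doubleS !qcount_recR !mulrDr !(mulrCA q (chi * q)) IH0 IH1 !exprS; split; ring.
Qed.

Lemma qcount_odd m :
  (qcount m.*2.+1 p 0)%:R = q ^+ m.*2 /\
  (qcount m.*2.+1 p 1)%:R = q ^+ m.*2 + chi ^+ m.+1 * q ^+ m.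
Proof.
elim: m => [|m [IH0 IH1]].
  have [-> /(congr1 (fun z : int => z%:~R : R))] := qcount_odd1 pp podd.
  by rewrite -pmulrn rmorphD /= -chi4E => ->; rewrite /chi !expr0 expr1 mulr1.
by rewrite doubleS !qcount_recR IH0 IH1 !exprS; split; ring.
Qed.

Lemma pcountE n : (pcount n p p)%:R = (qcount n p 0)%:R - 1 :> R.
Proof. by rewrite qcount_primitive1 ?prime_gt1 // natrD addrK. Qed.

(** With eta = chi^m = 1 or -1, the denominator 1 - q^(2m) y^2 splits into (1 - eta q^m y)(1 + eta
    q^m y), and the second factor cancels against the numerator. *)
Lemma Lodd_even m (y : R) : (0 < m)%N -> q ^+ m.*2.-1 * y != 1 -> q ^+ m.*2 * y ^+ 2 != 1 ->
  Lodd m.*2 p y = (1 - chi ^+ m * q ^+ m.-1 * y) /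
     ((1 - q ^+ m.*2.-1 * y) * (1 - chi ^+ m * q ^+ m * y)).
Proof.
case: m => // m _; rewrite doubleS /= => y1 y2; have [E _] := qcount_even m.+1.
have q0 : q != 0 by have := odd_prime_ge3; lra.
have E' : (qcount m.*2.+2 p 0)%:R = q ^+ m.*2.+1 + chi ^+ m.+1 * (q - 1) * q ^+ m.
  by apply: (mulfI q0); rewrite E doubleS !exprS; ring.
rewrite /Lodd pcountE E' -/q /=.
have h2 : (chi ^+ m.+1) ^+ 2 = 1 by rewrite -exprM mulnC exprM chi4_odd_sqr ?expr1n.
move: (chi ^+ m.+1) h2 => eta h2.
have qm : q ^+ m.*2.+1 = q * (q ^+ m) ^+ 2 by rewrite exprS -muln2 exprM.
have y2' : 1 - q ^+ m.*2.+2 * y ^+ 2 = (1 - eta * q ^+ m.+1 * y) * (1 + eta * q ^+ m.+1 * y).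
  by rewrite !exprS -muln2 exprM -[LHS]mulr1 -[X in _ * X]subr0 -(subrr (eta ^+ 2)) h2; ring: h2.
have n1 : 1 - q ^+ m.*2.+1 * y != 0 by rewrite subr_eq0 eq_sym.
have : 1 - q ^+ m.*2.+2 * y ^+ 2 != 0 by rewrite subr_eq0 eq_sym.
rewrite y2' mulf_eq0 negb_or => /andP[n2 n3].
rewrite qm (exprS q m) expr2 in n1 n2 n3 *.
move: (q ^+ m) n1 n2 n3 => x n1 n2 n3.
have /orP[/eqP e|/eqP e] : (eta == 1) || (eta == -1) by rewrite -sqrf_eq1 h2.
  rewrite e in n2 n3 *; field; apply/and3P; split.
  - by apply: contra_neq n2 => h; rewrite -[RHS]h /q; ring.
  - by apply: contra_neq n1 => h; rewrite -[RHS]h /q; ring.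
  - by apply: contra_neq n3 => h; rewrite -[RHS]h /q; ring.
rewrite e in n2 n3 *; field; apply/and3P; split.
- by first [apply: contra_neq n3 => h; rewrite -[RHS]h /q; ring|apply: contra_neq n2 => h; rewrite -[RHS]h /q; ring].
- by apply: contra_neq n1 => h; rewrite -[RHS]h /q; ring.
- by first [apply: contra_neq n3 => h; rewrite -[RHS]h /q; ring|apply: contra_neq n2 => h; rewrite -[RHS]h /q; ring].
Qed.

Lemma Lodd_odd m (y : R) : q ^+ m.*2 * y != 1 -> q ^+ m.*2.+1 * y ^+ 2 != 1 ->
  Lodd m.*2.+1 p y = (1 - q ^+ m.*2 * y ^+ 2) /
     ((1 - q ^+ m.*2 * y) * (1 - q ^+ m.*2.+1 * y ^+ 2)).
Proof.
rewrite /Lodd pcountE => y1 y2; have [-> _] := qcount_odd m; rewrite -/q /=.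
have n1 : 1 - q ^+ m.*2 * y != 0 by rewrite subr_eq0 eq_sym.
have n2 : 1 - q ^+ m.*2.+1 * y ^+ 2 != 0 by rewrite subr_eq0 eq_sym.
by rewrite exprS in n2 *; field; rewrite n1 n2.
Qed.

(* [Mloc] is the local series of the counts attached to p b^2 + |a|^2. *)
Definition Mloc (L y : R) n p := (qcount n p 1)%:R + (L - 1 - (qcount n p 0)%:R * y) / y.

End OddPrime.
End LocalFactors.

Section Epsilon.
Variable R : realType.

Lemma powR_nat_sub (q x : R) (k : nat) : 0 <= q -> x = k%:R -> q `^ x = q ^+ k.
Proof. by move=> q0 ->; rewrite powR_mulrn. Qed.

Lemma powR_nat_neg (q x : R) (k : nat) : 0 <= q -> x = - k%:R -> q `^ x = (q ^+ k)^-1.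
Proof. by move=> q0 ->; rewrite powRN powR_mulrn. Qed.

Lemma natd m : (m.*2)%:R = 2 * m%:R :> R.
Proof. by rewrite -muln2 natrM mulrC. Qed.

Variable p : nat.
Hypotheses (pp : prime p) (podd : odd p).
Let q : R := p%:R.
Let chi : R := chi4 R p.

Lemma chi_pow_even m : chi ^+ m.*2 = 1.
Proof. by rewrite -mul2n exprM chi4_odd_sqr // expr1n. Qed.

(** The power of chi is 1 or chi according to the parity of m + 1, which merges the cases n = 0 and
    n = 2 modulo 4. [epsilon_odd] merges n = 1 and n = 3 in the same way. *)
Lemma epsilon_even m : epsilon m.+1.*2 p (m.+1.*2%:R : R) =
  (q * (q ^+ m) ^+ 2 + 1 - q^-1 - chi ^+ m.+1 * q ^+ m) / (1 - chi ^+ m.+1 / (q ^+ 2 * q ^+ m)).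
Proof.
have q0 : 0 <= q := ler0n _ _.
have e1 : q `^ (m.+1.*2%:R - 1) = q * (q ^+ m) ^+ 2.
  rewrite (@powR_nat_sub _ _ m.*2.+1) // ?natd //; last by rewrite -!natr1 natd; ring.
  by rewrite exprS -muln2 exprM.
have e2 : q `^ (m.+1.*2%:R / 2 - 1) = q ^+ m.
  by rewrite (@powR_nat_sub _ _ m) // natd -natr1; field.
have e3 : q `^ (m.+1.*2%:R - m.+1.*2%:R) = 1 by rewrite subrr powRr0.
have e4 : q `^ (2 * m.+1.*2%:R - 1 - 2 * m.+1.*2%:R) = q^-1.
  by rewrite (@powR_nat_neg _ _ 1%N) ?expr1 //; ring.
have e5 : q `^ (m.+1.*2%:R / 2 - 1 - m.+1.*2%:R) = (q ^+ 2 * q ^+ m)^-1.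
  rewrite (@powR_nat_neg _ _ m.+2) //; last by rewrite natd -!natr1; field.
  by rewrite !exprS !mulrA expr0 mulr1.
rewrite /epsilon -/q e1 e2 e3 e4 e5 {e1 e2 e3 e4 e5}.
case: (boolP (odd m)) => om.
  have -> : (m.+1.*2 %% 4 == 0)%N by clear -om; lia.
  have -> : chi ^+ m.+1 = 1 by rewrite (_ : m.+1 = (m.+1./2).*2)%N ?chi_pow_even //; clear -om; lia.
  by rewrite !mul1r.
have -> : (m.+1.*2 %% 4 == 0)%N = false by clear -om; lia.
have -> : (m.+1.*2 %% 4 == 2)%N by clear -om; lia.
by have -> : chi ^+ m.+1 = chi by rewrite exprS [in LHS](_ : m = (m./2).*2)%N ?chi_pow_even ?mulr1 //; clear -om; lia.
Qed.

Lemma epsilon_odd m : epsilon m.*2.+1 p (m.*2.+1%:R : R) =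
  ((q ^+ m) ^+ 2 + 1 - q^-1 + chi ^+ m.+1 * q ^+ m) / (1 + chi ^+ m.+1 / (q * q ^+ m)).
Proof.
have q0 : 0 <= q := ler0n _ _.
have e1 : q `^ (m.*2.+1%:R - 1) = (q ^+ m) ^+ 2.
  rewrite (@powR_nat_sub _ _ m.*2) //; last by rewrite -natr1; ring.
  by rewrite -muln2 exprM.
have e2 : q `^ ((m.*2.+1%:R - 1) / 2) = q ^+ m.
  by rewrite (@powR_nat_sub _ _ m) // -natr1 natd; field.
have e3 : q `^ (m.*2.+1%:R - m.*2.+1%:R) = 1 by rewrite subrr powRr0.
have e4 : q `^ (2 * m.*2.+1%:R - 1 - 2 * m.*2.+1%:R) = q^-1.
  by rewrite (@powR_nat_neg _ _ 1%N) ?expr1 //; ring.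
have e5 : q `^ ((m.*2.+1%:R - 1) / 2 - m.*2.+1%:R) = (q * q ^+ m)^-1.
  rewrite (@powR_nat_neg _ _ m.+1) //; last by rewrite -!natr1 natd; field.
  by rewrite exprS.
rewrite /epsilon -/q e1 e2 e3 e4 e5 {e1 e2 e3 e4 e5}.
have -> : (m.*2.+1 %% 4 == 0)%N = false by clear; lia.
have -> : (m.*2.+1 %% 4 == 2)%N = false by clear; lia.
case: (boolP (odd m)) => om.
  have -> : (m.*2.+1 %% 4 == 1)%N = false by clear -om; lia.
  have -> : chi ^+ m.+1 = 1 by rewrite (_ : m.+1 = (m.+1./2).*2)%N ?chi_pow_even //; clear -om; lia.
  by rewrite !mul1r.
have -> : (m.*2.+1 %% 4 == 1)%N by clear -om; lia.
by have -> : chi ^+ m.+1 = chi by rewrite exprS [in LHS](_ : m = (m./2).*2)%N ?chi_pow_even ?mulr1 //; clear -om; lia.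
Qed.

(** The value of [epsilon] at s = n is the local factor for e = p divided by the one for e = 1, both
    at y = p^-n. In terms of q and X = q^m this is a rational identity, checked for either sign of
    the power of chi. *)
Lemma epsilonE n : (0 < n)%N -> let y := (q ^+ n)^-1 in
  Lodd n p y != 0 /\ Mloc (Lodd n p y) y n p / Lodd n p y = epsilon n p (n%:R : R).
Proof.
move=> n0 y.
have q3 : 3 <= q := odd_prime_ge3 R pp podd.
have X1 k : 1 <= q ^+ k by rewrite exprn_ege1 //; lra.
have qX3 k : 3 <= q * q ^+ k by rewrite -[3]mulr1; apply: ler_pM.
have eta2 k : chi ^+ k = 1 \/ chi ^+ k = -1.
  have : (chi ^+ k) ^+ 2 = 1 by rewrite -exprM mulnC exprM chi4_odd_sqr // expr1n.
  by move=> /eqP; rewrite sqrf_eq1 => /orP[/eqP|/eqP]; [left|right].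
have [m nE] : exists m, n = m.+1.*2 \/ n = m.*2.+1.
  by exists (n.-1./2); case: (boolP (odd n)) => ?; [right|left]; lia.
have x0 : q != 0 by lra.
case: nE => nE; rewrite nE in y *.
  have yE : y = (q ^+ 2 * (q ^+ m) ^+ 2)^-1.
    by rewrite /y -muln2 exprM (exprS q m) exprMn.
  have E1 : q ^+ (m.+1).*2.-1 = q * (q ^+ m) ^+ 2 by rewrite doubleS /= exprS -muln2 exprM.
  have E2 : q ^+ (m.+1).*2 = q ^+ 2 * (q ^+ m) ^+ 2 by rewrite -muln2 exprM (exprS q m) exprMn.
  have [F0 F1] := @qcount_even R p pp podd m.+1.
  have {}F0 : (qcount m.+1.*2 p 0)%:R = q * (q ^+ m) ^+ 2 + chi ^+ m.+1 * (q - 1) * q ^+ m.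
    by apply: (mulfI x0); rewrite F0 -/q E2 -/chi (exprS q m); ring.
  have {}F1 : (qcount m.+1.*2 p 1)%:R = q * (q ^+ m) ^+ 2 - chi ^+ m.+1 * q ^+ m.
    by apply: (mulfI x0); rewrite F1 -/q E2 -/chi (exprS q m); ring.
  have Z0 : q ^+ 2 * (q ^+ m) ^+ 2 * y = 1 by rewrite yE divff // -E2 expf_neq0.
  have y9 : y <= 9^-1.
    have Q : 9 <= q ^+ 2 * (q ^+ m) ^+ 2.
      by have := ler_pM (ler0n _ 3) (ler0n _ 3) (qX3 m) (qX3 m); rewrite -exprMn expr2; lra.
    by rewrite yE lef_pV2 ?posrE //; lra.
  have LE : Lodd m.+1.*2 p y = (1 - chi ^+ m.+1 * q ^+ m * y) /
     ((1 - q^-1) * (1 - chi ^+ m.+1 * (q * q ^+ m) * y)).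
    have YE : q * (q ^+ m) ^+ 2 * y = q^-1 by rewrite yE; field; rewrite x0 expf_neq0.
    rewrite Lodd_even //= -/q -/chi ?E1 ?E2 ?(exprS q m) ?YE //.
    - by rewrite -invr1 (inj_eq invr_inj); lra.
    - by rewrite [y ^+ 2]expr2 mulrA Z0 mul1r; lra.
  rewrite /Mloc epsilon_even LE F0 F1.
  move: (q ^+ m) (X1 m) yE {LE F0 F1 E1 E2 Z0 y9} => X X1m yE.
  have qX : 3 <= q * X by rewrite -[3]mulr1; apply: ler_pM.
  have qX2 : 9 <= q * (q * X) by have := ler_pM (ler0n _ 3) (ler0n _ 3) q3 qX; lra.
  have X0 : X != 0 by lra.
  have qm1 : q - 1 != 0 by lra.
  have g1 : q * X - 1 != 0 by lra.
  have g2 : q * X + 1 != 0 by lra.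
  have g3 : q ^+ 2 * X - 1 != 0 by rewrite expr2 -mulrA; lra.
  have g4 : q ^+ 2 * X + 1 != 0 by rewrite expr2 -mulrA; lra.
  have q1 : 1 - q^-1 != 0 by rewrite subr_eq0 eq_sym -invr1 (inj_eq invr_inj); lra.
  have N1 e : e = 1 \/ e = -1 -> 1 - e * X * y != 0 /\ 1 - e * (q * X) * y != 0.
    move=> e1; have -> : 1 - e * X * y = (q ^+ 2 * X - e) / (q ^+ 2 * X) by rewrite yE; field; rewrite x0 X0.
    have -> : 1 - e * (q * X) * y = (q * X - e) / (q * X) by rewrite yE; field; rewrite x0 X0.
    by rewrite !mulf_neq0 ?invr_eq0 ?mulf_neq0 ?expf_neq0 //; case: e1 => ->; rewrite ?opprK.
  have [n1 n2] := N1 _ (eta2 m.+1).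
  split; first by rewrite !mulf_neq0 // invr_eq0 mulf_neq0.
  rewrite yE in n1 n2 *; case: (eta2 m.+1) n1 n2 => -> n1 n2; rewrite ?(mul1r, mulN1r, opprK, mulNr) in n1 n2 *; field.
  - by rewrite ?x0 ?X0 ?qm1 ?g1 ?g2 ?g3 ?g4.
  - by rewrite ?x0 ?X0 ?qm1 ?g1 ?g2 ?g3 ?g4.
have yE : y = (q * (q ^+ m) ^+ 2)^-1 by rewrite /y exprS -muln2 exprM.
have E1 : q ^+ m.*2 = (q ^+ m) ^+ 2 by rewrite -muln2 exprM.
have [F0 F1] := @qcount_odd R p pp podd m.
have E2 : q ^+ m.*2.+1 = q * (q ^+ m) ^+ 2 by rewrite exprS E1.
have Z1 : (q ^+ m) ^+ 2 * y = q^-1 by rewrite yE; field; rewrite x0 expf_neq0.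
have Z2 : q * (q ^+ m) ^+ 2 * y = 1 by rewrite yE divff // -E2 expf_neq0.
have y3 : y <= 3^-1.
  have Q : 3 <= q * (q ^+ m) ^+ 2 by rewrite -exprM -[3]mulr1; apply: ler_pM.
  by rewrite yE lef_pV2 ?posrE //; lra.
have LE : Lodd m.*2.+1 p y = (1 - q^-1 * y) / ((1 - q^-1) * (1 - y)).
  have e1 : (q ^+ m) ^+ 2 * y ^+ 2 = q^-1 * y by rewrite [y ^+ 2]expr2 mulrA Z1.
  have e2 : q * (q ^+ m) ^+ 2 * y ^+ 2 = y by rewrite [y ^+ 2]expr2 mulrA Z2 mul1r.
  rewrite Lodd_odd // -/q ?E1 ?E2 ?e1 ?e2 ?Z1 //.
  - by rewrite -invr1 (inj_eq invr_inj); lra.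
  - by lra.
rewrite /Mloc epsilon_odd LE F0 F1 -/q -/chi E1.
move: (q ^+ m) (X1 m) yE {LE F0 F1 E1 E2 Z1 Z2 y3} => X X1m yE.
have qX : 3 <= q * X by rewrite -[3]mulr1; apply: ler_pM.
have qX2 : 3 <= q * X ^+ 2 by rewrite -[3]mulr1; apply: ler_pM => //; apply: exprn_ege1.
have X0 : X != 0 by lra.
have qm1 : q - 1 != 0 by lra.
have g1 : q * X - 1 != 0 by lra.
have g2 : q * X + 1 != 0 by lra.
have g3 : q * X ^+ 2 - 1 != 0 by lra.
have n1 : 1 - q^-1 * y = (q * X - 1) * (q * X + 1) / (q * X) ^+ 2.
  by rewrite yE; field; rewrite x0 X0.
have n2 : 1 - y = (q * X ^+ 2 - 1) / (q * X ^+ 2) by rewrite yE; field; rewrite x0 X0.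
have n3 : 1 - q^-1 = (q - 1) / q by field.
split.
  by rewrite n1 n2 n3 !(mulf_neq0, invr_eq0, expf_neq0) // ?invr_eq0 !(mulf_neq0, invr_eq0, expf_neq0).
rewrite n1 n2 n3 yE; case: (eta2 m.+1) => ->; rewrite ?(mul1r, mulN1r, mulNr); field.
- by rewrite ?x0 ?X0 ?qm1 ?g1 ?g2 ?g3.
- by rewrite ?x0 ?X0 ?qm1 ?g1 ?g2 ?g3.
Qed.

End Epsilon.

(** * The local factor at 2 *)

Section TwoAdic.
Variable R : realType.

Lemma qcount_eqm n m c j r k : (j = k * m + r)%N -> qcount n m (j + c) = qcount n m (r + c).
Proof. by move=> ->; apply: qcount_mod; rewrite -addnA modnMDl. Qed.

Lemma qcount4S n c : qcount n.+1 4 c = (2 * qcount n 4 c + 2 * qcount n 4 c.+1)%N.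
Proof.
rewrite qcountS -(big_mkord xpredT (fun x => qcount n 4 (x ^ 2 + c))) !big_nat_recr //= big_geq //.
rewrite (@qcount_eqm n 4 c (2 ^ 2) 0 1) // (@qcount_eqm n 4 c (3 ^ 2) 1 2) //.
rewrite !add0n !(@qcount_eqm n 4 c (0 ^ 2) 0 0) // (@qcount_eqm n 4 c (1 ^ 2) 1 0) //.
by rewrite !add0n add1n; move: (qcount n 4 c) (qcount n 4 c.+1) => x y; clear; lia.
Qed.

(** Among the eight squares modulo 8, two are 0, two are 4 and four are 1. *)
Lemma qcount8S n c : qcount n.+1 8 c =
  (2 * qcount n 8 c + 2 * qcount n 8 (c + 4) + 4 * qcount n 8 c.+1)%N.
Proof.
rewrite qcountS -(big_mkord xpredT (fun x => qcount n 8 (x ^ 2 + c))) !big_nat_recr //= big_geq //.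
rewrite (@qcount_eqm n 8 c (7 ^ 2) 1 6) // (@qcount_eqm n 8 c (6 ^ 2) 4 4) //.
rewrite (@qcount_eqm n 8 c (5 ^ 2) 1 3) // (@qcount_eqm n 8 c (4 ^ 2) 0 2) //.
rewrite (@qcount_eqm n 8 c (3 ^ 2) 1 1) // (@qcount_eqm n 8 c (2 ^ 2) 4 0) //.
rewrite (@qcount_eqm n 8 c (1 ^ 2) 1 0) // (@qcount_eqm n 8 c (0 ^ 2) 0 0) //.
rewrite !add0n !add1n (addnC 4 c).
by move: (qcount n 8 c) (qcount n 8 c.+1) (qcount n 8 (c + 4)) => x y z; clear; lia.
Qed.

(** A quarter of the sum of exp(2 pi i k j / 8) over odd k modulo 8. *)
Definition sgm (j : nat) : R := if (4 %| j)%N then (-1) ^+ (j %/ 4) else 0.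

Lemma sgmD4 j : sgm (j + 4) = - sgm j.
Proof.
rewrite /sgm dvdn_addl //; case: ifP => [_|]; last by rewrite oppr0.
by rewrite divnDr // exprD expr1 mulrN1.
Qed.

(* tau n c = 2 Re ((1+i)^n i^c) *)
Fixpoint tau (n c : nat) : R :=
  if n is n'.+1 then tau n' c + tau n' c.+1
  else if (c %% 4 == 0)%N then 2 else if (c %% 4 == 2)%N then - 2 else 0.

Lemma tauD2 n c : tau n c.+2 = - tau n c.
Proof.
elim: n c => [|n IH] c /=; last by rewrite !IH; ring.
have : (c %% 4 = 0 \/ c %% 4 = 1 \/ c %% 4 = 2 \/ c %% 4 = 3)%N by lia.
move=> [|[|[|]]] h; rewrite (_ : c.+2 %% 4 = (c %% 4 + 2) %% 4)%N ?h /= ?oppr0 ?opprK //; lia.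
Qed.

Lemma tau4 n c : tau n.+4 c = - 4 * tau n c.
Proof. by rewrite /= !tauD2; ring. Qed.

Lemma tau4k k n c : tau (4 * k + n)%N c = (- 4) ^+ k * tau n c.
Proof.
elim: k => [|k IH]; first by rewrite mul1r.
by rewrite (_ : 4 * k.+1 + n = (4 * k + n).+4)%N ?tau4 ?IH ?exprS ?mulrA //; lia.
Qed.

(** This is the Fourier expansion modulo 4. Frequency 0 gives 4^n, frequencies 1 and 3 together give
    2^n [tau n c], and frequency 2 has a vanishing Gauss sum, so it shows up only for n = 0. *)
Lemma qcount4E n c : 4 * (qcount n 4 c)%:R =
  4 ^+ n + 2 ^+ n * tau n c + (n == 0%N)%:R * (-1) ^+ c :> R.
Proof.
elim: n c => [|n IH] c.
  rewrite qcount0 !expr0 /= !mul1r -signr_odd.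
  have : (c %% 4 = 0 \/ c %% 4 = 1 \/ c %% 4 = 2 \/ c %% 4 = 3)%N by lia.
  move=> [|[|[|]]] h; rewrite h /= /dvdn h /=.
  - by rewrite (_ : odd c = false) ?expr0; [ring|lia].
  - by rewrite (_ : odd c = true) ?expr1; [ring|lia].
  - by rewrite (_ : odd c = false) ?expr0; [ring|lia].
  - by rewrite (_ : odd c = true) ?expr1; [ring|lia].
rewrite qcount4S natrD !natrM mulrDr !(mulrCA 4) !IH /= !exprS.
by case: n {IH} => [|n] /=; ring.
Qed.

(** The even frequencies modulo 8 reproduce the count modulo 4; the odd ones have Gauss sums 4 exp(2
    pi i k / 8) and add up to the [sgm] term. The proof verifies this by induction on n. *)
Lemma qcount8E n c : 2 * (qcount n 8 c)%:R =
  2 ^+ n * (qcount n 4 c)%:R + 4 ^+ n * sgm (n + c) :> R.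
Proof.
elim: n c => [|n IH] c.
  rewrite !qcount0 add0n !mul1r /sgm.
  case: (boolP (4 %| c)%N) => h4; last first.
    by rewrite (_ : (8 %| c)%N = false) /=; [ring|lia].
  rewrite -signr_odd; case: (boolP (8 %| c)%N) => h8.
    by rewrite (_ : odd (c %/ 4) = false) /=; [ring|lia].
  by rewrite (_ : odd (c %/ 4) = true) /=; [ring|lia].
rewrite qcount8S 2!natrD !natrM qcount4S natrD !natrM.
have h0 := IH c; have h1 := IH c.+1; have h4 := IH (c + 4)%N.
rewrite addnA sgmD4 in h4; rewrite addnS -addSn in h1.
rewrite (addnC c 4) (@qcount_eqm n 4 c 4 0 1) // add0n in h4 *.
by rewrite !exprS; lra.
Qed.

Lemma qcount_two n c : (0 < n)%N -> (2 * qcount n 2 c = 2 ^ n)%N.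
Proof.
case: n => // n _; have := @qcount_total n 2 c isT; rewrite expnS => <-.
rewrite qcountS -(big_mkord xpredT (fun x => qcount n 2 (x ^ 2 + c))) -(big_mkord xpredT (fun x => qcount n 2 (x + c))).
rewrite !big_nat_recr //= big_geq //.
by rewrite [(0 ^ 2 + c)%N]/(0 + c)%N [(1 ^ 2 + c)%N]/(1 + c)%N big_geq // add0n.
Qed.

(** At y = 2^-n the geometric tail of [Ltwo] has ratio 1/2, and the primitive counts modulo 2, 4 and
    8 come from [qcount_two], [qcount4E] and [qcount8E]. *)
Lemma Mloc_two n : (0 < n)%N -> let y : R := (2 ^+ n)^-1 in
  Mloc (Ltwo n y) y n 2 = (2 ^+ n + tau n 0 / 2 - 1 + sgm n) / (1 - y).
Proof.
move=> n0 y; have T c : (qcount n 2 c)%:R = 2 ^+ n / 2 :> R.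
  by have /(congr1 (fun m => m%:R : R)) := qcount_two c n0; rewrite natrM natrX => <-; field.
have P1 : (pcount n 2 2)%:R = 2 ^+ n / 2 - 1 :> R.
  by have /(congr1 (fun m => m%:R : R)) := @qcount_primitive1 n 2 isT; rewrite natrD T => ->; ring.
have q1 : qcount n 1 0 = 1%N.
  rewrite /qcount (eq_bigr (fun=> 1%N)) => [|a _]; last by rewrite dvd1n.
  by rewrite sum1_card card_ffun !card_ord exp1n.
have x0 : (2 ^+ n : R) != 0 by rewrite expf_neq0.
have four : (4 ^+ n : R) = (2 ^+ n) ^+ 2 by rewrite -exprM mulnC exprM; congr (_ ^+ _); ring.
have P2 : (pcount n 4 2)%:R = (2 ^+ n) ^+ 2 / 4 + 2 ^+ n * tau n 0 / 4 - 2 ^+ n :> R.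
  have /(congr1 (fun m => m%:R : R)) := @qcount_primitive n 2 0 isT.
  rewrite natrD natrM natrX /= q1 => E.
  have := qcount4E n 0; rewrite (gtn_eqF n0) mul0r addr0 four.
  by rewrite [qcount n 4 0]/(qcount n (2 ^ 2) 0) E; lra.
have P3 : (pcount n 8 2)%:R = (2 ^+ n * ((2 ^+ n) ^+ 2 / 4 + 2 ^+ n * tau n 0 / 4)
    + (2 ^+ n) ^+ 2 * sgm n) / 2 - 2 ^+ n * (2 ^+ n / 2) :> R.
  have /(congr1 (fun m => m%:R : R)) := @qcount_primitive n 2 1 isT.
  rewrite natrD natrM natrX expn1 T => E.
  have := qcount4E n 0; rewrite (gtn_eqF n0) mul0r addr0 four => E4.
  have := qcount8E n 0; rewrite addn0 four.
  rewrite [qcount n 8 0]/(qcount n (2 ^ 3) 0) E.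
  have -> : (qcount n 4 0)%:R = (2 ^+ n) ^+ 2 / 4 + 2 ^+ n * tau n 0 / 4 :> R by lra.
  by lra.
have x2 : (2 <= 2 ^+ n :> R).
  by case: n n0 {y T P1 q1 x0 four P2 P3} => // n _; rewrite exprS ler_peMr // exprn_ege1 // ler1n.
have h : 2 ^+ n.-1 * y = 2^-1.
  by rewrite /y -{2}(prednK n0) exprS; field; rewrite expf_neq0.
rewrite /Mloc /Ltwo !T P1 P2 P3 h /y.
move: (2 ^+ n) x0 x2 => x x0 x2.
by field; rewrite x0 /=; lra.
Qed.

End TwoAdic.

(** * Zeta and L-functions on the real axis *)

Section Series.
Variable R : realType.

Lemma series_tail (f B : nat -> R) : (forall k, `|f k| <= B k) -> cvgn (series B) ->
  cvgn (series f) /\ forall N, `|limn (series f) - series f N| <= limn (series B) - series B N.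
Proof.
move=> fB cB.
have cf : cvgn (series f).
  apply: normed_cvg; apply: (series_le_cvg _ _ _ cB) => k //=.
  by apply: le_trans (fB k).
split=> // N.
have h1 : `|series f M - series f N| @[M --> \oo] --> `|limn (series f) - series f N|.
  by apply: cvg_norm; apply: cvgB => //; exact: cvg_cst.
have h2 : series B M - series B N @[M --> \oo] --> limn (series B) - series B N.
  by apply: cvgB => //; exact: cvg_cst.
rewrite -(cvg_lim _ h1) // -(cvg_lim _ h2) //.
apply: ler_lim; [exact: cvgP h1|exact: cvgP h2|].
near=> M; have NM : (N <= M)%N by near: M; exact: nbhs_infty_ge.
rewrite /series /= !(big_cat_nat (leq0n N) NM) /= !(addrAC _ _ (- _)) !subrr !add0r.
by apply: le_trans (ler_norm_sum _ _ _) _; apply: ler_sum => k _.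
Unshelve. all: by end_near.
Qed.

(** Dominated convergence for series: beyond a fixed N all tails are below the tail of the majorant,
    and a finite sum passes to the limit. *)
Lemma tannery_right (f : R -> nat -> R) (B : nat -> R) (a : R) :
  cvgn (series B) -> (forall z k, a <= z < a + 1 -> `|f z k| <= B k) ->
  (forall k, f z k @[z --> a^'+] --> f a k) ->
  limn (series (f z)) @[z --> a^'+] --> limn (series (f a)).
Proof.
move=> cB fB fc; apply/cvgrPdist_lt => e e0.
have e3 : 0 < e / 3 by rewrite divr_gt0.
have [N _ HN] : \forall N \near \oo, `|limn (series B) - series B N| < e / 3.
  by move/cvgrPdist_lt: cB => /(_ _ e3).
have {}HN := HN N (leqnn N).
have tail z : a <= z < a + 1 -> `|limn (series (f z)) - series (f z) N| < e / 3.
  move=> za; have [_ /(_ N) h] := series_tail (fun k => fB z k za) cB.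
  by apply: le_lt_trans h (le_lt_trans (ler_norm _) HN).
have fin : series (f z) N @[z --> a^'+] --> series (f a) N.
  rewrite /series /=; elim: (N) => [|M IH].
    by under eq_cvg do rewrite big_geq //; rewrite big_geq //; exact: cvg_cst.
  by under eq_cvg do rewrite big_nat_recr //=; rewrite big_nat_recr //=; exact: cvgD.
near=> z.
have za : a <= z < a + 1.
  apply/andP; split; first by apply: ltW; near: z; exact: nbhs_right_gt.
  by near: z; apply: nbhs_right_lt; rewrite ltrDl.
have h1 := tail z za; have h2 : `|limn (series (f a)) - series (f a) N| < e / 3.
  by apply: tail; rewrite lexx ltrDl ltr01.
have h3 : `|series (f a) N - series (f z) N| < e / 3.
  by near: z; move/cvgrPdist_lt: fin => /(_ _ e3).
have -> : limn (series (f a)) - limn (series (f z)) = (limn (series (f a)) - series (f a) N)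
   + (series (f a) N - series (f z) N) - (limn (series (f z)) - series (f z) N) by ring.
apply: le_lt_trans (ler_normB _ _) _; apply: le_lt_trans (lerD (ler_normD _ _) (lexx _)) _.
by move: h1 h2 h3; lra.
Unshelve. all: by end_near.
Qed.

Lemma powR_cvg (x a : R) : 0 < x -> x `^ z @[z --> a^'+] --> x `^ a.
Proof.
move=> x0; have E z : x `^ z = expR (z * ln x) by rewrite /powR gt_eqF.
under eq_cvg do rewrite E; rewrite E.
apply: cvg_at_right_filter; apply: (cvg_comp (fun z => z * ln x) expR).
  by apply: cvgM; [exact: cvg_id|exact: cvg_cst].
exact: continuous_expR.
Qed.

Lemma powRN_cvg (x a : R) : 0 < x -> x `^ (- z) @[z --> a^'+] --> x `^ (- a).
Proof.
move=> x0; have E z : x `^ (- z) = (x `^ z)^-1 by rewrite powRN.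
under eq_cvg do rewrite E; rewrite E.
by apply: cvgV; [rewrite gt_eqF // powR_gt0|exact: powR_cvg].
Qed.

End Series.

(** * The zeta function to the right of 1 *)

Section Zeta.
Variable R : realType.
Implicit Types s x y : R.

(** Convexity: t^(1-s) lies above its tangent at x. Applied to consecutive integers and telescoped,
    it replaces the comparison of the zeta series with an integral. *)
Lemma powR_tangent s x y : 1 <= s -> 0 < x -> 0 < y ->
  x `^ (1 - s) + (1 - s) * x `^ (- s) * (y - x) <= y `^ (1 - s).
Proof.
move=> s1 x0 y0; have x0' : x != 0 by rewrite gt_eqF.
have -> : y `^ (1 - s) = x `^ (1 - s) * (y / x) `^ (1 - s).
  by rewrite -powRM ?divr_ge0 ?ltW // mulrC divfK.
have -> : (1 - s) * x `^ (- s) * (y - x) = x `^ (1 - s) * ((1 - s) * (y / x - 1)).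
  rewrite powRD ?x0' ?implybT // powRr1 ?ltW //.
  by field.
rewrite -[X in X + _]mulr1 -mulrDr ler_wpM2l ?powR_ge0 //.
have u0 : 0 < y / x by rewrite divr_gt0.
rewrite /powR gt_eqF //; apply: le_trans (expR_ge1Dx _).
rewrite lerD2l; apply: ler_wnM2l; first by lra.
rewrite -ler_expR lnK ?posrE //; apply: le_trans (expR_ge1Dx _).
by rewrite addrC subrK.
Qed.

Definition zterm s (k : nat) : R := k.+1%:R `^ (- s).

Lemma zterm_ge0 s k : 0 <= zterm s k. Proof. exact: powR_ge0. Qed.

Lemma zseries_le s N : 1 < s -> (s - 1) * series (zterm s) N.+1 <= s - N.+1%:R `^ (1 - s).
Proof.
move=> s1; elim: N => [|N IH].
  by rewrite /series /= big_nat1 /zterm !powR1; lra.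
rewrite seriesSr mulrDr.
have := @powR_tangent s N.+2%:R N.+1%:R (ltW s1) (ltr0Sn _ _) (ltr0Sn _ _).
rewrite -[N.+2%:R]natr1 opprD addrA subrr add0r mulrN1 natr1 -/(zterm s N.+1).
by move: (zterm s N.+1) (series _ _) IH => u v; nra.
Qed.

Lemma zseries_ge s N : 1 < s -> 1 - N.+1%:R `^ (1 - s) <= (s - 1) * series (zterm s) N.
Proof.
move=> s1; elim: N => [|N IH].
  by rewrite /series /= big_geq // powR1 mulr0 subrr.
rewrite seriesSr mulrDr.
have := @powR_tangent s N.+1%:R N.+2%:R (ltW s1) (ltr0Sn _ _) (ltr0Sn _ _).
rewrite -[N.+2%:R]natr1 addrAC subrr add0r mulr1 natr1 -/(zterm s N).
by move: (zterm s N) (series _ _) IH => u v; nra.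
Qed.

Lemma zeta_cvg s : 1 < s -> series (zterm s) @ \oo --> zeta s.
Proof.
move=> s1; have nd : nondecreasing_seq (series (zterm s)).
  by apply/nondecreasing_seqP => N; rewrite /series /= big_nat_recr //= lerDl zterm_ge0.
suff: cvgn (series (zterm s)) by [].
apply: nondecreasing_is_cvgn => //; exists (s / (s - 1)) => _ [N _ <-].
rewrite ler_pdivlMr ?subr_gt0 // mulrC.
have := nd N N.+1 (leqnSn _); rewrite -(ler_pM2l (_ : 0 < s - 1)) ?subr_gt0 // => /le_trans; apply.
by apply: le_trans (zseries_le N s1) _; rewrite lerBlDr lerDl powR_ge0.
Qed.

Lemma zseries_zeta s N : 1 < s -> series (zterm s) N <= zeta s.
Proof.
move=> s1; have c := zeta_cvg s1; rewrite -(cvg_lim (@Rhausdorff R) c).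
apply: (nondecreasing_cvgn_le _ (cvgP _ c) N).
by apply/nondecreasing_seqP => m; rewrite /series /= big_nat_recr //= lerDl zterm_ge0.
Qed.

Lemma zeta_ge1 s : 1 < s -> 1 <= zeta s.
Proof. by move=> s1; have := zseries_zeta 1 s1; rewrite /series /= big_nat1 /zterm powR1. Qed.

Lemma zeta_bounds s : 1 < s -> 1 <= (s - 1) * zeta s <= s.
Proof.
move=> s1; have s0 : 0 < s - 1 by rewrite subr_gt0.
apply/andP; split; last first.
  rewrite mulrC -ler_pdivlMr //; apply: limr_le; first exact: cvgP (zeta_cvg s1).
  near=> N; rewrite ler_pdivlMr // mulrC.
  have N0 : (0 < N)%N by near: N; exact: nbhs_infty_gt.
  rewrite -(prednK N0); apply: le_trans (zseries_le _ s1) _.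
  by rewrite lerBlDr lerDl powR_ge0.
apply/ler_addgt0Pr => e e0.
have [N eN] : exists N : nat, (e^-1) `^ ((s - 1)^-1) < N.+1%:R.
  by exists (Num.truncn ((e^-1) `^ ((s - 1)^-1))); have /andP[_] := truncn_itv (powR_ge0 (e^-1) ((s - 1)^-1)).
have := zseries_ge N s1; have := zseries_zeta N s1; rewrite -(ler_pM2l s0) => h1 h2.
suff : N.+1%:R `^ (1 - s) <= e by move: h1 h2; lra.
have -> : 1 - s = - (s - 1) by ring.
rewrite powRN -[e]invrK lef_pV2 ?posrE ?invr_gt0 // ?powR_gt0 //.
have -> : e^-1 = ((e^-1) `^ ((s - 1)^-1)) `^ (s - 1).
  by rewrite -powRrM mulVf ?gt_eqF // powRr1 // invr_ge0 ltW.
by apply: ge0_ler_powR; rewrite ?nnegrE ?powR_ge0 ?ltW.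
Unshelve. all: by end_near.
Qed.

Lemma zeta_esum s : 1 < s ->
  (\esum_(b in [set b | (0 < b)%N]) (b%:R `^ (- s))%:E = (zeta s)%:E)%E.
Proof.
move=> s1; rewrite -(esum_series (@zterm_ge0 s) (zeta_cvg s1)).
rewrite (reindex_esum [set: nat] [set b | (0 < b)%N] succn) //.
split=> [k|k l _ _ []|k /= k0]; rewrite //.
by exists k.-1 => //=; rewrite prednK.
Qed.

Lemma zeta_right a : 1 < a -> zeta (z : R) @[z --> a^'+] --> zeta a.
Proof.
move=> a1; apply: (@tannery_right R zterm (zterm a)).
- exact: cvgP (zeta_cvg a1).
- move=> z k /andP[az _]; rewrite ger0_norm ?zterm_ge0 // /zterm.
  by rewrite ler_powR ?lerN2 // ler1n.
- by move=> k; apply: powRN_cvg.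
Qed.

End Zeta.

(** * Euler products of signed completely multiplicative functions *)

Section SignedEuler.
Variable R : realType.

Lemma sum_multiples (P N : nat) (g : nat -> R) : (0 < P)%N ->
  \sum_(0 <= k < N | (P %| k.+1)%N) g k.+1 = \sum_(0 <= k < (N %/ P)%N) g (P * k.+1)%N.
Proof.
move=> P0; elim: N => [|N IH]; first by rewrite div0n !big_geq.
rewrite divnS // big_mkcond big_nat_recr //= -big_mkcond IH.
case: ifP => PN; last by rewrite add0n addr0.
rewrite add1n big_nat_recr //=; congr (_ + g _).
have := divnK PN; rewrite divnS // PN add1n => h.
by rewrite -{1}h mulnC.
Qed.

Variables (f : nat -> R) (s : R).
Hypothesis f1 : f 1%N = 1.
Hypothesis fM : forall x y, (0 < x)%N -> (0 < y)%N -> f (x * y)%N = f x * f y.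
Hypothesis s1 : 1 < s.
Hypothesis fs : forall k, `|f k.+1| <= zterm s k.

Definition rough (P m : nat) : bool := all (fun p => ~~ (prime p && (p %| m)%N)) (iota 0 P).

Let A P := series (fun k => if rough P k.+1 then f k.+1 else 0).

Lemma roughS P m : rough P.+1 m = rough P m && ~~ (prime P && (P %| m)%N).
Proof. by rewrite /rough -addn1 iotaD all_cat /= andbT. Qed.

Lemma rough_mul P m : prime P -> rough P (P * m) = rough P m.
Proof.
move=> pP; apply: eq_in_all => p; rewrite mem_iota /= add0n => pP'.
case: (boolP (prime p)) => //= pp; rewrite Euclid_dvdM // dvdn_prime2 //.
by rewrite (ltn_eqF pP').
Qed.

(** One step of the sieve of Eratosthenes. Among the indices free of primes below P, the multiples
    of a prime P carry the factor f P by complete multiplicativity, and their cofactors run up to N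
    / P. *)
Lemma seriesS_rough P N : A P.+1 N =
  A P N - if prime P then f P * A P (N %/ P)%N else 0.
Proof.
have -> : A P.+1 N = A P N - \sum_(0 <= k < N) if rough P k.+1 && (prime P && (P %| k.+1)%N) then f k.+1 else 0.
  rewrite /A /series /= -sumrB; apply: eq_bigr => k _; rewrite roughS.
  by case: (rough P _); case: (prime P && _); rewrite //= ?subrr ?subr0.
congr (_ - _); case: ifP => pP; last first.
  by rewrite big1 // => k _; rewrite andbF.
have := @sum_multiples P N (fun m => if rough P m then f m else 0) (prime_gt0 pP).
rewrite big_mkcond /= => E.
transitivity (\sum_(0 <= i < N) (if (P %| i.+1)%N then if rough P i.+1 then f i.+1 else 0 else 0)).
  by apply: eq_bigr => k _; case: (rough P _) => //=; case: ifP.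
rewrite E /A /series /= mulr_sumr; apply: eq_bigr => k _.
have -> : rough P (P * k.+1) = rough P k.+1 by exact: rough_mul.
have -> := fM (prime_gt0 pP) (ltn0Sn k).
by case: (rough P k.+1) => //; rewrite mulr0.
Qed.

Lemma divn_cvg P : (0 < P)%N -> (N %/ P)%N @[N --> \oo] --> \oo.
Proof.
move=> P0; apply/cvgnyPge => M; near=> N.
rewrite leq_divRL //; near: N; exact: nbhs_infty_ge.
Unshelve. all: by end_near.
Qed.

Lemma rough_cvg P : A P @ \oo -->
  \prod_(p < P | prime p) (1 - f p) * limn (series (fun k => f k.+1)).
Proof.
elim: P => [|P IH].
  rewrite big_ord0 mul1r.
  have [cf _] := series_tail fs (cvgP _ (zeta_cvg s1)).
  exact: cf.
rewrite big_mkcond big_ord_recr -big_mkcond /=.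
have -> : A P.+1 = (fun N => A P N - if prime P then f P * A P (N %/ P)%N else 0).
  by apply/funext => N; exact: seriesS_rough.
case: ifP => pP; last first.
  by rewrite mulr1; under eq_cvg do rewrite subr0; exact: IH.
set Q := \prod_(_ < P | _) _; set L := limn _.
have -> : Q * (1 - f P) * L = Q * L - f P * (Q * L) by ring.
apply: cvgB; first exact: IH.
by apply: cvgMr; apply: cvg_comp IH; apply: divn_cvg; exact: prime_gt0.
Qed.

Lemma rough_small P m : (1 < m)%N -> rough P m -> (P <= m)%N.
Proof.
move=> m1 /allP rm; rewrite leqNgt; apply/negP => mP.
have := rm (pdiv m); rewrite mem_iota /= add0n (leq_ltn_trans (pdiv_leq (ltnW m1)) mP).
by rewrite pdiv_prime // pdiv_dvd => /(_ isT).
Qed.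

(** After sieving by all primes below P only the index 1 and indices at least P survive, so the
    distance to 1 is bounded by a tail of the zeta series. Signs do not matter, and nonvanishing of
    the limit follows. *)
Lemma euler_signed : \prod_(p < P | prime p) (1 - f p) *
  limn (series (fun k => f k.+1)) @[P --> \oo] --> (1 : R).
Proof.
set L := limn _; apply/cvgrPdist_le => e e0.
have [N0 _ HN] : \forall N \near \oo, `|zeta s - series (zterm s) N| <= e.
  by move/cvgrPdist_le: (zeta_cvg s1) => /(_ _ e0).
near=> P; have P0 : (N0 < P)%N by near: P; exact: nbhs_infty_gt.
have cP := rough_cvg (P := P).
have c' : `|1 - A P N| @[N --> \oo] --> `|1 - \prod_(p < P | prime p) (1 - f p) * L|.
  by apply: cvg_norm; apply: cvgB => //; exact: cvg_cst.
rewrite -(cvg_lim _ c') //; apply: limr_le; first exact: cvgP c'.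
near=> N; have PN : (P.-1 <= N)%N by near: N; exact: nbhs_infty_ge.
have N1 : (0 < N)%N by near: N; exact: nbhs_infty_gt.
have := HN P.-1; rewrite /= => /(_ _) h; apply: le_trans (h _); last by move: P0; clear; lia.
have r1 : rough P 1.
  by apply/allP => p _; case: (boolP (prime p)) => //= pp; rewrite dvdn1; apply: contraTneq pp => ->.
have key M : `|1 - A P M.+1| <= Num.max 0 (series (zterm s) M.+1 - series (zterm s) P.-1).
  elim: M => [|M IH].
    by rewrite /A /series /= big_nat1 r1 f1 subrr normr0 le_max lexx.
  rewrite /A seriesSr -/(A P) opprD addrA.
  case: (ltnP M.+2 P) => MP.
    rewrite ifF; last by apply/negP => rP; have := @rough_small P M.+2 isT rP; rewrite leqNgt MP.
    rewrite subr0; apply: le_trans IH _; rewrite ge_max le_max lexx /= le_max; apply/orP; right.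
    by rewrite [in leRHS]seriesSr lerD2r lerDl zterm_ge0.
  apply: le_trans (ler_normB _ _) _.
  have h0 : series (zterm s) P.-1 <= series (zterm s) M.+1.
    have MP' : (P.-1 <= M.+1)%N by move: MP; clear; lia.
    rewrite -(subnKC MP'); elim: (M.+1 - P.-1)%N => [|j IHj]; first by rewrite addn0.
    by apply: le_trans IHj _; rewrite addnS seriesSr lerDl zterm_ge0.
  move: IH; rewrite max_r ?subr_ge0 // => IH.
  rewrite le_max; apply/orP; right; rewrite [in leRHS]seriesSr addrAC lerD //.
  by case: ifP => _; rewrite ?normr0 ?zterm_ge0.
have := key N.-1; rewrite prednK // => /le_trans; apply.
rewrite ge_max normr_ge0 /=; apply: le_trans (ler_norm _); rewrite lerD2r.
exact: zseries_zeta.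
Unshelve. all: by end_near.
Qed.

Lemma euler_signed_neq0 : limn (series (fun k => f k.+1)) != 0.
Proof.
apply/eqP => L0; have h : (fun _ : nat => 0 : R) @ \oo --> (1 : R).
  by have := euler_signed; rewrite L0; under eq_cvg do rewrite mulr0.
by have := cvg_lim (@Rhausdorff R) h; rewrite lim_cst // => E; have := oner_neq0 R; rewrite -E eqxx.
Qed.

Lemma euler_signedV : \prod_(p < P | prime p) (1 - f p)^-1 @[P --> \oo] -->
  limn (series (fun k => f k.+1)).
Proof.
have L0 := euler_signed_neq0.
set L := limn _ in L0 *.
have h : (\prod_(p < P | prime p) (1 - f p) * L)^-1 @[P --> \oo] --> (1 : R).
  by rewrite -[1 in X in _ --> X]invr1; apply: cvgV; [exact: oner_neq0|exact: euler_signed].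
have h2 : (\prod_(p < P | prime p) (1 - f p) * L)^-1 * L @[P --> \oo] --> 1 * L by apply: cvgMl.
move: h2; rewrite mul1r; apply: cvg_trans.
apply: near_eq_cvg; near=> P.
by rewrite invfM -mulrA mulVf // mulr1 -prodfV.
Unshelve. all: by end_near.
Qed.

End SignedEuler.

(** * The L-function of chi_(-4) *)

Section LFunction.
Variable R : realType.

Lemma chi4M x y : chi4 R (x * y)%N = chi4 R x * chi4 R y.
Proof.
rewrite /chi4 -modnMm.
have : (x %% 4 < 4)%N by rewrite ltn_mod.
have : (y %% 4 < 4)%N by rewrite ltn_mod.
by case: (x %% 4)%N => [|[|[|[|?]]]] //; case: (y %% 4)%N => [|[|[|[|?]]]] // _ _ /=;
  rewrite ?mulr0 ?mul0r ?mulr1 ?mul1r ?mulrNN ?mulr1.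
Qed.

Lemma chi4_norm x : `|chi4 R x| <= 1.
Proof. by rewrite /chi4; case: ifP => _; [|case: ifP => _]; rewrite ?normrN ?normr1 ?normr0. Qed.

(** The terms with indices 4j + 1 and 4j + 3 taken together. The pairs are O(j^-2) uniformly near
    any a >= 1, which includes the conditionally convergent point 1 required for n = 2. *)
Definition lpair (z : R) (j : nat) : R :=
  (4 * j + 1)%:R `^ (- z) - (4 * j + 3)%:R `^ (- z).

(** The tangent inequality with exponent z + 1 bounds the difference by 2 z x^-(z+1) at x = 4j +
    1. *)
Lemma lpair_bound a z j : 1 <= a -> a <= z < a + 1 ->
  `|lpair z j| <= 2 * (a + 1) * zterm 2 j.
Proof.
move=> a1 /andP[az za]; have z1 : 1 <= z + 1 by lra.
set x : R := (4 * j + 1)%:R; set y : R := (4 * j + 3)%:R.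
have x0 : 0 < x by rewrite ltr0n; lia.
have y0 : 0 < y by rewrite ltr0n; lia.
have xy : y = x + 2 by rewrite /x /y -natrD; congr (_%:R); lia.
have le1 : y `^ (- z) <= x `^ (- z).
  rewrite !powRN lef_pV2 ?posrE ?powR_gt0 //; apply: ge0_ler_powR; rewrite ?nnegrE ?ltW //; lra.
rewrite /lpair -/x -/y ger0_norm ?subr_ge0 //.
have h := @powR_tangent R (z + 1) x y.
have e1 : 1 - (z + 1) = - z by ring.
have e2 : y - x = 2 by rewrite xy addrAC subrr add0r.
rewrite e1 e2 in h; have {}h := h z1 x0 y0.
have x1 : 1 <= x by rewrite ler1n addn1.
have h2 : x `^ (- (z + 1)) <= zterm 2 j.
  apply: (@le_trans _ _ (x `^ (- 2))); first by rewrite ler_powR // lerN2; lra.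
  rewrite /zterm !powRN lef_pV2 ?posrE ?powR_gt0 // ?ltr0n //.
  by apply: ge0_ler_powR; rewrite ?nnegrE ?ler0n // /x ler_nat; lia.
have := powR_ge0 x (- (z + 1)).
move: h h2; move: (x `^ (- z)) (y `^ (- z)) (x `^ (- (z + 1))) (zterm 2 j) => u v w t h h2 w0.
have : z * w <= (a + 1) * t by apply: ler_pM => //; lra.
by move: h; rewrite !mulNr; clear; lra.
Qed.

Lemma lseries4 z K : series (fun k => chi4 R k.+1 * k.+1%:R `^ (- z)) (4 * K)%N = series (lpair z) K.
Proof.
elim: K => [|K IH]; first by rewrite muln0 /series /= !big_geq.
rewrite (_ : 4 * K.+1 = (4 * K).+4)%N; last by lia.
rewrite !seriesSr IH; set m := (4 * K)%N.
have c1 : chi4 R m.+1 = 1 by rewrite /chi4 (_ : m.+1 %% 4 = 1)%N //; lia.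
have c2 : chi4 R m.+2 = 0 by rewrite /chi4 (_ : m.+2 %% 4 = 2)%N //; lia.
have c3 : chi4 R m.+3 = -1 by rewrite /chi4 (_ : m.+3 %% 4 = 3)%N //; lia.
have c4 : chi4 R m.+4 = 0 by rewrite /chi4 (_ : m.+4 %% 4 = 0)%N //; lia.
by rewrite c1 c2 c3 c4 /lpair -/m addn1 addn3; ring.
Qed.

Lemma zterm2_cvg c : cvgn (series (fun k => c * zterm (2 : R) k)).
Proof.
have h := zeta_cvg (ltr1n R 2 : 1 < (2 : R)).
apply/cvg_ex; exists (c * zeta (2 : R)).
rewrite (_ : series _ = (fun N => c * series (zterm 2) N)); last first.
  by apply/funext => N; rewrite /series /= mulr_sumr.
by apply: cvgMr.
Qed.

Lemma lpair_cvg z : 1 <= z ->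
  series (fun k => chi4 R k.+1 * k.+1%:R `^ (- z)) @ \oo --> limn (series (lpair z)).
Proof.
move=> z1; have zz : z <= z < z + 1 by rewrite lexx ltrDl ltr01.
have [c _] := series_tail (fun j => lpair_bound j z1 zz) (@zterm2_cvg _).
set u := series _.
have c4 : series (lpair z) (N %/ 4)%N @[N --> \oo] --> limn (series (lpair z)).
  by apply: cvg_comp c; apply: divn_cvg.
rewrite -[X in _ --> X]add0r.
have -> : u = (fun N => (u N - series (lpair z) (N %/ 4)%N) + series (lpair z) (N %/ 4)%N).
  by apply/funext => N; rewrite subrK.
apply: cvgD => //.
apply/cvgr0Pnorm_le => e e0; near=> N.
have b : `|u N - series (lpair z) (N %/ 4)%N| <= (N %/ 4).+1%:R^-1.
  rewrite -lseries4 -/(u _) {1}(divn_eq N 4) mulnC; set m := (4 * (N %/ 4))%N.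
  have c1 : chi4 R m.+1 = 1 by rewrite /chi4 (_ : m.+1 %% 4 = 1)%N //; lia.
  have c2 : chi4 R m.+2 = 0 by rewrite /chi4 (_ : m.+2 %% 4 = 2)%N //; lia.
  have c3 : chi4 R m.+3 = -1 by rewrite /chi4 (_ : m.+3 %% 4 = 3)%N //; lia.
  have sm k : (N %/ 4 <= k)%N -> `|(k.+1%:R : R) `^ (- z)| <= (N %/ 4).+1%:R^-1.
    move=> hk; rewrite ger0_norm ?powR_ge0 //.
    rewrite powRN lef_pV2 ?posrE ?powR_gt0 ?ltr0n //.
    by apply: (@le_trans _ _ k.+1%:R); rewrite ?ler_nat // -[leLHS]powRr1 ?ler0n // ler_powR // ler1n.
  have nn : (N %/ 4 <= m)%N by rewrite /m leq_pmull.
  have : (N %% 4 < 4)%N by rewrite ltn_mod.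
  case: (N %% 4)%N => [|[|[|[|?]]]] // _.
  - by rewrite addn0 subrr normr0 invr_ge0.
  - by rewrite addn1 /u seriesSr c1 mul1r addrC addKr; exact: sm.
  - by rewrite addn2 /u !seriesSr c1 c2 mul0r addr0 mul1r addrC addKr; exact: sm.
  - rewrite addn3 /u !seriesSr c1 c2 c3 mul0r addr0 mul1r mulN1r.
    rewrite (_ : _ + _ - _ - _ = m.+1%:R `^ (- z) - m.+3%:R `^ (- z)); last by ring.
    have mo : m.+3%:R `^ (- z) <= (m.+1%:R : R) `^ (- z).
      rewrite !powRN lef_pV2 ?posrE ?powR_gt0 ?ltr0n //.
      have mm : (m.+1%:R <= m.+3%:R :> R) by rewrite ler_nat -(addn2 m.+1) leq_addr.
      by apply: ge0_ler_powR; rewrite ?nnegrE ?ler0n //; lra.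
    rewrite ger0_norm ?subr_ge0 //; have := sm m nn; rewrite ger0_norm ?powR_ge0 //.
    by apply: le_trans; rewrite lerBlDr lerDl powR_ge0.
apply: le_trans b _; rewrite invf_ple ?posrE ?ltr0n //.
apply: (@le_trans _ _ (Num.truncn e^-1).+1%:R).
  have e1 : 0 <= e^-1 by rewrite invr_ge0 ltW.
  by have /andP[_ h] := truncn_itv e1; exact: ltW.
rewrite ler_nat ltnS leq_divRL //; near: N; exact: nbhs_infty_ge.
Unshelve. all: by end_near.
Qed.

Lemma Lchi4E z : 1 <= z -> Lchi4 z = limn (series (lpair z)).
Proof. by move=> z1; apply: (cvg_lim (@Rhausdorff R)); exact: lpair_cvg. Qed.

Lemma Lchi4_right (a : R) : 1 <= a -> Lchi4 z @[z --> a^'+] --> Lchi4 a.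
Proof.
move=> a1; rewrite (Lchi4E a1).
apply: cvg_trans; last apply: (@tannery_right R lpair (fun j => 2 * (a + 1) * zterm 2 j) a).
- apply: near_eq_cvg; near=> z; rewrite Lchi4E //; apply: le_trans a1 _; apply: ltW.
  by near: z; exact: nbhs_right_gt.
- exact: zterm2_cvg.
- by move=> z k; exact: lpair_bound.
- by move=> k; apply: cvgB; apply: powRN_cvg; rewrite ltr0n; lia.
Unshelve. all: by end_near.
Qed.

Definition zchar (z : R) (m : nat) : R := m%:R `^ (- z).
Definition lchar (z : R) (m : nat) : R := chi4 R m * m%:R `^ (- z).

Lemma zcharM z x y : (0 < x)%N -> (0 < y)%N -> zchar z (x * y)%N = zchar z x * zchar z y.
Proof. by move=> x0 y0; rewrite /zchar natrM powRM. Qed.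

Lemma lcharM z x y : (0 < x)%N -> (0 < y)%N -> lchar z (x * y)%N = lchar z x * lchar z y.
Proof. by move=> x0 y0; rewrite /lchar chi4M -/(zchar z _) zcharM // /zchar; ring. Qed.

Lemma zeta_euler (z : R) : 1 < z ->
  \prod_(p < P | prime p) (1 - p%:R `^ (- z))^-1 @[P --> \oo] --> zeta z.
Proof.
move=> z1; apply: (@euler_signedV R (zchar z) z) => //.
- by rewrite /zchar powR1.
- by move=> x y; exact: zcharM.
- by move=> k; rewrite ger0_norm // powR_ge0.
Qed.

Lemma zeta_eulerV (z : R) : 1 < z ->
  \prod_(p < P | prime p) (1 - p%:R `^ (- z)) @[P --> \oo] --> (zeta z)^-1.
Proof.
move=> z1; have : (\prod_(p < P | prime p) (1 - p%:R `^ (- z))^-1)^-1 @[P --> \oo] --> (zeta z)^-1.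
  by apply: cvgV; [rewrite gt_eqF // (lt_le_trans ltr01 (zeta_ge1 z1))|exact: zeta_euler].
apply: cvg_trans.
by apply: near_eq_cvg; near=> P; rewrite -prodfV; apply: eq_bigr => p _; rewrite invrK.
Unshelve. all: by end_near.
Qed.

Lemma lchar_hyps z : 1 < z -> [/\ lchar z 1 = 1,
  forall x y, (0 < x)%N -> (0 < y)%N -> lchar z (x * y)%N = lchar z x * lchar z y &
  forall k, `|lchar z k.+1| <= zterm z k].
Proof.
move=> z1; split=> [|x y|k]; [by rewrite /lchar powR1 /chi4 mulr1|exact: lcharM|].
rewrite normrM [X in _ * X]ger0_norm ?powR_ge0 //.
by rewrite -[leRHS]mul1r ler_wpM2r ?powR_ge0 ?chi4_norm.
Qed.

Lemma Lchi4_euler z : 1 < z ->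
  \prod_(p < P | prime p) (1 - chi4 R p * p%:R `^ (- z))^-1 @[P --> \oo] --> Lchi4 z.
Proof. by move=> z1; have [h1 h2 h3] := lchar_hyps z1; exact: (euler_signedV h1 h2 z1 h3). Qed.

Lemma Lchi4_neq0 (z : R) : 1 < z -> Lchi4 z != 0.
Proof. by move=> z1; have [h1 h2 h3] := lchar_hyps z1; exact: (euler_signed_neq0 h1 h2 z1 h3). Qed.

Lemma Lchi4_eulerV z : 1 < z ->
  \prod_(p < P | prime p) (1 - chi4 R p * p%:R `^ (- z)) @[P --> \oo] --> (Lchi4 z)^-1.
Proof.
move=> z1; have : (\prod_(p < P | prime p) (1 - chi4 R p * p%:R `^ (- z))^-1)^-1 @[P --> \oo] --> (Lchi4 z)^-1.
  by apply: cvgV; [exact: Lchi4_neq0|exact: Lchi4_euler].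
apply: cvg_trans.
by apply: near_eq_cvg; near=> P; rewrite -prodfV; apply: eq_bigr => p _; rewrite invrK.
Unshelve. all: by end_near.
Qed.

End LFunction.

(** The N(b) of the overview with a general e in place of 2d, so that the primes of d can be removed
    one at a time. *)
Definition Nb (n e b : nat) : nat := qcount n (e * b) (b ^ 2).

(** Modulo e1 b1 the number b2 is a unit, so (b1 b2)^2 may be replaced by b1^2; likewise with the
    indices exchanged. *)
Lemma Nb_split n e1 e2 b1 b2 : coprime (e1 * b1) (e2 * b2) ->
  Nb n (e1 * e2) (b1 * b2) = (Nb n e1 b1 * Nb n e2 b2)%N.
Proof.
move=> co; rewrite /Nb mulnACA qcount_crt // expnMn; congr (_ * _)%N.
  by rewrite (mulnC (b1 ^ 2)%N) qcount_sqr_coprime // (coprime_dvdr (dvdn_mull e2 (dvdnn b2)) co).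
by rewrite qcount_sqr_coprime // coprime_sym (coprime_dvdl (dvdn_mull e1 (dvdnn b1)) co).
Qed.

Lemma Nb1 n b : Nb n 1 b = qcount n b 0.
Proof.
rewrite /Nb mul1n; apply: qcount_mod; apply/eqP.
by rewrite eqn_mod_dvd // subn0 dvdn_exp.
Qed.

Lemma qcount_1 n c : qcount n 1 c = 1%N.
Proof.
rewrite /qcount (eq_bigr (fun=> 1%N)) => [|a _]; last by rewrite dvd1n.
by rewrite sum1_card card_ffun !card_ord exp1n.
Qed.

(** * The Dirichlet series of the solution counts *)

Section DirichletSeries.
Variable R : realType.
Implicit Types (s y L : R).

Definition Dser (n e : nat) (s : R) : \bar R :=
  (\esum_(b in [set b | (0 < b)%N]) ((Nb n e b)%:R * b%:R `^ (- s))%:E)%E.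

(** The cofactor of the local series at p in [Dser], when p does not divide e. *)
Definition Dcop (n e p : nat) (s : R) : \bar R :=
  (\esum_(b in [set b | (p^')%N.-nat b]) ((Nb n e b)%:R * b%:R `^ (- s))%:E)%E.

Lemma powR_exp (p j : nat) s : (0 < p)%N -> (p ^ j)%:R `^ (- s) = (p%:R `^ (- s)) ^+ j :> R.
Proof. by move=> p0; rewrite natrX -powR_mulrn // -powRrM mulrC powRrM powR_mulrn ?powR_ge0. Qed.

Lemma Dser_part n e e' p s : prime p -> (0 < e)%N -> (p.-nat e') -> ~~ (p %| e)%N ->
  Dser n (e' * e) s = ((\esum_(j in [set: nat])
     ((Nb n e' (p ^ j))%:R * (p%:R `^ (- s)) ^+ j)%:E) * Dcop n e p s)%E.
Proof.
move=> pp e0 pe' pe; rewrite /Dser (@esum_partn _ p _ [set b | (p^')%N.-nat b] _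
   (fun b => ((Nb n e' b)%:R * b%:R `^ (- s))%:E) (fun b => ((Nb n e b)%:R * b%:R `^ (- s))%:E)) //.
- rewrite esum_ppow //; congr (_ * _)%E; apply: eq_esum => j _.
  by rewrite powR_exp // prime_gt0.
- move=> x y px py; have x0 : (0 < x)%N by case/andP: px.
  have y0 : (0 < y)%N by case/andP: py.
  by split=> //= _; rewrite muln_gt0 x0.
- move=> x y px /= py; rewrite Nb_split; last first.
    apply: (@pnat_coprime p); first by rewrite pnatM pe'.
    by rewrite pnatM py andbT p'natE.
  by rewrite !natrM powRM // -EFinM; congr EFin; ring.
Qed.

Lemma Mloc_esum n p y L : prime p -> 0 < y ->
  (\esum_(j in [set: nat]) ((qcount n (p ^ j) 0)%:R * y ^+ j)%:E = L%:E)%E ->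
  (\esum_(j in [set: nat]) ((Nb n p (p ^ j))%:R * y ^+ j)%:E = (Mloc L y n p)%:E)%E.
Proof.
move=> pp y0 hL.
have f0 j : 0 <= (qcount n (p ^ j) 0)%:R * y ^+ j by rewrite mulr_ge0 // exprn_ge0 // ltW.
have cL := series_esum f0 hL.
apply: esum_series; first by move=> j; rewrite mulr_ge0 // exprn_ge0 // ltW.
rewrite -cvg_shiftS.
have -> : (fun N => series (fun j => (Nb n p (p ^ j))%:R * y ^+ j) N.+1) =
  (fun N => (qcount n p 1)%:R + (series (fun j => (qcount n (p ^ j) 0)%:R * y ^+ j) N.+2
     - 1 - (qcount n p 0)%:R * y) / y).
  apply/funext => N; elim: N => [|N IH].
    rewrite !seriesSr /series /= !big_geq // expn0 expn1 expr0 expr1 qcount_1.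
    by rewrite /Nb muln1 exp1n; field; rewrite gt_eqF.
  rewrite seriesSr IH [in RHS]seriesSr /Nb -expnS.
  rewrite (@qcount_mod n (p ^ N.+2) _ 0); last first.
    by apply/eqP; rewrite eqn_mod_dvd // subn0 -expnM dvdn_exp2l //; lia.
  by rewrite [y ^+ N.+2]exprS; field; rewrite gt_eqF.
rewrite /Mloc; apply: cvgD; first exact: cvg_cst.
apply: cvgMl; apply: cvgB; last exact: cvg_cst.
apply: cvgB; last exact: cvg_cst.
by rewrite (cvg_shiftS (fun N => series _ N.+1)) cvg_shiftS.
Qed.

Lemma local_ge1 n p y L : 0 <= y ->
  (\esum_(j in [set: nat]) ((qcount n (p ^ j) 0)%:R * y ^+ j)%:E = L%:E)%E -> 1 <= L.
Proof.
move=> y0 hL; rewrite -lee_fin -hL.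
have := @le_esum_term R nat [set: nat] (fun j => ((qcount n (p ^ j) 0)%:R * y ^+ j)%:E) 0%N I.
by rewrite expn0 qcount_1 expr0 mulr1; apply => j; rewrite lee_fin mulr_ge0 // exprn_ge0.
Qed.

(** The series for p e and for e are two local series at p times the same [Dcop n e p s]. The
    quotient of the local series makes sense even if this common factor is infinite, because L >=
    1. *)
Lemma Dser_step n e p s L : prime p -> (0 < e)%N -> ~~ (p %| e)%N ->
  (\esum_(j in [set: nat]) ((qcount n (p ^ j) 0)%:R * (p%:R `^ (- s)) ^+ j)%:E = L%:E)%E ->
  Dser n (p * e) s = ((Mloc L (p%:R `^ (- s)) n p / L)%:E * Dser n e s)%E.
Proof.
move=> pp e0 pe hL; have y0 : 0 < p%:R `^ (- s) by rewrite powR_gt0 // ltr0n prime_gt0.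
rewrite (Dser_part _ _ pp e0 _ pe) ?pnat_id // -[X in Dser n X s]mul1n.
rewrite (@Dser_part n e 1 p) // (Mloc_esum pp y0 hL).
under [X in (_ = _ * (X * _))%E]eq_esum => j _ do rewrite Nb1.
rewrite hL muleA -EFinM divfK // gt_eqF // (lt_le_trans ltr01) //.
exact: local_ge1 (ltW y0) hL.
Qed.

Lemma powR_lt1_sub (p n : nat) s t : (1 < p)%N -> t < s -> p%:R `^ t * p%:R `^ (- s) < 1 :> R.
Proof.
move=> p1 ts; have p0 : (p%:R : R) != 0 by rewrite pnatr_eq0; lia.
rewrite -powRD ?p0 ?implybT // -[ltRHS](powRr0 (p%:R : R)); rewrite /powR (negbTE p0) ltr_expR.
by rewrite ltr_pM2r ?subr_lt0 // ln_gt0 // ltr1n.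
Qed.

(** The conditions admit s = n: each local series still converges there, and only the infinite
    product has a pole. *)
Lemma local_conv n p s : (0 < n)%N -> (1 < p)%N -> n%:R < s + 2^-1 -> 2^-1 <= s - n%:R / 2 ->
  p%:R ^+ n.-1 * p%:R `^ (- s) < 1 :> R /\ p%:R ^+ n * (p%:R `^ (- s)) ^+ 2 < 1 :> R.
Proof.
move=> n0 p1 ns ns2; have p0 : 0 <= (p%:R : R) by [].
rewrite -!powR_mulrn ?powR_ge0 // -powRrM mulNr.
split; apply: powR_lt1_sub => //.
  by case: n n0 ns {ns2} => // n _; rewrite -natr1 /=; lra.
by lra.
Qed.

Lemma Lodd_esumR n p s : prime p -> odd p -> (0 < n)%N -> n%:R <= s ->
  (\esum_(j in [set: nat]) ((qcount n (p ^ j) 0)%:R * (p%:R `^ (- s)) ^+ j)%:E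
    = (Lodd n p (p%:R `^ (- s)))%:E)%E.
Proof.
move=> pp po n0 ns; have n1 : 1 <= (n%:R : R) by rewrite ler1n.
have [||h1 h2] := @local_conv n p s n0 (prime_gt1 pp); [lra|lra|].
by apply: Lodd_esum => //; exact: powR_ge0.
Qed.

Lemma Ltwo_esumR n s : (0 < n)%N -> n%:R <= s ->
  (\esum_(j in [set: nat]) ((qcount n (2 ^ j) 0)%:R * (2 `^ (- s)) ^+ j)%:E
    = (Ltwo n (2 `^ (- s)))%:E)%E.
Proof.
move=> n0 ns; have n1 : 1 <= (n%:R : R) by rewrite ler1n.
have [||h1 h2] := @local_conv n 2 s n0 isT; [lra|lra|].
by apply: Ltwo_esum => //; exact: powR_ge0.
Qed.

Definition Mratio n p s : R := Mloc (Lodd n p (p%:R `^ (- s))) (p%:R `^ (- s)) n p / Lodd n p (p%:R `^ (- s)).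

Lemma Dser_prod n (l : seq nat) s : (0 < n)%N -> n%:R <= s -> uniq l ->
  (forall p, p \in l -> prime p && odd p) ->
  Dser n (2 * \prod_(p <- l) p) s = ((\prod_(p <- l) Mratio n p s)%:E * Dser n 2 s)%E.
Proof.
move=> n0 ns; elim: l => [|p l IH] /=; first by rewrite !big_nil muln1 mul1e.
move=> /andP[pl ul] hl; rewrite !big_cons mulnCA.
have /andP[pp po] := hl p (mem_head _ _).
have hl' q : q \in l -> prime q && odd q by move=> ql; apply: hl; rewrite inE ql orbT.
have l0 : (0 < \prod_(q <- l) q)%N.
  by rewrite big_seq; apply: prodn_cond_gt0 => q /hl' /andP[/prime_gt0].
rewrite (Dser_step pp _ _ (Lodd_esumR pp po n0 ns)) ?muln_gt0 //.
  by rewrite IH // muleA -EFinM.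
rewrite Euclid_dvdM // negb_or dvdn_prime2 //; apply/andP; split.
  by apply: contraTneq po => ->.
rewrite big_seq; elim/big_ind: _ => [|x y|q ql].
- by rewrite dvdn1; apply: contraTneq pp => ->.
- by rewrite Euclid_dvdM // negb_or => -> ->.
- have /andP[pq _] := hl' _ ql; rewrite dvdn_prime2 //.
  by apply: contraNneq pl => ->.
Qed.

Lemma prod_primes_squarefree d : (0 < d)%N -> squarefree d -> \prod_(p <- primes d) p = d.
Proof.
move=> d0 sf; rewrite [in RHS](prod_prime_decomp d0) prime_decompE big_map /=.
rewrite !big_seq; apply: eq_bigr => p; rewrite mem_primes => /and3P[pp _ pd].
have := sf p pp; rewrite pfactor_dvdn // -ltnNge ltnS => l1.
have : (0 < logn p d)%N by rewrite logn_gt0 mem_primes pp d0.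
by case: (logn p d) l1 => [|[|]] // _ _; rewrite expn1.
Qed.

Lemma Dser_two n s : (0 < n)%N -> n%:R <= s ->
  Dser n 2 s = ((Mloc (Ltwo n (2 `^ (- s))) (2 `^ (- s)) n 2)%:E * Dcop n 1 2 s)%E.
Proof.
move=> n0 ns; rewrite -[2%N in LHS]muln1 (@Dser_part n 1 2 2) // (Mloc_esum _ _ (Ltwo_esumR n0 ns)) //.
Qed.

Lemma Dcop_euler n s (a b c : nat -> R) (A B C : R) : (0 < n)%N -> n%:R <= s ->
  \prod_(p < P | prime p) (1 - a p)^-1 @[P --> \oo] --> A ->
  \prod_(p < P | prime p) (1 - b p)^-1 @[P --> \oo] --> B ->
  \prod_(p < P | prime p) (1 - c p) @[P --> \oo] --> C ->
  1 - a 2%N != 0 -> 1 - b 2%N != 0 -> 1 - c 2%N != 0 ->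
  (forall p, prime p -> odd p -> Lodd n p (p%:R `^ (- s)) = (1 - c p) / ((1 - a p) * (1 - b p))) ->
  Dcop n 1 2 s = (A * B * C * ((1 - a 2%N) * (1 - b 2%N) / (1 - c 2%N)))%:E.
Proof.
move=> n0 ns hA hB hC a2 b2 c2 LE.
pose f b := if odd b then (qcount n b 0)%:R * b%:R `^ (- s) else 0 : R.
pose Z p := if odd p then Lodd n p (p%:R `^ (- s)) else 1.
(* Removes the Euler factors at 2, which A, B and C contain but the sum over odd b does not. *)
pose kap := (1 - a 2%N) * (1 - b 2%N) / (1 - c 2%N).
have f0 k : 0 <= f k by rewrite /f; case: ifP => // _; rewrite mulr_ge0 // powR_ge0.
have f1 : f 1%N = 1 by rewrite /f /= qcount_1 powR1 mulr1.
have fM (x y : nat) : (0 < x)%N -> (0 < y)%N -> coprime x y -> f (x * y)%N = f x * f y.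
  move=> x0 y0 co; rewrite /f oddM; case: (odd x); case: (odd y); rewrite /= ?mulr0 ?mul0r //.
  by rewrite qcount_crt // !natrM powRM //; ring.
have fZ (p : nat) : prime p -> (\esum_(j in [set: nat]) (f (p ^ j)%N)%:E = (Z p)%:E)%E.
  move=> pp; rewrite /Z; case: ifP => po.
    rewrite -(Lodd_esumR pp po n0 ns); apply: eq_esum => j _.
    by rewrite /f oddX po orbT powR_exp // prime_gt0.
  apply: esum_series => //; apply: cvg_near_cst; near=> N.
  have N0 : (0 < N)%N by near: N; exact: nbhs_infty_gt.
  rewrite -(prednK N0) /series /= big_ltn // expn0 f1 big_nat big1 ?addr0 // => j /andP[j0 _].
  by rewrite /f oddX po orbF (gtn_eqF j0).
have ZP : \prod_(p < P | prime p) Z p @[P --> \oo] --> A * B * C * kap.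
  have h : (\prod_(p < P | prime p) (1 - a p)^-1 * \prod_(p < P | prime p) (1 - b p)^-1 *
      \prod_(p < P | prime p) (1 - c p)) * kap @[P --> \oo] --> A * B * C * kap.
    by apply: cvgMl; apply: cvgM => //; apply: cvgM.
  apply: cvg_trans h; apply: near_eq_cvg; near=> P.
  have P2 : (2 < P)%N by near: P; exact: nbhs_infty_gt.
  have -> : kap = \prod_(p < P | prime p) (if p == 2%N :> nat then kap else 1).
    rewrite (bigD1 (Ordinal P2)) //= big1 ?mulr1 // => p /andP[_ /negP p2].
    rewrite (_ : (nat_of_ord p == 2%N) = false) //.
    by apply/negP => /eqP e; case: p2; apply/eqP/val_inj.
  rewrite -!big_split /=; apply: eq_bigr => p pp; rewrite /Z.
  case: eqP => [->|p2] /=; first by rewrite /kap; field; rewrite a2 b2 c2.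
  case: ifP => po; first by rewrite mulr1 LE // invfM mulrC mulrA.
  by case: (even_prime pp) => // h; rewrite h in po.
rewrite -(euler_cvg f0 f1 fM fZ ZP) /Dcop esum_mkcond [RHS]esum_mkcond.
apply: eq_esum => k _; rewrite /f Nb1.
case: (posnP k) => [->|k0].
  by rewrite !memNset //= => /andP[].
rewrite [in RHS]mem_set //=; case: (boolP (odd k)) => ok.
  by rewrite mem_set //= p'natE // dvdn2 ok.
by rewrite memNset //=; apply/negP; rewrite p'natE // dvdn2 (negbTE ok).
Unshelve. all: by end_near.
Qed.

End DirichletSeries.

(** * Closed form of the odd part and the limit at s = n *)

Section Limits.
Variable R : realType.

Lemma right_affine (f : R -> R) (k c a l : R) : 0 < k ->
  f z @[z --> (k * a + c)^'+] --> l -> f (k * s + c) @[s --> a^'+] --> l.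
Proof.
move=> k0; apply: cvg_comp => P [e /= e0 Pe]; exists (e / k); first by rewrite /= divr_gt0.
move=> s /= sa ais; apply: Pe; last by rewrite ltrD2r ltr_pM2l.
rewrite /ball_ /= opprD addrACA subrr addr0 -mulrBr normrM gtr0_norm // mulrC.
by rewrite -ltr_pdivlMr.
Qed.

Lemma right_shift (f : R -> R) (c a l : R) :
  f z @[z --> (a + c)^'+] --> l -> f (s + c) @[s --> a^'+] --> l.
Proof.
move=> h; have -> : (fun s => f (s + c)) = (fun s => f (1 * s + c)) by apply/funext => s; rewrite mul1r.
by apply: right_affine; rewrite ?mul1r.
Qed.

Lemma zeta_pole (a : R) : (s - a) * zeta (s - a + 1) @[s --> a^'+] --> (1 : R).
Proof.
have c1 : (1 : R) @[s --> a^'+] --> (1 : R) by exact: cvg_cst.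
have c2 : (s - a + 1) @[s --> a^'+] --> (1 : R).
  rewrite -[X in _ --> X]add0r -(subrr a); apply: cvg_at_right_filter.
  by apply: cvgD; [apply: cvgB; [exact: cvg_id|exact: cvg_cst]|exact: cvg_cst].
apply: squeeze_cvgr c1 c2; near=> s.
have s1 : 1 < s - a + 1 by rewrite -ltrBlDr subrr subr_gt0; near: s; exact: nbhs_right_gt.
by have := zeta_bounds s1; rewrite addrK.
Unshelve. all: by end_near.
Qed.

Lemma powR_aff_cvg (p : nat) (k c a : R) : (0 < p)%N -> 0 < k ->
  p%:R `^ (- (k * s + c)) @[s --> a^'+] --> p%:R `^ (- (k * a + c)).
Proof.
move=> p0 k0; apply: (@right_affine (fun z => p%:R `^ (- z))) => //.
by apply: powRN_cvg; rewrite ltr0n.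
Qed.

Lemma Lodd_cvg n p (F : set_system R) (FF : Filter F) (y : R -> R) (l : R) :
  y s @[s --> F] --> l -> 1 - p%:R ^+ n.-1 * l != 0 -> 1 - p%:R ^+ n * l ^+ 2 != 0 ->
  Lodd n p (y s) @[s --> F] --> Lodd n p l.
Proof.
move=> yl n1 n2; rewrite /Lodd; apply: cvgM; last first.
  apply: cvgV => //; apply: cvgB; first exact: cvg_cst.
  by apply: cvgMr; rewrite expr2; under eq_cvg do rewrite expr2; exact: cvgM.
apply: cvgD; first by apply: cvgD => //; exact: cvg_cst.
apply: cvgM; first by apply: cvgMr.
by apply: cvgV => //; apply: cvgB; [exact: cvg_cst|apply: cvgMr].
Qed.

Lemma Ltwo_cvg n (F : set_system R) (FF : Filter F) (y : R -> R) (l : R) :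
  y s @[s --> F] --> l -> 1 - 2 ^+ n.-1 * l != 0 -> 1 - 2 ^+ n * l ^+ 2 != 0 ->
  Ltwo n (y s) @[s --> F] --> Ltwo n l.
Proof.
move=> yl n1 n2; have y2 : y s ^+ 2 @[s --> F] --> l ^+ 2.
  by rewrite expr2; under eq_cvg do rewrite expr2; exact: cvgM.
have y3 : y s ^+ 3 @[s --> F] --> l ^+ 3.
  by rewrite exprS; under eq_cvg do rewrite exprS; exact: cvgM.
rewrite /Ltwo; apply: cvgM; last first.
  by apply: cvgV => //; apply: cvgB; [exact: cvg_cst|apply: cvgMr].
apply: cvgD; last first.
  apply: cvgM; first by apply: cvgMr.
  by apply: cvgV => //; apply: cvgB; [exact: cvg_cst|apply: cvgMr].
apply: cvgD; last by apply: cvgMr.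
apply: cvgD; last by apply: cvgMr.
by apply: cvgD => //; exact: cvg_cst.
Qed.

Lemma Mloc_cvg n p (F : set_system R) (FF : Filter F) (L y : R -> R) (l m : R) :
  y s @[s --> F] --> l -> L s @[s --> F] --> m -> l != 0 ->
  Mloc (L s) (y s) n p @[s --> F] --> Mloc m l n p.
Proof.
move=> yl Lm l0; rewrite /Mloc; apply: cvgD; first exact: cvg_cst.
apply: cvgM; last exact: cvgV.
apply: cvgB; last by apply: cvgMr.
by apply: cvgB => //; exact: cvg_cst.
Qed.

Lemma cvg_bigprod (T : eqType) (l : seq T) (F : set_system R) (FF : Filter F) (f : T -> R -> R) (g : T -> R) :
  (forall t, t \in l -> f t s @[s --> F] --> g t) ->
  \prod_(t <- l) f t s @[s --> F] --> \prod_(t <- l) g t.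
Proof.
elim: l => [|t l IH] h; first by under eq_cvg do rewrite big_nil; rewrite big_nil; exact: cvg_cst.
under eq_cvg do rewrite big_cons; rewrite big_cons; apply: cvgM; first by apply: h; rewrite mem_head.
by apply: IH => u ul; apply: h; rewrite inE ul orbT.
Qed.

(** For odd p the local factor has zeta(s - n + 1) and a second numerator depending on n modulo 4,
    recorded here; [Cfac] is its shift by 1 in the denominator. [twofac] takes out the factors at 2,
    and its second half is 1 for n = 2 modulo 4 because chi_(-4)(2) = 0. *)
Definition Bfac (n : nat) (s : R) : R :=
  if (n %% 4 == 0)%N then zeta (s - n%:R / 2)
  else if (n %% 4 == 2)%N then Lchi4 (s - n%:R / 2) else zeta (2 * s - n%:R).

Definition Cfac (n : nat) (s : R) : R :=
  if (n %% 4 == 0)%N then zeta (s - n%:R / 2 + 1)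
  else if (n %% 4 == 2)%N then Lchi4 (s - n%:R / 2 + 1) else zeta (2 * s - n%:R + 1).

Definition twofac (n : nat) (s : R) : R := (1 - 2 `^ (- (s - n%:R + 1))) *
  (if (n %% 4 == 0)%N then (1 - 2 `^ (- (s - n%:R / 2))) / (1 - 2 `^ (- (s - n%:R / 2 + 1)))
  else if (n %% 4 == 2)%N then 1
  else (1 - 2 `^ (- (2 * s - n%:R))) / (1 - 2 `^ (- (2 * s - n%:R + 1)))).

Lemma powR2_neq1 (t : R) : 0 < t -> 1 - 2 `^ (- t) != 0.
Proof.
move=> t0; rewrite gt_eqF // subr_gt0 /powR pnatr_eq0 /= -[ltRHS]expR0 ltr_expR.
by rewrite nmulr_rlt0 ?oppr_lt0 // ln_gt0 // ltr1n.
Qed.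

Lemma Dcop_closed n s : (0 < n)%N -> n%:R < s ->
  Dcop n 1 2 s = (zeta (s - n%:R + 1) * Bfac n s / Cfac n s * twofac n s)%:E.
Proof.
move=> n0 ns; have n1 : 1 <= (n%:R : R) by rewrite ler1n.
have pp0 p : prime p -> (p%:R : R) != 0 by move=> pp; rewrite pnatr_eq0; have := prime_gt0 pp; lia.
have nat_pow p (k : nat) (x : R) : x = k%:R -> p%:R ^+ k = p%:R `^ x by move=> ->; rewrite powR_mulrn.
rewrite /Bfac /Cfac /twofac.
case: (boolP (odd n)) => on.
  have -> : (n %% 4 == 0)%N = false by clear -on; lia.
  have -> : (n %% 4 == 2)%N = false by clear -on; lia.
  rewrite (@Dcop_euler R n s (fun p => p%:R `^ (- (s - n%:R + 1))) (fun p => p%:R `^ (- (2 * s - n%:R)))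
    (fun p => p%:R `^ (- (2 * s - n%:R + 1))) (zeta (s - n%:R + 1)) (zeta (2 * s - n%:R)) (zeta (2 * s - n%:R + 1))^-1) //.
  - by congr EFin; rewrite !mulrA.
  - exact: ltW.
  - by apply: zeta_euler; lra.
  - by apply: zeta_euler; lra.
  - by apply: zeta_eulerV; lra.
  - by apply: powR2_neq1; lra.
  - by apply: powR2_neq1; lra.
  - by apply: powR2_neq1; lra.
  move=> p pp po; have q0 := pp0 p pp.
  have [m nE] : exists m, n = m.*2.+1 by exists n./2; clear -on; lia.
  have mE : (n%:R : R) = 2 * m%:R + 1 by rewrite nE -natr1 natd.
  have [||h1 h2] := @local_conv R n p s n0 (prime_gt1 pp); [lra|lra|].
  have -> : Lodd n p (p%:R `^ (- s)) = Lodd m.*2.+1 p (p%:R `^ (- s)) by rewrite -nE.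
  have nm : n.-1 = m.*2 by rewrite nE.
  rewrite Lodd_odd ?lt_eqF // -?nE -?nm //.
  have pD (t u : R) : t - s = - u -> p%:R `^ t * p%:R `^ (- s) = p%:R `^ (- u).
    by move=> h; rewrite -powRD ?q0 ?implybT // h.
  rewrite (@nat_pow p n.-1 (n%:R - 1)) ?(@nat_pow p n n%:R) //; last by rewrite nm natd mE; ring.
  rewrite -powR_mulrn ?powR_ge0 // -powRrM.
  rewrite (pD _ (s - n%:R + 1)); last by ring.
  rewrite -!powRD ?q0 ?implybT //.
  have -> : n%:R - 1 + - s * 2 = - (2 * s - n%:R + 1) :> R by ring.
  by have -> : n%:R + - s * 2 = - (2 * s - n%:R) :> R by ring.
have [m nE] : exists m, n = m.+1.*2 by exists (n./2).-1; clear -on n0; lia.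
have mE : (n%:R : R) = 2 * (m%:R + 1) by rewrite nE natd natr1.
have h0 (eta : nat -> R) p : prime p -> odd p -> chi4 R p ^+ m.+1 = eta p ->
    Lodd n p (p%:R `^ (- s)) = (1 - eta p * p%:R `^ (- (s - n%:R / 2 + 1))) /
     ((1 - p%:R `^ (- (s - n%:R + 1))) * (1 - eta p * p%:R `^ (- (s - n%:R / 2)))).
  move=> pp po <-; have q0 := pp0 p pp.
  have [||h1 h2] := @local_conv R n p s n0 (prime_gt1 pp); [lra|lra|].
  have -> : Lodd n p (p%:R `^ (- s)) = Lodd m.+1.*2 p (p%:R `^ (- s)) by rewrite -nE.
  rewrite Lodd_even ?lt_eqF // -?nE //= -!mulrA.
  have pD (t u : R) : t - s = - u -> p%:R `^ t * p%:R `^ (- s) = p%:R `^ (- u).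
    by move=> h; rewrite -powRD ?q0 ?implybT // h.
  rewrite (@nat_pow p m (n%:R / 2 - 1)); last by rewrite mE; field.
  rewrite (@nat_pow p n.-1 (n%:R - 1)); last by rewrite nE doubleS /= -!natr1; ring.
  rewrite (@nat_pow p m.+1 (n%:R / 2)); last by rewrite mE -natr1; field.
  rewrite (pD _ (s - n%:R / 2 + 1)); last by ring.
  rewrite (pD _ (s - n%:R + 1)); last by ring.
  by rewrite (pD _ (s - n%:R / 2)) //; ring.
have m0 : 0 <= (m%:R : R) by [].
case: (boolP (odd m)) => om.
  have -> : (n %% 4 == 0)%N by rewrite nE; clear -om; lia.
  rewrite (@Dcop_euler R n s (fun p => p%:R `^ (- (s - n%:R + 1))) (fun p => p%:R `^ (- (s - n%:R / 2)))
    (fun p => p%:R `^ (- (s - n%:R / 2 + 1))) (zeta (s - n%:R + 1)) (zeta (s - n%:R / 2)) (zeta (s - n%:R / 2 + 1))^-1) //.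
  - by congr EFin; rewrite !mulrA.
  - exact: ltW.
  - by apply: zeta_euler; lra.
  - by apply: zeta_euler; lra.
  - by apply: zeta_eulerV; lra.
  - by apply: powR2_neq1; lra.
  - by apply: powR2_neq1; lra.
  - by apply: powR2_neq1; lra.
  move=> p pp po; rewrite (h0 (fun=> 1)) ?mul1r //.
  by rewrite (_ : m.+1 = (m.+1./2).*2)%N ?chi_pow_even //; clear -om; lia.
have -> : (n %% 4 == 0)%N = false by rewrite nE; clear -om; lia.
have -> : (n %% 4 == 2)%N by rewrite nE; clear -om; lia.
have c2 : chi4 R 2 = 0 by [].
rewrite (@Dcop_euler R n s (fun p => p%:R `^ (- (s - n%:R + 1))) (fun p => chi4 R p * p%:R `^ (- (s - n%:R / 2)))
  (fun p => chi4 R p * p%:R `^ (- (s - n%:R / 2 + 1))) (zeta (s - n%:R + 1)) (Lchi4 (s - n%:R / 2)) (Lchi4 (s - n%:R / 2 + 1))^-1) //.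
- by congr EFin; rewrite c2 !mul0r !subr0 divr1 !mulr1.
- exact: ltW.
- by apply: zeta_euler; lra.
- by apply: Lchi4_euler; lra.
- by apply: Lchi4_eulerV; lra.
- by apply: powR2_neq1; lra.
- by rewrite c2 mul0r subr0 oner_neq0.
- by rewrite c2 mul0r subr0 oner_neq0.
move=> p pp po; rewrite (h0 (chi4 R)) //.
by rewrite exprS [in LHS](_ : m = (m./2).*2)%N ?chi_pow_even ?mulr1 //; clear -om; lia.
Qed.

Lemma Bfac_cvg n : (1 < n)%N -> Bfac n s @[s --> (n%:R : R)^'+] --> Bfac n n%:R.
Proof.
move=> n1; have n2 : 2 <= (n%:R : R) by rewrite ler_nat.
rewrite /Bfac; case: ifP => n4; [|case: ifP => n42].
- have n4' : 4 <= (n%:R : R) by rewrite ler_nat; clear -n4 n1; lia.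
  by apply: (@right_shift (@zeta R)); apply: zeta_right; lra.
- by apply: (@right_shift (@Lchi4 R)); apply: Lchi4_right; lra.
- apply: (@right_affine (@zeta R) 2 (- n%:R) n%:R) => //.
  by apply: zeta_right; lra.
Qed.

Lemma Cfac_cvg n : (0 < n)%N -> Cfac n s @[s --> (n%:R : R)^'+] --> Cfac n n%:R /\ Cfac n (n%:R : R) != 0.
Proof.
move=> n1; have n2 : 1 <= (n%:R : R) by rewrite ler1n.
have z0 (z : R) : 1 < z -> zeta z != 0 by move=> z1; rewrite gt_eqF // (lt_le_trans ltr01) ?zeta_ge1.
rewrite /Cfac; case: ifP => n4; [|case: ifP => n42]; split.
- rewrite -addrA; under eq_cvg do rewrite -addrA.
  by apply: (@right_shift (@zeta R)); apply: zeta_right; lra.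
- by apply: z0; lra.
- rewrite -addrA; under eq_cvg do rewrite -addrA.
  by apply: (@right_shift (@Lchi4 R)); apply: Lchi4_right; lra.
- by apply: Lchi4_neq0; lra.
- rewrite -addrA; under eq_cvg do rewrite -addrA.
  by apply: (@right_affine (@zeta R)) => //; apply: zeta_right; lra.
- by apply: z0; lra.
Qed.

Lemma twofac_cvg n : (0 < n)%N -> twofac n s @[s --> (n%:R : R)^'+] --> twofac n n%:R.
Proof.
move=> n1; have n2 : 1 <= (n%:R : R) by rewrite ler1n.
have pc (k c : R) (f : R -> R) : 0 < k -> (forall s, f s = k * s + c) ->
    1 - 2 `^ (- f s) @[s --> (n%:R : R)^'+] --> 1 - 2 `^ (- f n%:R).
  move=> k0 fE; apply: cvgB; first exact: cvg_cst.
  by under eq_cvg do rewrite fE; rewrite fE; exact: powR_aff_cvg.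
rewrite /twofac; apply: cvgM; first by apply: (pc 1 (- n%:R + 1)) => // s; ring.
case: ifP => n4; [|case: ifP => n42].
- apply: cvgM; first by apply: (pc 1 (- (n%:R / 2))) => // s; ring.
  apply: cvgV; first by apply: powR2_neq1; lra.
  by apply: (pc 1 (- (n%:R / 2) + 1)) => // s; ring.
- exact: cvg_cst.
- apply: cvgM; first by apply: (pc 2 (- n%:R)).
  apply: cvgV; first by apply: powR2_neq1; lra.
  by apply: (pc 2 (- n%:R + 1)) => // s; ring.
Qed.

(** For n = 1 the numerator zeta(2s - 1) has its own pole at s = 1; division by zeta(s) cancels it
    and leaves the quotient 1/2 of the residues. *)
Lemma Bfac_zeta_cvg n : (0 < n)%N -> Bfac n s / zeta s @[s --> (n%:R : R)^'+] -->
  if n == 1%N then 2^-1 else Bfac n n%:R / zeta n%:R.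
Proof.
move=> n0; case: eqP => [->|n1]; last first.
  have n1' : 1 < (n%:R : R) by rewrite ltr1n; lia.
  apply: cvgM; first by apply: Bfac_cvg; lia.
  apply: cvgV; last exact: zeta_right.
  by rewrite gt_eqF // (lt_le_trans ltr01) ?zeta_ge1.
rewrite /Bfac /=.
have p1 := zeta_pole (1 : R).
have p2 : (2 * s - 1 - 1) * zeta (2 * s - 1) @[s --> (1 : R)^'+] --> (1 : R).
  have e : 2 * 1 + -1 = 1 :> R by ring.
  have := @right_affine (fun z => (z - 1) * zeta (z - 1 + 1)) 2 (- 1) 1 1 (ltr0Sn _ _).
  by rewrite e => /(_ p1); under eq_cvg do rewrite subrK.
have h : 2^-1 * (((2 * s - 1 - 1) * zeta (2 * s - 1)) / ((s - 1) * zeta (s - 1 + 1))) @[s --> (1 : R)^'+] --> 2^-1 * (1 / 1 : R).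
  by apply: cvgMr; apply: (cvgM p2); apply: (cvgV _ p1); exact: oner_neq0.
move: h; rewrite divr1 mulr1; apply: cvg_trans; apply: near_eq_cvg; near=> s.
have s1 : 1 < s by near: s; exact: nbhs_right_gt.
have z0 : zeta s != 0 by rewrite gt_eqF // (lt_le_trans ltr01) ?zeta_ge1.
have s0 : s - 1 != 0 by lra.
by rewrite subrK; field; rewrite z0 s0.
Unshelve. all: by end_near.
Qed.

(** The limit at s = n of (s - n) / zeta(s) times the series over odd b; for n = 1 the quotient of
    [Bfac] by zeta is replaced by its limit. *)
Definition kap (n : nat) : R :=
  (if n == 1%N then 2^-1 else Bfac n n%:R / zeta n%:R) / Cfac n n%:R * twofac n n%:R.

Lemma Dser_limit n d : (0 < n)%N -> (0 < d)%N -> odd d -> squarefree d ->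
  exists Dr : R -> R, (forall s, n%:R < s -> Dser n (2 * d) s = (Dr s)%:E) /\
    (s - n%:R) * Dr s / zeta s @[s --> (n%:R : R)^'+] -->
    (\prod_(p <- primes d) epsilon n p (n%:R : R)) *
    ((2 ^+ n + tau R n 0 / 2 - 1 + sgm R n) / (1 - (2 ^+ n)^-1)) * kap n.
Proof.
move=> n0 d0 od sf.
pose M2 s : R := Mloc (Ltwo n (2 `^ (- s))) (2 `^ (- s)) n 2.
exists (fun s => (\prod_(p <- primes d) Mratio n p s) * (M2 s * (zeta (s - n%:R + 1) * Bfac n s / Cfac n s * twofac n s))).
have pd p : p \in primes d -> prime p && odd p.
  rewrite mem_primes => /and3P[-> _ pd] /=; exact: dvdn_odd pd od.
split=> [s ns|].
  rewrite -[d in LHS](prod_primes_squarefree d0 sf) Dser_prod ?primes_uniq ?ltW //.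
  by rewrite Dser_two ?ltW // Dcop_closed // -!EFinM.
have yn p : (0 < p)%N -> p%:R `^ (- n%:R) = (p%:R ^+ n)^-1 :> R by move=> p0; rewrite powRN powR_mulrn.
have lc p : (1 < p)%N -> 1 - p%:R ^+ n.-1 * p%:R `^ (- n%:R) != 0 :> R /\ 1 - p%:R ^+ n * (p%:R `^ (- n%:R)) ^+ 2 != 0 :> R.
  move=> p1; have n1 : 1 <= (n%:R : R) by rewrite ler1n.
  have [||h1 h2] := @local_conv R n p n%:R n0 p1; [lra|lra|].
  by rewrite !subr_eq0 ![1 == _]eq_sym !lt_eqF.
have h1 : \prod_(p <- primes d) Mratio n p s @[s --> (n%:R : R)^'+] -->
    \prod_(p <- primes d) epsilon n p (n%:R : R).
  apply: cvg_bigprod => p /pd /andP[pp po].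
  have [L0 <-] := epsilonE R pp po n0; have p0 := prime_gt0 pp.
  have [c1 c2] := lc p (prime_gt1 pp).
  rewrite -yn // in L0 *; have yc : p%:R `^ (- s) @[s --> (n%:R : R)^'+] --> p%:R `^ (- n%:R).
    by apply: powRN_cvg; rewrite ltr0n.
  have Lc : Lodd n p (p%:R `^ (- s)) @[s --> (n%:R : R)^'+] --> Lodd n p (p%:R `^ (- n%:R)) by exact: Lodd_cvg.
  apply: cvgM; last exact: cvgV.
  by apply: (@Mloc_cvg _ _ _ _ (fun s => Lodd n p (p%:R `^ (- s))) (fun s => p%:R `^ (- s))) => //; rewrite gt_eqF // powR_gt0 // ltr0n.
have h2 : M2 s @[s --> (n%:R : R)^'+] --> (2 ^+ n + tau R n 0 / 2 - 1 + sgm R n) / (1 - (2 ^+ n)^-1).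
  rewrite -(Mloc_two R n0) -(yn 2%N) //; have [c1 c2] := lc 2%N isT.
  have yc : 2 `^ (- s) @[s --> (n%:R : R)^'+] --> 2 `^ (- n%:R) by apply: powRN_cvg.
  have Lc : Ltwo n (2 `^ (- s)) @[s --> (n%:R : R)^'+] --> Ltwo n (2 `^ (- n%:R)) by exact: Ltwo_cvg.
  by apply: (@Mloc_cvg _ _ _ _ (fun s => Ltwo n (2 `^ (- s))) (fun s => 2 `^ (- s))) => //; rewrite gt_eqF // powR_gt0.
have [cC C0] := Cfac_cvg n0.
have h3 : ((s - n%:R) * zeta (s - n%:R + 1)) * ((Bfac n s / zeta s) / Cfac n s * twofac n s)
    @[s --> (n%:R : R)^'+] --> 1 * kap n.
  apply: cvgM; first exact: zeta_pole.
  apply: cvgM; last exact: twofac_cvg.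
  by apply: cvgM; [exact: Bfac_zeta_cvg|exact: cvgV].
have : \prod_(p <- primes d) Mratio n p s * M2 s * (((s - n%:R) * zeta (s - n%:R + 1)) *
    ((Bfac n s / zeta s) / Cfac n s * twofac n s)) @[s --> (n%:R : R)^'+] -->
   (\prod_(p <- primes d) epsilon n p (n%:R : R)) *
    ((2 ^+ n + tau R n 0 / 2 - 1 + sgm R n) / (1 - (2 ^+ n)^-1)) * (1 * kap n).
  by apply: cvgM => //; apply: cvgM.
rewrite mul1r; apply: cvg_trans; apply: near_eq_cvg; near=> s.
by rewrite /=; ring.
Unshelve. all: by end_near.
Qed.

End Limits.

(** * The Gamma function and Riemann sums *)

Section DeriveRules.
Variable R : realType.
Implicit Types (f g : R -> R) (x a b : R).

Lemma dE f x a b : is_derive x 1 f a -> a = b -> is_derive x 1 f b.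
Proof. by move=> h <-. Qed.

Lemma dD f g x a b : is_derive x 1 f a -> is_derive x 1 g b ->
  is_derive x 1 (fun y => f y + g y) (a + b).
Proof. by move=> h1 h2; exact: (is_deriveD h1 h2). Qed.

Lemma dB f g x a b : is_derive x 1 f a -> is_derive x 1 g b ->
  is_derive x 1 (fun y => f y - g y) (a - b).
Proof. by move=> h1 h2; exact: (is_deriveB h1 h2). Qed.

Lemma dM f g x a b : is_derive x 1 f a -> is_derive x 1 g b ->
  is_derive x 1 (fun y => f y * g y) (f x * b + g x * a).
Proof. by move=> h1 h2; exact: (is_deriveM h1 h2). Qed.

Lemma dZ f x a c : is_derive x 1 f a -> is_derive x 1 (fun y => c * f y) (c * a).
Proof. by move=> h1; exact: (is_deriveZ c h1). Qed.

Lemma dXn f n x a : is_derive x 1 f a ->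
  is_derive x 1 (fun y => f y ^+ n) (n%:R * f x ^+ n.-1 * a).
Proof.
move=> h1; elim: n => [|n IH].
  by apply: dE (is_derive_cst (1 : R) x 1) _; rewrite !mul0r.
have -> : (fun y => f y ^+ n.+1) = (fun y => f y * f y ^+ n) by apply/funext => y; rewrite exprS.
apply: dE (dM h1 IH) _; case: n {IH} => [|n] /=; first by rewrite !expr0; ring.
by rewrite -[in RHS](natr1 n.+1) exprS; ring.
Qed.

Lemma dV f x a : f x != 0 -> is_derive x 1 f a ->
  is_derive x 1 (fun y => (f y)^-1) (- (f x ^+ 2)^-1 * a).
Proof. by move=> n0 h1; exact: (is_deriveV n0 h1). Qed.

Lemma dexpN x : is_derive x 1 (fun y => expR (- y)) (- expR (- x)).
Proof.
have d1 : is_derive x 1 (fun y : R => - y) (- 1) by exact: is_deriveNid.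
by apply: dE (@is_derive1_comp R expR _ x _ _ (is_derive_expR _) d1) _; rewrite mulrN1.
Qed.

Lemma is_derive_cts f x a : is_derive x 1 f a -> {for x, continuous f}.
Proof. by move=> [dF _]; apply: differentiable_continuous; apply/derivable1_diffP. Qed.

End DeriveRules.

Section GammaFunction.
Variable R : realType.

(** The integrand may be singular at 0: the integral is the monotone limit of those over [1/(k+1),
    +oo[, where the fundamental theorem applies. *)
Lemma improper_FTC (f G : R -> R) (m c : R) :
  (forall t : R, 0 < t -> 0 <= f t) -> (forall t : R, 0 < t -> {for t, continuous f}) ->
  (forall t : R, 0 < t -> is_derive t 1 G (f t)) ->
  G t @[t --> 0^'+] --> m -> G t @[t --> +oo] --> c ->
  \int[lebesgue_measure]_(t in `]0, +oo[) f t = c - m.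
Proof.
move=> f0 fc dG Gm Gc.
pose F (n : nat) : set R := `[n.+1%:R^-1, +oo[%classic.
have a0 n : 0 < n.+1%:R^-1 :> R by rewrite invr_gt0.
have UF : \bigcup_n F n = `]0, +oo[%classic.
  apply/seteqP; split=> [x [n _]|x] /=; rewrite /F /= !in_itv /= !andbT.
    by apply: lt_le_trans.
  move=> x0; exists (Num.truncn x^-1) => //=; rewrite in_itv /= andbT.
  rewrite invf_ple ?posrE //; have x1 : 0 <= x^-1 by rewrite invr_ge0 ltW.
  by have /andP[_ h] := truncn_itv x1; exact: ltW.
have cf n : {within F n, continuous f}.
  apply/continuous_within_itvcyP; split.
    by move=> x; rewrite in_itv /= andbT => ax; apply: fc; exact: lt_trans ax.
  by apply: cvg_at_right_filter; exact: fc.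
have ndF : nondecreasing_seq F.
  apply/nondecreasing_seqP => n; apply/subsetPset => x /=; rewrite /F /= !in_itv /= !andbT.
  by apply: le_trans; rewrite lef_pV2 ?posrE // ler_nat.
have h1 := @ge0_nondecreasing_set_cvg_integral _ (measurableTypeR R) R F (fun x => (f x)%:E) (@lebesgue_measure R) ndF.
have {h1} : (\int[lebesgue_measure]_(x in F i) (f x)%:E)%E @[i --> \oo] -->
    (\int[lebesgue_measure]_(x in `]0%R, +oo[) (f x)%:E)%E.
  rewrite -UF; apply: h1.
  - by move=> n; exact: measurable_itv.
  - move=> n; apply/measurable_EFinP; apply: subspace_continuous_measurable_fun => //.
    exact: measurable_itv.
  - move=> n x; rewrite /F /= in_itv /= andbT => ax; rewrite lee_fin f0 //.
    exact: lt_le_trans ax.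
have -> : (fun i => (\int[lebesgue_measure]_(x in F i) (f x)%:E)%E) = (fun i => (c - G i.+1%:R^-1)%:E).
  apply/funext => n; rewrite (@ge0_continuous_FTC2y R f G _ c) //.
  - by move=> x ax; apply: f0; exact: lt_le_trans ax.
  - exact: cf.
  - by move=> x ax; have [] := dG x (lt_trans (a0 n) ax).
  - apply: cvg_at_right_filter; apply: differentiable_continuous; apply/derivable1_diffP.
    by have [] := dG _ (a0 n).
  - move=> x; rewrite in_itv /= andbT => ax; rewrite derive1E.
    by have [_ ->] := dG x (lt_trans (a0 n) ax).
move=> h1; have h2 : (c - G i.+1%:R^-1)%:E @[i --> \oo] --> (c - m)%:E.
  apply: cvg_EFin; first exact: nearW.
  apply: cvgB; first exact: cvg_cst.
  apply: cvg_comp Gm => P [e /= e0 Pe].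
  exists (Num.truncn e^-1) => // n /= en; apply: Pe => //=.
  rewrite sub0r normrN ger0_norm ?ltW // invf_plt ?posrE //.
  have e1 : 0 <= e^-1 by rewrite invr_ge0 ltW.
  have /andP[_ h] := truncn_itv e1; apply: lt_le_trans h _.
  by rewrite ler_nat ltnS.
by rewrite /Rintegral (cvg_unique _ h1 h2).
Qed.

(** An antiderivative together with its boundary values. The functional equation and the
    substitution in the Gaussian integral then reduce to differentiation. *)
Definition Gamma_primitive (x c : R) : Prop := exists G : R -> R,
  [/\ forall t : R, 0 < t -> is_derive t 1 G (t `^ (x - 1) * expR (- t)),
      G t @[t --> 0^'+] --> (0 : R) & G t @[t --> +oo] --> c].

Lemma Gamma_primitiveE x c : Gamma_primitive x c -> Gamma x = c.
Proof.
move=> [G [dG G0 Gc]]; rewrite /Gamma (@improper_FTC _ G 0 c) ?subr0 //.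
- by move=> t t0; rewrite mulr_ge0 ?powR_ge0 ?expR_ge0.
- by move=> t t0; exact: is_derive_cts (dM (is_derive1_powR _ t0) (dexpN t)).
Qed.

Lemma powR_cvg0 (x : R) : 0 < x -> t `^ x @[t --> 0^'+] --> (0 : R).
Proof.
move=> x0; apply/cvgr0Pnorm_lt => e e0; near=> t.
have t0 : 0 < t by near: t; exact: nbhs_right_gt.
have te : t < e `^ x^-1 by near: t; apply: nbhs_right_lt; rewrite powR_gt0.
rewrite ger0_norm ?powR_ge0 //.
have -> : e = (e `^ x^-1) `^ x by rewrite -powRrM mulVf ?gt_eqF // powRr1 // ltW.
by apply: gt0_ltr_powR; rewrite ?nnegrE ?powR_ge0 // ltW.
Unshelve. all: by end_near.
Qed.

(** The tangent of ln at 2x gives t^x <= (2x)^x exp(t/2), which leaves a factor exp(-t/2). *)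
Lemma powR_expR_cvg0 (x : R) : 0 < x -> t `^ x * expR (- t) @[t --> +oo] --> (0 : R).
Proof.
move=> x0; apply/cvgr0Pnorm_lt => e e0.
pose C := expR (x * ln (2 * x)); have C0 : 0 < C by exact: expR_gt0.
near=> t.
have t0 : 0 < t by near: t; exact: nbhs_pinfty_gt.
have tC : 2 * C / e < t by near: t; apply: nbhs_pinfty_gt; rewrite num_real.
rewrite ger0_norm ?mulr_ge0 ?powR_ge0 ?expR_ge0 //.
have c0 : 0 < 2 * x by rewrite mulr_gt0.
have lt : ln t <= ln (2 * x) + (t / (2 * x) - 1).
  have -> : ln t = ln (2 * x) + ln (t / (2 * x)).
    by rewrite -lnM ?posrE ?divr_gt0 // mulrC divfK // gt_eqF.
  rewrite lerD2l -ler_expR lnK ?posrE ?divr_gt0 //; apply: le_trans (expR_ge1Dx _).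
  by rewrite addrC subrK.
have b : t `^ x * expR (- t) <= C * expR (- (t / 2)).
  rewrite /powR gt_eqF // -!expRD ler_expR.
  have : x * ln t <= x * (ln (2 * x) + (t / (2 * x) - 1)) by rewrite ler_pM2l.
  have -> : x * (ln (2 * x) + (t / (2 * x) - 1)) = x * ln (2 * x) + t / 2 - x.
    by field; rewrite gt_eqF.
  by lra.
apply: le_lt_trans b _; rewrite expRN.
have h : t / 2 < expR (t / 2) by apply: lt_le_trans (expR_ge1Dx _); rewrite ltrDr.
rewrite ltr_pdivrMr ?expR_gt0 //; apply: (@lt_trans _ _ (e * (t / 2))); last by rewrite ltr_pM2l.
by move: tC; rewrite ltr_pdivrMr //; lra.
Unshelve. all: by end_near.
Qed.

(** Integration by parts: the new antiderivative is x G(t) - t^x exp(-t). *)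
Lemma Gamma_primitiveS x c : 0 < x -> Gamma_primitive x c -> Gamma_primitive (x + 1) (x * c).
Proof.
move=> x0 [G [dG G0 Gc]]; exists (fun t => x * G t - t `^ x * expR (- t)); split.
- move=> t t0; apply: dE (dB (dZ x (dG t t0)) (dM (is_derive1_powR x t0) (dexpN t))) _.
  rewrite addrK; have -> : t `^ x = t * t `^ (x - 1).
    by rewrite -{2}(powRr1 (ltW t0)) -powRD ?gt_eqF ?implybT // addrC subrK.
  by ring.
- suff : x * G t - t `^ x * expR (- t) @[t --> 0^'+] --> x * 0 - 0 * expR (- 0).
    by rewrite mulr0 mul0r subrr.
  apply: cvgB; first exact: cvgMr.
  apply: cvgM; first exact: powR_cvg0.
  by apply: cvg_at_right_filter; exact: is_derive_cts (dexpN 0).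
- rewrite -[X in _ --> X]subr0; apply: cvgB; first exact: cvgMr.
  exact: powR_expR_cvg0.
Qed.

Lemma Gamma_primitive1 : Gamma_primitive 1 1.
Proof.
exists (fun t => 1 - expR (- t)); split.
- move=> t t0; rewrite subrr powRr0 mul1r.
  by apply: dE (dB (is_derive_cst (1 : R) t 1) (dexpN t)) _; rewrite sub0r opprK.
- suff : 1 - expR (- t) @[t --> 0^'+] --> (1 - expR (- 0) : R) by rewrite oppr0 expR0 subrr.
  apply: cvgB; first exact: cvg_cst.
  by apply: cvg_at_right_filter; exact: is_derive_cts (dexpN 0).
- rewrite -[X in _ --> X]subr0; apply: cvgB; first exact: cvg_cst.
  apply/cvgr0Pnorm_lt => e e0; near=> t.
  have t0 : 0 < t by near: t; exact: nbhs_pinfty_gt.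
  have te : e^-1 < t by near: t; apply: nbhs_pinfty_gt; rewrite num_real.
  rewrite ger0_norm ?expR_ge0 // expRN invf_plt ?posrE ?expR_gt0 //.
  by apply: lt_le_trans te _; apply: le_trans (expR_ge1Dx _); rewrite lerDr.
Unshelve. all: by end_near.
Qed.

(** The substitution t = u^2: the antiderivative is 2 I(sqrt t), with I(u) the integral of exp(-x^2)
    from 0 to u. *)
Lemma gauss_primitive : Gamma_primitive (1 / 2) (Num.sqrt pi).
Proof.
pose I := @gauss_integral_proof.integral0_gauss R.
have dI (u : R) : 0 < u -> is_derive u 1 I (expR (- u ^+ 2)).
  move=> u0; have [||||d1 d2] := @continuous_FTC1_closed R (@gauss_fun R) 0 u (u + 1).
  - by rewrite ltrDl.
  - apply: continuous_compact_integrable; first exact: segment_compact.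
    by apply: continuous_subspaceT; exact: continuous_gauss_fun.
  - exact: u0.
  - exact: continuous_gauss_fun.
  - by rewrite /I /gauss_integral_proof.integral0_gauss; split; [exact: d1|rewrite -derive1E; exact: d2].
have I0 u : 0 <= I u by exact: gauss_integral_proof.integral0_gauss_ge0.
have sq0 t : 0 < t -> 0 < Num.sqrt t :> R by rewrite sqrtr_gt0.
exists (fun t => 2 * I (Num.sqrt t)); split.
- move=> t t0; have d1 := dI _ (sq0 t t0); have d2 := is_derive1_sqrt t0.
  have d3 := @is_derive1_comp R I Num.sqrt t _ _ d1 d2.
  apply: dE (dZ 2 d3) _.
  rewrite sqr_sqrtr ?ltW // (_ : 1 / 2 - 1 = - (1 / 2)); last by field.
  rewrite powRN -powR12_sqrt ?ltW // mul1r.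
  by field; rewrite gt_eqF // powR_gt0.
- have Ib u : 0 < u -> I u <= u.
    move=> u0; have [||c] := @MVT _ I (fun x => expR (- x ^+ 2)) 0 u u0.
    + by move=> x; rewrite in_itv /= => /andP[x0 _]; exact: dI.
    + apply: parameterized_integral_continuous; first exact: ltW.
      apply: continuous_compact_integrable; first exact: segment_compact.
      by apply: continuous_subspaceT; exact: continuous_gauss_fun.
    + have -> : I 0 = 0 by rewrite /I /gauss_integral_proof.integral0_gauss set_itv1 Rintegral_set1.
      rewrite in_itv /= !subr0 => _ ->; rewrite ler_piMl ?(ltW u0) // -expR0 ler_expR oppr_le0.
      exact: sqr_ge0.
  apply/cvgr0Pnorm_lt => e e0; near=> t.
  have t0 : 0 < t by near: t; exact: nbhs_right_gt.
  have te : t < (e / 2) ^+ 2 by near: t; apply: nbhs_right_lt; rewrite exprn_gt0 // divr_gt0.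
  rewrite ger0_norm ?mulr_ge0 //.
  apply: (@le_lt_trans _ _ (2 * Num.sqrt t)); first by rewrite ler_pM2l // Ib // sq0.
  rewrite mulrC -ltr_pdivlMr // -[ltRHS](@ger0_norm _ (e / 2)) ?divr_ge0 ?ltW //.
  by rewrite -sqrtr_sqr ltr_sqrt // exprn_gt0 // divr_gt0.
- have h : Num.sqrt (I x ^+ 2) @[x --> +oo] --> Num.sqrt (pi / 4).
    by apply: continuous_cvg; [exact: sqrt_continuous|exact: gauss_integral_proof.cvg_integral0_gauss_sqr].
  have {}h : I x @[x --> +oo] --> Num.sqrt (pi / 4).
    by move: h; under eq_cvg do rewrite sqrtr_sqr ger0_norm //.
  have -> : Num.sqrt pi = 2 * Num.sqrt (pi / 4) :> R.
    rewrite sqrtrM ?pi_ge0 // sqrtrV // (_ : 4 = 2 ^+ 2); last by ring.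
    by rewrite sqrtr_sqr ger0_norm //; field.
  apply: cvgMr; apply: cvg_comp h => P [M [Mr PM]].
  exists (Num.max M 0 ^+ 2); split; first by rewrite num_real.
  move=> t Mt; apply: PM; apply: le_lt_trans (_ : Num.max M 0 < _); first by rewrite le_max lexx.
  rewrite -[ltLHS]ger0_norm ?le_max ?lexx ?orbT // -sqrtr_sqr ltr_sqrt //.
  by apply: le_lt_trans Mt; exact: sqr_ge0.
Unshelve. all: by end_near.
Qed.

(* [hgam k] is Gamma (k / 2) for k > 0. *)
Fixpoint hgam (k : nat) : R :=
  match k with
  | 0%N | 1%N => Num.sqrt pi
  | 2%N => 1
  | k'.+2 => k'%:R / 2 * hgam k'
  end.

Arguments hgam : simpl never.

Lemma hgamSS k : (0 < k)%N -> hgam k.+2 = k%:R / 2 * hgam k.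
Proof. by case: k => [|[|k]]. Qed.

Lemma hgam_gt0 k : 0 < hgam k.
Proof.
suff: 0 < hgam k /\ 0 < hgam k.+1 by case.
elim: k => [|k [IH1 IH2]]; first by rewrite /hgam sqrtr_gt0 pi_gt0.
split=> //; case: k IH1 IH2 => [|k] IH1 IH2; first by rewrite /hgam.
by rewrite hgamSS // mulr_gt0 // divr_gt0.
Qed.

Lemma Gamma_half k : (0 < k)%N -> Gamma (k%:R / 2 : R) = hgam k.
Proof.
move=> k0; apply: Gamma_primitiveE.
suff: Gamma_primitive (k%:R / 2) (hgam k) /\ Gamma_primitive (k.+1%:R / 2) (hgam k.+1) by case.
case: k k0 => // k _; elim: k => [|k [IH1 IH2]].
  split; first exact: gauss_primitive.
  by rewrite divff //; exact: Gamma_primitive1.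
split=> //; rewrite hgamSS // (_ : k.+3%:R / 2 = k.+1%:R / 2 + 1); last first.
  by rewrite -[in LHS]natr1 -[in LHS]natr1; field.
by apply: Gamma_primitiveS => //; rewrite divr_gt0.
Qed.

(** Legendre's duplication formula at half-integers. *)
Lemma hgam_dup k : (0 < k)%N -> hgam k * hgam k.+1 = 2 * Num.sqrt pi * hgam k.*2 / 2 ^+ k.
Proof.
case: k => // k _; elim: k => [|k IH]; first by rewrite doubleS double0 /hgam expr1; field.
rewrite (@hgamSS k.+1 isT) mulrCA [hgam k.+2 * _]mulrC IH doubleS (@hgamSS k.+1.*2) //.
rewrite [2 ^+ k.+2]exprS -[in X in X%:R / 2 * hgam _]muln2 natrM; field.
by rewrite expf_neq0.
Qed.

(* W j is the integral of (1 + x^2)^(-j/2) over the line. *)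
Definition W (j : nat) : R := Num.sqrt pi * hgam j.-1 / hgam j.

Lemma W2 : W 2 = pi. Proof. by rewrite /W /= /hgam divr1 -expr2 sqr_sqrtr // pi_ge0. Qed.

Lemma W3 : W 3 = 2.
Proof. by rewrite /W /= /hgam; field; rewrite gt_eqF // sqrtr_gt0 pi_gt0. Qed.

Lemma WSS j : (1 < j)%N -> W j.+2 = W j * j.-1%:R / j%:R.
Proof.
case: j => [|[|j]] // _; rewrite /W /= (@hgamSS j.+1 isT) (@hgamSS j.+2 isT).
have := hgam_gt0 j.+2; move: (hgam j.+2) (hgam j.+1) => a b a0.
have j2 : (j.+2%:R : R) != 0 by [].
by move: (j.+2%:R : R) (j.+1%:R : R) j2 => u v u0; field; rewrite u0 gt_eqF.
Qed.

Lemma W_ge0 j : 0 <= W j.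
Proof. by rewrite /W !mulr_ge0 ?invr_ge0 ?sqrtr_ge0 // ltW // hgam_gt0. Qed.

(* Vol n j is the integral of (1 + |x|^2)^(-j/2) over R^n. *)
Fixpoint Vol (n j : nat) : R := if n is n'.+1 then Vol n' j * W (j - n') else 1.

(** The product of [W j], [W (j - 1)], ... telescopes. *)
Lemma VolE n j : (n < j)%N -> Vol n j = Num.sqrt pi ^+ n * hgam (j - n) / hgam j.
Proof.
elim: n => [|n IH] nj /=.
  by rewrite subn0 mul1r divff // gt_eqF ?hgam_gt0.
rewrite IH ?(ltnW nj) // /W -subnS exprS.
by field; rewrite !gt_eqF ?hgam_gt0.
Qed.

End GammaFunction.

(** * Riemann sums on the line *)

Section RiemannSums.
Variable R : realType.

Lemma MVT_half (f F : R -> R) (x y : R) : 0 <= x -> x < y ->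
  (forall x : R, 0 <= x -> is_derive x 1 F (f x)) ->
  exists2 c, x < c < y & F y - F x = f c * (y - x).
Proof.
move=> x0 xy dF; have [||c] := @MVT R F f x y xy.
- by move=> z; rewrite in_itv /= => /andP[xz _]; apply: dF; apply: le_trans x0 (ltW xz).
- apply/continuous_within_itvP => //; split.
  + move=> z; rewrite in_itv /= => /andP[xz _].
    by apply: is_derive_cts (dF z _); apply: le_trans x0 (ltW xz).
  + by apply: cvg_at_right_filter; exact: is_derive_cts (dF x x0).
  + by apply: cvg_at_left_filter; apply: is_derive_cts (dF y _); apply: le_trans x0 (ltW xy).
- by rewrite in_itv /= => h E; exists c.
Qed.

Section HalfLine.
Variables (f F : R -> R) (c : R).
Hypothesis dF : forall x : R, 0 <= x -> is_derive x 1 F (f x).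
Hypothesis fd : forall x y : R, 0 <= x -> x <= y -> f y <= f x.
Hypothesis f0 : forall x, 0 <= f x.
Hypothesis Fc : F x @[x --> +oo] --> c.

Lemma prim_step (x h : R) : 0 <= x -> 0 < h -> h * f (x + h) <= F (x + h) - F x <= h * f x.
Proof.
move=> x0 h0; have [|z /andP[xz zh] ->] := MVT_half x0 (_ : x < x + h) dF; first by rewrite ltrDl.
rewrite (addrAC x h) subrr add0r (mulrC (f z)) !ler_pM2l // !fd ?(ltW xz) ?(ltW zh) //.
exact: le_trans x0 (ltW xz).
Qed.

Lemma prim_mono (x y : R) : 0 <= x -> x <= y -> F x <= F y.
Proof.
move=> x0; rewrite le_eqVlt => /orP[/eqP->//|xy].
have d0 : 0 < y - x by rewrite subr_gt0.
have /andP[h _] := prim_step x0 d0.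
rewrite -subr_ge0 -[X in F X - _](subrKC x y); apply: le_trans h.
by rewrite mulr_ge0 // ltW.
Qed.

Lemma prim_le (x : R) : 0 <= x -> F x <= c.
Proof.
move=> x0; rewrite -(cvg_lim (@Rhausdorff R) Fc); apply: limr_ge; first exact: cvgP Fc.
near=> y; apply: prim_mono => //; near: y; apply: nbhs_pinfty_ge; exact: num_real.
Unshelve. all: by end_near.
Qed.

(** On each step h f at the right end is at most the increment of F, which is at most h f at the
    left end; the two resulting sums differ by at most h f(x0). *)
Lemma half_sum (h x0 : R) : 0 < h -> 0 <= x0 -> exists2 T,
  (\esum_(n in [set: nat]) (f (x0 + h * n%:R))%:E = T%:E)%E &
  c - F x0 <= h * T <= c - F x0 + h * f x0.
Proof.
move=> h0 x00; pose u n := f (x0 + h * n%:R).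
have xn n : 0 <= x0 + h * n%:R by rewrite addr_ge0 // mulr_ge0 // ltW.
have xS n : x0 + h * n.+1%:R = x0 + h * n%:R + h by rewrite -natr1; ring.
have b N : F (x0 + h * N%:R) - F x0 <= h * series u N <= F (x0 + h * N%:R) - F x0 + h * (f x0 - u N).
  elim: N => [|N IH].
    by rewrite /series /= big_geq // /u !mulr0 addr0 !subrr mulr0 addr0 lexx.
  rewrite seriesSr mulrDr [in X in _ <= _ <= X]/u xS -/(u N).
  have := prim_step (xn N) h0; move: IH; rewrite -/(u N).
  by lra.
have ub N : h * series u N <= c - F x0 + h * f x0.
  have /andP[_ h1] := b N; apply: le_trans h1 _; apply: lerD.
    by rewrite lerD2r prim_le.
  by rewrite ler_pM2l // lerBlDr lerDl f0.
have nd : nondecreasing_seq (series u).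
  by apply/nondecreasing_seqP => N; rewrite seriesSr lerDl f0.
have cv : cvgn (series u).
  apply: nondecreasing_is_cvgn => //; exists ((c - F x0 + h * f x0) / h) => _ [N _ <-].
  by rewrite ler_pdivlMr // mulrC.
exists (limn (series u)); first exact: esum_series.
have cv2 : h * series u N @[N --> \oo] --> h * limn (series u) by apply: cvgMr.
apply/andP; split; last first.
  rewrite -(cvg_lim (@Rhausdorff R) cv2); apply: limr_le; first exact: cvgP cv2.
  exact: nearW.
have cF : F (x0 + h * N%:R) - F x0 @[N --> \oo] --> c - F x0.
  apply: cvgB; last exact: cvg_cst.
  apply: cvg_comp Fc => P [M [Mr PM]].
  exists (Num.truncn (`|M| / h)).+1 => // N /= MN; apply: PM.
  have e1 : 0 <= `|M| / h by rewrite divr_ge0 // ltW.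
  have /andP[_ h1] := truncn_itv e1.
  apply: le_lt_trans (ler_norm M) _; apply: (@lt_le_trans _ _ (h * N%:R)); last by rewrite lerDr.
  rewrite mulrC -ltr_pdivrMr //; apply: lt_le_trans h1 _; by rewrite ler_nat.
rewrite -(cvg_lim (@Rhausdorff R) cv2) -(cvg_lim (@Rhausdorff R) cF).
apply: ler_lim; [exact: cvgP cF|exact: cvgP cv2|].
by apply: nearW => N; have /andP[] := b N.
Qed.

Lemma esum_int (a : int -> \bar R) : (forall k, 0 <= a k)%E ->
  (\esum_(k in [set: int]) a k = \esum_(n in [set: nat]) a (Posz n) + \esum_(n in [set: nat]) a (Negz n))%E.
Proof.
move=> a0; rewrite (esumID [set k | (0 <= k)%R]) //; congr (_ + _)%E.
  apply: (@reindex_esum R nat int) => //; split=> [n //|m n _ _ [] //|].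
  by case=> n //= [_ h]; exists n.
apply: (@reindex_esum R nat int) => //; split=> [n /=|m n _ _ [] //|].
  by split => //; apply/negP; rewrite -ltNge.
by case=> n //= [_ h]; [case: h|exists n].
Qed.

Hypothesis feven : forall x, f (- x) = f x.
Hypothesis F00 : F 0 = 0.

(** Translating the index reduces the shift to some t in [0, h[. Evenness of f then folds the
    negative indices onto a second half line, starting at h - t. *)
Lemma int_sum (h th : R) : 0 < h -> exists2 T,
  (\esum_(k in [set: int]) (f (h * k%:~R + th))%:E = T%:E)%E &
  2 * c - h * f 0 <= h * T <= 2 * c + 2 * h * f 0.
Proof.
move=> h0; pose m := Num.floor (th / h); pose t := th - h * m%:~R.
have /andP[m1 m2] : m%:~R <= th / h < (m + 1)%:~R by exact: floor_itv.
have t0 : 0 <= t by rewrite subr_ge0 mulrC -ler_pdivlMr.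
have t1 : t < h.
  by rewrite ltrBlDr -[X in X + _]mulr1 -mulrDr mulrC -ltr_pdivrMr // addrC -[1]/(1%:~R) -intrD.
have ht : 0 <= h - t by rewrite subr_ge0 ltW.
have [T1 E1 b1] := half_sum h0 t0.
have [T2 E2 b2] := half_sum h0 ht.
exists (T1 + T2).
  transitivity (\esum_(k in [set: int]) (f (h * k%:~R + t))%:E)%E.
    rewrite (@reindex_esum R int int [set: int] [set: int] (fun k => k - m)).
      by apply: eq_esum => k _; rewrite /t intrB; congr (f _)%:E; ring.
    split=> [//|k l _ _ /addIr//|k _]; exists (k + m) => //; by rewrite addrK.
  rewrite esum_int => [|k]; last by rewrite lee_fin.
  rewrite EFinD -E1 -E2; congr (_ + _)%E; apply: eq_esum => n _.
    by rewrite addrC -pmulrn.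
  rewrite -feven NegzE; congr (f _)%:E.
  by rewrite mulrNz -pmulrn -natr1; ring.
have F1 : F t <= t * f 0.
  have [->|tp] := eqVneq t 0; first by rewrite F00 mul0r.
  have tp' : 0 < t by rewrite lt_neqAle eq_sym tp.
  by have /andP[_] := prim_step (lexx 0) tp'; rewrite add0r F00 subr0.
have F2 : F (h - t) <= (h - t) * f 0.
  have tp' : 0 < h - t by rewrite subr_gt0.
  by have /andP[_] := prim_step (lexx 0) tp'; rewrite add0r F00 subr0.
have F3 : 0 <= F t by rewrite -F00; apply: prim_mono.
have F4 : 0 <= F (h - t) by rewrite -F00; apply: prim_mono.
have g1 : h * f t <= h * f 0 by rewrite ler_pM2l // fd.
have g2 : h * f (h - t) <= h * f 0 by rewrite ler_pM2l // fd.
move: b1 b2 => /andP[b1 b1'] /andP[b2 b2']; rewrite mulrDr.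
by apply/andP; split; lra.
Qed.

End HalfLine.

Definition rho (x : R) : R := Num.sqrt (1 + x ^+ 2).

Lemma rho_ge1 x : 1 <= rho x.
Proof. by rewrite -[leLHS](@sqrtr1 R) ler_wsqrtr // lerDl sqr_ge0. Qed.

Lemma rho_gt0 x : 0 < rho x. Proof. exact: lt_le_trans ltr01 (rho_ge1 x). Qed.

Lemma rho_sqr x : rho x ^+ 2 = 1 + x ^+ 2.
Proof. by rewrite sqr_sqrtr // addr_ge0 // sqr_ge0. Qed.

Lemma rho_ge x : x <= rho x.
Proof.
apply: le_trans (ler_norm x) _; rewrite -sqrtr_sqr ler_wsqrtr //.
by rewrite lerDr.
Qed.

Lemma is_derive_rho (x : R) : is_derive x 1 rho (x / rho x).
Proof.
have p : 0 < 1 + x ^+ 2 by rewrite ltr_wpDr // sqr_ge0.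
have d2 := dD (is_derive_cst (1 : R) x 1) (dXn 2 (is_derive_id x 1)).
have d3 := @is_derive1_comp R Num.sqrt _ x _ _ (is_derive1_sqrt p) d2.
apply: dE d3 _; rewrite -/(rho x) expr1 add0r mulr1.
by field; rewrite gt_eqF // rho_gt0.
Qed.

Lemma is_derive_rhoXV j (x : R) : is_derive x 1 (fun x => (rho x ^+ j)^-1) (- j%:R * x / rho x ^+ j.+2).
Proof.
have r0' : rho x != 0 by rewrite gt_eqF // rho_gt0.
have r0 : rho x ^+ j != 0 by rewrite expf_neq0.
apply: dE (@dV R (fun y => rho y ^+ j) x _ r0 (dXn j (is_derive_rho x))) _.
case: j r0 => [|j] r0; first by rewrite !mul0r mulr0 oppr0 !mul0r.
by rewrite /= !exprS; field; rewrite r0' expf_neq0.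
Qed.

Lemma rho_anti j (x y : R) : 0 <= x -> x <= y -> (rho y ^+ j)^-1 <= (rho x ^+ j)^-1.
Proof.
move=> x0 xy; rewrite lef_pV2 ?posrE ?exprn_gt0 ?rho_gt0 // lerXn2r ?nnegrE ?(ltW (rho_gt0 _)) //.
by rewrite ler_wsqrtr // lerD2l lerXn2r // nnegrE (le_trans x0).
Qed.

Lemma cvgV_pinfty : x^-1 @[x --> +oo] --> (0 : R).
Proof.
apply/cvgr0Pnorm_lt => e e0; near=> x.
have x0 : 0 < x by near: x; exact: nbhs_pinfty_gt.
rewrite ger0_norm ?invr_ge0 ?ltW // invf_plt ?posrE //.
near: x; apply: nbhs_pinfty_gt; exact: num_real.
Unshelve. all: by end_near.
Qed.

(** Integration by parts raises the exponent by 2 through x / rho^j; the recursion starts from atan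
    for j = 2 and x / rho for j = 3. *)
Lemma rho_antiderivative j : (1 < j)%N -> exists F : R -> R,
  [/\ forall x : R, is_derive x 1 F (rho x ^+ j)^-1, F 0 = 0 & F x @[x --> +oo] --> W R j / 2].
Proof.
pose P k := exists F : R -> R,
  [/\ forall x : R, is_derive x 1 F (rho x ^+ k)^-1, F 0 = 0 & F x @[x --> +oo] --> W R k / 2].
suff H : forall k, P k.+2 /\ P k.+3 by case: j => [|[|j]] // _; have [] := H j.
elim=> [|k [IH1 IH2]]; last first.
  split=> //; have [F [dF F0 Fl]] := IH1.
  exists (fun x => (x / rho x ^+ k.+2 + k.+1%:R * F x) / k.+2%:R); split.
  - move=> x; have d := dZ (k.+2%:R^-1) (dD (dM (is_derive_id x 1) (is_derive_rhoXV k.+2 x)) (dZ k.+1%:R (dF x))).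
    have -> : (fun x => (x / rho x ^+ k.+2 + k.+1%:R * F x) / k.+2%:R) =
       (fun x => k.+2%:R^-1 * (x / rho x ^+ k.+2 + k.+1%:R * F x)).
      by apply/funext => y; rewrite mulrC.
    apply: dE d _.
    have r0 : rho x != 0 by rewrite gt_eqF // rho_gt0.
    have -> : (rho x ^+ k.+2)^-1 = rho x ^+ 2 / rho x ^+ k.+4.
      by rewrite [rho x ^+ k.+4](exprD _ 2 k.+2); field; rewrite r0 expf_neq0.
    rewrite rho_sqr; have k2 : (k.+2%:R : R) != 0 by [].
    have e : (k.+2%:R : R) = k.+1%:R + 1 by rewrite natr1.
    move: (rho x ^+ k.+4)^-1 => v; move: k2; rewrite e; move: (k.+1%:R : R) => u u0.
    by field.
  - by rewrite F0 mul0r mulr0 addr0 mul0r.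
  - rewrite WSS //= (_ : _ / 2 = (0 + k.+1%:R * (W R k.+2 / 2)) / k.+2%:R); last by field.
    apply: cvgMl; apply: cvgD; last by apply: cvgMr.
    apply: (@squeeze_cvgr _ _ _ _ (cst 0) (fun x => x^-1)); [|exact: cvg_cst|exact: cvgV_pinfty].
    near=> x; have x0 : 0 < x by near: x; exact: nbhs_pinfty_gt.
    have r1 : 0 < rho x ^+ k.+2 by rewrite exprn_gt0 // rho_gt0.
    rewrite /= divr_ge0 ?(ltW x0) ?(ltW r1) //= ler_pdivrMr // (mulrC x^-1) ler_pdivlMr //.
    apply: (@le_trans _ _ (rho x ^+ 2)); first by rewrite rho_sqr -expr2 lerDr.
    by rewrite (exprD _ 2 k) ler_peMr ?sqr_ge0 // exprn_ege1 // rho_ge1.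
split.
  exists atan; split; [|exact: atan0|by rewrite W2; exact: cvgy_atan].
  by move=> x; rewrite rho_sqr; exact: is_derive1_atan.
exists (fun x => x / rho x); split; [|by rewrite mul0r|].
  move=> x; have d := dM (is_derive_id x 1) (is_derive_rhoXV 1 x).
  apply: dE d _; rewrite expr1 mulr1; have r0 : rho x != 0 by rewrite gt_eqF // rho_gt0.
  rewrite [RHS](_ : _ = (rho x ^+ 2 - x ^+ 2) / rho x ^+ 3); first by field.
  by rewrite rho_sqr addrK mul1r.
rewrite W3 divff // -[X in _ --> X]subr0.
have -> : (fun x => x / rho x) = (fun x => 1 - (1 - x / rho x)) by apply/funext => x; rewrite subKr.
apply: cvgB; first exact: cvg_cst.
apply: (@squeeze_cvgr _ _ _ _ (cst 0) (fun x => x^-1)); [|exact: cvg_cst|exact: cvgV_pinfty].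
near=> x; have x0 : 0 < x by near: x; exact: nbhs_pinfty_gt.
have r1 := rho_gt0 x; have r2 := rho_ge x; have r3 := rho_sqr x; have r4 := rho_ge1 x.
rewrite /= subr_ge0 ler_pdivrMr // mul1r r2 /=.
have -> : 1 - x / rho x = (rho x - x) / rho x by field; rewrite gt_eqF.
rewrite ler_pdivrMr // mulrC ler_pdivlMr //.
by nra.
Unshelve. all: by end_near.
Qed.

Lemma rho_int_sum j h th : (1 < j)%N -> 0 < h -> exists2 T,
  (\esum_(k in [set: int]) ((rho (h * k%:~R + th) ^+ j)^-1)%:E = T%:E)%E &
  W R j - 2 * h <= h * T <= W R j + 2 * h.
Proof.
move=> j1 h0; have [F [dF F0 Fl]] := rho_antiderivative j1.
have [] := @int_sum (fun x => (rho x ^+ j)^-1) F _ (fun x _ => dF x) _ _ Fl _ F0 h th h0.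
- by move=> x y; exact: rho_anti.
- by move=> x; rewrite invr_ge0 exprn_ge0 // ltW // rho_gt0.
- by move=> x; rewrite /rho sqrrN.
move=> T E /andP[b1 b2]; exists T => //.
move: b1 b2; have -> : rho 0 = 1 by rewrite /rho expr0n addr0 sqrtr1.
by rewrite expr1n invr1 => b1 b2; apply/andP; split; lra.
Qed.

(** Rescaling by sqrt A replaces the mesh h by h / sqrt A <= h, so the error relative to X is
    uniform in A >= 1. *)
Lemma sqrtA_int_sum j h th A : (1 < j)%N -> 0 < h <= 1 -> 1 <= A -> exists2 T,
  (\esum_(k in [set: int]) ((Num.sqrt (A + (h * k%:~R + th) ^+ 2) ^+ j)^-1)%:E = T%:E)%E &
  let X := (Num.sqrt A ^+ j.-1)^-1 in
  W R j * X - 2 * h * X <= h * T <= W R j * X + 2 * h * X.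
Proof.
move=> j1 /andP[h0 h1] A1; move EB : (Num.sqrt A) => B.
have B1 : 1 <= B by rewrite -EB -[leLHS](@sqrtr1 R) ler_wsqrtr.
have B0 : 0 < B by exact: lt_le_trans B1.
have AB : A = B ^+ 2 by rewrite -EB sqr_sqrtr // (le_trans ler01).
have hB : 0 < h / B by rewrite divr_gt0.
have [T E /andP[b1 b2]] := rho_int_sum (th / B) j1 hB.
exists ((B ^+ j)^-1 * T).
  rewrite EFinM -E -esumZl_fin => [|k|]; last 2 first.
  - by rewrite lee_fin invr_ge0 exprn_ge0 // ltW // rho_gt0.
  - by rewrite invr_ge0 exprn_ge0 // ltW.
  apply: eq_esum => k _; rewrite -EFinM -invfM -exprMn; congr ((_ ^+ _)^-1)%:E.
  rewrite -[RHS]ger0_norm ?mulr_ge0 ?(ltW B0) ?(ltW (rho_gt0 _)) // -sqrtr_sqr exprMn rho_sqr AB.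
  by congr (Num.sqrt _); field; rewrite gt_eqF.
move=> X; have -> : h * ((B ^+ j)^-1 * T) = X * (h / B * T).
  rewrite /X -{1}(prednK (ltnW j1)) exprS; field.
  by rewrite !(gt_eqF B0) // expf_neq0 // gt_eqF.
have X0 : 0 < X by rewrite invr_gt0 exprn_gt0.
have hBh : h / B <= h by rewrite ler_pdivrMr // ler_peMr // ltW.
rewrite -!mulrBl -!mulrDl ![_ * X]mulrC !ler_pM2l //.
by apply/andP; split; lra.
Qed.

End RiemannSums.

(** * Riemann sums over the n-dimensional lattice *)

Section LatticeSums.
Variable R : realType.
Notation zvec n := {ffun 'I_n -> int}.

Definition zcons n (x : int) (k : zvec n) : zvec n.+1 :=
  [ffun i => if unlift ord0 i is Some j then k j else x].

Lemma zcons0 n x (k : zvec n) : zcons x k ord0 = x.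
Proof. by rewrite ffunE unlift_none. Qed.

Lemma zconsS n x (k : zvec n) i : zcons x k (lift ord0 i) = k i.
Proof. by rewrite ffunE liftK. Qed.

Lemma esum_zvec0 (a : zvec 0 -> \bar R) (k0 : zvec 0) :
  (0 <= a k0 -> \esum_(k in [set: zvec 0]) a k = a k0)%E.
Proof.
move=> a0; have -> : [set: zvec 0] = [set k0]; last by rewrite esum_set1.
by apply/seteqP; split=> k // _; apply/ffunP; case.
Qed.

Lemma esum_zvecS n (a : zvec n.+1 -> \bar R) : (forall k, 0 <= a k)%E ->
  (\esum_(k in [set: zvec n.+1]) a k =
   \esum_(x in [set: int]) \esum_(k in [set: zvec n]) a (zcons x k))%E.
Proof.
move=> a0; rewrite esum_esum => [|//].
rewrite (@reindex_esum R _ _ ([set: int] `*`` (fun=> [set: zvec n])) [set: zvec n.+1] (fun xk => zcons xk.1 xk.2)) //.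
split=> [//|[x k] [y l] _ _ /= /ffunP E|k _].
  have := E ord0; rewrite !zcons0 => ->; congr pair; apply/ffunP => i.
  by have := E (lift ord0 i); rewrite !zconsS.
exists (k ord0, [ffun i => k (lift ord0 i)]) => //=; apply/ffunP => i.
case: (unliftP ord0 i) => [j ->|->]; last by rewrite zcons0.
by rewrite zconsS ffunE.
Qed.

Definition znorm n (h : R) (th : 'I_n -> R) (k : zvec n) : R :=
  \sum_i (h * (k i)%:~R + th i) ^+ 2.

Lemma znorm_ge0 n h th (k : zvec n) : 0 <= znorm h th k.
Proof. by apply: sumr_ge0 => i _; exact: sqr_ge0. Qed.

Lemma znormS n h th x (k : zvec n) : znorm h th (zcons x k) =
  (h * x%:~R + th ord0) ^+ 2 + znorm h (fun i => th (lift ord0 i)) k.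
Proof.
rewrite /znorm big_ord_recl zcons0; congr (_ + _).
by apply: eq_bigr => i _; rewrite zconsS.
Qed.

(** Induction on n: for a fixed first coordinate the other ones form a sum of the same kind with A
    enlarged by its square, and the powers obtained are summed in dimension 1. This is why the
    estimate must be uniform in A and th, with an error proportional to the main power X. *)
Lemma riemann_sum n j : (n < j)%N -> exists2 C, 0 <= C &
  forall h A (th : 'I_n -> R), 0 < h <= 1 -> 1 <= A -> exists2 T,
  (\esum_(k in [set: zvec n]) ((Num.sqrt (A + znorm h th k) ^+ j)^-1)%:E = T%:E)%E &
  let X := (Num.sqrt A ^+ (j - n))^-1 in
  Vol R n j * X <= h ^+ n * T + C * h * X /\ h ^+ n * T <= Vol R n j * X + C * h * X.
Proof.
elim: n => [|n IH] nj.
  exists 0 => // h A th h01 A1; exists (Num.sqrt A ^+ j)^-1.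
    rewrite (@esum_zvec0 _ [ffun=> 0]) ?lee_fin ?invr_ge0 ?exprn_ge0 ?sqrtr_ge0 //.
    by rewrite /znorm big_ord0 addr0.
  by move=> X; rewrite /X subn0 /= expr0 !mul0r !addr0 lexx.
have [C C0 HC] := IH (ltnW nj).
have V0 : 0 <= Vol R n j.
  by rewrite VolE ?(ltnW nj) // !mulr_ge0 ?invr_ge0 ?exprn_ge0 ?sqrtr_ge0 // ltW // hgam_gt0.
pose e := (j - n)%N; have e1 : (1 < e)%N by rewrite /e; lia.
have W0 : 0 <= W R e := W_ge0 R e.
exists (C * (W R e + 2) + 2 * Vol R n j).
  by rewrite addr_ge0 ?mulr_ge0 // addr_ge0.
move=> h A th h01 A1; have /andP[h0 h1] := h01.
pose r x := A + (h * x%:~R + th ord0) ^+ 2.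
have r1 x : 1 <= r x by rewrite /r ler_wpDr // sqr_ge0.
have HT x := HC h (r x) (fun i => th (lift ord0 i)) h01 (r1 x).
pose T x := projT1 (cid2 (HT x)).
have ET x : (\esum_(k in [set: zvec n]) ((Num.sqrt (A + znorm h th (zcons x k)) ^+ j)^-1)%:E = (T x)%:E)%E.
  rewrite /T; case: (cid2 (HT x)) => T' E _ /=; rewrite -E; apply: eq_esum => k _.
  by rewrite znormS addrA.
have BT x : let X := (Num.sqrt (r x) ^+ e)^-1 in
   Vol R n j * X <= h ^+ n * T x + C * h * X /\ h ^+ n * T x <= Vol R n j * X + C * h * X.
  by rewrite /T; case: (cid2 (HT x)).
have T0 x : 0 <= T x.
  by rewrite -lee_fin -ET; apply: esum_ge0 => k _; rewrite lee_fin invr_ge0 exprn_ge0 // sqrtr_ge0.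
have [T1 E1 /= b1] := sqrtA_int_sum (th ord0) e1 h01 A1.
pose X x := (Num.sqrt (r x) ^+ e)^-1.
have X0 x : 0 <= X x by rewrite invr_ge0 exprn_ge0 // sqrtr_ge0.
have hn0 : 0 < h ^+ n by rewrite exprn_gt0.
have T10 : 0 <= T1 by rewrite -lee_fin -E1; apply: esum_ge0 => x _; rewrite lee_fin X0.
have Ch : 0 <= C * h by rewrite mulr_ge0 // ltW.
have sU : (\esum_(x in [set: int]) (h ^+ n * T x)%:E <= (((Vol R n j + C * h) * T1)%:E))%E.
  rewrite EFinM -E1 -esumZl_fin => [|x|]; last 2 first.
  - by rewrite lee_fin X0.
  - by rewrite addr_ge0.
  apply: le_esum => x _; rewrite -EFinM lee_fin mulrDl.
  by have [] := BT x.
have [S ES] : exists S, (\esum_(x in [set: int]) (T x)%:E = S%:E)%E.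
  have := sU; under eq_esum do rewrite EFinM.
  rewrite esumZl_fin ?(ltW hn0) //.
  have S0 : (0 <= \esum_(x in [set: int]) (T x)%:E)%E by apply: esum_ge0 => x _; rewrite lee_fin.
  case: (\esum_(x in _) _)%E S0 => [S _ _|_|//]; first by exists S.
  by rewrite gt0_muley ?lte_fin.
exists S; first by rewrite -ES esum_zvecS => [|k]; [apply: eq_esum => x _; rewrite ET|rewrite lee_fin invr_ge0 exprn_ge0 // sqrtr_ge0].
have {}sU : h ^+ n * S <= (Vol R n j + C * h) * T1.
  move: sU; under eq_esum do rewrite EFinM.
  by rewrite esumZl_fin ?(ltW hn0) // ES -EFinM lee_fin.
have sL : Vol R n j * T1 <= h ^+ n * S + C * h * T1.
  rewrite -lee_fin EFinD !EFinM -ES -E1 -EFinM -!esumZl_fin ?(ltW hn0) //; try by move=> x; rewrite lee_fin.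
  rewrite -esumD; try by move=> x _; rewrite -EFinM lee_fin mulr_ge0 // ltW.
  apply: le_esum => x _; rewrite -!EFinM -EFinD lee_fin.
  by have [] := BT x.
have B1 : 1 <= Num.sqrt A by rewrite -[leLHS](@sqrtr1 R) ler_wsqrtr.
rewrite subnS -/e.
have : 0 <= (Num.sqrt A ^+ e.-1)^-1 by rewrite invr_ge0 exprn_ge0 // sqrtr_ge0.
have [Y EY] : exists Y : R, (Num.sqrt A ^+ e.-1)^-1 = Y by eexists.
move: b1; rewrite {}EY => /andP[b1 b2] Y0.
have q1 : h * (h ^+ n * S) <= (Vol R n j + C * h) * (h * T1) by rewrite [in leRHS]mulrCA ler_pM2l.
have q2 : Vol R n j * (h * T1) <= h * (h ^+ n * S) + C * h * (h * T1).
  by rewrite (mulrCA (Vol R n j)) (mulrCA (C * h)) -mulrDr ler_pM2l.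
have q3 : Vol R n j * (h * T1) <= Vol R n j * (W R e * Y + 2 * h * Y) by rewrite ler_wpM2l.
have q4 : Vol R n j * (W R e * Y - 2 * h * Y) <= Vol R n j * (h * T1) by rewrite ler_wpM2l.
have q5 : C * h * (h * T1) <= C * h * ((W R e + 2) * Y).
  have hY : h * Y <= Y by rewrite ler_piMl.
  by apply: ler_wpM2l => //; move: b2 hY; clear; lra.
rewrite exprS -!mulrA; split.
  by move: q2 q4 q5; rewrite -!mulrA; clear; move=> *; lra.
by move: q1 q3 q5; rewrite -!mulrA; clear; move=> *; lra.
Qed.

End LatticeSums.

(** * The periodic function Phi and its mean *)

Section LatticeFunction.
Variable R : realType.
Local Notation zvec n := {ffun 'I_n -> int}.

Lemma esum_finType (T : finType) (a : T -> \bar R) : (forall t, 0 <= a t)%E ->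
  (\esum_(t in [set: T]) a t = \sum_t a t)%E.
Proof.
move=> a0; have -> : [set: T] = [set` enum T] by apply/seteqP; split=> t //= _; rewrite mem_enum.
rewrite esum_fset; [|exact: finite_seq|by []].
by rewrite -fsbig_seq ?enum_uniq // big_enum.
Qed.

Lemma esum_zmod n M (a : zvec n -> \bar R) : (0 < M)%N -> (forall k, 0 <= a k)%E ->
  (\esum_(k in [set: zvec n]) a k =
   \sum_(j : {ffun 'I_n -> 'I_M}) \esum_(k in [set: zvec n]) a [ffun i => ((j i)%:Z + M%:Z * k i)%R])%E.
Proof.
move=> M0 a0; rewrite -esum_finType => [|j]; last by apply: esum_ge0.
rewrite esum_esum //.
rewrite (@reindex_esum R _ _ ([set: {ffun 'I_n -> 'I_M}] `*`` (fun=> [set: zvec n])) [set: zvec n]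
  (fun jk => [ffun i => (jk.1 i)%:Z + M%:Z * jk.2 i])) //.
have Mz : M%:Z != 0 by rewrite eqz_nat -lt0n.
split=> [//|[j k] [j' k'] _ _ /= /ffunP E|k _].
  have jE i : j i = j' i :> nat.
    have := congr1 (fun z => (z %% M%:Z)%Z) (E i); rewrite !ffunE /= !(mulrC M%:Z) ![_ + _ * _]addrC !modzMDl.
    by rewrite !modz_small /= ?ltz_nat ?ltn_ord ?lez_nat // => -[].
  have -> : j = j' by apply/ffunP => i; exact: val_inj (jE i).
  have -> // : k = k'.
  by apply/ffunP => i; have := E i; rewrite !ffunE /= jE => /addrI /(mulfI Mz).
have lt i : (`|(k i %% M)%Z| < M)%N.
  by rewrite -ltz_nat gez0_abs ?modz_ge0 // ltz_pmod // ltz_nat.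
exists ([ffun i => Ordinal (lt i)], [ffun i => (k i %/ M)%Z]) => //=.
apply/ffunP => i; rewrite !ffunE /= gez0_abs ?modz_ge0 //.
by rewrite [RHS](divz_eq (k i) M) addrC mulrC.
Qed.

(* int_sum applies to this majorant of [(1 + x^2)^(-3/4)]. *)
Definition maj (x : R) : R := (Num.sqrt (1 + `|x|) ^+ 3)^-1.

Lemma maj_ge0 x : 0 <= maj x.
Proof. by rewrite invr_ge0 exprn_ge0 // sqrtr_ge0. Qed.

Lemma maj_le1 x : maj x <= 1.
Proof.
rewrite invf_le1 ?exprn_gt0 ?sqrtr_gt0 ?ltr_wpDr //.
by rewrite exprn_ege1 // -[leLHS](@sqrtr1 R) ler_wsqrtr // lerDl.
Qed.

(** The antiderivative on the half line is 2 - 2 / sqrt(1 + x), of total mass 2. *)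
Lemma maj_int_sum (h : R) : 0 < h -> exists2 C, 0 <= C &
  forall th, (\esum_(k in [set: int]) (maj (h * k%:~R + th))%:E <= C%:E)%E.
Proof.
move=> h0; pose F (x : R) : R := 2 - 2 * (Num.sqrt (1 + x))^-1.
exists ((2 * 2 + 2 * h) / h) => [|th]; first by rewrite divr_ge0 ?addr_ge0 ?mulr_ge0 // ltW.
have [] := @int_sum R maj F 2 _ _ maj_ge0 _ _ _ h th h0.
- move=> x x0; have p : 0 < 1 + x by rewrite ltr_wpDr.
  have r0 : Num.sqrt (1 + x) != 0 by rewrite gt_eqF // sqrtr_gt0.
  have d1 : is_derive x 1 (fun y => Num.sqrt (1 + y)) _ :=
    @is_derive1_comp R Num.sqrt _ x _ _ (is_derive1_sqrt p) (dD (is_derive_cst (1 : R) x 1) (is_derive_id x 1)).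
  apply: dE (dB (is_derive_cst (2 : R) x 1) (dZ 2 (@dV R (fun y => Num.sqrt (1 + y)) x _ r0 d1))) _; rewrite /maj ger0_norm // !exprS expr0 add0r.
  by field.
- move=> x y x0 xy; rewrite /maj !ger0_norm // ?(le_trans x0) //.
  rewrite lef_pV2 ?posrE ?exprn_gt0 ?sqrtr_gt0 ?ltr_wpDr // ?(le_trans x0) //.
  by rewrite lerXn2r ?nnegrE ?sqrtr_ge0 // ler_wsqrtr // lerD2l.
- rewrite /F -[X in _ --> X]subr0; apply: cvgB; first exact: cvg_cst.
  rewrite -(mulr0 2); apply: cvgMr.
  apply/cvgr0Pnorm_lt => e e0; near=> x.
  have x0 : 0 < x by near: x; exact: nbhs_pinfty_gt.
  rewrite ger0_norm ?invr_ge0 ?sqrtr_ge0 // invf_plt ?posrE ?sqrtr_gt0 ?ltr_wpDr ?(ltW x0) //.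
  rewrite -[e^-1]gtr0_norm ?invr_gt0 // -sqrtr_sqr ltr_sqrt; last by rewrite ltr_wpDr ?(ltW x0).
  apply: (@lt_le_trans _ _ x); last by rewrite lerDr.
  near: x; apply: nbhs_pinfty_gt; exact: num_real.
- by move=> x; rewrite /maj normrN.
- by rewrite /F addr0 sqrtr1 invr1 mulr1 subrr.
move=> T -> /andP[_ hT]; rewrite lee_fin ler_pdivlMr // mulrC (le_trans hT) // lerD2l.
by rewrite ler_piMr ?mulr_ge0 ?(ltW h0) // maj_le1.
Unshelve. all: by end_near.
Qed.

Lemma maj_zvec_sum n (h : R) : 0 < h -> exists2 C, 0 <= C & forall th : 'I_n -> R,
  (\esum_(k in [set: zvec n]) (\prod_i maj (h * (k i)%:~R + th i))%:E <= C%:E)%E.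
Proof.
move=> h0; have [C C0 HC] := maj_int_sum h0.
exists (C ^+ n) => [|th]; first exact: exprn_ge0.
elim: n th => [|n IH] th.
  by rewrite (@esum_zvec0 R _ [ffun=> 0]) big_ord0 ?lee_fin.
have m0 m (t : 'I_m -> R) (k : zvec m) : 0 <= \prod_i maj (h * (k i)%:~R + t i).
  by apply: prodr_ge0 => i _; exact: maj_ge0.
rewrite esum_zvecS => [|k]; last by rewrite lee_fin.
apply: (@le_trans _ _ (\esum_(x in [set: int]) ((C ^+ n)%:E * (maj (h * x%:~R + th ord0))%:E))%E).
  apply: le_esum => x _.
  rewrite (_ : \esum_(k in _) _ = \esum_(k in [set: zvec n]) ((maj (h * x%:~R + th ord0))%:E *
     (\prod_i maj (h * (k i)%:~R + th (lift ord0 i)))%:E))%E.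
    rewrite esumZl ?lee_fin ?maj_ge0 // => [|k]; last by rewrite lee_fin m0.
    rewrite [leLHS]muleC lee_wpmul2r ?lee_fin ?maj_ge0 //; exact: IH.
  apply: eq_esum => k _; rewrite big_ord_recl zcons0 EFinM; congr (_ * (_%:E))%E.
  by apply: eq_bigr => i _; rewrite zconsS.
rewrite esumZl ?lee_fin ?exprn_ge0 // => [|x]; last by rewrite lee_fin maj_ge0.
by rewrite exprSr EFinM lee_wpmul2l ?lee_fin ?exprn_ge0 //; exact: HC.
Qed.

Lemma powRE (a x : R) : 0 < a -> a `^ x = expR (x * ln a).
Proof. by move=> a0; rewrite /powR gt_eqF. Qed.

(** Since s >= n - 1/4 >= 3n/4, the power is at most a product of n copies of Y^(-3/4), and Y >= 1 +
    y_i^2 >= (1 + |y_i|)^2 / 2 for each i. The constant 2 per coordinate covers 2^(3/4). *)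
Lemma powR_le_maj n (y : 'I_n -> R) s : (0 < n)%N -> n%:R - 4^-1 <= s ->
  (1 + \sum_i y i ^+ 2) `^ (- s) <= 2 ^+ n * \prod_i maj (y i).
Proof.
move=> n0 ns; set Y := 1 + _.
have Y1 : 1 <= Y by rewrite lerDl sumr_ge0 // => i _; exact: sqr_ge0.
apply: (@le_trans _ _ (Y `^ (- (3 / 4)) ^+ n)).
  rewrite -powR_mulrn ?powR_ge0 // -powRrM ler_powR // mulNr lerN2 (le_trans _ ns) //.
  have : 1 <= n%:R :> R by rewrite ler1n.
  lra.
have -> : 2 ^+ n * \prod_i maj (y i) = \prod_i (2 * maj (y i)).
  by rewrite big_split prodr_const card_ord.
rewrite -[X in _ ^+ X](card_ord n) -prodr_const; apply: ler_prod => i _.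
rewrite powR_ge0 /=.
have Yi : 1 + y i ^+ 2 <= Y.
  by rewrite lerD2l (bigD1 i) //= lerDl sumr_ge0 // => j _; exact: sqr_ge0.
have p0 : 0 < 1 + `|y i| by rewrite ltr_wpDr.
have Y2 : (1 + `|y i|) ^+ 2 / 2 <= Y.
  apply: le_trans Yi; rewrite -(real_normK (num_real (y i))).
  by have := sqr_ge0 (1 - `|y i|); lra.
have -> : maj (y i) = (1 + `|y i|) `^ (- (3 / 2)).
  rewrite /maj -powR12_sqrt ?(ltW p0) // -powR_mulrn ?powR_ge0 // -powRrM powRN; congr (_ `^ _)^-1.
  by lra.
have a0 : 0 < Y `^ (3 / 4) by rewrite powR_gt0 // (lt_le_trans ltr01).
have b0 : 0 < (1 + `|y i|) `^ (3 / 2) by rewrite powR_gt0.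
rewrite !powRN ler_pdivlMr // mulrC ler_pdivrMr //.
have q0 : 0 <= (1 + `|y i|) ^+ 2 / 2 by rewrite divr_ge0 ?sqr_ge0.
have -> : (1 + `|y i|) `^ (3 / 2) = 2 `^ (3 / 4) * ((1 + `|y i|) ^+ 2 / 2) `^ (3 / 4).
  rewrite -powRM // (_ : 2 * _ = (1 + `|y i|) ^+ 2); last by field.
  by rewrite -powR_mulrn ?(ltW p0) // -powRrM; congr (_ `^ _); field.
apply: ler_pM; rewrite ?powR_ge0 //.
  by rewrite -[leRHS]powRr1 // ler_powR ?ler1n //; lra.
apply: ge0_ler_powR; rewrite ?nnegrE ?divr_ge0 //; exact: le_trans ler01 Y1.
Qed.

Section Phi.
Variables (n : nat) (lam : R).
Hypothesis n0 : (0 < n)%N.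
Hypothesis lam0 : 0 < lam.
Implicit Types (s : R) (th : 'I_n -> R) (k : zvec n).

Definition Pterm s th k : R := (1 + znorm lam th k) `^ (- s).

Definition Phi s th : R := fine (\esum_(k in [set: zvec n]) (Pterm s th k)%:E).

Lemma Pterm_ge0 s th k : 0 <= Pterm s th k. Proof. exact: powR_ge0. Qed.

Lemma Pbase_ge1 th k : 1 <= 1 + znorm lam th k.
Proof. by rewrite lerDl znorm_ge0. Qed.

Lemma Pterm_bound : exists2 C, 0 <= C & forall s th, n%:R - 4^-1 <= s ->
  (\esum_(k in [set: zvec n]) (Pterm s th k)%:E <= C%:E)%E.
Proof.
have [C C0 HC] := maj_zvec_sum n lam0.
exists (2 ^+ n * C) => [|s th ns]; first by rewrite mulr_ge0 // exprn_ge0.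
apply: (@le_trans _ _ (\esum_(k in [set: zvec n]) ((2 ^+ n)%:E * (\prod_i maj (lam * (k i)%:~R + th i))%:E))%E).
  by apply: le_esum => k _; rewrite -EFinM lee_fin; exact: powR_le_maj.
rewrite esumZl ?lee_fin ?exprn_ge0 // => [|k]; last by rewrite lee_fin prodr_ge0 // => i _; exact: maj_ge0.
by rewrite EFinM lee_wpmul2l ?lee_fin ?exprn_ge0.
Qed.

(** The sum still converges at exponent n - 1/4. This margin pays for the logarithm in the variation
    of s, through ln Y <= 4 Y^(1/4), so Phi varies at most linearly in s - n, uniformly in th. *)
Lemma Phi_spec : exists2 C, 0 <= C &
  [/\ forall s th, n%:R <= s -> (\esum_(k in [set: zvec n]) (Pterm s th k)%:E = (Phi s th)%:E)%E,
      forall s th, n%:R <= s -> 0 <= Phi s th <= C &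
      forall s th, n%:R <= s -> Phi n%:R th - (s - n%:R) * C <= Phi s th <= Phi n%:R th].
Proof.
have [C C0 HC] := Pterm_bound.
have fin s th : n%:R - 4^-1 <= s -> (\esum_(k in [set: zvec n]) (Pterm s th k)%:E = (Phi s th)%:E)%E.
  move=> ns; rewrite /Phi fineK // ge0_fin_numE; last by apply: esum_ge0 => k _; rewrite lee_fin Pterm_ge0.
  exact: le_lt_trans (HC s th ns) (ltry _).
have le4 s : n%:R <= s -> n%:R - 4^-1 <= s by lra.
have P0 s th : n%:R - 4^-1 <= s -> 0 <= Phi s th.
  by move=> ns; rewrite -lee_fin -fin //; apply: esum_ge0 => k _; rewrite lee_fin Pterm_ge0.
exists (4 * C); first by rewrite mulr_ge0.
split=> s th ns; first by rewrite fin ?le4.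
  rewrite P0 ?le4 //= -lee_fin -fin ?le4 //; apply: le_trans (HC _ _ (le4 _ ns)) _.
  by rewrite lee_fin ler_peMl // ler1n.
have ns4 := le4 _ ns; have nn4 := le4 _ (lexx n%:R).
apply/andP; split; last first.
  rewrite -lee_fin -!fin //; apply: le_esum => k _; rewrite lee_fin.
  by rewrite ler_powR ?Pbase_ge1 // lerN2.
rewrite lerBlDr -lee_fin EFinD -!fin //.
have -> : (((s - n%:R) * (4 * C))%:E = ((s - n%:R) * 4)%:E * C%:E)%E by rewrite -EFinM mulrA.
have c0 : 0 <= (s - n%:R) * 4 by rewrite mulr_ge0 // subr_ge0.
apply: (@le_trans _ _ (\esum_(k in [set: zvec n]) (Pterm s th k)%:E +
   ((s - n%:R) * 4)%:E * \esum_(k in [set: zvec n]) (Pterm (n%:R - 4^-1) th k)%:E)%E); last first.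
  by rewrite leeD2l // lee_wpmul2l ?lee_fin // HC.
rewrite -esumZl ?lee_fin // => [|k]; last by rewrite lee_fin Pterm_ge0.
rewrite -esumD => [|k _|k _]; last 2 first.
- by rewrite lee_fin Pterm_ge0.
- by rewrite -EFinM lee_fin mulr_ge0 ?Pterm_ge0.
apply: le_esum => k _; rewrite -EFinM -EFinD lee_fin /Pterm.
have := Pbase_ge1 th k; move: (1 + _) => Y Y1; have Y0 : 0 < Y by exact: lt_le_trans Y1.
have -> : Y `^ (- s) = Y `^ (- n%:R) * expR (- (s - n%:R) * ln Y).
  by rewrite !powRE // -expRD; congr expR; ring.
have -> : Y `^ (- (n%:R - 4^-1)) = Y `^ (- n%:R) * Y `^ (4^-1).
  by rewrite !powRE // -expRD; congr expR; ring.
have l4 : ln Y <= 4 * Y `^ (4^-1).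
  have : ln (Y `^ 4^-1) < Y `^ 4^-1 by rewrite ln_sublinear // powR_gt0.
  by rewrite ln_powR; lra.
have e1 := expR_ge1Dx (- (s - n%:R) * ln Y).
rewrite -subr_ge0 (_ : _ - _ = Y `^ (- n%:R) * (expR (- (s - n%:R) * ln Y) + (s - n%:R) * 4 * Y `^ 4^-1 - 1)); last by ring.
rewrite mulr_ge0 ?powR_ge0 // subr_ge0.
have : (s - n%:R) * ln Y <= (s - n%:R) * (4 * Y `^ 4^-1) by rewrite ler_wpM2l // subr_ge0.
by move: e1; rewrite mulNr -mulrA; lra.
Qed.

Lemma PhiE s th : n%:R <= s -> (\esum_(k in [set: zvec n]) (Pterm s th k)%:E = (Phi s th)%:E)%E.
Proof. by case: Phi_spec => C _ [h _ _]; exact: h. Qed.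

Lemma Phi_per s th (m : 'I_n -> int) : Phi s (fun i => th i + lam * (m i)%:~R) = Phi s th.
Proof.
rewrite /Phi; congr fine.
rewrite [RHS](@reindex_esum R (zvec n) (zvec n) setT setT (fun k => [ffun i => k i + m i])).
  apply: eq_esum => k _; congr ((1 + _) `^ _)%:E; apply: eq_bigr => i _.
  by rewrite ffunE intrD; ring.
split=> [//|k l _ _ /ffunP E|k _].
  by apply/ffunP => i; have := E i; rewrite !ffunE => /addIr.
by exists [ffun i => k i - m i] => //; apply/ffunP => i; rewrite !ffunE subrK.
Qed.

(** The cross term is split by 2 z u <= eta z^2 + u^2 / eta. *)
Lemma base_close (z u : 'I_n -> R) (eta : R) : 0 < eta -> \sum_i u i ^+ 2 <= eta ^+ 2 ->
  1 + \sum_i (z i + u i) ^+ 2 <= (1 + eta + eta ^+ 2) * (1 + \sum_i z i ^+ 2).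
Proof.
move=> e0 hu.
have H i : (z i + u i) ^+ 2 <= (1 + eta) * z i ^+ 2 + (1 + eta^-1) * u i ^+ 2.
  rewrite -subr_ge0 (_ : _ - _ = (eta * z i - u i) ^+ 2 / eta); last by field; rewrite gt_eqF.
  by rewrite divr_ge0 ?sqr_ge0 // ltW.
apply: le_trans (_ : 1 + (\sum_i ((1 + eta) * z i ^+ 2 + (1 + eta^-1) * u i ^+ 2)) <= _).
  by rewrite lerD2l; apply: ler_sum => i _; exact: H.
rewrite big_split /= -!mulr_sumr.
have : (1 + eta^-1) * \sum_i u i ^+ 2 <= (1 + eta^-1) * eta ^+ 2.
  by rewrite ler_wpM2l // addr_ge0 // invr_ge0 ltW.
have -> : (1 + eta^-1) * eta ^+ 2 = eta ^+ 2 + eta by field; rewrite gt_eqF.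
have : 0 <= \sum_i z i ^+ 2 by apply: sumr_ge0 => i _; exact: sqr_ge0.
have := mulr_ge0 (ltW e0) (ltW e0); rewrite -expr2; move: (\sum_i z i ^+ 2) (_ * \sum_i u i ^+ 2) => Z U e2 Z0 HU.
have := mulr_ge0 e2 Z0; lra.
Qed.

(** Continuity in multiplicative form: the bases of corresponding terms differ by a factor at most 1
    + eta + eta^2, so the comparison is made term by term. *)
Lemma Phi_close th th' (eta : R) : 0 < eta -> \sum_i (th i - th' i) ^+ 2 <= eta ^+ 2 ->
  Phi n%:R th <= (1 + eta + eta ^+ 2) ^+ n * Phi n%:R th'.
Proof.
move=> e0 h; rewrite -lee_fin EFinM -!PhiE // -esumZl ?lee_fin ?exprn_ge0 //; last 2 first.
- by move=> k; rewrite lee_fin Pterm_ge0.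
- by rewrite !addr_ge0 // ?sqr_ge0 // ltW.
apply: le_esum => k _; rewrite -EFinM lee_fin /Pterm.
have q0 : 0 < 1 + eta + eta ^+ 2 by rewrite !addr_gt0 // exprn_gt0.
have b : 1 + znorm lam th' k <= (1 + eta + eta ^+ 2) * (1 + znorm lam th k).
  have := @base_close (fun i => lam * (k i)%:~R + th i) (fun i => th' i - th i) eta e0.
  rewrite (eq_bigr (fun i => (th i - th' i) ^+ 2)) => [/(_ h)|i _]; last by rewrite -opprB sqrrN.
  apply: le_trans; rewrite lerD2l; apply: ler_sum => i _.
  by rewrite (_ : _ + (th' i - th i) = lam * (k i)%:~R + th' i) //; ring.
have B0 := lt_le_trans ltr01 (Pbase_ge1 th k); have B0' := lt_le_trans ltr01 (Pbase_ge1 th' k).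
rewrite !powRN !powR_mulrn ?(ltW B0) ?(ltW B0') // ler_pdivlMr ?exprn_gt0 // mulrC ler_pdivrMr ?exprn_gt0 //.
by rewrite -exprMn lerXn2r ?nnegrE ?mulr_ge0 ?(ltW B0) ?(ltW B0') ?(ltW q0).
Qed.

(** Averaging over the grid of step 1/M merges with the lattice sum inside Phi into a single Riemann
    sum of mesh lam / M over Z^n. *)
Lemma Phi_mean (mu : 'I_n -> R) : exists2 C, 0 <= C & forall M : nat, lam <= M%:R ->
  `|(M%:R ^+ n)^-1 * (\sum_(j : {ffun 'I_n -> 'I_M}) Phi n%:R (fun i => lam * ((j i)%:R / M%:R) + mu i))
     - (lam ^+ n)^-1 * Vol R n (n + n)| <= C / M%:R.
Proof.
have nn : (n < n + n)%N by rewrite -[X in (X < _)%N]addn0 ltn_add2l.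
have [C C0 HC] := @riemann_sum R n (n + n) nn.
exists ((lam ^+ n)^-1 * (C * lam)) => [|M lM]; first by rewrite !mulr_ge0 ?invr_ge0 ?exprn_ge0 ?(ltW lam0).
have M0 : 0 < M%:R :> R by exact: lt_le_trans lM.
have M0' : (0 < M)%N by rewrite -(ltr0n R).
pose h := lam / M%:R.
have h01 : 0 < h <= 1 by rewrite divr_gt0 //= ler_pdivrMr // mul1r.
have [T ET] := HC h 1 mu h01 (lexx _).
rewrite /= sqrtr1 expr1n invr1 !mulr1 => -[b1 b2].
set S := \sum_j _.
have TS : T = S.
  apply: EFin_inj; rewrite -ET (@esum_zmod n M _ M0') => [|k]; last by rewrite lee_fin invr_ge0 exprn_ge0 // sqrtr_ge0.
  rewrite /S -sumEFin; apply: eq_bigr => j _; rewrite -PhiE //; apply: eq_esum => k _.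
  have e : znorm h mu [ffun i => (j i)%:Z + M%:Z * k i] = znorm lam (fun i => lam * ((j i)%:R / M%:R) + mu i) k.
    apply: eq_bigr => i _; congr (_ ^+ 2); rewrite ffunE intrD intrM /h -!pmulrn.
    by field; rewrite gt_eqF.
  rewrite e /Pterm powRN powR_mulrn ?addr_ge0 ?znorm_ge0 //; congr (_^-1)%:E.
  by rewrite exprD -exprMn -expr2 sqr_sqrtr // addr_ge0 ?znorm_ge0.
move: b1 b2; rewrite {}TS => b1 b2.
have -> : (M%:R ^+ n)^-1 * S = (lam ^+ n)^-1 * (h ^+ n * S).
  by rewrite mulrA /h expr_div_n; congr (_ * _); field; rewrite !expf_neq0 ?gt_eqF.
rewrite -mulrBr normrM ger0_norm ?invr_ge0 ?exprn_ge0 ?(ltW lam0) // -!mulrA.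
rewrite ler_wpM2l ?invr_ge0 ?exprn_ge0 ?(ltW lam0) // -/h ler_norml.
by apply/andP; split; lra.
Qed.

End Phi.

End LatticeFunction.

(** * The archimedean and 2-adic constants *)

Section Basel.
Variable R : realType.

(** From sin t <= t <= tan t together with csc^2 = cot^2 + 1. *)
Lemma sinV2_bounds (t : R) : 0 < t < pi / 2 ->
  (t ^+ 2)^-1 <= (sin t ^+ 2)^-1 <= (t ^+ 2)^-1 + 1.
Proof.
move=> /andP[t0 t2].
have ct x : 0 <= x -> x <= t -> 0 < cos x :> R.
  move=> x0 xt; apply: cos_gt0_pihalf; have := pi_gt0 R; move: t2; rewrite ltr_pdivlMr // => t2 p0.
  by rewrite (le_lt_trans xt) ?ltr_pdivlMr // andbT; apply: lt_le_trans x0; rewrite oppr_lt0 divr_gt0.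
have s0 : 0 < sin t.
  by apply: sin_gt0_pihalf; rewrite t0.
have [|c1 _ E1] := @MVT R sin cos 0 t t0.
  apply: continuous_subspaceT => x; exact: continuous_sin.
have [||c2 hc2 E2] := @MVT R tan (fun x => (cos x ^+ 2)^-1) 0 t t0.
- move=> x; rewrite in_itv /= => /andP[x0 xt]; apply: is_derive_tan.
  by rewrite gt_eqF // ct // ltW.
- apply: derivable_within_continuous => x; rewrite in_itv /= => /andP[x0 xt].
  have [] := @is_derive_tan R x _ => //; by rewrite gt_eqF // ct.
move: E1 E2; rewrite sin0 tan0 !subr0 => E1 E2.
have st : sin t <= t by rewrite E1 ler_piMl ?cos_le1 // ltW.
have tt : t <= tan t.
  have c2p : 0 < cos c2 by move: hc2; rewrite in_itv /= => /andP[h1 h2]; apply: ct; exact: ltW.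
  rewrite E2 ler_peMl ?(ltW t0) // invf_ge1 ?exprn_gt0 // exprn_ile1 ?cos_le1 //; exact: ltW.
apply/andP; split.
  by rewrite lef_pV2 ?posrE ?exprn_gt0 // lerXn2r ?nnegrE ?(ltW s0) ?(ltW t0).
have c0 := ct t (ltW t0) (lexx t).
have -> : (sin t ^+ 2)^-1 = (tan t ^+ 2)^-1 + 1.
  have := cos2Dsin2 t; rewrite /tan; move: (cos t) (sin t) c0 s0 => c s c0 s0 h.
  have -> : ((s / c) ^+ 2)^-1 + 1 = (c ^+ 2 + s ^+ 2) / s ^+ 2 by field; rewrite !gt_eqF.
  by rewrite h mul1r.
have tp : 0 < tan t := lt_le_trans t0 tt.
by rewrite lerD2r lef_pV2 ?posrE ?exprn_gt0 // lerXn2r ?nnegrE ?(ltW tp) ?(ltW t0).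
Qed.

Lemma sum_fold (N : nat) (F : nat -> R) :
  \sum_(k < N + N) F k = \sum_(k < N) (F k + F (N + N - k.+1)%N).
Proof.
rewrite big_split_ord big_split /=; congr (_ + _); rewrite (reindex_inj rev_ord_inj) /=.
by apply: eq_bigr => i _; congr F; have := ltn_ord i; lia.
Qed.

Let ang (m k : nat) : R := (2 * k%:R + 1) * pi / 2 ^+ m.+2.

(* The halving identity csc^2 x = (csc^2 (x/2) + sec^2 (x/2)) / 4. *)
Lemma csc2_sum m : \sum_(k < 2 ^ m) (sin (ang m k) ^+ 2)^-1 = 2 * 4 ^+ m.
Proof.
elim: m => [|m IH].
  rewrite expn0 big_ord1 /ang mulr0 add0r mul1r expr0 mulr1.
  have E : pi / 2 ^+ 2 = pi / 2 - pi / 2 ^+ 2 :> R by field.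
  have h := cos2Dsin2 (pi / 2 ^+ 2 : R).
  have : cos (pi / 2 ^+ 2) = sin (pi / 2 ^+ 2) :> R.
    by rewrite {1}E cosB cos_pihalf sin_pihalf mul0r add0r mul1r.
  move=> hc; move: h; rewrite hc => h; have {}h : sin (pi / 2 ^+ 2) ^+ 2 = 2^-1 :> R by lra.
  by rewrite h invrK.
rewrite expnS mul2n -addnn (sum_fold _ (fun k => (sin (ang m.+1 k) ^+ 2)^-1)) exprS mulrCA -IH mulr_sumr.
apply: eq_bigr => k _.
have p0 := pi_gt0 R; have k2 : (k < 2 ^ m)%N by [].
have pm : 0 < 2 ^+ m :> R by rewrite exprn_gt0.
have kR : k%:R + 1 <= 2 ^+ m :> R by rewrite natr1 -natrX ler_nat.
have a1 : ang m k = ang m.+1 k + ang m.+1 k.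
  by rewrite /ang !exprS; field; rewrite gt_eqF.
have a2 : ang m.+1 (2 ^ m + 2 ^ m - k.+1) = pi / 2 - ang m.+1 k.
  rewrite /ang natrB; last by rewrite ltn_addr.
  by rewrite natrD natrX -(natr1 k) !exprS; field; rewrite gt_eqF.
have x0 : 0 < ang m.+1 k.
  by rewrite /ang divr_gt0 ?exprn_gt0 // mulr_gt0 // ltr_wpDl // mulr_ge0.
have x2 : ang m.+1 k < pi / 2.
  rewrite /ang ltr_pdivrMr ?exprn_gt0 // mulrC mulrAC -mulrA ltr_pM2l //.
  rewrite !exprS; move: kR pm; lra.
rewrite a1 a2 sinD sinB cos_pihalf sin_pihalf mul1r mul0r subr0.
have s0 : 0 < sin (ang m.+1 k) by apply: sin_gt0_pihalf; rewrite x0.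
have c0 : 0 < cos (ang m.+1 k).
  by apply: cos_gt0_pihalf; rewrite x2 andbT (lt_trans _ x0) // oppr_lt0 divr_gt0.
have := cos2Dsin2 (ang m.+1 k); move: (cos _) (sin _) c0 s0 => c s c0 s0 h.
have sn : s != 0 by rewrite gt_eqF.
have cn : c != 0 by rewrite gt_eqF.
have -> : 4 * ((s * c + c * s) ^+ 2)^-1 = (c ^+ 2 + s ^+ 2) / (s * c) ^+ 2.
  by rewrite h (_ : s * c + c * s = 2 * (s * c)); [field; rewrite sn cn|ring].
by field; rewrite sn cn.
Qed.

(** The exact sum of the csc^2 is of order 4^m, while replacing each term by the inverse square of
    its angle costs at most 1 per term, hence 2^m in all. *)
Lemma odd_sum_bounds m : (pi : R) ^+ 2 / 8 - pi ^+ 2 / 16 / 2 ^+ m <=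
  \sum_(k < 2 ^ m) ((2 * k%:R + 1) ^+ 2)^-1 <= (pi : R) ^+ 2 / 8.
Proof.
have p0 := pi_gt0 R; have pm : 0 < 2 ^+ m :> R by rewrite exprn_gt0.
set S := \sum_(k < _) _.
have aE (k : 'I_(2 ^ m)) : (ang m k ^+ 2)^-1 = 16 * 4 ^+ m / pi ^+ 2 * ((2 * k%:R + 1) ^+ 2)^-1.
  have k0 : 0 <= k%:R :> R by [].
  have -> : 4 ^+ m = (2 ^+ m) ^+ 2 :> R by rewrite -exprM mulnC exprM; congr (_ ^+ _); ring.
  have kn : 2 * k%:R + 1 != 0 :> R by rewrite gt_eqF // ltr_wpDl // mulr_ge0.
  have pn : (pi : R) != 0 by rewrite gt_eqF.
  have xn : 2 ^+ m != 0 :> R by rewrite gt_eqF.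
  rewrite /ang [2 ^+ m.+2]exprS [2 ^+ m.+1]exprS.
  move: kn pn xn; move: (2 * k%:R + 1) (pi : R) (2 ^+ m) => u p X un pn xn.
  by field; apply/and3P; split.
have b (k : 'I_(2 ^ m)) : (ang m k ^+ 2)^-1 <= (sin (ang m k) ^+ 2)^-1 <= (ang m k ^+ 2)^-1 + 1.
  apply: sinV2_bounds; have kR : k%:R + 1 <= 2 ^+ m :> R by rewrite natr1 -natrX ler_nat.
  have k0 : 0 <= k%:R :> R by [].
  have a0 : 0 < 2 * k%:R + 1 :> R by rewrite ltr_wpDl // mulr_ge0.
  apply/andP; split; first by apply: divr_gt0; [exact: mulr_gt0|rewrite exprn_gt0].
  rewrite /ang ltr_pdivrMr ?exprn_gt0 // mulrC mulrAC -mulrA ltr_pM2l //.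
  by rewrite !exprS; move: kR pm; lra.
have u : 16 * 4 ^+ m / pi ^+ 2 * S <= 2 * 4 ^+ m.
  rewrite -csc2_sum /S mulr_sumr; apply: ler_sum => k _; rewrite -aE; by case/andP: (b k).
have l : 2 * 4 ^+ m <= 16 * 4 ^+ m / pi ^+ 2 * S + 2 ^+ m.
  have -> : 2 ^+ m = \sum_(k < 2 ^ m) 1 :> R by rewrite sumr_const card_ord natrX.
  rewrite -csc2_sum /S mulr_sumr -big_split /=.
  by apply: ler_sum => k _; rewrite -aE; case/andP: (b k).
move: u l; have -> : 4 ^+ m = (2 ^+ m) ^+ 2 :> R by rewrite -exprM mulnC exprM; congr (_ ^+ _); ring.
move: (2 ^+ m) pm S => X X0 S u l; clear aE b; move: p0 u l; move: (pi : R) => p p0 u l.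
have q0 : 0 < p ^+ 2 / (16 * X ^+ 2) :> R by rewrite divr_gt0 ?exprn_gt0 // mulr_gt0 // exprn_gt0.
have := ler_wpM2r (ltW q0) u; have := ler_wpM2r (ltW q0) l.
have -> : (16 * X ^+ 2 / p ^+ 2 * S + X) * (p ^+ 2 / (16 * X ^+ 2)) = S + p ^+ 2 / 16 / X.
  by field; rewrite !gt_eqF.
have -> : 16 * X ^+ 2 / p ^+ 2 * S * (p ^+ 2 / (16 * X ^+ 2)) = S by field; rewrite !gt_eqF.
have -> : 2 * X ^+ 2 * (p ^+ 2 / (16 * X ^+ 2)) = p ^+ 2 / 8 :> R by field; rewrite !gt_eqF.
by move=> h1 h2; apply/andP; split; lra.
Qed.

(** The odd terms add up to pi^2 / 8 and the even ones to a quarter of the whole. For n = 1 this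
    value in [Cfac] is what turns the constant into 4 / pi. *)
Lemma zeta_two : zeta 2 = pi ^+ 2 / 6 :> R.
Proof.
have h2 : (1 : R) < 2 by rewrite ltr1n.
have zE := @zeta_esum R 2 h2.
pose f (b : nat) : R := b%:R `^ (- 2).
have f0 b : 0 <= f b by exact: powR_ge0.
have fE b : f b = (b%:R ^+ 2)^-1 by rewrite /f powRN (powR_mulrn 2).
have ev : (\esum_(b in [set b | (0 < b)%N] `&` [set b | ~~ odd b]) (f b)%:E = (4^-1 * zeta 2)%:E)%E.
  rewrite (reindex_esum [set b | (0 < b)%N] _ (fun b => 2 * b)%N).
    rewrite EFinM -zE -esumZl ?lee_fin ?invr_ge0 //.
    apply: eq_esum => b _; rewrite -EFinM fE /f powRN (powR_mulrn 2) // natrM exprMn invfM.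
    by congr (_ * _)%:E; field.
  split=> [b /= b0|b c _ _ /eqP|b /= [b0 eb]]; first by split=> /=; lia.
    by rewrite eqn_pmul2l // => /eqP.
  by exists b./2 => /=; lia.
have od : (\esum_(b in [set b | (0 < b)%N] `&` ~` [set b | ~~ odd b]) (f b)%:E =
    \esum_(k in [set: nat]) (((2 * k%:R + 1) ^+ 2)^-1)%:E)%E.
  rewrite (reindex_esum [set: nat] _ (fun b => (2 * b).+1)%N).
    by apply: eq_esum => k _; rewrite fE -natr1 natrM.
  split=> [b _ /=|b c _ _ [] /eqP|b /= [b0 /negP/negPn eb]].
  - by split=> //=; apply/negP; rewrite negbK /= mul2n odd_double.
  - by rewrite -/(2 * b)%N -/(2 * c)%N; lia.
  - by exists b./2 => //; lia.
have := zE; rewrite (esumID [set b | ~~ odd b]) => [|b _]; last by rewrite lee_fin.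
rewrite ev od.
case E : (\esum_(k in [set: nat]) (((2 * k%:R + 1) ^+ 2)^-1)%:E)%E => [T||] //= -[hT].
have u0 k : 0 <= ((2 * k%:R + 1) ^+ 2)^-1 :> R by rewrite invr_ge0 sqr_ge0.
have cv := series_esum u0 E.
have nd : nondecreasing_seq (series (fun k : nat => ((2 * k%:R + 1) ^+ 2)^-1 : R)).
  by apply/nondecreasing_seqP => N; rewrite seriesSr lerDl.
have sE N : series (fun k : nat => ((2 * k%:R + 1) ^+ 2)^-1 : R) N = \sum_(k < N) ((2 * k%:R + 1) ^+ 2)^-1.
  by rewrite /series /= big_mkord.
have Tu : T <= pi ^+ 2 / 8.
  rewrite -(cvg_lim (@Rhausdorff R) cv); apply: limr_le; first exact: cvgP cv.
  apply: nearW => N; have := nd N (2 ^ N)%N (ltnW (ltn_expl N (ltnSn 1))).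
  by move=> /le_trans; apply; rewrite sE; case/andP: (odd_sum_bounds N).
have Tl m : pi ^+ 2 / 8 - pi ^+ 2 / 16 / 2 ^+ m <= T.
  have /andP[h _] := odd_sum_bounds m; apply: le_trans h _; rewrite -sE -(cvg_lim (@Rhausdorff R) cv).
  by apply: nondecreasing_cvgn_le => //; exact: cvgP cv.
have p0 := pi_gt0 R.
have {}Tl : pi ^+ 2 / 8 <= T.
  rewrite leNgt; apply/negP => h; have d0 : 0 < pi ^+ 2 / 8 - T by rewrite subr_gt0.
  pose m := Num.truncn (pi ^+ 2 / 16 / (pi ^+ 2 / 8 - T)).
  have /andP[_ hm] := truncn_itv (ltW (divr_gt0 (divr_gt0 (exprn_gt0 2 p0) (ltr0Sn R 15)) d0)).
  have h1 : m.+1%:R <= 2 ^+ m.+1 :> R by rewrite -natrX ler_nat ltnW // ltn_expl.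
  have := Tl m.+1; rewrite lerBlDr => h3.
  have : pi ^+ 2 / 16 / 2 ^+ m.+1 < pi ^+ 2 / 8 - T.
    rewrite ltr_pdivrMr ?exprn_gt0 // [ltRHS]mulrC -ltr_pdivrMr //.
    exact: lt_le_trans hm h1.
  by lra.
lra.
Qed.

End Basel.

(** * The constant omega as volume times 2-adic factor times L-values *)

Section ResidueConstant.
Variable R : realType.
Local Notation h := (hgam R).
Local Notation r := (Num.sqrt pi : R).

Lemma sqrtpi_gt0 : 0 < r. Proof. by rewrite sqrtr_gt0 pi_gt0. Qed.

Lemma pi_powRN (k : nat) : pi `^ (- (k%:R / 2)) = (r ^+ k)^-1 :> R.
Proof.
rewrite powRN; congr (_^-1); rewrite -powR12_sqrt ?pi_ge0 // -powR_mulrn ?powR_ge0 // -powRrM.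
by congr (_ `^ _); rewrite mulrC.
Qed.

Lemma xi_nat (k : nat) : (0 < k)%N -> xi (k%:R : R) = (r ^+ k)^-1 * h k * zeta k%:R.
Proof. by move=> k0; rewrite /xi mulNr pi_powRN Gamma_half. Qed.

Lemma Vol_double (n : nat) : (0 < n)%N -> Vol R n (n + n) = 2 * r ^+ n.+1 / (2 ^+ n * h n.+1).
Proof.
move=> n0; rewrite VolE ?addnK; last by rewrite -[X in (X < _)%N]addn0 ltn_add2l.
have := @hgam_dup R n n0; rewrite -addnn.
have := hgam_gt0 R (n + n); have := hgam_gt0 R n; have := hgam_gt0 R n.+1; have := sqrtpi_gt0.
have : 0 < 2 ^+ n :> R by rewrite exprn_gt0.
rewrite exprS; move: (h (n + n)) (h n) (h n.+1) (r ^+ n) (2 ^+ n) r => a b c q X s X0 s0 c0 b0 a0 E.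
have -> : a = b * c * X / (2 * s) by rewrite E; field; rewrite !gt_eqF.
by field; rewrite !gt_eqF.
Qed.

(** The 2-adic local factor at s = n, in the form given by [Mloc_two]. *)
Definition Tfac (n : nat) : R := (2 ^+ n + tau R n 0 / 2 - 1 + sgm R n) / (1 - (2 ^+ n)^-1).

Lemma powR2N (k : nat) : 2 `^ (- k%:R) = (2 ^+ k)^-1 :> R.
Proof. by rewrite powRN powR_mulrn. Qed.

Lemma signr_unit (q : nat) : ((-1) ^+ q = 1 :> R) \/ ((-1) ^+ q = -1 :> R).
Proof. by rewrite -signr_odd; case: odd; [right|left]. Qed.

Lemma zeta_nat_gt0 (k : nat) : (1 < k)%N -> 0 < zeta k%:R :> R.
Proof. by move=> k1; apply: lt_le_trans ltr01 (zeta_ge1 _); rewrite ltr1n. Qed.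

(** All Gamma values become [hgam] at integers, the duplication formula eliminates [hgam (2 * q)],
    and [tau] equals (-4)^q times 2. A rational identity remains, checked for either sign of
    (-1)^q. *)
Lemma omegaQ_mod0 q : (0 < q)%N ->
  omegaQ R (4 * q) = Vol R (4 * q) (4 * q + 4 * q) * Tfac (4 * q) * kap R (4 * q).
Proof.
move=> q0; have n0 : (0 < 4 * q)%N by rewrite muln_gt0.
have nm : (4 * q)%:R / 2 = (2 * q)%:R :> R by rewrite !natrM; field.
rewrite Vol_double // /omegaQ /kap /Bfac /Cfac /twofac mulnC modnMl eqxx mulnK //.
have -> : (q * 4 == 1)%N = false by lia.
rewrite mulnC !nm.
have e1 : ((4 * q)%:R + 2) / 4 = (2 * q).+1%:R / 2 :> R by rewrite -natr1 !natrM; field.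
have e2 : ((4 * q)%:R + 1) / 2 = (4 * q).+1%:R / 2 :> R by rewrite -(natr1 (4 * q)).
have e3 : (4 * q)%:R - (2 * q)%:R = (2 * q)%:R :> R by rewrite -nm; field.
rewrite e1 e2 e3 !Gamma_half // (Gamma_half R (k := 1)) // natr1 !xi_nat ?muln_gt0 //.
rewrite (_ : 2 `^ ((2 * q)%:R - 1) = 2 ^+ (2 * q) / 2); last first.
  by rewrite powRB ?pnatr_eq0 ?implybT // powR_mulrn // powRr1.
rewrite (_ : 2 `^ (- 1 - (2 * q)%:R) = (2 ^+ (2 * q))^-1 / 2); last first.
  by rewrite powRB ?pnatr_eq0 ?implybT // powR_mulrn // powR_inv1 // mulrC.
rewrite subrr add0r (powR2N 1) !powR2N.
have dup := @hgam_dup R (2 * q) (_ : 0 < 2 * q)%N.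
have {dup} dup : h (2 * q) * h (2 * q).+1 = 2 * r * h (4 * q) / 2 ^+ (2 * q).
  by rewrite dup ?muln_gt0 // -mul2n mulnA.
have tE : tau R (4 * q) 0 / 2 = (-1) ^+ q * 2 ^+ (2 * q).
  rewrite -[(4 * q)%N in LHS]addn0 tau4k exprM -exprMn.
  rewrite (_ : tau R 0 0 = 2) ?mulfK //.
  by congr (_ ^+ _); ring.
have sE : sgm R (4 * q) = (-1) ^+ q by rewrite /sgm dvdn_mulr // mulKn.
rewrite /Tfac tE sE.
have XX : 2 ^+ (4 * q) = (2 ^+ (2 * q)) ^+ 2 :> R by rewrite -exprM; congr (_ ^+ _); lia.
have hh1 : h 1 = r by [].
have z1 := @zeta_nat_gt0 (4 * q) (_ : 1 < 4 * q)%N; have z2 := @zeta_nat_gt0 (2 * q).+1 (_ : 1 < (2 * q).+1)%N.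
have {}z1 := z1 ltac:(lia); have {}z2 := z2 ltac:(lia).
rewrite XX hh1 expr1 (exprS r (4 * q)) (exprS r (2 * q)) [2 ^+ (2 * q).+1]exprS.
have X1 : 1 < 2 ^+ (2 * q) :> R by rewrite exprn_egt1 // ?ltr1n // -lt0n muln_gt0.
have r0 := sqrtpi_gt0; have a0 := hgam_gt0 R (2 * q).+1; have b0 := hgam_gt0 R (4 * q); have c0 := hgam_gt0 R (4 * q).+1.
have rq0 : 0 < r ^+ (2 * q) by rewrite exprn_gt0. have rp0 : 0 < r ^+ (4 * q) by rewrite exprn_gt0.
have bE : h (2 * q) = 2 * r * h (4 * q) / 2 ^+ (2 * q) / h (2 * q).+1 by rewrite -dup mulfK // gt_eqF.
rewrite bE; have [->|->] := signr_unit q; move: X1 r0 a0 b0 c0 rq0 rp0 z1 z2; clear.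
all: move: (2 ^+ (2 * q)) (r ^+ (2 * q)) (r ^+ (4 * q)) r (h (2 * q).+1) (h (4 * q)) (h (4 * q).+1).
all: move: (zeta (2 * q)%:R) (zeta (4 * q)%:R) (zeta (2 * q).+1%:R).
all: move=> z u v X a b c s1 s2 s3 X1 c0 s10 s20 s30 a0 b0 u0 v0; field; rewrite !gt_eqF //=; try lra; try nra.
Qed.

(** Here [tau] and [sgm] vanish. The base pi / 4 in [Lstar_chi4] supplies the factor sqrt(pi) / 2
    between the two completed L-values. *)
Lemma omegaQ_mod2 q :
  omegaQ R (4 * q + 2) = Vol R (4 * q + 2) ((4 * q + 2) + (4 * q + 2)) * Tfac (4 * q + 2) * kap R (4 * q + 2).
Proof.
set n := (4 * q + 2)%N; pose m := (2 * q).+1.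
have n0 : (0 < n)%N by rewrite /n addn2.
have n4 : (n %% 4 = 2)%N by rewrite /n; lia.
have mn : (m.*2 = n)%N by rewrite /m /n; lia.
have nm : n%:R / 2 = m%:R :> R by rewrite -mn -muln2 natrM mulfK.
have n40 : (n %% 4 == 0)%N = false by rewrite n4.
have n42 : (n %% 4 == 2)%N by rewrite n4.
rewrite Vol_double // /omegaQ /kap /Bfac /Cfac /twofac n40 n42.
have -> : (n == 1%N) = false by apply/negbTE; rewrite /n; lia.
rewrite !nm.
have e1 : n%:R / 4 = m%:R / 2 :> R by rewrite -nm; field.
have e4 : n%:R / 4 + 1 = m.+2%:R / 2 :> R by rewrite e1 -(natr1 m.+1) -(natr1 m); field.
have e2 : (n%:R + 1) / 2 = n.+1%:R / 2 :> R by rewrite -(natr1 n).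
have e3 : n%:R - m%:R = m%:R :> R by rewrite -nm; field.
rewrite e4 e1 e2 e3 !Gamma_half // (Gamma_half R (k := 1)) //.
rewrite /Lstar_chi4 xi_nat // !natr1 (Gamma_half R (k := m.+1)) // (Gamma_half R (k := m.+2)) //.
rewrite powR_mulrn // subrr add0r (powR2N 1) expr1.
have p4 : 0 < pi / 4 :> R by rewrite divr_gt0 // pi_gt0.
have pE : (pi / 4) `^ (- (m.+1%:R / 2)) = (pi / 4) `^ (- (m.+2%:R / 2)) * (r / 2) :> R.
  have -> : r / 2 = (pi / 4) `^ 2^-1.
    have -> : pi / 4 = (r / 2) ^+ 2 :> R by rewrite expr_div_n sqr_sqrtr ?pi_ge0 //; field.
    by rewrite powR12_sqrt ?sqr_ge0 // sqrtr_sqr ger0_norm // divr_ge0 // ltW // sqrtpi_gt0.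
  rewrite -powRD ?(gt_eqF p4) ?implybT //; congr (_ `^ _).
  by rewrite -(natr1 m.+1); field.
rewrite pE.
have dup : h m * h m.+1 = 2 * r * h n / 2 ^+ m by rewrite (@hgam_dup R m) // mn.
have tE : tau R n 0 = 0.
  by rewrite /n tau4k /= !add0r addr0 ?subrr ?mulr0 // addNr mulr0.
have sE : sgm R n = 0 by rewrite /sgm /dvdn n4.
rewrite /Tfac tE sE mul0r !addr0.
have XX : 2 ^+ n = (2 ^+ m) ^+ 2 :> R by rewrite -exprM muln2 mn.
have hh1 : h 1 = r by [].
rewrite XX hh1 (exprS r n).
have X1 : 1 < 2 ^+ m :> R by rewrite exprn_egt1 // ltr1n.
have r0 := sqrtpi_gt0; have a0 := hgam_gt0 R m.+1; have b0 := hgam_gt0 R n; have c0 := hgam_gt0 R n.+1.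
have d0 := hgam_gt0 R m.+2.
have rp0 : 0 < r ^+ n by rewrite exprn_gt0.
have w0 : 0 < (pi / 4) `^ (- (m.+2%:R / 2)) :> R by rewrite powR_gt0.
have z1 : 0 < zeta n%:R :> R by apply: zeta_nat_gt0; rewrite /n; clear; lia.
have l1 : Lchi4 (m.+1%:R : R) != 0 by apply: Lchi4_neq0; rewrite ltr1n.
have bE : h m = 2 * r * h n / 2 ^+ m / h m.+1 by rewrite -dup mulfK // gt_eqF.
rewrite bE; move: X1 r0 a0 b0 c0 d0 rp0 w0 z1 l1; clear.
move: (2 ^+ m) ((pi / 4) `^ _) (r ^+ n) r (h m.+1) (h n) (h n.+1) (h m.+2).
move: (Lchi4 m%:R) (zeta n%:R) (Lchi4 m.+1%:R).
move=> L z L' X w t s a b c d X1 s0 a0 b0 c0 d0 t0 w0 z0 L0; field.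
by rewrite L0 !gt_eqF //=; nra.
Qed.

(** With n = 2k - 1, twice the real part of (1 + i)^n is sg 2^k; this is the origin of the sign
    (-1)^((n^2 - 1)/8) in the constant. *)
Lemma omegaQ_odd k (sg : R) (n := k.*2.-1) : (1 < k)%N -> odd n ->
  (-1) ^+ ((n ^ 2 - 1) %/ 8) = sg -> sg ^+ 2 = 1 -> tau R n 0 = sg * 2 ^+ k ->
  omegaQ R n = Vol R n (n + n) * Tfac n * kap R n.
Proof.
move=> k1 on sgE sg2 tE.
have nE : n.+1 = k.*2 by rewrite /n prednK // double_gt0; lia.
have n0 : (0 < n)%N by rewrite /n; lia.
have n4 : (n %% 4 == 0)%N = false by apply/negbTE; move: on; rewrite /n; lia.
have n4' : (n %% 4 == 2)%N = false by apply/negbTE; move: on; rewrite /n; lia.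
have n1 : (n == 1%N) = false by apply/negbTE; rewrite /n; lia.
rewrite Vol_double // /omegaQ /kap /Bfac /Cfac /twofac n4 n4' n1 sgE.
have nk : n%:R = 2 * k%:R - 1 :> R by rewrite -(mul2n k) in nE; have := congr1 (fun i => i%:R : R) nE; rewrite -(natr1 n) natrM; lra.
have e1 : (n%:R + 1) / 4 = k%:R / 2 :> R by rewrite nk; field.
have e2 : (n%:R + 3) / 4 = k.+1%:R / 2 :> R by rewrite nk -(natr1 k); field.
have e3 : 2 * n%:R - n%:R = n%:R :> R by ring.
have e4 : (n%:R - 1) / 2 = k%:R - 1 :> R by rewrite nk; field.
have e5 : (n%:R + 1) / 2 = k%:R :> R by rewrite nk; field.
rewrite e1 e2 e3 e4 natr1 (Gamma_half R (k := n.+1)) // -(natr1 n) e5 !Gamma_half // ?(ltnW k1) // natr1.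
rewrite (Gamma_half R (k := 1)) // xi_nat // subrr add0r (powR2N 1) expr1 !powR2N.
rewrite (_ : 2 `^ (k%:R - 1) = 2 ^+ k / 2 :> R); last first.
  by rewrite powRB ?pnatr_eq0 ?implybT // powR_mulrn // powRr1.
have dup : h k * h k.+1 = 2 * r * h n.+1 / 2 ^+ k by rewrite hgam_dup ?(ltnW k1) // nE.
have sE : sgm R n = 0 by rewrite /sgm /dvdn n4.
rewrite /Tfac tE sE addr0.
have X1 : 1 < 2 ^+ k :> R by rewrite exprn_egt1 // ?ltr1n //; lia.
have X2 : 2 <= 2 ^+ k / 2 :> R.
  rewrite ler_pdivlMr // -(natrM _ 2 2) -(natrX _ 2 k) ler_nat; exact: (@leq_pexp2l 2 2 k).
have XX : 2 ^+ n = (2 ^+ k) ^+ 2 / 2 :> R.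
  by rewrite -exprM muln2 -nE exprS mulrC mulKf.
have XX' : 2 ^+ n.+1 = (2 ^+ k) ^+ 2 :> R by rewrite -exprM muln2 -nE.
have hh1 : h 1 = r by [].
rewrite mulrA dup XX XX' hh1.
have r0 := sqrtpi_gt0; have b0 := hgam_gt0 R n.+1.
have rp0 : 0 < r ^+ n.+1 by rewrite exprn_gt0.
have z1 : 0 < zeta n%:R :> R by apply: zeta_nat_gt0; move: n1 n0; case: (n) => [|[|]].
have z2 : 0 < zeta n.+1%:R :> R by exact: zeta_nat_gt0.
have sg1 : (sg == 1) || (sg == -1) by rewrite -sqrf_eq1 sg2.
move: sg1 X1 X2 r0 b0 rp0 z1 z2; clear; move: (2 ^+ k) (r ^+ n.+1) r (h n.+1).
move: (zeta n%:R) (zeta n.+1%:R) => z z' X t s b sg1 X1 X2 s0 b0 t0 z0 z0'.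
case/orP: sg1 => /eqP ->; field; rewrite !gt_eqF //=; try lra; try nra.
Qed.

Lemma omegaQ_one : omegaQ R 1 = Vol R 1 2 * Tfac 1 * kap R 1.
Proof.
rewrite (@Vol_double 1) // /omegaQ /kap /Cfac /twofac /Tfac /=.
have -> : sgm R 1 = 0 by [].
have -> : 2 * 1 - 1 + 1 = 2 :> R by ring.
have -> : 2 * 1 - 1 = 1 :> R by ring.
rewrite zeta_two subrr add0r (powR2N 1) powR2N expr1.
have -> : r ^+ 2 = pi by rewrite sqr_sqrtr // pi_ge0.
have := pi_gt0 R; move: (pi : R) => p p0; field; by rewrite gt_eqF.
Qed.

Lemma omegaQE n : (0 < n)%N -> omegaQ R n = Vol R n (n + n) * Tfac n * kap R n.
Proof.
have sgq (j : nat) : (-1 : R) ^+ j ^+ 2 = 1 by rewrite -exprM mulnC exprM sqrrN !expr1n.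
have four (j : nat) : (-4 : R) ^+ j = (-1) ^+ j * (2 ^+ 2) ^+ j.
  by rewrite -exprMn; congr (_ ^+ _); ring.
have := divn_eq n 4; have : (n %% 4 < 4)%N by rewrite ltn_mod.
move: (n %/ 4)%N (n %% 4)%N => q [|[|[|[|//]]]] _ -> n0; rewrite mulnC in n0 *.
- by rewrite addn0 omegaQ_mod0 //; lia.
- have [->|q0] := posnP q; first exact: omegaQ_one.
  have kE : ((2 * q).+1.*2.-1 = 4 * q + 1)%N by lia.
  rewrite -kE; apply: (@omegaQ_odd _ ((-1) ^+ q)); rewrite ?sgq ?kE //.
  + by lia.
  + by lia.
  + have -> : (((4 * q + 1) ^ 2 - 1) %/ 8 = 2 * q ^ 2 + q)%N.
      rewrite -[RHS](@mulnK _ 8) //; congr (_ %/ 8)%N.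
      by rewrite -!mulnn; nia.
    by rewrite exprD exprM sqrrN !expr1n mul1r.
  + rewrite tau4k four (_ : tau R 1 0 = 2) /=; last by rewrite addr0.
    by rewrite [2 ^+ (2 * q).+1]exprS (exprM 2 2 q); ring.
- by rewrite omegaQ_mod2.
- have kE : ((2 * q).+2.*2.-1 = 4 * q + 3)%N by lia.
  rewrite -kE; apply: (@omegaQ_odd _ ((-1) ^+ q.+1)); rewrite ?sgq ?kE //.
  + by lia.
  + have -> : (((4 * q + 3) ^ 2 - 1) %/ 8 = 2 * (q ^ 2 + q) + q.+1)%N.
      rewrite -[RHS](@mulnK _ 8) //; congr (_ %/ 8)%N.
      by rewrite -!mulnn; nia.
    by rewrite exprD exprM sqrrN !expr1n mul1r.
  + rewrite tau4k four (_ : tau R 3 0 = - 4) /=; last by ring.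
    by rewrite [(-1) ^+ q.+1]exprS [2 ^+ (2 * q).+2]exprS [2 ^+ (2 * q).+1]exprS (exprM 2 2 q); ring.
Qed.

End ResidueConstant.

Local Open Scope complex_scope.

(** * Residues from limits along the real axis *)

Section ComplexNorm.
Variable R : realType.
Implicit Types z w : R[i].

Lemma half_gt0 (e : R) : 0 < e -> 0 < e / 2.
Proof. by move=> e0; rewrite divr_gt0. Qed.

(** The modulus as an element of R: the norm of R[i] takes its values in R[i], where the order is
    only partial. *)
Definition cnorm z : R := Normc.normc z.

Lemma cnormE z : `|z| = (cnorm z)%:C.
Proof. by case: z. Qed.

Lemma cnormM z w : cnorm (z * w) = cnorm z * cnorm w.
Proof. exact: Normc.normcM. Qed.

Lemma cnormV z : cnorm z^-1 = (cnorm z)^-1.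
Proof. exact: Normc.normcV. Qed.

Lemma cnormX z m : cnorm (z ^+ m) = cnorm z ^+ m.
Proof. by apply: (@complexI R); rewrite -cnormE normrX cnormE rmorphXn. Qed.

Lemma cnorm_ge0 z : 0 <= cnorm z.
Proof. by rewrite -ler0c -cnormE. Qed.

Lemma cnorm0 : cnorm 0 = 0.
Proof. exact: Normc.normc0. Qed.

Lemma cnorm1 : cnorm 1 = 1.
Proof. exact: Normc.normc1. Qed.

Lemma cnorm_eq0 z : (cnorm z == 0) = (z == 0).
Proof. by rewrite -[RHS]normr_eq0 cnormE (inj_eq (@complexI R) _ 0). Qed.

Lemma cnorm_gt0 z : (0 < cnorm z) = (z != 0).
Proof. by rewrite lt_def cnorm_ge0 andbT cnorm_eq0. Qed.

Lemma cnormN z : cnorm (- z) = cnorm z.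
Proof. by apply: (@complexI R); rewrite -!cnormE normrN. Qed.

Lemma cnormD z w : cnorm (z + w) <= cnorm z + cnorm w.
Proof. by rewrite -lecR rmorphD /= -!cnormE ler_normD. Qed.

Lemma cnormB z w : cnorm (z - w) <= cnorm z + cnorm w.
Proof. by rewrite -(cnormN w) cnormD. Qed.

Lemma cdistC z w : cnorm (z - w) = cnorm (w - z).
Proof. by rewrite -cnormN opprB. Qed.

Lemma cnorm_real (x : R) : cnorm x%:C = `|x|.
Proof. by rewrite /cnorm /= expr0n /= addr0 sqrtr_sqr. Qed.

Lemma cnormi : cnorm ('i : R[i]) = 1.
Proof. by rewrite /cnorm /= expr0n expr1n /= add0r sqrtr1. Qed.

Lemma normRe_le z : `|complex.Re z| <= cnorm z.
Proof.
by case: z => a b; rewrite /cnorm /= -sqrtr_sqr ler_wsqrtr // lerDl sqr_ge0.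
Qed.

Lemma normIm_le z : `|complex.Im z| <= cnorm z.
Proof.
by case: z => a b; rewrite /cnorm /= -[`|b|]sqrtr_sqr ler_wsqrtr // lerDr sqr_ge0.
Qed.

Lemma cnorm_le z : cnorm z <= `|complex.Re z| + `|complex.Im z|.
Proof.
case: z => a b; rewrite (_ : a +i* b = a%:C + 'i * b%:C); last first.
  by rewrite [LHS]complexE.
by rewrite (le_trans (cnormD _ _)) // cnormM cnormi mul1r !cnorm_real /= !mul0r !mul1r !subr0 !addr0 !add0r.
Qed.

Lemma cnorm_sum (I : Type) (r : seq I) (P : pred I) (F : I -> R[i]) :
  cnorm (\sum_(i <- r | P i) F i) <= \sum_(i <- r | P i) cnorm (F i).
Proof.
rewrite -lecR -cnormE rmorph_sum /=; apply: le_trans (ler_norm_sum _ _ _) _.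
by apply: ler_sum => i _; rewrite cnormE.
Qed.

End ComplexNorm.

Section ComplexDerivative.
Variable R : realType.
Notation C := R[i].
Implicit Types (f g : C -> C) (z D : C).

(** Complex differentiability with real radii and without division, which is easier to estimate
    with; [cderiv_derivable] and [derivable_cderiv] relate it to [derivable]. *)
Definition cderiv f z D := forall e : R, 0 < e -> exists2 d : R, 0 < d &
  forall w, cnorm (w - z) < d -> cnorm (f w - f z - D * (w - z)) <= e * cnorm (w - z).

Definition ccont f z := forall e : R, 0 < e -> exists2 d : R, 0 < d &
  forall w, cnorm (w - z) < d -> cnorm (f w - f z) < e.

Lemma near_cballP (z : C) (P : C -> Prop) :
  (\forall w \near (z : C^o), P w) <->
  exists2 d : R, 0 < d & forall w, cnorm (w - z) < d -> P w.
Proof.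
split.
  move/nbhs_ballP => [e /= e0 eP].
  have /andP[/eqP ie re] : (complex.Im e == 0) && (0 < complex.Re e).
    by move: e0; rewrite ltcE /=.
  exists (complex.Re e) => // w wd; apply: eP; rewrite /ball /= distrC cnormE.
  by rewrite ltcE /= ie eqxx.
move=> [d d0 dP]; apply/nbhs_ballP; exists d%:C; first by rewrite /= ltcR.
by move=> w; rewrite /ball /= distrC cnormE ltcR; exact: dP.
Qed.

Lemma near_cball'P (z : C) (P : C -> Prop) :
  (\forall w \near (z : C^o)^', P w) <->
  exists2 d : R, 0 < d & forall w, cnorm (w - z) < d -> w != z -> P w.
Proof. exact: (near_cballP z (fun w => w != z -> P w)). Qed.

Lemma cderiv_derivable (f : C^o -> C^o) z D : cderiv f z D -> derivable f z 1.
Proof.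
move=> fD; apply/cvg_ex; exists (D : C^o); apply/cvgrPdist_le => e e0.
have /andP[/eqP ie re] : (complex.Im e == 0) && (0 < complex.Re e).
  by move: e0; rewrite ltcE.
have [d d0 dP] := fD _ re.
apply/near_cball'P; exists d => // h; rewrite subr0 => hd h0.
have := dP (h + z); rewrite addrK => /(_ hd).
have eE : e = (complex.Re e)%:C by case: (e) ie => a b /= ->.
have hE : h *: (1 : C^o) = h by rewrite /GRing.scale /= mulr1.
rewrite {2}eE hE.
rewrite (_ : D - h^-1 *: (f (h + z) - f z) = - (h^-1 * (f (h + z) - f z - D * h))).
  rewrite normrN cnormE lecR cnormM cnormV => H.
  by rewrite ler_pdivrMl ?cnorm_gt0 // [leRHS]mulrC.
by rewrite mulrBr opprB [h^-1 * (D * h)]mulrC mulfK.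
Qed.

Lemma derivable_cderiv (f : C^o -> C^o) z : derivable f z 1 ->
  cderiv f z ('D_1 f z).
Proof.
move=> df e e0.
have /cvgrPdist_le := df => /(_ e%:C); rewrite ltcR => /(_ e0).
move/near_cball'P => [d d0 dP]; exists d => // w wz.
have [->|nwz] := eqVneq w z; first by rewrite !subrr mulr0 subr0 cnorm0 mulr0.
have /(_ _ _) := dP (w - z); rewrite subr0 subr_eq0 => /(_ wz nwz).
have hE : (w - z) *: (1 : C^o) = w - z by rewrite /GRing.scale /= mulr1.
rewrite /= hE subrK.
set D := 'D_1 f z.
rewrite (_ : D - (w - z)^-1 *: (f w - f z) = - ((w - z)^-1 * (f w - f z - D * (w - z)))).
  rewrite normrN cnormE lecR cnormM cnormV.
  by rewrite ler_pdivrMl ?cnorm_gt0 ?subr_eq0 // [leRHS]mulrC.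
by rewrite mulrBr opprB [_^-1 * (D * _)]mulrC mulfK // subr_eq0.
Qed.

Lemma cderiv_ccont f z D : cderiv f z D -> ccont f z.
Proof.
move=> fD e e0; have [d d0 dP] := fD 1 ltr01.
have K0 : 0 < 1 + cnorm D by rewrite ltr_wpDr // cnorm_ge0.
exists (Num.min d (e / (1 + cnorm D))); first by rewrite lt_min d0 divr_gt0.
move=> w; rewrite lt_min ltr_pdivlMr // => /andP[wd we].
rewrite (_ : f w - f z = (f w - f z - D * (w - z)) + D * (w - z)); last by rewrite subrK.
apply: le_lt_trans (cnormD _ _) _; apply: le_lt_trans we.
by rewrite cnormM (mulrDr (cnorm (w - z))) mulr1 (mulrC _ (cnorm D)) lerD // -[leRHS]mul1r dP.
Qed.

Lemma cderivD f g z D D' : cderiv f z D -> cderiv g z D' ->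
  cderiv (fun w => f w + g w) z (D + D').
Proof.
move=> fD gD e e0; have e20 : 0 < e / 2 by rewrite divr_gt0.
have [d d0 dP] := fD _ e20; have [d' d'0 d'P] := gD _ e20.
exists (Num.min d d'); first by rewrite lt_min d0.
move=> w; rewrite lt_min => /andP[/dP + /d'P] => h1 h2.
rewrite (_ : _ - _ - _ = (f w - f z - D * (w - z)) + (g w - g z - D' * (w - z))); last by ring.
by apply: le_trans (cnormD _ _) _; rewrite [in leRHS](splitr e) mulrDl lerD.
Qed.

Lemma cderivZ f z D c : cderiv f z D -> cderiv (fun w => c * f w) z (c * D).
Proof.
move=> fD e e0; have K0 : 0 < 1 + cnorm c by rewrite ltr_wpDr // cnorm_ge0.
have [d d0 dP] := fD (e / (1 + cnorm c)) (divr_gt0 e0 K0).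
exists d => // w /dP h.
rewrite (_ : _ - _ - _ = c * (f w - f z - D * (w - z))); last by ring.
rewrite cnormM; apply: le_trans (_ : (1 + cnorm c) * (e / (1 + cnorm c) * cnorm (w - z)) <= _).
  by apply: ler_pM; rewrite ?cnorm_ge0 ?lerDr.
by rewrite mulrA mulrCA mulfV ?gt_eqF // mulr1.
Qed.

Lemma cderiv_cst c z : cderiv (fun=> c) z 0.
Proof.
move=> e e0; exists 1 => // w _.
by rewrite subrr mul0r subr0 cnorm0 mulr_ge0 ?cnorm_ge0 // ltW.
Qed.

Lemma cderiv_id z : cderiv id z 1.
Proof.
move=> e e0; exists 1 => // w _.
by rewrite mul1r subrr cnorm0 mulr_ge0 ?cnorm_ge0 // ltW.
Qed.

Lemma cderivM f g z D D' : cderiv f z D -> cderiv g z D' ->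
  cderiv (fun w => f w * g w) z (D * g z + f z * D').
Proof.
move=> fD gD e e0.
have e30 : 0 < e / 3 by rewrite divr_gt0.
have K1 : 0 < 1 + cnorm (g z) by rewrite ltr_wpDr // cnorm_ge0.
have K2 : 0 < 1 + cnorm (f z) by rewrite ltr_wpDr // cnorm_ge0.
have K3 : 0 < 1 + cnorm D' by rewrite ltr_wpDr // cnorm_ge0.
have [d1 d10 P1] := fD _ (divr_gt0 e30 K1).
have [d2 d20 P2] := gD _ (divr_gt0 e30 K2).
have [d3 d30 P3] := cderiv_ccont fD (divr_gt0 e30 K3).
have [d4 d40 P4] := gD _ (@ltr01 R).
exists (Num.min (Num.min d1 d2) (Num.min d3 d4)); first by rewrite !lt_min d10 d20 d30.
move=> w; rewrite !lt_min => /andP[/andP[/P1 h1 /P2 h2] /andP[/P3 h3 /P4 h4]].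
rewrite (_ : _ - _ - _ = g z * (f w - f z - D * (w - z))
    + f z * (g w - g z - D' * (w - z)) + (f w - f z) * (g w - g z)); last by ring.
have bnd (K x : R) : 0 < 1 + K -> 0 <= K -> 0 <= x -> K * (e / 3 / (1 + K) * x) <= e / 3 * x.
  move=> K0 K'0 x0; rewrite mulrA ler_wpM2r // mulrCA ger_pMr //.
  by rewrite ler_pdivrMr // mul1r lerDr.
have g4 : cnorm (g w - g z) <= (1 + cnorm D') * cnorm (w - z).
  rewrite (_ : g w - g z = (g w - g z - D' * (w - z)) + D' * (w - z)); last by rewrite subrK.
  by rewrite (le_trans (cnormD _ _)) // mulrDl lerD // cnormM.
have -> : e * cnorm (w - z) = e / 3 * cnorm (w - z) + e / 3 * cnorm (w - z) + e / 3 * cnorm (w - z).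
  by field.
apply: le_trans (cnormD _ _) _; apply: lerD; first apply: le_trans (cnormD _ _) _; first apply: lerD.
- rewrite cnormM; apply: le_trans (bnd _ _ K1 (cnorm_ge0 _) (cnorm_ge0 _)).
  by rewrite ler_wpM2l ?cnorm_ge0.
- rewrite cnormM; apply: le_trans (bnd _ _ K2 (cnorm_ge0 _) (cnorm_ge0 _)).
  by rewrite ler_wpM2l ?cnorm_ge0.
- rewrite cnormM.
  apply: le_trans (_ : e / 3 / (1 + cnorm D') * ((1 + cnorm D') * cnorm (w - z)) <= _).
    by apply: ler_pM; rewrite ?cnorm_ge0 // ltW.
  by rewrite mulrA divfK // gt_eqF.
Qed.

Lemma cderivV z : z != 0 -> cderiv (fun w => w^-1) z (- z ^- 2).
Proof.
move=> z0 e e0.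
have nz : 0 < cnorm z by rewrite cnorm_gt0.
exists (Num.min (cnorm z / 2) (e * cnorm z ^+ 3 / 2)).
  by rewrite lt_min !divr_gt0 ?mulr_gt0 ?exprn_gt0.
move=> w; rewrite lt_min => /andP[w1 w2].
have nw : cnorm z / 2 <= cnorm w.
  have := cnormD w (z - w); rewrite addrC subrK cdistC => h.
  have : cnorm z <= cnorm w + cnorm z / 2 by apply: le_trans h _; rewrite lerD2l ltW.
  lra.
have w0 : w != 0 by rewrite -cnorm_gt0 (lt_le_trans _ nw) // divr_gt0.
rewrite (_ : _ - _ - _ = (w - z) ^+ 2 * (w^-1 * z ^- 2)); last by field; rewrite ?w0 ?z0.
rewrite cnormM cnormX expr2 -mulrA [leRHS]mulrC ler_wpM2l ?cnorm_ge0 //.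
rewrite cnormM !cnormV cnormX.
apply: le_trans (_ : e * cnorm z ^+ 3 / 2 * ((cnorm z / 2)^-1 * (cnorm z ^+ 2)^-1) <= _).
  rewrite ler_pM ?cnorm_ge0 ?mulr_ge0 ?invr_ge0 ?cnorm_ge0 ?exprn_ge0 ?cnorm_ge0 //; first exact: ltW.
  rewrite ler_wpM2r ?invr_ge0 ?exprn_ge0 ?cnorm_ge0 // lef_pV2 // posrE ?divr_gt0 // cnorm_gt0 //.
by rewrite le_eqVlt; apply/orP; left; apply/eqP; field; rewrite gt_eqF.
Qed.

Lemma cderiv_comp f g z D D' : cderiv f z D -> cderiv g (f z) D' ->
  cderiv (fun w => g (f w)) z (D' * D).
Proof.
move=> fD gD e e0.
have K0 : 0 < 1 + cnorm D by rewrite ltr_wpDr // cnorm_ge0.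
have K1 : 0 < 1 + cnorm D' by rewrite ltr_wpDr // cnorm_ge0.
have e20 : 0 < e / 2 by rewrite divr_gt0.
have [d1 d10 P1] := gD _ (divr_gt0 e20 K0).
have [d2 d20 P2] := cderiv_ccont fD d10.
have [d3 d30 P3] := fD _ (divr_gt0 e20 K1).
have [d4 d40 P4] := fD _ (@ltr01 R).
exists (Num.min d2 (Num.min d3 d4)); first by rewrite !lt_min d20 d30.
move=> w; rewrite !lt_min => /and3P[/P2 /P1 h1 /P3 h3 /P4 h4].
rewrite (_ : _ - _ - _ = (g (f w) - g (f z) - D' * (f w - f z))
   + D' * (f w - f z - D * (w - z))); last by ring.
have g4 : cnorm (f w - f z) <= (1 + cnorm D) * cnorm (w - z).
  rewrite (_ : f w - f z = (f w - f z - D * (w - z)) + D * (w - z)); last by rewrite subrK.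
  by rewrite (le_trans (cnormD _ _)) // mulrDl lerD // cnormM.
apply: le_trans (cnormD _ _) _; rewrite [in leRHS](splitr e) mulrDl; apply: lerD.
  apply: le_trans h1 _; rewrite -!mulrA ler_wpM2l ?(ltW e0) // ler_wpM2l ?invr_ge0 //.
  by rewrite mulrC ler_pdivrMr // mulrC.
rewrite cnormM; apply: le_trans (_ : (1 + cnorm D') * (e / 2 / (1 + cnorm D') * cnorm (w - z)) <= _).
  by apply: ler_pM; rewrite ?cnorm_ge0 ?lerDr.
by rewrite mulrA [X in X * _]mulrC divfK // gt_eqF.
Qed.

End ComplexDerivative.

(** * Integrals of complex functions over segments *)

Section SegmentIntegral.
Variable R : realType.
Notation C := R[i].
Notation mu := (@lebesgue_measure R).
Implicit Types (g h : R -> C) (a b c : R).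

Definition rcont g x := forall e : R, 0 < e -> exists2 d : R, 0 < d &
  forall y, `|y - x| < d -> cnorm (g y - g x) < e.

Definition cts g a b := forall x, a <= x <= b -> rcont g x.

Definition cint g a b : C :=
  (\int[mu]_(x in `[a, b]) complex.Re (g x)) +i* (\int[mu]_(x in `[a, b]) complex.Im (g x)).

Lemma ReB (z w : C) : complex.Re (z - w) = complex.Re z - complex.Re w.
Proof. by case: z; case: w. Qed.

Lemma ImB (z w : C) : complex.Im (z - w) = complex.Im z - complex.Im w.
Proof. by case: z; case: w. Qed.

Lemma ReD (z w : C) : complex.Re (z + w) = complex.Re z + complex.Re w.
Proof. by case: z; case: w. Qed.

Lemma ImD (z w : C) : complex.Im (z + w) = complex.Im z + complex.Im w.
Proof. by case: z; case: w. Qed.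

Lemma rcont_ReIm g x : rcont g x ->
  {for x, continuous (fun y => complex.Re (g y))} /\
  {for x, continuous (fun y => complex.Im (g y))}.
Proof.
move=> gx; split; apply/cvgrPdist_lt => e e0; have [d d0 dP] := gx e e0;
  apply/nbhs_ballP; exists d => //= y; rewrite /ball /= distrC => /dP gy;
  apply: le_lt_trans gy; rewrite -(ReB, ImB) cdistC ?normRe_le ?normIm_le //.
Qed.

Lemma cts_integrable g a b : cts g a b ->
  mu.-integrable `[a, b] (EFin \o (fun x => complex.Re (g x))) /\
  mu.-integrable `[a, b] (EFin \o (fun x => complex.Im (g x))).
Proof.
move=> gc; split; apply: continuous_compact_integrable;
  do ?exact: segment_compact; apply: continuous_in_subspaceT => x;
  rewrite inE /= in_itv /= => /gc /rcont_ReIm[]//.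
Qed.

Lemma cts_sub g a b a' b' : a <= a' -> b' <= b -> cts g a b -> cts g a' b'.
Proof.
move=> aa' bb' gc x /andP[ax xb]; apply: gc.
by rewrite (le_trans aa' ax) (le_trans xb bb').
Qed.

Lemma rcontZ g x k : rcont g x -> rcont (fun y => k * g y) x.
Proof.
move=> gx e e0; have K0 : 0 < 1 + cnorm k by rewrite ltr_wpDr // cnorm_ge0.
have [d d0 dP] := gx _ (divr_gt0 e0 K0); exists d => // y /dP h1.
rewrite -mulrBr cnormM; apply: le_lt_trans (_ : (1 + cnorm k) * cnorm (g y - g x) < _).
  by rewrite ler_wpM2r ?cnorm_ge0 // lerDr.
by rewrite -ltr_pdivlMl // mulrC.
Qed.

Lemma rcont_cst (k : C) x : rcont (fun=> k) x.
Proof. by move=> e e0; exists 1 => // y _; rewrite subrr cnorm0. Qed.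

Lemma cintD g h a b : cts g a b -> cts h a b ->
  cint (fun x => g x + h x) a b = cint g a b + cint h a b.
Proof.
move=> /cts_integrable[rg ig] /cts_integrable[rh ih].
rewrite /cint; apply/eqP; rewrite eq_complex /=; apply/andP; split; apply/eqP.
- rewrite -RintegralD //=; apply: eq_Rintegral => x _; exact: ReD.
- rewrite -RintegralD //=; apply: eq_Rintegral => x _; exact: ImD.
Qed.

Lemma cintZ g a b k : cts g a b -> cint (fun x => k * g x) a b = k * cint g a b.
Proof.
move=> /cts_integrable[rg ig].
have iZ (f : R -> R) r : mu.-integrable `[a, b] (EFin \o f) ->
    mu.-integrable `[a, b] (EFin \o (fun x => r * f x)).
  move=> fi; rewrite (_ : (EFin \o _) = (fun x => r%:E * (EFin \o f) x)%E).
    exact: integrableZl.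
  by apply/funext => x; rewrite /= EFinM.
rewrite /cint; case: k => k l; apply/eqP; rewrite eq_complex /=; apply/andP; split; apply/eqP.
- rewrite -!RintegralZl // -RintegralB //; [|exact: iZ..].
  by apply: eq_Rintegral => x _; case: (g x).
- rewrite -!RintegralZl // -RintegralD //; [|exact: iZ..].
  by apply: eq_Rintegral => x _; case: (g x).
Qed.

Lemma cint_split g a b c : a <= c <= b -> cts g a b ->
  cint g a b = cint g a c + cint g c b.
Proof.
move=> /andP[ac cb] gc; have [rg ig] := cts_integrable gc.
have [rg' ig'] := cts_integrable (cts_sub ac (lexx b) gc).
have sp (f : R -> R) : mu.-integrable `[a, b] (EFin \o f) ->
    \int[mu]_(x in `[a, b]) f x = \int[mu]_(x in `[a, c]) f x + \int[mu]_(x in `[c, b]) f x.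
  move=> fi; have := Rintegral_itvB fi => /(_ c).
  rewrite !bnd_simp => /(_ ac cb) H.
  rewrite -(subrK (\int[mu]_(x in `[a, c]) f x) (\int[mu]_(x in `[a, b]) f x)) H addrC.
  congr (_ + _); apply: Rintegral_itv_obnd_cbnd.
  apply: integrableS fi => //; apply: subset_itv => //; rewrite bnd_simp //.
by rewrite /cint; apply/eqP; rewrite eq_complex /= -!sp // !eqxx.
Qed.

Lemma cint_eq g h a b : (forall x, a <= x <= b -> g x = h x) -> cint g a b = cint h a b.
Proof.
move=> gh; rewrite /cint; congr (_ +i* _); apply: eq_Rintegral => x;
  by rewrite inE /= in_itv /= => /gh ->.
Qed.

Lemma Rintegral_seg_cst a b (k : R) : a <= b -> \int[mu]_(x in `[a, b]) k = k * (b - a).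
Proof.
move=> ab; rewrite Rintegral_cst //= lebesgue_measure_itv /= lte_fin.
by move: ab; rewrite le_eqVlt => /predU1P[->|->] //=; rewrite ltxx /= subrr.
Qed.

Lemma cint_cst (k : C) a b : a <= b -> cint (fun=> k) a b = k * (b - a)%:C.
Proof.
move=> ab; rewrite /cint !Rintegral_seg_cst //; case: k => k l.
by apply/eqP; rewrite eq_complex /= !mulr0 subr0 add0r !eqxx.
Qed.

Lemma Rintegral_seg_id a b : a <= b -> \int[mu]_(x in `[a, b]) x = (b ^+ 2 - a ^+ 2) / 2.
Proof.
rewrite le_eqVlt => /predU1P[->|ab].
  by rewrite set_itv1 Rintegral_set1 subrr mul0r.
have dF (x : R) : is_derive x 1 (fun y : R => y ^+ 2 / 2) x.
  have -> : (fun y : R => y ^+ 2 / 2) = 2^-1 \*: (@id R ^+ 2).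
    by apply/funext => y; rewrite /= /GRing.scale /= mulrC.
  have H := is_deriveZ 2^-1 (@is_deriveX _ _ _ 2 x 1 1 (is_derive_id x 1)).
  apply: (is_derive_eq H).
  by rewrite /GRing.scale /=; field.
have := @continuous_FTC2 R (fun x => x) (fun y => y ^+ 2 / 2) a b ab.
rewrite /Rintegral => ->.
- by rewrite -EFinB /= mulrBl.
- by apply: continuous_in_subspaceT => x _; exact: cvg_id.
- have df : forall x, derivable (fun y : R => y ^+ 2 / 2) x 1 by move=> x; exact: ex_derive.
  have cf x : {for x, continuous (fun y : R => y ^+ 2 / 2)}.
    by apply: differentiable_continuous; apply/derivable1_diffP.
  by split => //; [apply: cvg_at_right_filter; exact: cf|apply: cvg_at_left_filter; exact: cf].
- by move=> x _; rewrite derive1E derive_val.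
Qed.

Lemma cint_real_id a b : a <= b -> cint (fun x => x%:C) a b = ((b ^+ 2 - a ^+ 2) / 2)%:C.
Proof.
move=> ab; rewrite /cint /= Rintegral_seg_id // Rintegral_seg_cst // mul0r //.
Qed.

(** The factor 2 comes from bounding real and imaginary parts separately. *)
Lemma cint_bound g a b (M : R) : a <= b -> cts g a b ->
  (forall x, a <= x <= b -> cnorm (g x) <= M) -> cnorm (cint g a b) <= 2 * M * (b - a).
Proof.
move=> ab /cts_integrable[rg ig] gM.
have bd (f : R -> R) : mu.-integrable `[a, b] (EFin \o f) ->
    (forall x, a <= x <= b -> `|f x| <= M) -> `|\int[mu]_(x in `[a, b]) f x| <= M * (b - a).
  move=> fi fM; apply: le_trans (le_normr_Rintegral _ fi) _ => //.
  have iA : mu.-integrable `[a, b] (EFin \o (fun x => `|f x|)) by exact: (integrable_abse fi).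
  rewrite -Rintegral_seg_cst //; apply: le_Rintegral => //.
  - apply: continuous_compact_integrable; first exact: segment_compact.
    by apply: continuous_subspaceT => x; exact: cvg_cst.
apply: le_trans (cnorm_le _) _; rewrite /= -mulrA mulr2n mulrDl mul1r.
apply: lerD; apply: bd => // x /gM h; apply: le_trans h; rewrite ?normRe_le ?normIm_le //.
Qed.

End SegmentIntegral.

(** * Integrals along boundaries of rectangles *)

Section RectangleIntegral.
Variable R : realType.
Notation C := R[i].
Implicit Types (f g : C -> C).

Definition hcurve f (y x : R) := f (x +i* y).
Definition vcurve f (x y : R) := f (x +i* y).

(* Integral of f along the boundary of [x0, x1] x [y0, y1], counterclockwise. *)
Definition rint f (x0 x1 y0 y1 : R) : C :=
  cint (hcurve f y0) x0 x1 - cint (hcurve f y1) x0 x1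
  + 'i * (cint (vcurve f x1) y0 y1 - cint (vcurve f x0) y0 y1).

Definition rect (x0 x1 y0 y1 : R) (z : C) :=
  x0 <= complex.Re z <= x1 /\ y0 <= complex.Im z <= y1.

Definition brect (x0 x1 y0 y1 : R) (z : C) := rect x0 x1 y0 y1 z /\
  (complex.Re z = x0 \/ complex.Re z = x1 \/ complex.Im z = y0 \/ complex.Im z = y1).

Lemma hcurve_cont f y x : ccont f (x +i* y) -> rcont (hcurve f y) x.
Proof.
move=> fc e e0; have [d d0 dP] := fc e e0; exists d => // t td; apply: dP.
rewrite (_ : _ - _ = (t - x)%:C) ?cnorm_real //.
by apply/eqP; rewrite eq_complex /= subrr !eqxx.
Qed.

Lemma vcurve_cont f x y : ccont f (x +i* y) -> rcont (vcurve f x) y.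
Proof.
move=> fc e e0; have [d d0 dP] := fc e e0; exists d => // t td; apply: dP.
rewrite (_ : _ - _ = 'i * (t - y)%:C) ?cnormM ?cnormi ?mul1r ?cnorm_real //.
by apply/eqP; rewrite eq_complex /= !mul0r !mul1r subrr subr0 add0r !eqxx.
Qed.

Definition bcont f (x0 x1 y0 y1 : R) := forall z, brect x0 x1 y0 y1 z -> ccont f z.

Lemma bcont_cts f (x0 x1 y0 y1 : R) : x0 <= x1 -> y0 <= y1 -> bcont f x0 x1 y0 y1 ->
  [/\ cts (hcurve f y0) x0 x1, cts (hcurve f y1) x0 x1,
      cts (vcurve f x0) y0 y1 & cts (vcurve f x1) y0 y1].
Proof.
move=> xx yy fc; split=> t tt; (apply: hcurve_cont || apply: vcurve_cont);
  apply: fc; rewrite /brect /rect /= ?lexx ?xx ?yy; intuition.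
Qed.

Lemma rintD f g (x0 x1 y0 y1 : R) : x0 <= x1 -> y0 <= y1 ->
  bcont f x0 x1 y0 y1 -> bcont g x0 x1 y0 y1 ->
  rint (fun z => f z + g z) x0 x1 y0 y1 = rint f x0 x1 y0 y1 + rint g x0 x1 y0 y1.
Proof.
move=> xx yy /(bcont_cts xx yy)[f1 f2 f3 f4] /(bcont_cts xx yy)[g1 g2 g3 g4].
rewrite /rint.
rewrite -[hcurve (fun z => _) y0]/(fun x => hcurve f y0 x + hcurve g y0 x).
rewrite -[hcurve (fun z => _) y1]/(fun x => hcurve f y1 x + hcurve g y1 x).
rewrite -[vcurve (fun z => _) x0]/(fun x => vcurve f x0 x + vcurve g x0 x).
rewrite -[vcurve (fun z => _) x1]/(fun x => vcurve f x1 x + vcurve g x1 x).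
rewrite !cintD //; ring.
Qed.

Lemma rintZ f (x0 x1 y0 y1 : R) k : x0 <= x1 -> y0 <= y1 -> bcont f x0 x1 y0 y1 ->
  rint (fun z => k * f z) x0 x1 y0 y1 = k * rint f x0 x1 y0 y1.
Proof.
move=> xx yy /(bcont_cts xx yy)[f1 f2 f3 f4]; rewrite /rint.
rewrite -[hcurve (fun z => _) y0]/(fun x => k * hcurve f y0 x).
rewrite -[hcurve (fun z => _) y1]/(fun x => k * hcurve f y1 x).
rewrite -[vcurve (fun z => _) x0]/(fun x => k * vcurve f x0 x).
rewrite -[vcurve (fun z => _) x1]/(fun x => k * vcurve f x1 x).
rewrite !cintZ //; ring.
Qed.

Lemma rint_eq f g (x0 x1 y0 y1 : R) : x0 <= x1 -> y0 <= y1 ->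
  (forall z, brect x0 x1 y0 y1 z -> f z = g z) ->
  rint f x0 x1 y0 y1 = rint g x0 x1 y0 y1.
Proof.
move=> xx yy fg; rewrite /rint; congr (_ - _ + _ * (_ - _));
  apply: cint_eq => t tt; apply: fg; rewrite /brect /rect /= ?lexx ?xx ?yy; intuition.
Qed.

Lemma rint_bound f (x0 x1 y0 y1 M : R) : x0 <= x1 -> y0 <= y1 ->
  bcont f x0 x1 y0 y1 -> (forall z, brect x0 x1 y0 y1 z -> cnorm (f z) <= M) ->
  cnorm (rint f x0 x1 y0 y1) <= 4 * M * (x1 - x0 + (y1 - y0)).
Proof.
move=> xx yy /(bcont_cts xx yy)[f1 f2 f3 f4] fM.
rewrite /rint; apply: le_trans (cnormD _ _) _; rewrite cnormM cnormi mul1r.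
have b1 : cnorm (cint (hcurve f y0) x0 x1) <= 2 * M * (x1 - x0).
  apply: cint_bound => // t tt; apply: fM; rewrite /brect /rect /= ?lexx ?xx ?yy; intuition.
have b2 : cnorm (cint (hcurve f y1) x0 x1) <= 2 * M * (x1 - x0).
  apply: cint_bound => // t tt; apply: fM; rewrite /brect /rect /= ?lexx ?xx ?yy; intuition.
have b3 : cnorm (cint (vcurve f x0) y0 y1) <= 2 * M * (y1 - y0).
  apply: cint_bound => // t tt; apply: fM; rewrite /brect /rect /= ?lexx ?xx ?yy; intuition.
have b4 : cnorm (cint (vcurve f x1) y0 y1) <= 2 * M * (y1 - y0).
  apply: cint_bound => // t tt; apply: fM; rewrite /brect /rect /= ?lexx ?xx ?yy; intuition.
have := cnormB (cint (hcurve f y0) x0 x1) (cint (hcurve f y1) x0 x1).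
have := cnormB (cint (vcurve f x1) y0 y1) (cint (vcurve f x0) y0 y1).
lra.
Qed.

Lemma rint_splith f (x0 x1 y0 y1 c : R) : x0 <= c <= x1 -> y0 <= y1 ->
  bcont f x0 x1 y0 y1 ->
  rint f x0 x1 y0 y1 = rint f x0 c y0 y1 + rint f c x1 y0 y1.
Proof.
move=> /[dup] xcx /andP[xc cx] yy.
move=> /(bcont_cts (le_trans xc cx) yy)[f1 f2 f3 f4]; rewrite /rint.
by rewrite (cint_split xcx f1) (cint_split xcx f2); ring.
Qed.

Lemma rint_splitv f (x0 x1 y0 y1 c : R) : x0 <= x1 -> y0 <= c <= y1 ->
  bcont f x0 x1 y0 y1 ->
  rint f x0 x1 y0 y1 = rint f x0 x1 y0 c + rint f x0 x1 c y1.
Proof.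
move=> xx /[dup] ycy /andP[yc cy].
move=> /(bcont_cts xx (le_trans yc cy))[f1 f2 f3 f4]; rewrite /rint.
by rewrite (cint_split ycy f3) (cint_split ycy f4); ring.
Qed.

Lemma ccont_id (z : C) : ccont id z.
Proof. exact: cderiv_ccont (cderiv_id z). Qed.

Lemma rint_affine (k l : C) (x0 x1 y0 y1 : R) : x0 <= x1 -> y0 <= y1 ->
  rint (fun z => k + l * z) x0 x1 y0 y1 = 0.
Proof.
move=> xx yy.
have ck (c z : C) : ccont (fun=> c) z by exact: cderiv_ccont (cderiv_cst c z).
have cl (z : C) : ccont (fun z => l * z) z by exact: cderiv_ccont (cderivZ l (cderiv_id z)).
have H1 : bcont (fun=> k) x0 x1 y0 y1 by move=> z _; exact: ck.
have H2 : bcont (fun z => l * z) x0 x1 y0 y1 by move=> z _; exact: cl.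
rewrite (rintD xx yy H1 H2).
rewrite rintZ //; last by move=> z _; exact: ccont_id.
rewrite {1}/rint /hcurve /vcurve !subrr mulr0 addr0 add0r.
suff -> : rint id x0 x1 y0 y1 = 0 by rewrite mulr0.
have cR (c : C) a b : cts (fun=> c) a b by move=> x _; exact: rcont_cst.
have cid (a b : R) : cts (fun x : R => x%:C) a b.
  by move=> x _ e e0; exists e => // y; rewrite -rmorphB cnorm_real.
have cidi (a b : R) : cts (fun x : R => 'i * x%:C) a b by move=> x xx'; exact: rcontZ (cid a b x xx').
have hE y : cint (hcurve id y) x0 x1 = ((x1 ^+ 2 - x0 ^+ 2) / 2)%:C + 'i * y%:C * (x1 - x0)%:C.
  rewrite -cint_real_id // -cint_cst // -cintD //.
  by apply: cint_eq => x _; rewrite /hcurve [LHS]complexE.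
have vE x : cint (vcurve id x) y0 y1 = x%:C * (y1 - y0)%:C + 'i * ((y1 ^+ 2 - y0 ^+ 2) / 2)%:C.
  rewrite -cint_real_id // -cint_cst // -cintZ // -cintD //.
  by apply: cint_eq => y _; rewrite /hcurve [LHS]complexE.
rewrite /rint !hE !vE !rmorphB; ring.
Qed.

End RectangleIntegral.

(** * Goursat's theorem *)

Section Goursat.
Variable R : realType.
Notation C := R[i].
Implicit Types (f g : C -> C).

Lemma rectS (x0 x1 y0 y1 u0 u1 v0 v1 : R) z :
  x0 <= u0 -> u1 <= x1 -> y0 <= v0 -> v1 <= y1 ->
  rect u0 u1 v0 v1 z -> rect x0 x1 y0 y1 z.
Proof.
move=> h1 h2 h3 h4 [/andP[h5 h6] /andP[h7 h8]]; split; apply/andP; split.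
- exact: le_trans h1 h5.
- exact: le_trans h6 h2.
- exact: le_trans h3 h7.
- exact: le_trans h8 h4.
Qed.

(** The integrals over the four quarters add up to the whole, so one of them has at least a quarter
    of its modulus. *)
Lemma goursat_quarter f (x0 x1 y0 y1 : R) : x0 <= x1 -> y0 <= y1 ->
  (forall z, rect x0 x1 y0 y1 z -> ccont f z) ->
  exists q : R * R * R * R, let: (u0, u1, v0, v1) := q in
    [/\ x0 <= u0 /\ u1 <= x1, y0 <= v0 /\ v1 <= y1,
        u1 - u0 = (x1 - x0) / 2, v1 - v0 = (y1 - y0) / 2 &
        cnorm (rint f x0 x1 y0 y1) <= 4 * cnorm (rint f u0 u1 v0 v1)].
Proof.
move=> xx yy fc.
pose c := (x0 + x1) / 2; pose d := (y0 + y1) / 2.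
have [xc cx] : x0 <= c /\ c <= x1 by rewrite /c; split; lra.
have [yd dy] : y0 <= d /\ d <= y1 by rewrite /d; split; lra.
have [c1 c2] : c - x0 = (x1 - x0) / 2 /\ x1 - c = (x1 - x0) / 2 by rewrite /c; split; field.
have [d1 d2] : d - y0 = (y1 - y0) / 2 /\ y1 - d = (y1 - y0) / 2 by rewrite /d; split; field.
have sub (u0 u1 v0 v1 : R) : x0 <= u0 -> u1 <= x1 -> y0 <= v0 -> v1 <= y1 ->
    bcont f u0 u1 v0 v1.
  by move=> ? ? ? ? z [zr _]; apply: fc; apply: rectS zr.
have E : rint f x0 x1 y0 y1 = (rint f x0 c y0 d + rint f x0 c d y1)
    + (rint f c x1 y0 d + rint f c x1 d y1).
  rewrite (@rint_splith _ f x0 x1 y0 y1 c) ?xc ?cx //; last exact: sub.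
  by congr (_ + _); apply: rint_splitv; rewrite ?yd ?dy //; apply: sub.
have le : cnorm (rint f x0 x1 y0 y1) <=
    (cnorm (rint f x0 c y0 d) + cnorm (rint f x0 c d y1))
    + (cnorm (rint f c x1 y0 d) + cnorm (rint f c x1 d y1)).
  by rewrite E (le_trans (cnormD _ _)) // lerD // cnormD.
move: (cnorm (rint f x0 x1 y0 y1)) le => I le.
have [h1|h1] := leP I (4 * cnorm (rint f x0 c y0 d)).
  by exists (x0, c, y0, d); split.
have [h2|h2] := leP I (4 * cnorm (rint f x0 c d y1)).
  by exists (x0, c, d, y1); split.
have [h3|h3] := leP I (4 * cnorm (rint f c x1 y0 d)).
  by exists (c, x1, y0, d); split.
exists (c, x1, d, y1); split=> //.
move: (cnorm (rint f x0 c y0 d)) (cnorm (rint f x0 c d y1)) (cnorm (rint f c x1 y0 d))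
  (cnorm (rint f c x1 d y1)) le h1 h2 h3; clear; move=> *; lra.
Qed.

Lemma rint_degenerate f (x y : R) : rint f x x y y = 0.
Proof.
by rewrite /rint /cint !set_itv1 !Rintegral_set1 !subrr mulr0 addr0.
Qed.

(** Repeated bisection gives nested rectangles shrinking to a point z, with integrals at least 4^-k
    of the original. Near z the function is affine up to e |w - z|, and affine functions integrate
    to 0, so the k-th integral is also at most a constant times e 4^-k. *)
Theorem goursat f (x0 x1 y0 y1 : R) : x0 <= x1 -> y0 <= y1 ->
  (forall z, rect x0 x1 y0 y1 z -> exists D, cderiv f z D) ->
  rint f x0 x1 y0 y1 = 0.
Proof.
move=> xx yy df.
have fc z : rect x0 x1 y0 y1 z -> ccont f z by case/df => D /cderiv_ccont.
apply/eqP; rewrite -cnorm_eq0; apply/negPn/negP => I0.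
have {}I0 : 0 < cnorm (rint f x0 x1 y0 y1) by rewrite lt_def I0 cnorm_ge0.
pose T := (R * R * R * R)%type.
pose valid (q : T) := let: (u0, u1, v0, v1) := q in
  [/\ x0 <= u0, u0 <= u1, u1 <= x1 & [/\ y0 <= v0, v0 <= v1 & v1 <= y1]].
(* An implication, so that every quadruple has a successor and [choice] applies. *)
pose rel (q q' : T) := let: (x0, x1, y0, y1) := q in let: (u0, u1, v0, v1) := q' in
  valid q -> valid q' /\ [/\ x0 <= u0 /\ u1 <= x1, y0 <= v0 /\ v1 <= y1,
        u1 - u0 = (x1 - x0) / 2, v1 - v0 = (y1 - y0) / 2 &
        cnorm (rint f x0 x1 y0 y1) <= 4 * cnorm (rint f u0 u1 v0 v1)].
have ex q : exists q', rel q q'.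
  case: q => [[[a0 a1] b0] b1].
  have [[v1 v2 v3 [v4 v5 v6]]|nv] := pselect (valid (a0, a1, b0, b1)); last first.
    by exists (a0, a1, b0, b1).
  have [|[[[u0 u1] w0] w1] [[h1 h2] [h3 h4] h5 h6 h7]] :=
      @goursat_quarter f a0 a1 b0 b1 v2 v5.
    by move=> z zr; apply: fc; apply: rectS zr.
  have ge0 (u v u' v' : R) : u <= v -> u' - v' = (v - u) / 2 -> v' <= u' by lra.
  exists (u0, u1, w0, w1) => _; split => //; split; first exact: le_trans v1 h1.
  - exact: ge0 v2 h5.
  - exact: le_trans h2 v3.
  - by split; [exact: le_trans v4 h3|exact: ge0 v5 h6|exact: le_trans h4 v6].
have [nxt nxtP] := choice ex.
pose q k := iter k nxt (x0, x1, y0, y1).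
pose a0 k := (q k).1.1.1; pose a1 k := (q k).1.1.2; pose b0 k := (q k).1.2; pose b1 k := (q k).2.
have qE k : q k = (a0 k, a1 k, b0 k, b1 k).
  by rewrite /a0 /a1 /b0 /b1; case: (q k) => [[[? ?] ?] ?].
have qv k : valid (q k).
  elim: k => [|k IH]; first by rewrite /q /=; split => //; split.
  have := nxtP (q k); rewrite -[nxt (q k)]/(q k.+1) !qE /= in IH *.
  by move=> /(_ IH)[].
have qr k := nxtP (q k).
have step k : [/\ a0 k <= a0 k.+1 /\ a1 k.+1 <= a1 k, b0 k <= b0 k.+1 /\ b1 k.+1 <= b1 k,
        a1 k.+1 - a0 k.+1 = (a1 k - a0 k) / 2, b1 k.+1 - b0 k.+1 = (b1 k - b0 k) / 2 &
        cnorm (rint f (a0 k) (a1 k) (b0 k) (b1 k))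
          <= 4 * cnorm (rint f (a0 k.+1) (a1 k.+1) (b0 k.+1) (b1 k.+1))].
  have := qr k; have := qv k; rewrite -[nxt (q k)]/(q k.+1) !qE /=.
  by move=> vk /(_ vk)[].
have vk k : [/\ x0 <= a0 k, a0 k <= a1 k, a1 k <= x1 & [/\ y0 <= b0 k, b0 k <= b1 k & b1 k <= y1]].
  by have := qv k; rewrite qE.
have mono (u v : nat -> R) : (forall k, u k <= v k) -> (forall k, u k <= u k.+1) ->
    (forall k, v k.+1 <= v k) -> forall k, u k <= sup (range u) <= v k.
  move=> uv um vm.
  have umm i j : (i <= j)%N -> u i <= u j by move/(subnKC) <-; elim: (j - i)%N => [|m IH];
    rewrite ?addn0 ?addnS // (le_trans IH).
  have vmm i j : (i <= j)%N -> v j <= v i by move/(subnKC) <-; elim: (j - i)%N => [|m IH];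
    rewrite ?addn0 ?addnS // (le_trans _ IH).
  have ub k : ubound (range u) (v k).
    move=> _ [j _ <-]; case: (leqP j k) => jk; first exact: le_trans (umm _ _ jk) (uv k).
    exact: le_trans (uv j) (vmm _ _ (ltnW jk)).
  have hs : has_sup (range u) by split; [exists (u 0%N), 0%N|exists (v 0%N)].
  move=> k; apply/andP; split; first by apply: ub_le_sup; [case: hs|exists k].
  by apply: ge_sup; [case: hs|].
pose zx := sup (range a0); pose zy := sup (range b0).
have zxP k : a0 k <= zx <= a1 k.
  by apply: mono => {}k; [case: (vk k)|case: (step k) => -[]|case: (step k) => -[]].
have zyP k : b0 k <= zy <= b1 k.
  by apply: mono => {}k; [case: (vk k) => ? ? ? []|case: (step k) => ? []|case: (step k) => ? []].
have wx k : a1 k - a0 k = (x1 - x0) / 2 ^+ k.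
  elim: k => [|k IH]; first by rewrite expr0 divr1.
  by have [_ _ -> _ _] := step k; rewrite IH exprSr invfM mulrA.
have wy k : b1 k - b0 k = (y1 - y0) / 2 ^+ k.
  elim: k => [|k IH]; first by rewrite expr0 divr1.
  by have [_ _ _ -> _] := step k; rewrite IH exprSr invfM mulrA.
have lowI k : cnorm (rint f x0 x1 y0 y1) <= 4 ^+ k * cnorm (rint f (a0 k) (a1 k) (b0 k) (b1 k)).
  elim: k => [|k IH]; first by rewrite expr0 mul1r.
  apply: le_trans IH _; rewrite exprSr -mulrA ler_wpM2l ?exprn_ge0 //.
  by case: (step k).
pose z := zx +i* zy.
have zr : rect x0 x1 y0 y1 z.
  by have := zxP 0%N; have := zyP 0%N; split.
have [D fD] := df z zr.
pose L := (x1 - x0) + (y1 - y0).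
have L0 : 0 < L.
  rewrite lt_def addr_ge0 ?subr_ge0 // andbT; apply/negP => /eqP LE.
  have [e1 e2] : x1 = x0 /\ y1 = y0 by rewrite /L in LE; split; lra.
  by move: I0; rewrite e1 e2 rint_degenerate cnorm0 ltxx.
(* The final upper bound is 4 e L^2, which this choice makes half of the integral. *)
pose e := cnorm (rint f x0 x1 y0 y1) / (8 * L ^+ 2).
have e0 : 0 < e by rewrite divr_gt0 // mulr_gt0 // exprn_gt0.
have [d d0 dP] := fD e e0.
have [k Lk] : exists k, L / 2 ^+ k < d.
  exists (Num.trunc (L / d)).+1; rewrite ltr_pdivrMr ?exprn_gt0 // mulrC -ltr_pdivrMr //.
  apply: lt_le_trans (truncnS_gt _) _.
  by rewrite -natrX ler_nat ltnW // ltn_expl.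
have [v1 v2 v3 [v4 v5 v6]] := vk k.
have distz w : rect (a0 k) (a1 k) (b0 k) (b1 k) w -> cnorm (w - z) <= L / 2 ^+ k.
  move=> [/andP[h1 h2] /andP[h3 h4]]; apply: le_trans (cnorm_le _) _.
  rewrite ReB ImB /L mulrDl -wx -wy /z /=.
  have := zxP k; have := zyP k => /andP[h5 h6] /andP[h7 h8].
  have dist_le (a b u v : R) : a <= u <= b -> a <= v <= b -> `|u - v| <= b - a.
    by move=> /andP[? ?] /andP[? ?]; rewrite ler_norml; apply/andP; split; lra.
  by apply: lerD; apply: dist_le; apply/andP.
pose r w := f w - (f z - D * z) - D * w.
have rE w : r w = f w - f z - D * (w - z) by rewrite /r; ring.
have cr w : rect (a0 k) (a1 k) (b0 k) (b1 k) w -> ccont f w.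
  by move=> wr; apply: fc; apply: rectS wr.
have ca (k' l : C) w : ccont (fun w => k' + l * w) w.
  by apply: cderiv_ccont (cderivD (cderiv_cst k' w) (cderivZ l (cderiv_id w))).
have IE : rint r (a0 k) (a1 k) (b0 k) (b1 k) = rint f (a0 k) (a1 k) (b0 k) (b1 k).
  rewrite (_ : r = (fun w => f w + ((- (f z - D * z)) + (- D) * w))); last first.
    by apply/funext => w; rewrite /r; ring.
  by rewrite rintD ?rint_affine ?addr0 // => w [/cr].
have rc : bcont r (a0 k) (a1 k) (b0 k) (b1 k).
  move=> w [wr _] e' e'0; have [d1 d10 P1] := cr w wr (e' / 2) (half_gt0 e'0).
  have [d2 d20 P2] := ca (- (f z - D * z)) (- D) w (e' / 2) (half_gt0 e'0).
  exists (Num.min d1 d2); first by rewrite lt_min d10.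
  move=> u; rewrite lt_min => /andP[/P1 h1 /P2 h2].
  rewrite (_ : r u - r w = (f u - f w) + ((- (f z - D * z)) + (- D) * u - ((- (f z - D * z)) + (- D) * w))); last by rewrite /r; ring.
  by apply: le_lt_trans (cnormD _ _) _; rewrite [ltRHS]splitr ltrD.
have := @rint_bound _ r (a0 k) (a1 k) (b0 k) (b1 k) (e * (L / 2 ^+ k)) v2 v5 rc.
rewrite IE wx wy -mulrDl -/L => bd.
have {}bd : cnorm (rint f (a0 k) (a1 k) (b0 k) (b1 k)) <= 4 * (e * (L / 2 ^+ k)) * (L / 2 ^+ k).
  apply: bd => w [wr _]; rewrite rE; have wd := distz w wr.
  apply: le_trans (dP w (le_lt_trans wd Lk)) _.
  by rewrite ler_wpM2l // ltW.
have := lowI k; apply/negP; rewrite -ltNge.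
apply: le_lt_trans (_ : 4 ^+ k * (4 * (e * (L / 2 ^+ k)) * (L / 2 ^+ k)) < _).
  by rewrite ler_wpM2l // exprn_ge0.
rewrite (_ : 4 ^+ k = 2 ^+ k * 2 ^+ k :> R); last by rewrite -exprMn; congr (_ ^+ k); ring.
have p2 : 2 ^+ k != 0 :> R by rewrite gt_eqF // exprn_gt0.
have Ln0 : L != 0 by rewrite gt_eqF.
rewrite (_ : _ * _ = cnorm (rint f x0 x1 y0 y1) / 2); last by rewrite /e; field; rewrite p2.
by rewrite ltr_pdivrMr // ltr_pMr // ltr1n.
Qed.

End Goursat.

(** * Cauchy's formula on rectangles *)

Section Cauchy.
Variable R : realType.
Notation C := R[i].
Implicit Types (f g : C -> C).

(* Cutting out a small square around z shows that an isolated bounded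
   singularity does not contribute. *)
Lemma goursat_punctured f (x0 x1 y0 y1 p q M d0 : R) :
  x0 < p < x1 -> y0 < q < y1 -> 0 < d0 ->
  (forall w, rect x0 x1 y0 y1 w -> w != p +i* q -> exists D, cderiv f w D) ->
  (forall w, cnorm (w - (p +i* q)) < d0 -> w != p +i* q -> cnorm (f w) <= M) ->
  rint f x0 x1 y0 y1 = 0.
Proof.
move=> /andP[xp px] /andP[yq qy] d00 df fM.
have M0 : 0 <= M.
  pose w := (p + d0 / 2) +i* q.
  apply: le_trans (fM w _ _); first exact: cnorm_ge0.
    rewrite (_ : _ - _ = (d0 / 2)%:C).
      by rewrite cnorm_real ger0_norm ?divr_ge0 ?(ltW d00) // ltr_pdivrMr // ltr_pMr // ltr1n.
    by apply/eqP; rewrite eq_complex /= subrr addrAC subrr add0r !eqxx.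
  by rewrite eq_complex /= negb_and -subr_eq0 addrAC subrr add0r gt_eqF // divr_gt0.
have fc w : rect x0 x1 y0 y1 w -> w != p +i* q -> ccont f w.
  by move=> h1 h2; have [D /cderiv_ccont] := df w h1 h2.
pose m := Num.min (Num.min (p - x0) (x1 - p)) (Num.min (Num.min (q - y0) (y1 - q)) (d0 / 2)).
have m0 : 0 < m by rewrite /m !lt_min !subr_gt0 xp px yq qy divr_gt0.
have [m1 m2 m3 [m4 m5]] : [/\ m <= p - x0, m <= x1 - p, m <= q - y0 & m <= y1 - q /\ m <= d0 / 2].
  by rewrite /m; split; [..|split]; rewrite !ge_min !lexx ?orbT.
have bd t : 0 < t -> t < m -> cnorm (rint f x0 x1 y0 y1) <= 16 * M * t.
  move=> t0 tm.
  have bc (u0 u1 v0 v1 : R) : x0 <= u0 -> u1 <= x1 -> y0 <= v0 -> v1 <= y1 ->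
      u0 != p -> u1 != p -> v0 != q -> v1 != q -> bcont f u0 u1 v0 v1.
    move=> i1 i2 i3 i4 n1 n2 n3 n4 w [wr wE]; apply: fc; first exact: rectS wr.
    rewrite eq_complex /= negb_and.
    by case: wE => [->|[->|[->|->]]]; rewrite ?n1 ?n2 ?n3 ?n4 ?orbT.
  have gz (u0 u1 v0 v1 : R) : x0 <= u0 -> u0 <= u1 -> u1 <= x1 -> y0 <= v0 -> v0 <= v1 -> v1 <= y1 ->
      (p < u0 \/ u1 < p \/ q < v0 \/ v1 < q) -> rint f u0 u1 v0 v1 = 0.
    move=> i1 i2 i3 i4 i5 i6 out; apply: goursat => // w wr; apply: df; first exact: rectS wr.
    apply/eqP => wE; case: wr; rewrite wE /= => /andP[h1 h2] /andP[h3 h4].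
    by case: out => [|[|[|]]]; rewrite ltNge ?h1 ?h2 ?h3 ?h4.
  have [xpt ptt ptx] : [/\ x0 <= p - t, p - t <= p + t & p + t <= x1].
    by move: t0 tm m1 m2; clear; move=> *; split; lra.
  have [yqt qtt qty] : [/\ y0 <= q - t, q - t <= q + t & q + t <= y1].
    by move: t0 tm m3 m4; clear; move=> *; split; lra.
  have ltB (u : R) : u - t < u by rewrite ltrBlDr ltrDl.
  have ltA (u : R) : u < u + t by rewrite ltrDl.
  have [pl pr ql qr] : [/\ p - t != p, p + t != p, q - t != q & q + t != q].
    by split; rewrite ?(lt_eqF (ltB _)) ?(gt_eqF (ltA _)).
  have [xn xn' yn yn'] : [/\ x0 != p, x1 != p, y0 != q & y1 != q].
    by split; rewrite ?(lt_eqF xp) ?(lt_eqF yq) ?(gt_eqF px) ?(gt_eqF qy).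
  have pt1 := le_trans ptt ptx; have pt0 := le_trans xpt ptt.
  have qt1 := le_trans qtt qty; have qt0 := le_trans yqt qtt.
  have [xx yy] := (le_trans xpt pt1, le_trans yqt qt1).
  rewrite (@rint_splith _ f x0 x1 y0 y1 (p - t)); [|by rewrite xpt|by []|exact: bc].
  rewrite (gz x0 (p - t)) ?add0r //; last by right; left.
  rewrite (@rint_splith _ f (p - t) x1 y0 y1 (p + t)); [|by rewrite ptt|by []|exact: bc].
  rewrite (gz (p + t) x1) ?addr0 //; last by left.
  rewrite (@rint_splitv _ f (p - t) (p + t) y0 y1 (q - t)); [|by []|by rewrite yqt|exact: bc].
  rewrite (gz _ _ y0 (q - t)) ?add0r //; last by do 3 right.
  rewrite (@rint_splitv _ f (p - t) (p + t) (q - t) y1 (q + t)); [|by []|by rewrite qtt|exact: bc].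
  rewrite (gz _ _ (q + t) y1) ?addr0 //; last by do 2 right; left.
  rewrite (_ : 16 * M * t = 4 * M * (p + t - (p - t) + (q + t - (q - t)))); last by ring.
  apply: rint_bound => //; first exact: bc.
  have dist_le (u v : R) : u - t <= v <= u + t -> `|v - u| <= t.
    by move=> /andP[? ?]; rewrite ler_norml; apply/andP; split; lra.
  move=> w [[h1 h2] wE]; apply: fM.
    apply: le_lt_trans (cnorm_le _) _; rewrite ReB ImB /=.
    apply: le_lt_trans (lerD (dist_le _ _ h1) (dist_le _ _ h2)) _.
    by move: tm m5; clear; lra.
  rewrite eq_complex /= negb_and.
  by case: wE => [->|[->|[->|->]]]; rewrite ?pl ?pr ?ql ?qr ?orbT.
apply/eqP; rewrite -cnorm_eq0; apply/negPn/negP => I0.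
have {}I0 : 0 < cnorm (rint f x0 x1 y0 y1) by rewrite lt_def I0 cnorm_ge0.
set I := cnorm _ in I0 bd.
(* Keeps the square inside the admissible region and makes 16 M t smaller than half of the
   integral. *)
pose t := Num.min (m / 2) (I / (32 * (M + 1))).
have K0 : 0 < 32 * (M + 1) by rewrite mulr_gt0 // ltr_wpDl.
have t0 : 0 < t by rewrite lt_min !divr_gt0.
have tm : t < m by rewrite gt_min ltr_pdivrMr // ltr_pMr // ltr1n.
have tI : t <= I / (32 * (M + 1)) by rewrite ge_min lexx orbT.
have := bd t t0 tm; rewrite ler_pdivlMr // in tI.
have : 0 <= M * t by rewrite mulr_ge0 // ltW.
rewrite (_ : t * _ = 32 * (M * t) + 32 * t) in tI; last by ring.
rewrite -[16 * M * t]mulrA; move: (M * t) tI t0 => X; clear; lra.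
Qed.

Definition cauchy_int f (x0 x1 y0 y1 : R) z := rint (fun w => f w / (w - z)) x0 x1 y0 y1.

Lemma ccontM f g z : ccont f z -> ccont g z -> ccont (fun w => f w * g w) z.
Proof.
move=> fc gc e e0.
have K1 : 0 < 1 + cnorm (f z) by rewrite ltr_wpDr // cnorm_ge0.
have K2 : 0 < 1 + cnorm (g z) by rewrite ltr_wpDr // cnorm_ge0.
have e20 : 0 < e / 2 by rewrite divr_gt0.
have [d1 d10 P1] := fc _ (divr_gt0 e20 K2).
have [d2 d20 P2] := gc _ (divr_gt0 e20 K1).
have [d3 d30 P3] := gc 1 ltr01.
exists (Num.min d1 (Num.min d2 d3)); first by rewrite !lt_min d10 d20.
move=> w; rewrite !lt_min => /and3P[/P1 h1 /P2 h2 /P3 h3].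
rewrite (_ : _ - _ = (f w - f z) * g w + f z * (g w - g z)); last by ring.
apply: le_lt_trans (cnormD _ _) _; rewrite [ltRHS]splitr !cnormM.
have gw : cnorm (g w) <= 1 + cnorm (g z).
  rewrite (_ : g w = (g w - g z) + g z); last by rewrite subrK.
  by apply: le_trans (cnormD _ _) _; rewrite lerD2r ltW.
apply: ltr_leD.
  apply: le_lt_trans (_ : cnorm (f w - f z) * (1 + cnorm (g z)) < _).
    by rewrite ler_wpM2l ?cnorm_ge0.
  by rewrite -ltr_pdivlMr.
apply: le_trans (_ : (1 + cnorm (f z)) * cnorm (g w - g z) <= _).
  by rewrite ler_wpM2r ?cnorm_ge0 // lerDr.
by rewrite -ler_pdivlMl // mulrC ltW.
Qed.

Lemma ccont_inv_sub (z w : C) : w != z -> ccont (fun u => (u - z)^-1) w.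
Proof.
move=> wz; have H : cderiv (fun u => u - z) w (1 + 0).
  by apply: cderivD (cderiv_id w) (cderiv_cst _ w).
apply: cderiv_ccont; apply: cderiv_comp H _; apply: cderivV.
by rewrite subr_eq0.
Qed.

Lemma cderiv_inv_sub (z w : C) : w != z -> exists D, cderiv (fun u => (u - z)^-1) w D.
Proof.
move=> wz; have H : cderiv (fun u => u - z) w (1 + 0).
  by apply: cderivD (cderiv_id w) (cderiv_cst _ w).
eexists; apply: cderiv_comp H _; apply: cderivV.
by rewrite subr_eq0.
Qed.

(** The quotient (f w - f z) / (w - z) is bounded near z, so [goursat_punctured] applies to it. The
    integral of 1 / (w - z) is left unevaluated. *)
Lemma cauchy_formula f (x0 x1 y0 y1 p q : R) :
  x0 < p < x1 -> y0 < q < y1 ->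
  (forall w, rect x0 x1 y0 y1 w -> exists D, cderiv f w D) ->
  cauchy_int f x0 x1 y0 y1 (p +i* q) =
  f (p +i* q) * cauchy_int (fun=> 1) x0 x1 y0 y1 (p +i* q).
Proof.
move=> xpx yqy df; move: (xpx) (yqy) => /andP[xp px] /andP[yq qy].
set z := p +i* q.
have xx : x0 <= x1 by lra.
have yy : y0 <= y1 by lra.
have zin : rect x0 x1 y0 y1 z by split; rewrite /= ?(ltW xp) ?(ltW px) ?(ltW yq) ?(ltW qy).
have nz w : brect x0 x1 y0 y1 w -> w != z.
  move=> [_ wE]; rewrite eq_complex /= negb_and.
  by case: wE => [->|[->|[->|->]]]; apply/orP; [left|left|right|right]; apply/eqP; lra.
have [D fD] := df z zin.
have [d d0 dP] := fD 1 ltr01.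
have K : rint (fun w => (f w - f z) / (w - z)) x0 x1 y0 y1 = 0.
  apply: (@goursat_punctured _ x0 x1 y0 y1 p q (1 + cnorm D) d) => // w.
    move=> wr wz; have [D1 H1] := df w wr; have [D2 H2] := cderiv_inv_sub wz.
    eexists; apply: cderivM H2; apply: cderivD H1 (cderiv_cst _ w).
  move=> wd wz; have := dP w wd => h.
  rewrite cnormM cnormV ler_pdivrMr ?cnorm_gt0 ?subr_eq0 //.
  rewrite (_ : f w - f z = (f w - f z - D * (w - z)) + D * (w - z)); last by rewrite subrK.
  by rewrite (le_trans (cnormD _ _)) // mulrDl lerD // cnormM.
have fc w : brect x0 x1 y0 y1 w -> ccont f w.
  by move=> [/df[E /cderiv_ccont]].
have c1 : bcont (fun w => f w / (w - z)) x0 x1 y0 y1.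
  by move=> w wb; apply: ccontM; [exact: fc|apply: ccont_inv_sub; exact: nz].
have c2 : bcont (fun w => 1 / (w - z)) x0 x1 y0 y1.
  move=> w wb; apply: ccontM; last by apply: ccont_inv_sub; exact: nz.
  exact: cderiv_ccont (cderiv_cst _ w).
have c3 : bcont (fun w => - f z * (1 / (w - z))) x0 x1 y0 y1.
  move=> w wb; apply: ccontM (c2 w wb).
  exact: cderiv_ccont (cderiv_cst _ w).
apply/eqP; rewrite -subr_eq0; apply/eqP; rewrite -K /cauchy_int -mulNr -rintZ // -rintD //.
by apply: rint_eq => // w _; ring.
Qed.

(** The expansion of 1 / (w - u) around z to second order has an explicit remainder (u - z)^2 / ((w
    - u)(w - z)^2), bounded because u stays at distance r / 2 from the boundary. *)
Lemma cauchy_int_derivable f (x0 x1 y0 y1 M r : R) (z : C) :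
  x0 <= x1 -> y0 <= y1 -> 0 < r -> bcont f x0 x1 y0 y1 ->
  (forall w, brect x0 x1 y0 y1 w -> cnorm (f w) <= M) ->
  (forall w, brect x0 x1 y0 y1 w -> r <= cnorm (w - z)) ->
  exists D, cderiv (cauchy_int f x0 x1 y0 y1) z D.
Proof.
move=> xx yy r0 fc fM wr.
have nz u w : cnorm (u - z) < r / 2 -> brect x0 x1 y0 y1 w -> r / 2 <= cnorm (w - u).
  move=> uz /wr wz; have := cnormD (w - u) (u - z).
  rewrite addrA subrK => h; lra.
have nu u w : cnorm (u - z) < r / 2 -> brect x0 x1 y0 y1 w -> w != u.
  move=> uz wb; rewrite -subr_eq0 -cnorm_gt0; apply: lt_le_trans (nz u w uz wb).
  by rewrite divr_gt0.
have zz : cnorm (z - z) < r / 2 by rewrite subrr cnorm0 divr_gt0.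
have ci u : cnorm (u - z) < r / 2 -> bcont (fun w => (w - u)^-1) x0 x1 y0 y1.
  by move=> uz w wb; apply: ccont_inv_sub; exact: nu.
exists (rint (fun w => f w * ((w - z)^-1 * (w - z)^-1)) x0 x1 y0 y1).
move=> e e0.
pose K := 4 * ((1 + `|M|) * ((r / 2)^-1 * ((r / 2)^-1 * (r / 2)^-1))) * (x1 - x0 + (y1 - y0)) + 1.
have rh0 : 0 <= (r / 2)^-1 by rewrite invr_ge0 divr_ge0 // ltW.
have K0 : 0 < K.
  apply: ltr_wpDl => //; apply: mulr_ge0; last by rewrite addr_ge0 // subr_ge0.
  apply: mulr_ge0 => //; apply: mulr_ge0; first by rewrite addr_ge0.
  by apply: mulr_ge0 => //; apply: mulr_ge0.
exists (Num.min (r / 2) (e / K)); first by rewrite lt_min !divr_gt0.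
move=> u; rewrite lt_min => /andP[uz ue].
have b1 : bcont (fun w => f w / (w - u)) x0 x1 y0 y1.
  by move=> w wb; apply: ccontM; [exact: fc|exact: ci].
have b2 : bcont (fun w => f w / (w - z)) x0 x1 y0 y1.
  by move=> w wb; apply: ccontM; [exact: fc|exact: ci].
have b3 : bcont (fun w => f w * ((w - z)^-1 * (w - z)^-1)) x0 x1 y0 y1.
  by move=> w wb; apply: ccontM; [exact: fc|apply: ccontM; exact: ci].
have bZ k g : bcont g x0 x1 y0 y1 -> bcont (fun w => k * g w) x0 x1 y0 y1.
  by move=> gc w wb; apply: ccontM (gc w wb); exact: cderiv_ccont (cderiv_cst _ w).
have b4 : bcont (fun w => f w * ((w - u)^-1 * ((w - z)^-1 * (w - z)^-1))) x0 x1 y0 y1.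
  move=> w wb; apply: ccontM; first exact: fc.
  by apply: ccontM; [exact: ci|apply: ccontM; exact: ci].
have E : cauchy_int f x0 x1 y0 y1 u =
    cauchy_int f x0 x1 y0 y1 z
    + ((u - z) * rint (fun w => f w * ((w - z)^-1 * (w - z)^-1)) x0 x1 y0 y1
    + (u - z) ^+ 2 * rint (fun w => f w * ((w - u)^-1 * ((w - z)^-1 * (w - z)^-1))) x0 x1 y0 y1).
  rewrite /cauchy_int -!rintZ //.
  have bD g h : bcont g x0 x1 y0 y1 -> bcont h x0 x1 y0 y1 ->
      bcont (fun w => g w + h w) x0 x1 y0 y1.
    move=> gc hc w wb e' e'0; have [d1 d10 P1] := gc w wb (e' / 2) (half_gt0 e'0).
    have [d2 d20 P2] := hc w wb (e' / 2) (half_gt0 e'0).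
    exists (Num.min d1 d2); first by rewrite lt_min d10.
    move=> v; rewrite lt_min => /andP[/P1 h1 /P2 h2].
    rewrite (_ : _ - _ = (g v - g w) + (h v - h w)); last by ring.
    by apply: le_lt_trans (cnormD _ _) _; rewrite [ltRHS]splitr ltrD.
  rewrite -rintD //; [|exact: bZ..]; rewrite -rintD //; last by apply: bD; exact: bZ.
  apply: rint_eq => // w wb; field.
  by rewrite !subr_eq0 (nu u w uz wb) (nu z w zz wb).
rewrite E (_ : _ - _ - _ = (u - z) ^+ 2 * rint (fun w => f w * ((w - u)^-1 * ((w - z)^-1 * (w - z)^-1))) x0 x1 y0 y1); last by ring.
rewrite cnormM cnormX expr2 -mulrA [leRHS]mulrC ler_wpM2l ?cnorm_ge0 //.
apply: le_trans (_ : e / K * K <= _); last by rewrite divfK // gt_eqF.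
apply: ler_pM; rewrite ?cnorm_ge0 ?(ltW ue) //.
rewrite /K; apply: ler_wpDr => //.
apply: rint_bound => // w wb; rewrite !cnormM !cnormV.
have iv v : cnorm (v - z) < r / 2 -> (cnorm (w - v))^-1 <= (r / 2)^-1.
  move=> vz; have h := nz v w vz wb; rewrite lef_pV2 // posrE ?divr_gt0 //.
  by apply: lt_le_trans h; rewrite divr_gt0.
have h1 := iv u uz; have h2 := iv z zz.
apply: ler_pM; rewrite ?mulr_ge0 ?invr_ge0 ?cnorm_ge0 //.
  apply: le_trans (fM w wb) _; apply: le_trans (ler_norm _) _; by rewrite lerDr.
apply: ler_pM; rewrite ?mulr_ge0 ?invr_ge0 ?cnorm_ge0 //.
by apply: ler_pM; rewrite ?invr_ge0 ?cnorm_ge0.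
Qed.

End Cauchy.

(** * Division by z - a and the residue *)

Section Residue.
Variable R : realType.
Notation C := R[i].
Implicit Types (f g : C -> C).

Lemma Re_cint (g : R -> C) (a b : R) :
  complex.Re (cint g a b) = \int[@lebesgue_measure R]_(x in `[a, b]) complex.Re (g x).
Proof. by []. Qed.

Lemma Im_cint (g : R -> C) (a b : R) :
  complex.Im (cint g a b) = \int[@lebesgue_measure R]_(x in `[a, b]) complex.Im (g x).
Proof. by []. Qed.

(* The imaginary part of the integral of dw/(w-a) around a square centred at a
   is the integral of a positive function. *)
Lemma winding_square_neq0 (p q r : R) : 0 < r ->
  cauchy_int (fun=> 1) (p - r) (p + r) (q - r) (q + r) (p +i* q) != 0.
Proof.
move=> r0; rewrite /cauchy_int /rint.
have xx : p - r <= p + r by lra.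
have yy : q - r <= q + r by lra.
set f := fun w : C => 1 / (w - (p +i* q)).
have fc w : w != p +i* q -> ccont f w.
  by move=> wz; apply: ccontM (ccont_inv_sub wz); exact: cderiv_ccont (cderiv_cst _ w).
have ch y a b : y != q -> cts (hcurve f y) a b.
  by move=> yq x _; apply: hcurve_cont; apply: fc; rewrite eq_complex /= negb_and yq orbT.
have cv x a b : x != p -> cts (vcurve f x) a b.
  by move=> yq y _; apply: vcurve_cont; apply: fc; rewrite eq_complex /= negb_and yq.
have qr1 : q - r != q by apply/eqP; lra.
have qr2 : q + r != q by apply/eqP; lra.
have pr1 : p - r != p by apply/eqP; lra.
have pr2 : p + r != p by apply/eqP; lra.
have fE x y : f (x +i* y) = ((x - p) / ((x - p) ^+ 2 + (y - q) ^+ 2)) +i* (- (y - q) / ((x - p) ^+ 2 + (y - q) ^+ 2)).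
  by rewrite /f mul1r; apply/eqP; rewrite eq_complex /= !mulNr !eqxx.
have cts_integ (g : R -> C) (a b : R) := @cts_integrable R g a b.
have den (t : R) : 0 < t ^+ 2 + r ^+ 2 by rewrite ltr_wpDl ?sqr_ge0 // exprn_gt0.
have lowh (u : R) : `|u| <= r -> (2 * r)^-1 <= r / (u ^+ 2 + r ^+ 2).
  move=> ur; rewrite ler_pdivlMr // ler_pdivrMl ?mulr_gt0 //.
  have : u ^+ 2 <= r ^+ 2 by rewrite -real_normK ?num_real // lerXn2r ?nnegrE // ltW.
  by move=> h; rewrite expr2 in h *; lra.
suff : 0 < complex.Im (cint (hcurve f (q - r)) (p - r) (p + r) - cint (hcurve f (q + r)) (p - r) (p + r) +
  'i * (cint (vcurve f (p + r)) (q - r) (q + r) - cint (vcurve f (p - r)) (q - r) (q + r))).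
  by apply: contraPneq => ->; rewrite ltxx.
rewrite ImD ImB (_ : complex.Im ('i * _) = complex.Re (cint (vcurve f (p + r)) (q - r) (q + r))
   - complex.Re (cint (vcurve f (p - r)) (q - r) (q + r))); last first.
  by case: (_ - _) (ReB (cint (vcurve f (p + r)) (q - r) (q + r)) (cint (vcurve f (p - r)) (q - r) (q + r))) => a b <-; rewrite /= mul0r mul1r add0r.
have low (g : R -> R) (a : R) : a <= a + 2 * r ->
    (@lebesgue_measure R).-integrable `[a, a + 2 * r] (EFin \o g) ->
    (forall x, a <= x <= a + 2 * r -> (2 * r)^-1 <= g x) ->
    1 <= \int[@lebesgue_measure R]_(x in `[a, a + 2 * r]) g x.
  move=> ab gi glow.
  have E1 : (2 * r)^-1 * (a + 2 * r - a) = 1.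
    by rewrite addrAC subrr add0r mulVf // mulf_neq0 ?gt_eqF.
  rewrite -[leLHS]E1 -Rintegral_seg_cst //; apply: le_Rintegral => //.
    by apply: continuous_compact_integrable; [exact: segment_compact|apply: continuous_subspaceT => x; exact: cvg_cst].
have up (g : R -> R) (a : R) : a <= a + 2 * r ->
    (@lebesgue_measure R).-integrable `[a, a + 2 * r] (EFin \o g) ->
    (forall x, a <= x <= a + 2 * r -> g x <= - (2 * r)^-1) ->
    \int[@lebesgue_measure R]_(x in `[a, a + 2 * r]) g x <= - 1.
  move=> ab gi glow.
  have E1 : - (2 * r)^-1 * (a + 2 * r - a) = - 1.
    by rewrite addrAC subrr add0r mulNr mulVf // mulf_neq0 ?gt_eqF.
  rewrite -[leRHS]E1 -Rintegral_seg_cst //; apply: le_Rintegral => //.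
    by apply: continuous_compact_integrable; [exact: segment_compact|apply: continuous_subspaceT => x; exact: cvg_cst].
have pE : p + r = p - r + 2 * r by ring.
have qE : q + r = q - r + 2 * r by ring.
have within (a x : R) : a - r <= x <= a - r + 2 * r -> `|x - a| <= r.
  by move=> /andP[? ?]; rewrite ler_norml; apply/andP; split; lra.
have e1 : - (q - r - q) = r by ring.
have e2 : (q - r - q) ^+ 2 = r ^+ 2 by ring.
have e3 : - (q + r - q) = - r by ring.
have e4 : (q + r - q) ^+ 2 = r ^+ 2 by ring.
have e5 : p + r - p = r by ring.
have e6 : p - r - p = - r by ring.
have h1 : 1 <= complex.Im (cint (hcurve f (q - r)) (p - r) (p + r)).
  have [_] := cts_integ _ _ _ (ch _ (p - r) (p + r) qr1).
  rewrite Im_cint pE => gi; apply: low => //; first by lra.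
  move=> x xr; rewrite /hcurve fE [complex.Im _]/= e1 e2.
  exact: lowh (within _ _ xr).
have h2 : complex.Im (cint (hcurve f (q + r)) (p - r) (p + r)) <= - 1.
  have [_] := cts_integ _ _ _ (ch _ (p - r) (p + r) qr2).
  rewrite Im_cint pE => gi; apply: up => //; first by lra.
  move=> x xr; rewrite /hcurve fE [complex.Im _]/= e3 e4.
  by rewrite mulNr lerN2; exact: lowh (within _ _ xr).
have h3 : 1 <= complex.Re (cint (vcurve f (p + r)) (q - r) (q + r)).
  have [+ _] := cts_integ _ _ _ (cv _ (q - r) (q + r) pr2).
  rewrite Re_cint qE => gi; apply: low => //; first by lra.
  move=> x xr; rewrite /vcurve fE [complex.Re _]/= e5.
  by rewrite addrC; exact: lowh (within _ _ xr).
have h4 : complex.Re (cint (vcurve f (p - r)) (q - r) (q + r)) <= - 1.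
  have [+ _] := cts_integ _ _ _ (cv _ (q - r) (q + r) pr1).
  rewrite Re_cint qE => gi; apply: up => //; first by lra.
  move=> x xr; rewrite /vcurve fE [complex.Re _]/= e6.
  by rewrite sqrrN mulNr lerN2 addrC; exact: lowh (within _ _ xr).
move: (complex.Im _) (complex.Im _) (complex.Re _) (complex.Re _) h1 h2 h3 h4.
clear; move=> *; lra.
Qed.

Lemma cts_bounded (g : R -> C) (a b : R) : a <= b -> cts g a b ->
  exists M, forall x, a <= x <= b -> cnorm (g x) <= M.
Proof.
move=> ab gc; pose f x := cnorm (g x).
have cf : {within `[a, b], continuous f}.
  apply: continuous_in_subspaceT => x; rewrite inE /= in_itv /= => /gc gx.
  apply/cvgrPdist_lt => e e0; have [d d0 dP] := gx e e0.
  apply/nbhs_ballP; exists d => //= y; rewrite /ball /= distrC => /dP gy.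
  apply: le_lt_trans gy; rewrite /f ler_norml; apply/andP; split.
    by have := cnormD (g x) (g y - g x); rewrite addrC subrK; lra.
  by have := cnormD (g y) (g x - g y); rewrite addrC subrK cdistC; lra.
have [c _ cM] := EVT_max ab cf; exists (f c) => x xab.
by apply: cM; rewrite in_itv.
Qed.

(** By [cauchy_formula] the product of f z with W z, the Cauchy integral of 1, is the Cauchy
    integral of f. Writing 1/(w - z) = 1/(w - a) + (z - a)/((w - a)(w - z)) in both integrals
    exhibits the factor z - a, and W may be divided out near a, where it does not vanish. *)
Lemma holomorphic_quotient f (a : C) (d : R) : 0 < d ->
  (forall w, cnorm (w - a) < d -> exists D, cderiv f w D) ->
  exists2 g, (exists2 d', 0 < d' & forall w, cnorm (w - a) < d' -> exists D, cderiv g w D) &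
    exists2 d', 0 < d' & forall w, cnorm (w - a) < d' -> f w = f a + (w - a) * g w.
Proof.
case: a => p q; set a := p +i* q => d0 df.
pose r := d / 3; have r0 : 0 < r by rewrite divr_gt0.
pose x0 := p - r; pose x1 := p + r; pose y0 := q - r; pose y1 := q + r.
have xx : x0 <= x1 by rewrite /x0 /x1; lra.
have yy : y0 <= y1 by rewrite /y0 /y1; lra.
have rd w : rect x0 x1 y0 y1 w -> cnorm (w - a) < d.
  move=> [/andP[h1 h2] /andP[h3 h4]]; apply: le_lt_trans (cnorm_le _) _.
  rewrite ReB ImB /=; apply: le_lt_trans (_ : r + r < _); last by rewrite /r; lra.
  by apply: lerD; rewrite ler_norml; apply/andP; move: h1 h2 h3 h4; rewrite /x0 /x1 /y0 /y1; split; lra.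
have dfr w : rect x0 x1 y0 y1 w -> exists D, cderiv f w D by move/rd/df.
have brd w : brect x0 x1 y0 y1 w -> r <= cnorm (w - a).
  move=> [[/andP[h1 h2] /andP[h3 h4]] wE].
  have := normRe_le (w - a); have := normIm_le (w - a); rewrite ReB ImB /= => i1 i2.
  case: wE => [E|[E|[E|E]]].
  - by apply: le_trans i2; rewrite E /x0 addrAC subrr add0r normrN ler_norm.
  - by apply: le_trans i2; rewrite E /x1 addrAC subrr add0r ler_norm.
  - by apply: le_trans i1; rewrite E /y0 addrAC subrr add0r normrN ler_norm.
  - by apply: le_trans i1; rewrite E /y1 addrAC subrr add0r ler_norm.
have brz z w : cnorm (z - a) < r / 2 -> brect x0 x1 y0 y1 w -> r / 2 <= cnorm (w - z).
  move=> za /brd wa; have := cnormD (w - z) (z - a).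
  rewrite addrA subrK => h; lra.
have aa : cnorm (a - a) < r / 2 by rewrite subrr cnorm0 divr_gt0.
have nz z w : cnorm (z - a) < r / 2 -> brect x0 x1 y0 y1 w -> w != z.
  move=> za wb; rewrite -subr_eq0 -cnorm_gt0; apply: lt_le_trans (brz z w za wb).
  by rewrite divr_gt0.
have fcb : bcont f x0 x1 y0 y1 by move=> w [/dfr[D /cderiv_ccont]].
have c1 (k : C) : bcont (fun=> k) x0 x1 y0 y1.
  by move=> w _; exact: cderiv_ccont (cderiv_cst _ w).
have cq g : bcont g x0 x1 y0 y1 -> bcont (fun w => g w / (w - a)) x0 x1 y0 y1.
  by move=> gc w wb; apply: ccontM (gc w wb) _; apply: ccont_inv_sub; exact: nz.
have [M fM] : exists M, forall w, brect x0 x1 y0 y1 w -> cnorm (f w) <= M.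
  have [c_1 c_2 c_3 c_4] := bcont_cts xx yy fcb.
  have [M1 h1] := cts_bounded xx c_1; have [M2 h2] := cts_bounded xx c_2.
  have [M3 h3] := cts_bounded yy c_3; have [M4 h4] := cts_bounded yy c_4.
  exists (`|M1| + `|M2| + (`|M3| + `|M4|)) => -[u v] [[/= hu hv] wE].
  have := ler_norm M1; have := ler_norm M2; have := ler_norm M3; have := ler_norm M4.
  have := normr_ge0 M1; have := normr_ge0 M2; have := normr_ge0 M3; have := normr_ge0 M4.
  move=> n1 n2 n3 n4 m1 m2 m3 m4; case: wE => [E|[E|[E|E]]]; rewrite /= in E; subst.
  - by have := h3 v hv; rewrite /vcurve; lra.
  - by have := h4 v hv; rewrite /vcurve; lra.
  - by have := h1 u hu; rewrite /hcurve; lra.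
  - by have := h2 u hu; rewrite /hcurve; lra.
have Mq g M' : (forall w, brect x0 x1 y0 y1 w -> cnorm (g w) <= M') ->
    forall w, brect x0 x1 y0 y1 w -> cnorm (g w / (w - a)) <= M' / r.
  move=> gM w wb; rewrite cnormM cnormV; apply: ler_pM; rewrite ?invr_ge0 ?cnorm_ge0 ?gM //.
  by have h := brd w wb; rewrite lef_pV2 // posrE //; apply: lt_le_trans h.
pose W := cauchy_int (fun=> 1) x0 x1 y0 y1.
pose W1 := cauchy_int (fun w => 1 / (w - a)) x0 x1 y0 y1.
pose G1 := cauchy_int (fun w => f w / (w - a)) x0 x1 y0 y1.
have r20 : 0 < r / 2 by rewrite divr_gt0.
have oneM (w : C) : brect x0 x1 y0 y1 w -> cnorm (1 : C) <= 1 by rewrite cnorm1.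
have dW z : cnorm (z - a) < r / 2 -> exists D, cderiv W z D.
  by move=> za; apply: (cauchy_int_derivable xx yy r20 (c1 1) oneM) => w; exact: brz.
have dW1 z : cnorm (z - a) < r / 2 -> exists D, cderiv W1 z D.
  by move=> za; apply: (cauchy_int_derivable xx yy r20 (cq _ (c1 1)) (Mq _ _ oneM)) => w; exact: brz.
have dG1 z : cnorm (z - a) < r / 2 -> exists D, cderiv G1 z D.
  by move=> za; apply: (cauchy_int_derivable xx yy r20 (cq _ fcb) (Mq _ _ fM)) => w; exact: brz.
have Wa : W a != 0 by exact: winding_square_neq0.
have [e e0 eW] : exists2 e, 0 < e & forall z, cnorm (z - a) < e -> W z != 0.
  have [D /cderiv_ccont WC] := dW a aa.
  have Wa0 : 0 < cnorm (W a) by rewrite cnorm_gt0.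
  have [e e0 eP] := WC _ Wa0; exists e => // z /eP h.
  by apply: contraTneq h => ->; rewrite sub0r cnormN ltxx.
have shift g (M' : R) z : bcont g x0 x1 y0 y1 -> cnorm (z - a) < r / 2 ->
    cauchy_int g x0 x1 y0 y1 z = cauchy_int g x0 x1 y0 y1 a
     + (z - a) * cauchy_int (fun w => g w / (w - a)) x0 x1 y0 y1 z.
  move=> gc za.
  have i1 : bcont (fun w => g w / (w - a)) x0 x1 y0 y1 by exact: cq.
  have i2 : bcont (fun w => g w / (w - a) / (w - z)) x0 x1 y0 y1.
    by move=> w wb; apply: ccontM (i1 w wb) _; apply: ccont_inv_sub; exact: nz.
  have i3 : bcont (fun w => (z - a) * (g w / (w - a) / (w - z))) x0 x1 y0 y1.
    by move=> w wb; apply: ccontM (c1 _ w wb) (i2 w wb).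
  rewrite /cauchy_int -rintZ // -rintD //.
  apply: rint_eq => // w wb; field.
  by rewrite !subr_eq0 (nz _ _ za wb) (nz _ _ aa wb).
pose m := Num.min e (r / 2).
have m0 : 0 < m by rewrite lt_min e0.
exists (fun z => (G1 z + (- f a) * W1 z) * (W z)^-1).
  exists m => // z; rewrite lt_min => /andP[ze zr].
  have [D1 H1] := dG1 z zr; have [D2 H2] := dW1 z zr; have [D3 H3] := dW z zr.
  eexists; apply: cderivM; first exact: cderivD H1 (cderivZ _ H2).
  by apply: cderiv_comp H3 (cderivV _); exact: eW.
exists m => // z; rewrite lt_min => /andP[ze zr].
have F u : cnorm (u - a) < r / 2 -> cauchy_int f x0 x1 y0 y1 u = f u * W u.
  case: u => u v ua; apply: cauchy_formula => //.
  - have := normRe_le (u +i* v - a); rewrite ReB /= => h; rewrite /x0 /x1.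
    move: (le_lt_trans h ua); rewrite ltr_norml => /andP[? ?]; apply/andP; split; lra.
  - have := normIm_le (u +i* v - a); rewrite ImB /= => h; rewrite /y0 /y1.
    move: (le_lt_trans h ua); rewrite ltr_norml => /andP[? ?]; apply/andP; split; lra.
have Wz := eW z ze.
apply: (mulIf Wz); rewrite -F // (shift f M) // F // -/G1.
have Wsh : W z = W a + (z - a) * W1 z by exact: (shift (fun=> 1) 1).
rewrite [RHS]mulrDl -(mulrA (z - a)) -(mulrA _ (W z)^-1) mulVf // mulr1 Wsh; ring.
Qed.

(** Induction on the order k of the denominator. For k >= 2 the existence of the limit of x F(a + x)
    forces h(a) = 0, and division by z - a lowers k; for k = 1 the limit is h(a); for k = 0 it is 0.
    One direction of approach is enough because h is continuous. *)
Lemma residue_of_right_limit (F : C^o -> C^o) (a r : C) :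
  meromorphic_at F a ->
  (forall e : R, 0 < e -> exists2 d : R, 0 < d & forall x : R, 0 < x < d ->
     cnorm (x%:C * F (a + x%:C) - r) < e) ->
  is_residue F a r.
Proof.
move=> [k [h [hh FE]]] lim.
suff [g gh gE] : exists2 g : C^o -> C^o, holomorphic_at g a &
    \forall z \near (a : C^o)^', F z = r / (z - a) + g z.
  (* With m = 2 the sum over 2 <= k < m is empty: the pole is at most simple. *)
  exists 2%N, (fun=> 0), g; split => //.
  by apply: filterS gE => z ->; rewrite big_geq // addr0.
have pick (k' : nat) (u : C -> C) (e : R) : ccont u a -> 0 < e ->
    (\forall z \near (a : C^o)^', F z = u z / (z - a) ^+ k') ->
    exists x : R, [/\ 0 < x < e, cnorm (u (a + x%:C) - u a) < e,
      F (a + x%:C) = u (a + x%:C) / x%:C ^+ k' & cnorm (x%:C * F (a + x%:C) - r) < e].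
  move=> uc e0 /near_cball'P[d1 d10 P1].
  have [d2 d20 P2] := uc e e0; have [d3 d30 P3] := lim e e0.
  pose x := Num.min (Num.min (d1 / 2) (d2 / 2)) (Num.min (d3 / 2) (e / 2)).
  have x0 : 0 < x by rewrite !lt_min !divr_gt0.
  have [x1 x2 x3 x4] : [/\ x <= d1 / 2, x <= d2 / 2, x <= d3 / 2 & x <= e / 2].
    by rewrite /x; split; rewrite !ge_min !lexx ?orbT.
  have aE : a + x%:C - a = x%:C by rewrite addrAC subrr add0r.
  have xn : cnorm (a + x%:C - a) = x by rewrite aE cnorm_real gtr0_norm.
  have xa : a + x%:C != a by rewrite -subr_eq0 -cnorm_gt0 xn.
  exists x; split.
  - by rewrite x0; lra.
  - by apply: P2; rewrite xn; lra.
  - by rewrite (P1 (a + x%:C)) ?aE // -aE xn; lra.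
  - by apply: P3; rewrite x0; lra.
have holo_cont (u : C^o -> C^o) : holomorphic_at u a -> ccont u a.
  move=> /near_cballP[d1 d10 P1].
  by apply: cderiv_ccont (derivable_cderiv (P1 a _)); rewrite subrr cnorm0.
(* In the contradictions below, e (A + 1) bounds a quantity close to zero and another e its distance
   to the quantity of modulus B. *)
have small (A B : R) : 0 <= A -> 0 < B -> exists2 e : R, 0 < e <= 1 & e * (2 + A) < B.
  move=> A0 B0; have K0 : 0 < 2 + A by rewrite ltr_wpDr.
  exists (Num.min 1 (B / (2 * (2 + A)))).
    by rewrite ge_min lexx lt_min ltr01 divr_gt0 ?mulr_gt0.
  have : Num.min 1 (B / (2 * (2 + A))) <= B / (2 * (2 + A)) by rewrite ge_min lexx orbT.
  rewrite ler_pdivlMr ?mulr_gt0 // => mB.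
  have {}mB : Num.min 1 (B / (2 * (2 + A))) * (2 + A) <= B / 2.
    by rewrite ler_pdivlMr // -mulrA (mulrC _ 2).
  by apply: le_lt_trans mB _; rewrite ltr_pdivrMr // ltr_pMr // ltr1n.
elim: k h hh FE => [|k IH] h hh FE.
- exists h => //; suff r0 : r = 0.
    by apply: filterS FE => z ->; rewrite expr0 divr1 r0 mul0r add0r.
  apply/eqP; rewrite -cnorm_eq0; apply/negPn/negP => r0.
  have {}r0 : 0 < cnorm r by rewrite lt_def r0 cnorm_ge0.
  have [e /andP[e0 e1] eB] := small _ _ (cnorm_ge0 (h a)) r0.
  have [x [/andP[x0 xe] x1 x2 x3]] := pick _ _ _ (holo_cont _ hh) e0 FE.
  have h2 : cnorm (h (a + x%:C)) <= cnorm (h a) + 1.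
    rewrite (_ : h _ = (h (a + x%:C) - h a) + h a); last by rewrite subrK.
    by apply: le_trans (cnormD _ _) _; rewrite addrC lerD2l; lra.
  have h3 : cnorm (x%:C * F (a + x%:C)) <= e * (cnorm (h a) + 1).
    rewrite x2 expr0 divr1 cnormM cnorm_real gtr0_norm //.
    by apply: ler_pM; rewrite ?cnorm_ge0 // ltW.
  have := cnormD (x%:C * F (a + x%:C)) (r - x%:C * F (a + x%:C)).
  rewrite addrC subrK cdistC; lra.
- have /near_cballP[d1 d10 P1] := hh.
  have dh w : cnorm (w - a) < d1 -> exists D, cderiv h w D.
    by move=> /P1 /derivable_cderiv hd; eexists; exact: hd.
  have [g [d2 d20 gd] [d3 d30 gE]] := holomorphic_quotient d10 dh.
  have gh : holomorphic_at (g : C^o -> C^o) a.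
    by apply/near_cballP; exists d2 => // w /gd[D /cderiv_derivable].
  have /near_cball'P[d4 d40 P4] := FE.
  have FE' : \forall z \near (a : C^o)^', F z = h a / (z - a) ^+ k.+1 + g z / (z - a) ^+ k.
    apply/near_cball'P; exists (Num.min d3 d4); first by rewrite lt_min d30.
    move=> z; rewrite lt_min => /andP[/gE h1 /P4 h2] za; rewrite h2 // h1.
    by rewrite exprS; field; rewrite ?expf_neq0 ?subr_eq0.
  have [k0|k0] := eqVneq k 0%N.
  + suff hr : h a = r.
      exists g => //; apply: filterS FE' => z ->.
      by rewrite k0 expr0 divr1 expr1 hr.
    apply/eqP; rewrite -subr_eq0 -cnorm_eq0; apply/negPn/negP => r0.
    have {}r0 : 0 < cnorm (h a - r) by rewrite lt_def r0 cnorm_ge0.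
    have [x [/andP[x0 xe] x1 x2 x3]] := pick _ _ _ (holo_cont _ hh) (half_gt0 r0) FE.
    have xE : x%:C * F (a + x%:C) = h (a + x%:C).
      rewrite x2 k0 expr1 mulrC divfK //.
      by rewrite -cnorm_eq0 cnorm_real normr_eq0 gt_eqF.
    rewrite xE in x3; have := cnormD (h a - h (a + x%:C)) (h (a + x%:C) - r).
    rewrite addrA subrK cdistC => h1; move: x1 x3; rewrite cdistC (cdistC (h a)) => x1 x3; rewrite (cdistC (h a)) in h1.
    have := cdistC (h a) r; have := cdistC (h (a + x%:C)) (h a); lra.
  + suff h0 : h a = 0.
      apply: (IH g gh); apply: filterS FE' => z ->.
      by rewrite h0 mul0r add0r.
    apply/eqP; rewrite -cnorm_eq0; apply/negPn/negP => r0.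
    have {}r0 : 0 < cnorm (h a) by rewrite lt_def r0 cnorm_ge0.
    have [e /andP[e0 e1] eB] := small _ _ (cnorm_ge0 r) r0.
    have [x [/andP[x0 xe] x1 x2 x3]] := pick _ _ _ (holo_cont _ hh) e0 FE.
    have xn0 : x%:C != 0 by rewrite -cnorm_eq0 cnorm_real normr_eq0 gt_eqF.
    have xE : h (a + x%:C) = x%:C ^+ k * (x%:C * F (a + x%:C)).
      by rewrite x2 exprS; field; rewrite xn0 expf_neq0.
    have h2 : cnorm (x%:C * F (a + x%:C)) <= cnorm r + 1.
      rewrite (_ : x%:C * _ = (x%:C * F (a + x%:C) - r) + r); last by rewrite subrK.
      by apply: le_trans (cnormD _ _) _; rewrite addrC lerD2l; lra.
    have h3 : cnorm (h (a + x%:C)) <= e * (cnorm r + 1).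
      rewrite xE cnormM; apply: ler_pM; rewrite ?cnorm_ge0 //.
      rewrite cnormX cnorm_real gtr0_norm //; case: (k) k0 => // k' _.
      rewrite exprS; apply: le_trans (_ : x * 1 <= _); last by rewrite mulr1 ltW.
      by rewrite ler_wpM2l ?(ltW x0) // exprn_ile1 // ?(ltW x0) //; lra.
    have := cnormD (h (a + x%:C)) (h a - h (a + x%:C)).
    rewrite addrC subrK cdistC; lra.
Qed.

End Residue.

(** * Exponential sums over the cone *)

Section ExponentialSums.
Variable R : realType.

(** The character exp(2 pi i x). *)
Definition ex (x : R) : R[i] := cos (2 * pi * x) +i* sin (2 * pi * x).

Lemma exD x y : ex (x + y) = ex x * ex y.
Proof.
rewrite /ex mulrDr cosD sinD; apply/eqP; rewrite eq_complex /=.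
by apply/andP; split; apply/eqP; ring.
Qed.

Lemma ex0 : ex 0 = 1.
Proof. by rewrite /ex mulr0 cos0 sin0. Qed.

Lemma ex1 : ex 1 = 1.
Proof.
by rewrite /ex mulr1 mulr_natl cos2pi sin2pi.
Qed.

Lemma exMn x (m : nat) : ex (x * m%:R) = ex x ^+ m.
Proof.
elim: m => [|m IH]; first by rewrite mulr0 ex0.
by rewrite -natr1 mulrDr mulr1 exD IH exprSr.
Qed.

Lemma ex_int (m : int) : ex m%:~R = 1.
Proof.
case: m => m.
  by rewrite -pmulrn -[m%:R]mul1r exMn ex1 expr1n.
have h : ex (m.+1%:R - m.+1%:R) = ex m.+1%:R * ex (- m.+1%:R) by rewrite exD.
rewrite NegzE mulrNz -pmulrn; move: h; rewrite subrr ex0.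
by rewrite -{1}[m.+1%:R]mul1r exMn ex1 expr1n mul1r => <-.
Qed.

Lemma cnorm_ex x : cnorm (ex x) = 1.
Proof. by rewrite /cnorm /ex /= cos2Dsin2 sqrtr1. Qed.

Lemma ex_modn (m : nat) (x y : int) : (0 < m)%N -> (m %| x - y)%Z ->
  ex (x%:~R / m%:R) = ex (y%:~R / m%:R).
Proof.
move=> m0 /dvdzP [q E].
have -> : x%:~R / m%:R = y%:~R / m%:R + q%:~R :> R.
  have -> : x = y + q * m by rewrite -E; ring.
  rewrite rmorphD rmorphM /= -pmulrn; field.
  by rewrite pnatr_eq0 -lt0n.
by rewrite exD ex_int mulr1.
Qed.

(** For a nonzero remainder r, the angle pi r / m lies in ]0, pi[, where the sine is positive, so
    cos(2 pi r / m) = 1 - 2 sin^2 is less than 1. *)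
Lemma ex_eq1 (m : nat) (x : int) : (0 < m)%N -> ex (x%:~R / m%:R) = 1 -> (m %| x)%Z.
Proof.
move=> m0 E; have mm : (m%:Z != 0) by rewrite eqz_nat -lt0n.
have : ex ((x %% m)%Z%:~R / m%:R) = 1.
  rewrite -E; apply: ex_modn => //.
  by rewrite {2}(divz_eq x m) opprD addrCA subrr addr0 rpredN dvdz_mull.
have r0 := modz_ge0 x mm; have r1 : (x %% m)%Z < m by apply: ltz_pmod.
have [e _|nd] := eqVneq (x %% m)%Z 0; first exact/dvdz_mod0P.
have rp : 0 < (x %% m)%Z by rewrite lt_neqAle r0 andbT eq_sym.
move: (x %% m)%Z rp r1 => r rp r1; clear -m0 rp r1.
rewrite /ex => -[c1 _]; exfalso.
have mR : 0 < (m%:R : R) by rewrite ltr0n.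
have t0 : 0 < r%:~R / m%:R :> R by rewrite divr_gt0 // ltr0z.
have t1 : r%:~R / m%:R < 1 :> R by rewrite ltr_pdivrMr // mul1r pmulrn ltr_int.
move: (_ / _) t0 t1 c1 => t t0 t1 c1.
have pp : 0 < pi :> R := pi_gt0 R.
have s0 : 0 < sin (pi * t) by apply: sin_gt0_pi; rewrite ?mulr_gt0 // gtr_pMr.
have := cos2Dsin2 (pi * t); have : cos (2 * pi * t) = cos (pi * t) ^+ 2 - sin (pi * t) ^+ 2.
  by rewrite (_ : 2 * pi * t = pi * t + pi * t) ?cosD; ring.
by rewrite c1; nra.
Qed.

Lemma sum_ex_scale (p : nat) (x : int) : (0 < p)%N ->
  \sum_(t < p) ex ((t%:Z * x)%:~R / p%:R) = (if (p %| x)%Z then p%:R else 0).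
Proof.
move=> p0; have E t : ex ((t%:Z * x)%:~R / p%:R) = ex (x%:~R / p%:R) ^+ t.
  by rewrite -exMn rmorphM /= -pmulrn; congr ex; ring.
case: ifP => px.
  rewrite (eq_bigr (fun=> 1)) ?sumr_const ?card_ord // => t _.
  rewrite E (_ : ex _ = 1) ?expr1n // -[RHS](ex_int 0).
  rewrite (@ex_modn p x 0) ?subr0 // mul0r //.
set z := ex (x%:~R / p%:R) in E *.
have z1 : z - 1 != 0.
  by rewrite subr_eq0; apply/negP => /eqP /(ex_eq1 p0); rewrite px.
apply: (mulfI z1); rewrite mulr0 (eq_bigr _ (fun (t : 'I_p) _ => E t)) -subrX1.
have := E p; rewrite (_ : _ / _ = x%:~R :> R).
  by rewrite ex_int => <-; rewrite subrr.
by rewrite rmorphM /= -pmulrn; field; rewrite pnatr_eq0 -lt0n.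
Qed.

Variable n : nat.
Implicit Types (k : 'I_n -> int) (a : 'I_n -> nat).

Definition zdot k a : int := \sum_i k i * (a i)%:Z.

Lemma zdotD k a b : zdot k (fun i => a i + b i)%N = zdot k a + zdot k b.
Proof. by rewrite /zdot -big_split; apply: eq_bigr => i _; rewrite PoszD mulrDr. Qed.

Lemma zdotZ k u a : zdot k (fun i => u * a i)%N = u%:Z * zdot k a.
Proof. by rewrite /zdot mulr_sumr; apply: eq_bigr => i _; rewrite PoszM; ring. Qed.

Lemma zdot_mod k a m : (m %| zdot k (fun i => a i %% m)%N - zdot k a)%Z.
Proof.
rewrite /zdot -sumrB; elim/big_ind: _ => [|x y|i _]; rewrite ?dvdz0 //; first exact: rpredD.
have -> : k i * (a i %% m)%N - k i * a i = - (k i * (a i %/ m)%N) * m.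
  by rewrite {2}(divn_eq (a i) m) PoszD PoszM; ring.
by rewrite dvdz_mull.
Qed.

(** The exponential sum of frequency k / m over the solutions counted by [qcount]. *)
Definition Sg m c k : R[i] := \sum_(a : {ffun 'I_n -> 'I_m})
  (m %| sqs (fun i => a i) + c)%N%:R * ex ((zdot k (fun i => a i))%:~R / m%:R).

Lemma Sg_le m c k : cnorm (Sg m c k) <= (qcount n m c)%:R.
Proof.
apply: le_trans (cnorm_sum _ _ _) _; rewrite /qcount natr_sum; apply: ler_sum => a _.
by rewrite cnormM cnorm_ex mulr1; case: (_ %| _)%N; rewrite ?cnorm1 ?cnorm0.
Qed.

(** With a = q x + m y the phase k.a / (m q) is k.x / m + k.y / q. Modulo q the square (b q)^2
    vanishes, and modulo m the unit q^2 cancels. *)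
Lemma Sg_crt m q b k : (0 < m)%N -> (0 < q)%N -> coprime m q ->
  Sg (m * q) ((b * q) ^ 2) k = Sg m (b ^ 2) k * Sg q 0 k.
Proof.
move=> m0 q0 co; rewrite /Sg.
rewrite (@sum_ffun_crt _ n m q (fun a => (m * q %| sqs a + (b * q) ^ 2)%N%:R *
   ex ((zdot k a)%:~R / (m * q)%N%:R))) // mulr_suml; apply: eq_bigr => x _.
rewrite mulr_sumr; apply: eq_bigr => y _; rewrite sqs_crt //.
have -> : (m %| q ^ 2 * sqs (fun i => x i) + (b * q) ^ 2)%N = (m %| sqs (fun i => x i) + b ^ 2)%N.
  by rewrite expnMn (mulnC (b ^ 2)%N) -mulnDr Gauss_dvdr // coprimeXr.
have -> : (q %| m ^ 2 * sqs (fun i => y i) + (b * q) ^ 2)%N = (q %| sqs (fun i => y i) + 0)%N.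
  have qq : (q %| b ^ 2 * q ^ 2)%N by rewrite dvdn_mull ?dvdn_exp.
  rewrite addn0 expnMn dvdn_addl //.
  by rewrite Gauss_dvdr // coprimeXr // coprime_sym.
have -> : ex ((zdot k (fun i => (q * x i + m * y i) %% (m * q))%N)%:~R / (m * q)%:R) =
    ex ((zdot k (fun i => x i))%:~R / m%:R) * ex ((zdot k (fun i => y i))%:~R / q%:R).
  rewrite (@ex_modn (m * q) _ (zdot k (fun i => q * x i + m * y i)%N)) ?muln_gt0 ?m0 //; last exact: zdot_mod.
  rewrite natrM zdotD !zdotZ -exD rmorphD !rmorphM /= -!pmulrn; congr ex; field.
  by rewrite !pnatr_eq0 -!lt0n q0 m0.
by case: (m %| _)%N; case: (q %| _)%N; rewrite /= ?mul0r ?mulr0 ?mul0r ?mul1r ?mulr0.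
Qed.

Lemma Sg0_crt m q k : (0 < m)%N -> (0 < q)%N -> coprime m q ->
  Sg (m * q) 0 k = Sg m 0 k * Sg q 0 k.
Proof. by move=> m0 q0 co; have := @Sg_crt m q 0 k m0 q0 co; rewrite mul0n. Qed.

Lemma sum_ffun_shift (V : nmodType) m (w : 'I_n -> nat) (F : ('I_n -> nat) -> V) : (0 < m)%N ->
  \sum_(a : {ffun 'I_n -> 'I_m}) F (fun i => a i) =
  \sum_(a : {ffun 'I_n -> 'I_m}) F (fun i => (a i + w i) %% m)%N.
Proof.
move=> m0; pose sh (a : {ffun 'I_n -> 'I_m}) : {ffun 'I_n -> 'I_m} :=
  [ffun i => Ordinal (ltn_pmod (a i + w i) m0)].
have inj : injective sh.
  move=> a b /ffunP E; apply/ffunP => i; apply: val_inj => /=.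
  have := congr1 val (E i); rewrite !ffunE /= => /eqP; rewrite eqn_modDr => /eqP.
  by rewrite !modn_small.
rewrite (reindex_inj inj) /=; apply: eq_bigr => a _; congr F.
by apply/funext => i; rewrite ffunE.
Qed.

(* A nontrivial additive character sums to zero over the group of a with
   b | a^2. *)
Lemma Sg_one b k i0 : n = 1%N -> (0 < b)%N -> coprime b `|k i0| -> cnorm (Sg b 0 k) <= 1.
Proof.
move=> n1 b0 co; have all_i i : i = i0.
  by case: i i0 co => i hi [j hj] _; apply: val_inj => /=; lia.
have sq a : sqs a = (a i0 ^ 2)%N.
  by rewrite /sqs (bigD1 i0) //= big1 ?addn0 // => j; rewrite (all_i j) eqxx.
have zd a : zdot k a = k i0 * (a i0)%:Z.
  by rewrite /zdot (bigD1 i0) //= big1 ?addr0 // => j; rewrite (all_i j) eqxx.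
have [->|S0] := eqVneq (Sg b 0 k) 0; first by rewrite cnorm0 ler01.
apply: le_trans (Sg_le _ _ _) _.
have key (w : {ffun 'I_n -> 'I_b}) : (b %| sqs (fun i => w i) + 0)%N -> w = [ffun=> Ordinal b0].
  move=> hw; have hw' : (b %| w i0 ^ 2)%N by move: hw; rewrite addn0 sq.
  have inv a : (b %| sqs (fun i => (a i + w i) %% b)%N + 0)%N = (b %| sqs a + 0)%N.
    rewrite !addn0 !sq /dvdn modnXm -!/(dvdn b _).
    have sqD : ((a i0 + w i0) ^ 2 = a i0 ^ 2 + (2 * (a i0 * w i0) + w i0 ^ 2))%N by ring.
    have db x y : (b %| x ^ 2)%N -> (b %| y ^ 2)%N -> (b %| x * y)%N.
      by move=> h1 h2; rewrite -(@dvdn_pexp2r _ _ 2) // expnMn -[(b ^ 2)%N]mulnn dvdn_mul.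
    apply/idP/idP => h.
      have : (b %| (a i0 + w i0) * w i0)%N by exact: db.
      rewrite mulnDl mulnn dvdn_addl // => h2.
      by move: h; rewrite sqD dvdn_addl // dvdn_add // dvdn_mull.
    by rewrite sqD dvdn_add // dvdn_add // dvdn_mull // db.
  have E : Sg b 0 k = ex ((zdot k (fun i => w i))%:~R / b%:R) * Sg b 0 k.
    rewrite [LHS](@sum_ffun_shift _ b (fun i => w i) (fun a => (b %| sqs a + 0)%N%:R * ex ((zdot k a)%:~R / b%:R))) //.
    rewrite mulr_sumr; apply: eq_bigr => a _; rewrite inv.
    rewrite (@ex_modn b _ (zdot k (fun i => a i + w i)%N)) //; last exact: zdot_mod.
    by rewrite zdotD rmorphD mulrDl exD; ring.
  have : ex ((zdot k (fun i => w i))%:~R / b%:R) = 1.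
    apply: (mulIf S0); by rewrite mul1r -E.
  move=> /(ex_eq1 b0); rewrite zd dvdzE abszM /= Gauss_dvdr // => bw.
  apply/ffunP => i; apply: val_inj; rewrite ffunE /= (all_i i).
  by apply/eqP; rewrite -leqn0 leqNgt; apply/negP => w0; have := dvdn_leq w0 bw; rewrite leqNgt ltn_ord.
rewrite (ler_nat R _ 1) /qcount.
apply: (@leq_trans (\sum_(a : {ffun 'I_n -> 'I_b}) (a == [ffun=> Ordinal b0]))%N).
  by apply: leq_sum => a _; case: (boolP (b %| _)%N) => // /key ->; rewrite eqxx.
by rewrite (bigD1 [ffun=> Ordinal b0]) //= eqxx big1 // => a /negbTE ->.
Qed.

End ExponentialSums.

Lemma quad_roots p (A B C : nat) : prime p -> ~~ (p %| C)%N ->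
  (\sum_(t < p) (p %| A + B * t + C * t ^ 2) <= 2)%N.
Proof.
move=> pp pC; have chp := pchar_Fp pp.
pose P : {poly 'F_p} := A%:R%:P + B%:R *: 'X + C%:R *: 'X^2.
have ev (t : nat) : P.[t%:R] = (A + B * t + C * t ^ 2)%:R.
  have -> : (A + B * t + C * t ^ 2)%:R = A%:R + B%:R * t%:R + C%:R * t%:R ^+ 2 :> 'F_p.
    by rewrite -natrX -!natrM -!natrD.
  by rewrite /P !hornerE.
have C0 : (C%:R : 'F_p) != 0 by rewrite -(dvdn_pcharf chp).
have sz : size P = 3.
  rewrite /P addrC size_polyDl; first by rewrite size_scale // size_polyXn.
  rewrite size_scale // size_polyXn; apply: leq_ltn_trans (size_polyD _ _) _.
  rewrite gtn_max; apply/andP; split; first by apply: leq_ltn_trans (size_polyC_leq1 _) _.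
  by apply: leq_ltn_trans (size_scale_leq _ _) _; rewrite size_polyX.
have P0 : P != 0 by rewrite -size_poly_gt0 sz.
have -> : (\sum_(t < p) (p %| A + B * t + C * t ^ 2) = \sum_(x : 'F_p) (root P x))%N.
  rewrite (sum_F_ord pp (fun x => nat_of_bool (root P x))); apply: eq_bigr => t _.
  by rewrite rootE ev (dvdn_pcharf chp).
have -> : (\sum_(x : 'F_p) (root P x) = size (enum [pred x | root P x]))%N.
  by rewrite -cardE -sum1_card [RHS]big_mkcond /=; apply: eq_bigr => x _; rewrite inE; case: (root P x).
suff : (size (enum [pred x | root P x]) < 3)%N by [].
rewrite -[3%N]sz; apply: max_poly_roots P0 _ (enum_uniq _).
by apply/allP => x; rewrite mem_enum inE.
Qed.

Lemma Posz_sum n (f : 'I_n -> nat) : (\sum_i f i)%N%:Z = \sum_i (f i)%:Z.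
Proof. by rewrite -natz natr_sum; apply: eq_bigr => i _; rewrite natz. Qed.

(** * Exponential sums modulo a prime *)

Section PrimeSums.
Variables (n p : nat).
Hypothesis pp : prime p.
Implicit Types (k w : 'I_n -> int) (a : 'I_n -> nat).

Definition red w : 'I_n -> nat := fun i => `|(w i %% p)%Z|%N.

Let p0 : (0 < p)%N := prime_gt0 pp.

Lemma redE w i : (red w i)%:Z = (w i %% p)%Z.
Proof. by rewrite /red gez0_abs // modz_ge0 // eqz_nat -lt0n. Qed.

Lemma red_dvd w i : (p %| (red w i)%:Z - w i)%Z.
Proof.
rewrite redE {2}(divz_eq (w i) p) opprD addrCA subrr addr0.
by rewrite rpredN dvdz_mull.
Qed.

Lemma dvdz_sub_iff (d x y : int) : (d %| x - y)%Z -> (d %| x)%Z = (d %| y)%Z.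
Proof. by move=> h; rewrite -(rpredBr _ h) ?subKr //; rewrite -[x in LHS](subrK y) rpredDl. Qed.

Lemma dvdz_sumB (f g : 'I_n -> int) : (forall i, (p %| f i - g i)%Z) ->
  (p %| \sum_i f i - \sum_i g i)%Z.
Proof. by move=> h; rewrite -sumrB; apply: rpred_sum => i _. Qed.

Definition slice k : nat :=
  \sum_(a : {ffun 'I_n -> 'I_p}) ((p %| sqs (fun i => a i))%N && (p %| zdot k (fun i => a i))%Z).

(* Translating along a nonisotropic direction w orthogonal to k meets the
   cone |a|^2 = 0 at most twice. *)
Lemma slice_le k w : ~~ (p %| \sum_i w i ^+ 2)%Z -> (p %| \sum_i k i * w i)%Z ->
  (p * slice k <= 2 * \sum_(a : {ffun 'I_n -> 'I_p}) (p %| zdot k (fun i => a i))%Z)%N.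
Proof.
move=> pw kw; pose v := red w.
have pv : ~~ (p %| sqs v)%N.
  apply: contra pw => h; rewrite -(@dvdz_sub_iff _ (\sum_i (v i)%:Z ^+ 2)).
    rewrite (_ : \sum_i _ = (sqs v)%:Z) ?dvdzE //.
    by rewrite /sqs Posz_sum; apply: eq_bigr => i _; rewrite -mulnn PoszM -expr2.
  by apply: dvdz_sumB => i; rewrite subr_sqr dvdz_mulr // red_dvd.
have kv : (p %| zdot k v)%Z.
  rewrite (@dvdz_sub_iff _ _ (\sum_i k i * w i)) //.
  by apply: dvdz_sumB => i; rewrite -mulrBr dvdz_mull // red_dvd.
pose F a := nat_of_bool ((p %| sqs a)%N && (p %| zdot k a)%Z).
have FE (t : nat) a : F (fun i => (a i + t * v i) %% p)%N =
   ((p %| sqs a + 2 * (\sum_i a i * v i) * t + sqs v * t ^ 2)%N && (p %| zdot k a)%Z :> nat).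
  rewrite /F; congr (nat_of_bool (_ && _)).
    apply: dvdn_mod; rewrite (@sqs_mod _ _ _ (fun i => a i + t * v i)%N) => [|i]; last by rewrite modn_mod.
    congr (_ %% _)%N; rewrite /sqs !big_distrr /= !big_distrl /= -!big_split /=.
    by apply: eq_bigr => i _; ring.
  rewrite (dvdz_sub_iff (zdot_mod _ _ _)) zdotD zdotZ.
  by rewrite rpredDr // dvdz_mull.
have -> : (p * slice k = \sum_(t < p) \sum_(a : {ffun 'I_n -> 'I_p}) F (fun i => (a i + t * v i) %% p))%N.
  rewrite -[X in (X * _)%N](card_ord p) -sum_nat_const; apply: eq_bigr => t _.
  exact: (@sum_ffun_shift n nat p (fun i => t * v i)%N F p0).
rewrite exchange_big /= big_distrr /=; apply: leq_sum => a _.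
rewrite (eq_bigr (fun t : 'I_p => (p %| sqs (fun i => a i) + 2 * (\sum_i a i * v i) * t + sqs v * t ^ 2)%N *
  (p %| zdot k (fun i => a i))%Z)%N) => [|t _]; last by rewrite FE mulnb.
by rewrite -big_distrl /= leq_mul2r quad_roots ?orbT.
Qed.

Lemma zdot0 a : zdot (fun=> 0) a = 0.
Proof. by rewrite /zdot big1 // => i _; rewrite mul0r. Qed.

Variable R : realType.

(** The cone modulo p is invariant under scaling, so all frequencies t k with t nonzero modulo p
    give the same sum. Summing over t detects the hyperplane k.a = 0 and expresses the exponential
    sum through the count on it. *)
Lemma slice_scale k : (p%:R * (slice k)%:R)%:C = (qcount n p 0)%:R%:C + (p.-1)%:R%:C * Sg R p 0 k :> R[i].
Proof.
transitivity (\sum_(t < p) \sum_(a : {ffun 'I_n -> 'I_p})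
   (p %| sqs (fun i => a i) + 0)%N%:R * ex ((t%:Z * zdot k (fun i => a i))%:~R / p%:R : R)).
  rewrite exchange_big /= rmorphM /= !rmorph_nat /slice natr_sum mulr_sumr.
  apply: eq_bigr => a _; rewrite -mulr_sumr sum_ex_scale // addn0.
  by case: (p %| sqs _)%N; case: (p %| zdot _ _)%Z; rewrite /= ?mulr1 ?mul1r ?mulr0 ?mul0r.
have -> : p.-1%:R%:C = \sum_(1 <= t < p) 1 :> R[i].
  by rewrite big_const_nat subn1 iter_addr_0 rmorph_nat.
rewrite -(big_mkord xpredT (fun t => \sum_(a : {ffun 'I_n -> 'I_p})
   (p %| sqs (fun i => a i) + 0)%N%:R * ex ((t%:Z * zdot k (fun i => a i))%:~R / p%:R : R))).
rewrite big_ltn //; congr (_ + _).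
  rewrite /qcount rmorph_nat natr_sum; apply: eq_bigr => a _.
  by rewrite mul0r mul0r ex0 mulr1.
rewrite mulr_suml !big_nat; apply: eq_bigr => t /andP[t0 tp]; rewrite mul1r.
have co : coprime p t by rewrite prime_coprime // gtnNdvd.
rewrite [RHS](@sum_ffun_scale _ n p t (fun a => (p %| sqs a + 0)%N%:R * ex ((zdot k a)%:~R / p%:R : R))) //.
apply: eq_bigr => a _; congr (_ * _).
  rewrite (_ : (p %| sqs (fun i => a i) + 0)%N = (p %| sqs (fun i => (t * a i) %% p) + 0)%N) //.
  rewrite !addn0 (@dvdn_mod p (sqs (fun i => (t * a i) %% p)%N) (sqs (fun i => t * a i)%N)).
    by rewrite sqsZ Gauss_dvdr // coprimeXr.
  by apply: sqs_mod => i; rewrite modn_mod.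
by rewrite -zdotZ; apply/esym/ex_modn => //; exact: zdot_mod.
Qed.

End PrimeSums.

(** By [slice_scale] the sum is (p |slice| - N) / (p - 1). By [slice_le], for the frequency k and
    for the frequency 0, both terms of the numerator are at most 2 p^(m+1). The result is one factor
    p better than the trivial bound. *)
Lemma Sg_prime (R : realType) m p (k w : 'I_m.+2 -> int) i0 : prime p -> odd p ->
  ~~ (p %| k i0)%Z -> ~~ (p %| \sum_i w i ^+ 2)%Z -> (p %| \sum_i k i * w i)%Z ->
  cnorm (Sg R p 0 k) <= 3 * p%:R ^+ m /\ (qcount m.+2 p 0 <= 2 * p ^ m.+1)%N.
Proof.
move=> pp podd pk pw kw; have p0 := prime_gt0 pp.
have p3 : (2 < p)%N by have := prime_gt1 pp; clear -podd; case: p podd => [|[|[|]]].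
have cU : (\sum_(a : {ffun 'I_m.+2 -> 'I_p}) (p %| zdot k (fun i => a i))%Z = p ^ m.+1)%N.
  rewrite -(@lin_count m.+1 p 0 (red p k) i0) //; last first.
    apply: contra pk => h; rewrite -(dvdz_sub_iff (red_dvd pp k i0)) dvdzE //.
  apply: eq_bigr => a _; congr nat_of_bool; rewrite add0n.
  rewrite -(@dvdz_sub_iff p (\sum_i red p k i * a i)%N%:Z); first by rewrite dvdzE.
  rewrite /zdot Posz_sum; apply: dvdz_sumB => i.
  by rewrite PoszM -mulrBl dvdz_mulr // red_dvd.
have H := slice_le pp pw kw; rewrite cU in H.
have {H}hH : (slice p k <= 2 * p ^ m)%N.
  by rewrite -(leq_pmul2l p0); apply: leq_trans H _; rewrite expnS mulnCA.
have N0 : slice p (fun _ : 'I_m.+2 => 0 : int) = qcount m.+2 p 0.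
  rewrite /slice /qcount; apply: eq_bigr => a _.
  by rewrite zdot0 dvdz0 andbT addn0.
have := slice_le pp pw (_ : (p %| \sum_i (fun _ : 'I_m.+2 => 0 : int) i * w i)%Z).
rewrite big1 ?dvdz0 => [|i _]; last by rewrite mul0r.
move=> /(_ isT); rewrite N0 (eq_bigr (fun=> 1%N)) => [|a _]; last by rewrite zdot0 dvdz0.
rewrite sum1_card card_ffun !card_ord => hN.
have {}hN : (qcount m.+2 p 0 <= 2 * p ^ m.+1)%N.
  by rewrite -(leq_pmul2l p0); apply: leq_trans hN _; rewrite (expnS p m.+1) mulnCA.
split=> //; have E := slice_scale pp R k.
have pm : 0 < p.-1%:R :> R by rewrite ltr0n; clear -p3; lia.
have {E}E : Sg R p 0 k = ((p%:R * (slice p k)%:R - (qcount m.+2 p 0)%:R) / p.-1%:R)%:C.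
  rewrite rmorphM fmorphV rmorphB /= E addrAC subrr add0r mulrC mulKf //.
  by rewrite (inj_eq (@complexI R) _ 0) gt_eqF.
rewrite E cnorm_real normrM normfV (ger0_norm (ltW pm)) ler_pdivrMr //.
have b1 : (p%:R * (slice p k)%:R : R) <= 2 * p%:R ^+ m.+1.
  rewrite exprS mulrCA ler_wpM2l ?ler0n // -natrX -natrM ler_nat //.
have b2 : ((qcount m.+2 p 0)%:R : R) <= 2 * p%:R ^+ m.+1 by rewrite -natrX -natrM ler_nat.
have b3 : 2 * p%:R ^+ m.+1 <= 3 * p%:R ^+ m * p.-1%:R :> R.
  rewrite -!natrX -!natrM ler_nat expnS mulnA (mulnAC 3) leq_mul2r.
  by apply/orP; right; clear -p3; lia.
have c1 : 0 <= p%:R * (slice p k)%:R :> R by rewrite mulr_ge0.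
have c2 : 0 <= (qcount m.+2 p 0)%:R :> R by [].
apply: le_trans b3; rewrite ler_norml; move: b1 b2 c1 c2; clear.
move: (_ * (slice p k)%:R) (_ ^+ m.+1) ((qcount _ _ _)%:R) => x z y b1 b2 c1 c2.
by apply/andP; split; lra.
Qed.

Lemma seq_le_esum (R : realType) (T : choiceType) (I : set T) (a : T -> \bar R) (s : seq T) :
  uniq s -> (forall i, i \in s -> I i) -> (\sum_(i <- s) a i <= \esum_(i in I) a i)%E.
Proof. by move=> us sI; rewrite fsbig_seq //; apply: fsum_le_esum => //; exact: finite_seq. Qed.

(** * Summing the exponential sums over b *)

Section ExpSumBound.
Variable R : realType.
Implicit Types (s : R).

Lemma Nb_le n e x : (Nb n e x <= e ^ n * qcount n x 0)%N.
Proof.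
rewrite /Nb /qcount (@sum_nat_eqm n _ _ (fun a => nat_of_bool (e * x %| sqs a + x ^ 2)%N) (mulnC e x)).
rewrite (@sum_nat_lift n x e (fun a => nat_of_bool (e * x %| sqs a + x ^ 2)%N)) big_distrr /=.
apply: leq_sum => a _.
apply: (@leq_trans (\sum_(y : {ffun 'I_n -> 'I_e}) (x %| sqs (fun i => a i) + 0)%N)%N); last first.
  by rewrite sum_nat_const card_ffun !card_ord.
apply: leq_sum => y _; case E: (e * x %| _)%N => //.
have {E} : (x %| sqs (fun i => a i + x * y i)%N + x ^ 2)%N by apply: dvdn_trans E; rewrite dvdn_mull.
rewrite dvdn_addl ?dvdn_exp // sqs_lift addn0 !dvdn_addl => [->//||].
  by rewrite (mulnC 2) -mulnA dvdn_mulr.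
by rewrite -mulnn -mulnA dvdn_mulr.
Qed.

Lemma powR_natM (x y : nat) s : (x * y)%:R `^ s = x%:R `^ s * y%:R `^ s :> R.
Proof. by rewrite natrM powRM. Qed.

Lemma powR_antiN (b : nat) s t : (0 < b)%N -> s <= t -> b%:R `^ (- t) <= b%:R `^ (- s) :> R.
Proof. by move=> b0 st; apply: ler_powR; rewrite ?ler1n // lerN2. Qed.

Lemma Sg1 n (k : 'I_n -> int) : cnorm (Sg R 1 0 k) = 1.
Proof.
rewrite /Sg (eq_bigr (fun=> 1)) => [|a _].
  by rewrite sumr_const card_ffun !card_ord exp1n cnorm1.
by rewrite dvd1n mul1r divr1 ex_int.
Qed.

Definition Lloc n p : R := if p == 2%N then Ltwo n (2 `^ (- n%:R)) else Lodd n p (p%:R `^ (- n%:R)).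

Lemma Lloc_esum n p : (0 < n)%N -> prime p ->
  (\esum_(j in [set: nat]) ((qcount n (p ^ j) 0)%:R * (p ^ j)%:R `^ (- n%:R))%:E = (Lloc n p)%:E)%E.
Proof.
move=> n0 pp; rewrite /Lloc.
under eq_esum => j _ do rewrite powR_exp ?prime_gt0 //.
by case: (even_prime pp) => [->|podd]; [rewrite Ltwo_esumR|rewrite ifN ?Lodd_esumR //; case: eqP podd => [->|]].
Qed.

Lemma Lloc_ge1 n p : (0 < n)%N -> prime p -> 1 <= Lloc n p.
Proof.
move=> n0 pp; apply: (@local_ge1 R n p (p%:R `^ (- n%:R))); first exact: powR_ge0.
by rewrite -Lloc_esum //; apply: eq_esum => j _; rewrite powR_exp ?prime_gt0.
Qed.

Lemma prod_ge1_le (Z : nat -> R) q P : (forall p, prime p -> 1 <= Z p) ->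
  (forall p, prime p -> (q < p)%N -> Z p = 1) ->
  \prod_(p < P | prime p) Z p <= \prod_(p < q.+1 | prime p) Z p.
Proof.
move=> Z1 Zq.
have Zge M N : 1 <= \prod_(M <= p < N | prime p) Z p.
  apply: (big_ind (fun x : R => 1 <= x)) => // x y x1 y1.
  by rewrite (le_trans x1) // ler_peMr // (le_trans ler01).
rewrite -!(big_mkord prime).
have [Pq|qP] := leqP P q.+1.
  rewrite (big_cat_nat (leq0n P) Pq) /= ler_peMr //.
  by apply: le_trans ler01 (Zge _ _).
rewrite (big_cat_nat (leq0n q.+1) (ltnW qP)) /= [X in _ * X]big_nat_cond [X in _ * X]big1 ?mulr1 //.
by move=> p /andP[/andP[qp _] pp]; apply: Zq.
Qed.

(** Only the finitely many primes dividing q occur, so the trivial bound on the exponential sums is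
    affordable here. *)
Lemma smooth_part n q : (0 < n)%N -> (0 < q)%N -> exists2 X : R, 0 <= X &
  (\esum_(x in [set x | \pi(q).-nat x]) ((qcount n x 0)%:R * x%:R `^ (- n%:R))%:E <= X%:E)%E.
Proof.
move=> n0 q0; pose Z p := if (p %| q)%N then Lloc n p else 1.
have Z1 p : prime p -> 1 <= Z p by rewrite /Z; case: ifP => // _ pp; exact: Lloc_ge1.
pose f x : R := (\pi(q).-nat x)%:R * ((qcount n x 0)%:R * x%:R `^ (- n%:R)).
exists (\prod_(p < q.+1 | prime p) Z p).
  by apply: prodr_ge0 => p pp; apply: le_trans ler01 (Z1 _ pp).
apply: (@le_trans _ _ (\esum_(b in [set b | (0 < b)%N]) (f b)%:E)%E).
  rewrite (eq_esum (b := fun b => (f b)%:E)) => [|b bq]; last by rewrite /f [pnat _ _]bq mul1r.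
  by apply: esum_subset => b bq; by case/andP: bq.
apply: (@euler_le R f Z) => [b||x y x0 y0 xy|p pp|P].
- by rewrite /f !mulr_ge0 ?powR_ge0.
- by rewrite /f qcount_1 powR1 !mulr1.
- by rewrite /f pnatM qcount_crt // natrM powR_natM -mulnb natrM; ring.
- rewrite /Z; case: ifP => pq.
    rewrite -Lloc_esum //; apply: eq_esum => j _; rewrite /f.
    have pi_p : p \in \pi(q) by rewrite inE /= mem_primes pp q0 pq.
    by rewrite (@pi_pnat _ p) ?mul1r ?pnatX ?pnat_id.
  rewrite (esumID [set 0%N]); last by move=> i _; rewrite lee_fin /f !mulr_ge0 ?powR_ge0.
  rewrite (setTI [set 0%N]) esum_set1; last by rewrite lee_fin /f !mulr_ge0 ?powR_ge0.
  rewrite esum1 ?adde0; first by rewrite /f expn0 qcount_1 powR1 !mulr1.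
  move=> [|j] [_ /= jn0]; first by case: jn0.
  have /negPf h : p \notin \pi(q) by rewrite inE /= mem_primes pp q0 pq.
  by rewrite /f pnatX pnatE // orbF h mul0r.
- by apply: prod_ge1_le => // p pp qp; rewrite /Z gtnNdvd.
Qed.

(** Only the term j = 1 is improved over the trivial majorant v: the saving is known modulo p but
    not modulo its higher powers. *)
Lemma esum_bump (u v : nat -> R) (L a : R) : (forall j, 0 <= u j) -> (forall j, u j <= v j) ->
  (\esum_(j in [set: nat]) (v j)%:E = L%:E)%E -> u 1%N <= a ->
  exists2 Z, (\esum_(j in [set: nat]) (u j)%:E = Z%:E)%E & 0 <= Z <= L - v 1%N + a.
Proof.
move=> u0 uv vL ua.
have v0 j : 0 <= v j by apply: le_trans (u0 j) (uv j).
have spl (w : nat -> R) : (forall j, 0 <= w j) -> (\esum_(j in [set: nat]) (w j)%:E =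
    (w 1%N)%:E + \esum_(j in [set: nat] `&` ~` [set 1%N]) (w j)%:E)%E.
  move=> w0; rewrite (esumID [set 1%N]); last by move=> j _; rewrite lee_fin.
  by rewrite (setTI [set 1%N]) esum_set1 // lee_fin.
have le1 : (\esum_(j in [set: nat] `&` ~` [set 1%N]) (u j)%:E <=
            \esum_(j in [set: nat] `&` ~` [set 1%N]) (v j)%:E)%E.
  by apply: le_esum => j _; rewrite lee_fin.
have ge0 : (0 <= \esum_(j in [set: nat] `&` ~` [set 1%N]) (u j)%:E)%E.
  by apply: esum_ge0 => j _; rewrite lee_fin.
move: vL le1 ge0; rewrite (spl u u0) (spl v v0).
case: (\esum_(j in _) (v j)%:E)%E => [V||] //= [<-].
case: (\esum_(j in _) (u j)%:E)%E => [U||] //=; rewrite !lee_fin => UV U0.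
by exists (u 1%N + U); [rewrite EFinD|have := u0 1%N => h; apply/andP; split; lra].
Qed.

(** Put z = 1/p, so y <= z^2. Without its term j = 1 the trivial local series is 1 + O(z^2), and the
    improved term a is at most 3 z^2; the constant 10 is generous. *)
Lemma Lodd_tail n p (a y : R) : (2 < p)%N -> y = (p%:R ^+ n)^-1 -> (1 < n)%N ->
  (pcount n p p)%:R + 1 <= 2 * p%:R ^+ n.-1 :> R -> a <= 3 * p%:R ^+ n.-2 * y ->
  Lodd n p y - ((pcount n p p)%:R + 1) * y + a <= 1 + 10 * (p%:R ^+ 2)^-1.
Proof.
move=> p3 yE n1 hP ha; rewrite /Lodd.
case: n n1 yE hP ha => [//|[//|m _]] /= yE hP ha.
have q3 : 3 <= p%:R :> R by rewrite ler_nat.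
have P0 : 0 <= (pcount m.+2 p p)%:R :> R by [].
move: P0 hP; move: (pcount m.+2 p p)%:R => P P0 hP.
move: q3 yE hP ha; move: (p%:R : R) => q q3 yE hP ha.
have q0 : q != 0 by apply: lt0r_neq0; lra.
have qm : q ^+ m != 0 by rewrite expf_neq0.
have Qm : 1 <= q ^+ m by apply: exprn_ege1; lra.
have [z zE] : exists z, z = q^-1 by exists q^-1.
have z0 : 0 < z by rewrite zE invr_gt0; lra.
have z3 : z <= 3^-1 by rewrite zE lef_pV2 ?posrE; lra.
have [x xE] : exists x, x = (q ^+ m)^-1 by exists (q ^+ m)^-1.
have x0 : 0 < x by rewrite xE invr_gt0; lra.
have x1 : x <= 1 by rewrite xE invf_le1; lra.
have yz : y = x * z ^+ 2 by rewrite yE xE zE !exprS expr0; field; rewrite q0.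
have e1 : q ^+ m.+1 * y = z by rewrite yz xE zE !exprS expr0; field; rewrite q0.
have e2 : q ^+ m.+2 * y ^+ 2 = y by rewrite yz xE zE !exprS expr0; field; rewrite q0.
have ha' : a <= 3 * z ^+ 2.
  by move: ha; rewrite yz (_ : 3 * q ^+ m * (x * z ^+ 2) = 3 * z ^+ 2) // xE; field.
have y0 : 0 < y by rewrite yz mulr_gt0 // exprn_gt0.
have yz2 : y <= z ^+ 2 by rewrite yz ler_piMl // exprn_ge0 // ltW.
have Py : (P + 1) * y <= 2 * z.
  by rewrite -e1 mulrA ler_wpM2r // ltW.
have -> : (q ^+ 2)^-1 = z ^+ 2 by rewrite zE exprVn.
have -> : q ^+ m.+2 * y ^+ 2 = y by [].
have -> : q ^+ m.+1 * y = z by [].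
have y9 : y <= 9^-1.
  by apply: le_trans yz2 _; nra.
have h1y : 0 < 1 - y by lra.
have h1z : 0 < 1 - z by lra.
suff : (1 + y + P * y / (1 - z)) / (1 - y) <= 1 + (P + 1) * y + 6 * z ^+ 2 by lra.
rewrite ler_pdivrMr //.
have t1 : P * y / (1 - z) <= P * y + 3 * z ^+ 2.
  rewrite ler_pdivrMr //.
  have : P * y <= 2 * z by lra.
  move: (P * y) => t tz; have := mulr_ge0 (ltW z0) (ltW z0); nra.
have t2 : (P + 1) * y * y <= z ^+ 2 by nra.
have := mulr_ge0 (ltW z0) (ltW z0); nra.
Qed.

(** Each Euler factor is at most exp(10 / p^2), by [Sg_prime] at the first power and the trivial
    bound above it, so the product is at most exp(10 zeta(2)), already at s = n. *)
Lemma coprime_part m q (k w : 'I_m.+2 -> int) i0 : (0 < q)%N -> (2 %| q)%N ->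
  (`|k i0| %| q)%N -> (`|(\sum_i w i ^+ 2)%R| %| q)%N -> \sum_i k i * w i = 0 ->
  exists2 Y : R, 0 <= Y &
  (\esum_(y in [set y | (0 < y)%N /\ coprime q y]) (cnorm (Sg R y 0 k) * y%:R `^ (- m.+2%:R))%:E <= Y%:E)%E.
Proof.
move=> q0 q2 qk qw kw; pose n := m.+2.
pose f y : R := (coprime q y)%:R * (cnorm (Sg R y 0 k) * y%:R `^ (- n%:R)).
have f0 b : 0 <= f b by rewrite /f !mulr_ge0 ?powR_ge0 ?cnorm_ge0.
have loc p : prime p -> exists2 Z : R, (\esum_(j in [set: nat]) (f (p ^ j)%N)%:E = Z%:E)%E &
    0 <= Z <= expR (10 * (p%:R ^+ 2)^-1).
  move=> pp; have [pq|pq] := boolP (p %| q)%N.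
    exists 1; last by rewrite ler01 /= -expR0 ler_expR mulr_ge0 ?invr_ge0 ?exprn_ge0.
    rewrite (esumID [set 0%N]); last by move=> i _; rewrite lee_fin.
    rewrite (setTI [set 0%N]) esum_set1 ?lee_fin // esum1 ?adde0; first by rewrite /f expn0 coprimen1 Sg1 powR1 !mulr1.
    move=> [|j] [_ /= jn0]; first by case: jn0.
    by rewrite /f coprime_sym coprime_pexpl // prime_coprime // pq mul0r.
  have podd : odd p by case: (even_prime pp) => // E; move: pq; rewrite E q2.
  have p3 : (2 < p)%N by have := prime_gt1 pp; clear -podd; case: p podd => [|[|[|]]].
  have pk : ~~ (p %| k i0)%Z by apply: contra pq => h; apply: dvdn_trans qk; rewrite dvdzE in h.
  have pw : ~~ (p %| \sum_i w i ^+ 2)%Z by apply: contra pq => h; apply: dvdn_trans qw; rewrite dvdzE in h.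
  have [S1 N1] := @Sg_prime R m p k w i0 pp podd pk pw (etrans (congr1 (fun z => (p %| z)%Z) kw) (dvdz0 _)).
  have cop j : coprime q (p ^ j) by rewrite coprimeXr // coprime_sym prime_coprime.
  have fE j : f (p ^ j)%N = cnorm (Sg R (p ^ j) 0 k) * (p%:R `^ (- n%:R)) ^+ j.
    by rewrite /f cop mul1r powR_exp ?prime_gt0.
  have yE : p%:R `^ (- n%:R) = (p%:R ^+ n)^-1 :> R by rewrite powRN powR_mulrn.
  have L := @Lodd_esumR R n p n%:R pp podd isT (lexx _).
  have [j|j||Z hZ /andP[Z0 ZL]] := @esum_bump (fun j => f (p ^ j)%N) (fun j => (qcount n (p ^ j) 0)%:R * (p%:R `^ (- n%:R)) ^+ j)
    _ (3 * p%:R ^+ m * p%:R `^ (- n%:R)) _ _ L _.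
  - exact: f0.
  - by rewrite fE ler_wpM2r ?exprn_ge0 ?powR_ge0 // Sg_le.
  - by rewrite fE expn1 expr1 ler_wpM2r // powR_ge0.
  exists Z => //; rewrite Z0 /=; apply: le_trans ZL _.
  apply: le_trans (expR_ge1Dx _); rewrite expn1 expr1 qcount_primitive1 ?prime_gt1 // natrD.
  apply: Lodd_tail => //.
  have -> : (pcount n p p)%:R + 1 = (qcount n p 0)%:R :> R by rewrite qcount_primitive1 ?prime_gt1 // natrD.
  by rewrite -natrX -natrM ler_nat.
pose Z p := if prime p =P true is ReflectT h then sval (cid2 (loc p h)) else 0.
have ZE p : prime p -> (\esum_(j in [set: nat]) (f (p ^ j)%N)%:E = (Z p)%:E)%E /\
    0 <= Z p <= expR (10 * (p%:R ^+ 2)^-1).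
  by rewrite /Z; case: eqP => // h _; case: (cid2 (loc p h)).
exists (expR (10 * zeta (2 : R))); first exact: expR_ge0.
apply: (@le_trans _ _ (\esum_(b in [set b | (0 < b)%N]) (f b)%:E)%E).
  rewrite (eq_esum (b := fun b => (f b)%:E)) => [|b [_ bq]]; last by rewrite /f bq mul1r.
  by apply: esum_subset => b [].
apply: (@euler_le R f Z) => // [|x y x0 y0 xy|p pp|P].
- by rewrite /f coprimen1 Sg1 powR1 !mulr1.
- by rewrite /f coprimeMr Sg0_crt // cnormM powR_natM -mulnb natrM; ring.
- by case: (ZE p pp).
apply: (@le_trans _ _ (\prod_(p < P | prime p) expR (10 * (p%:R ^+ 2)^-1))).
  by apply: ler_prod => p pp; case: (ZE p pp).
rewrite -expR_sum ler_expR -mulr_sumr ler_wpM2l //.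
rewrite -lee_fin -zeta_esum; last by rewrite ltr1n.
rewrite -(big_mkord prime (fun i => i%:R ^- 2)) /index_iota subn0 -big_filter.
rewrite -sumEFin (eq_bigr (fun i : nat => (i%:R `^ (- 2))%:E : \bar R)) => [|i _]; last by rewrite powRN (powR_mulrn 2).
apply: seq_le_esum => [|b /=]; first by rewrite filter_uniq ?iota_uniq.
rewrite mem_filter => /andP[pp _].
exact: prime_gt0.
Qed.

(** Write b = x y with x built from primes of q and y prime to q. The sum modulo e x is bounded
    trivially, and the sum modulo y no longer involves b^2. *)
Lemma Sg_sum_split n e q (k : 'I_n -> int) s (X Y : R) : (0 < e)%N -> (0 < q)%N -> (e %| q)%N ->
  0 <= X -> n%:R <= s ->
  (\esum_(x in [set x | \pi(q).-nat x]) ((qcount n x 0)%:R * x%:R `^ (- n%:R))%:E <= X%:E)%E ->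
  (\esum_(y in [set y | (0 < y)%N /\ coprime q y]) (cnorm (Sg R y 0 k) * y%:R `^ (- s))%:E <= Y%:E)%E ->
  (\esum_(b in [set b | (0 < b)%N]) (cnorm (Sg R (e * b) (b ^ 2) k) * b%:R `^ (- s))%:E
     <= ((e ^ n)%:R * X * Y)%:E)%E.
Proof.
move=> e0 q0 eq X0 ns hX hY.
pose F x := (((e ^ n)%:R%:E : \bar R) * ((qcount n x 0)%:R * x%:R `^ (- n%:R))%:E)%E.
pose G y := (cnorm (Sg R y 0 k) * y%:R `^ (- s))%:E.
have F0 x : (0 <= F x)%E by rewrite /F -EFinM lee_fin !mulr_ge0 ?powR_ge0.
have G0 y : (0 <= G y)%E by rewrite /G lee_fin mulr_ge0 ?powR_ge0 ?cnorm_ge0.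
apply: le_trans (@le_esum_partn R \pi(q) _ [set y | (0 < y)%N /\ coprime q y] _ F G _ _ _ F0 G0 _) _.
- by move=> b.
- by move=> y [y0]; rewrite coprime_pi'.
- move=> x y hx hy /=; have x0 : (0 < x)%N by case/andP: hx.
  rewrite muln_gt0 x0 /=.
  split=> [y0|[] //]; split=> //; by rewrite coprime_pi'.
- move=> x y hx [y0 qy]; rewrite /F /G -!EFinM lee_fin.
  have x0 : (0 < x)%N by case/andP: hx.
  have xy : coprime (e * x) y.
    rewrite coprimeMl (coprime_dvdl eq qy) /=.
    by apply: (pnat_coprime hx); rewrite -coprime_pi'.
  rewrite mulnA Sg_crt ?muln_gt0 ?e0 // cnormM powR_natM.
  rewrite (mulrACA _ _ (x%:R `^ _)) ler_wpM2r ?mulr_ge0 ?powR_ge0 ?cnorm_ge0 // mulrA.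
  apply: ler_pM; rewrite ?cnorm_ge0 ?powR_ge0 ?powR_antiN //.
  by apply: le_trans (Sg_le _ _ _ _) _; rewrite -natrM ler_nat; exact: Nb_le.
- rewrite EFinM; apply: lee_pmul => //; try by apply: esum_ge0.
  rewrite /F (@esumZl R nat _ (fun x => ((qcount n x 0)%:R * x%:R `^ (- n%:R))%:E)) ?lee_fin //.
    by rewrite EFinM lee_wpmul2l ?lee_fin.
Qed.

(** For n = 1 the part prime to the frequency is bounded by 1 termwise, which costs a factor
    zeta(s). For n >= 2 there is room for a vector orthogonal to k and of nonzero norm, as
    [coprime_part] requires. *)
Lemma Sg_sum_le n e (k : 'I_n -> int) i0 : (0 < e)%N -> k i0 != 0 ->
  exists2 K : R, 0 <= K & forall s, n%:R < s ->
  (\esum_(b in [set b | (0 < b)%N]) (cnorm (Sg R (e * b) (b ^ 2) k) * b%:R `^ (- s))%:E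
     <= (K * zeta s)%:E)%E.
Proof.
case: n k i0 => [|[|m]] k i0 e0 ki0; first by case: i0 ki0.
- pose q := (e * `|k i0|)%N.
  have q0 : (0 < q)%N by rewrite muln_gt0 e0 absz_gt0.
  have [X X0 hX] := @smooth_part 1 q isT q0.
  exists ((e ^ 1)%:R * X) => [|s s1]; first exact: mulr_ge0.
  apply: (@Sg_sum_split _ _ q) => //; rewrite ?dvdn_mulr ?(ltW s1) //.
  rewrite -zeta_esum //; apply: le_trans (_ : \esum_(y in [set y | (0 < y)%N /\ coprime q y]) (y%:R `^ (- s))%:E <= _)%E.
    apply: le_esum => y [y0 qy]; rewrite lee_fin ler_piMl ?powR_ge0 //.
    apply: (@Sg_one R 1 y k i0) => //; rewrite coprime_sym.
    by apply: coprime_dvdl qy; rewrite dvdn_mull.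
  by apply: esum_subset => y [].
- have [i1 i10] : exists i1, i1 != i0.
    by exists (if i0 == ord0 then ord_max else ord0); case: (eqVneq i0 ord0) => [->|]; rewrite // eq_sym.
  (* The vector (-k_i1, k_i0) in two coordinates: orthogonal to k, and of positive norm since k_i0
     is nonzero. *)
  pose w i := if i == i0 then - k i1 else if i == i1 then k i0 else 0.
  have w2 : \sum_i w i ^+ 2 = k i1 ^+ 2 + k i0 ^+ 2.
    rewrite (bigD1 i0) //= (bigD1 i1) //= big1 => [|i /andP[/negPf h1 /negPf h2]]; last by rewrite /w h1 h2 expr0n.
    by rewrite /w eqxx (negPf i10) eqxx sqrrN addr0.
  have kw : \sum_i k i * w i = 0.
    rewrite (bigD1 i0) //= (bigD1 i1) //= big1 => [|i /andP[/negPf h1 /negPf h2]]; last by rewrite /w h1 h2 mulr0.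
    by rewrite /w eqxx (negPf i10) eqxx addr0 mulrN (mulrC (k i1)) addNr.
  have W0 : \sum_i w i ^+ 2 != 0.
    by rewrite w2 gt_eqF // ltr_wpDl ?sqr_ge0 // exprn_even_gt0.
  (* Collects the bad primes: 2, those of e, those of k_i0 and those dividing the norm of w. *)
  pose q := (2 * e * `|k i0| * `|(\sum_i w i ^+ 2)%R|)%N.
  have q0 : (0 < q)%N by rewrite !muln_gt0 e0 !absz_gt0 ki0.
  have [X X0 hX] := @smooth_part m.+2 q isT q0.
  have [|||Y Y0 hY] := @coprime_part m q k w i0 q0 _ _ _ kw.
  + by rewrite /q -!mulnA dvdn_mulr.
  + by rewrite /q mulnAC dvdn_mull.
  + by rewrite /q dvdn_mull.
  exists ((e ^ m.+2)%:R * X * Y) => [|s s1]; first by rewrite !mulr_ge0.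
  have z1 : 1 <= zeta s by apply: zeta_ge1; apply: le_lt_trans s1; rewrite ler1n.
  apply: (@le_trans _ _ ((e ^ m.+2)%:R * X * Y)%:E); last by rewrite lee_fin ler_peMr // !mulr_ge0.
  apply: (@Sg_sum_split _ _ q) => //; rewrite ?(ltW s1) //.
    by rewrite /q (mulnC 2) -!mulnA dvdn_mulr.
  apply: le_trans hY; apply: le_esum => y [y0 _].
  by rewrite lee_fin ler_wpM2l ?cnorm_ge0 // powR_antiN // ltW.
Qed.

End ExpSumBound.

(** * Equidistribution *)

Section Fejer.
Variable R : realType.
Implicit Types (t : R) (M : nat).

(** The Fejer kernel, scaled so that its translates by multiples of 1/M form a partition of
    unity. *)
Definition fej M t : R := (M%:R ^+ 2)^-1 * cnorm (\sum_(l < M) ex (l%:R * t)) ^+ 2.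

Lemma fej_ge0 M t : 0 <= fej M t.
Proof. by rewrite mulr_ge0 ?invr_ge0 ?exprn_ge0 ?cnorm_ge0. Qed.

Lemma cnorm_sqr (z : R[i]) : (cnorm z ^+ 2)%:C = z * z^*.
Proof. by rewrite rmorphXn /= -cnormE normCK. Qed.

Lemma ex_conj t : (ex t)^* = ex (- t) :> R[i].
Proof. by rewrite /ex mulrN cosN sinN. Qed.

Lemma fejE M t : (fej M t)%:C = (M%:R ^+ 2)^-1 * \sum_(l < M) \sum_(l' < M) ex ((l%:R - l'%:R) * t).
Proof.
rewrite rmorphM /= fmorphV rmorphXn /= rmorph_nat cnorm_sqr; congr (_ * _).
rewrite rmorph_sum mulr_suml; apply: eq_bigr => l _; rewrite mulr_sumr; apply: eq_bigr => l' _.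
by rewrite [_ (ex (l'%:R * t))]ex_conj -exD mulrBl.
Qed.

Lemma sum_ex_grid M (l l' : 'I_M) : \sum_(j < M) ex ((l%:R - l'%:R) * (j%:R / M%:R) : R) =
  if l == l' then M%:R else 0.
Proof.
have M0 : (0 < M)%N by exact: leq_ltn_trans (ltn_ord l).
case: eqP => [->|ll'].
  rewrite (eq_bigr (fun=> 1)) ?sumr_const ?card_ord // => j _.
  by rewrite subrr mul0r ex0.
have H := @sum_ex_scale R M (l%:Z - l'%:Z) M0.
transitivity (\sum_(j < M) ex ((j%:Z * (l%:Z - l'%:Z))%:~R / M%:R : R)).
  by apply: eq_bigr => j _; congr ex; rewrite intrM intrB -!pmulrn; ring.
rewrite H ifF //; apply/negP => h; apply: ll'; apply: val_inj => /=.
move: h (ltn_ord l) (ltn_ord l'); rewrite -eqz_mod_dvd; move: (nat_of_ord l) (nat_of_ord l') => x y /eqP.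
by move=> h xM yM; move: h; rewrite !modz_small /= ?ltz_nat ?xM ?yM // => -[].
Qed.

(** Orthogonality on the grid keeps only l = l', that is, M terms equal to M against the factor
    M^-2. *)
Lemma fej_sum M t : (0 < M)%N -> \sum_(j < M) fej M (t - j%:R / M%:R) = 1.
Proof.
move=> M0; apply: (@complexI R); rewrite rmorph_sum /=.
under eq_bigr => j _ do rewrite fejE.
rewrite -mulr_sumr exchange_big /=.
have -> : \sum_(l < M) \sum_(j < M) \sum_(l' < M) ex ((l%:R - l'%:R) * (t - j%:R / M%:R)) =
  \sum_(l < M) M%:R :> R[i].
  apply: eq_bigr => l _; rewrite exchange_big /= (bigD1 l) //= [X in _ + X]big1 => [|l' ll'].
    rewrite addr0 (eq_bigr (fun=> 1)) ?sumr_const ?card_ord // => j _.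
    by rewrite subrr mul0r ex0.
  transitivity (ex ((l%:R - l'%:R) * t) * \sum_(j < M) ex ((l'%:R - l%:R) * (j%:R / M%:R) : R)).
    rewrite mulr_sumr; apply: eq_bigr => j _; rewrite -exD; congr ex; ring.
  by rewrite sum_ex_grid (negPf ll') mulr0.
rewrite sumr_const card_ord -(mulr_natl (M%:R)) -expr2 mulVf //.
by rewrite expf_neq0 // pnatr_eq0 -lt0n.
Qed.

(** Reducing t modulo 1 and reflecting x to 1 - x if it exceeds 1/2 leaves the monotonicity of the
    cosine on half a period. *)
Lemma cos_lattice_far (delta t : R) : 0 < delta <= 2^-1 ->
  (forall m : int, delta <= `|t - m%:~R|) -> cos (2 * pi * t) <= cos (2 * pi * delta).
Proof.
move=> /andP[d0 d2] far; pose x := t - (Num.floor t)%:~R.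
have /andP[f1 f2] : (Num.floor t)%:~R <= t < (Num.floor t + 1)%:~R by exact: floor_itv.
have x0 : 0 <= x by rewrite subr_ge0.
have x1 : x < 1 by rewrite ltrBlDr addrC -[X in _ + X]/(1%:~R) -intrD.
have xd : delta <= x by have := far (Num.floor t); rewrite ger0_norm.
have xd' : x <= 1 - delta.
  have := far (Num.floor t + 1); rewrite intrD opprD addrA -/x ler0_norm; last by rewrite subr_le0 ltW.
  by lra.
have -> : cos (2 * pi * t) = cos (2 * pi * x).
  have : ex t = ex x by rewrite -[t in LHS](subrK (Num.floor t)%:~R) exD ex_int mulr1.
  by case.
have p0 := pi_gt0 R.
have mono (a b : R) : 0 <= a -> a <= b -> b <= 2^-1 -> cos (2 * pi * b) <= cos (2 * pi * a).
  move=> a0 ab b2.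
  have pia (z : R) : 0 <= z -> z <= 2^-1 -> 2 * pi * z \in `[0, pi].
    move=> z0 z2; rewrite in_itv /= !mulr_ge0 ?pi_ge0 //= mulrAC ler_piMl ?pi_ge0 //; lra.
  have [->//|ab'] := eqVneq a b; apply: ltW.
  rewrite ltr_cos ?pia ?(le_trans ab) ?(le_trans a0) //.
  by rewrite ltr_pM2l ?mulr_gt0 // lt_neqAle ab'.
have [x2|x2] := leP x 2^-1; first by apply: mono => //; exact: ltW.
have -> : cos (2 * pi * x) = cos (2 * pi * (1 - x)).
  have : ex (1 - x) = ex (- x) by rewrite exD ex1 mul1r.
  by case=> -> _; rewrite mulrN cosN.
by apply: mono; lra.
Qed.

(** The geometric sum gives |1 - e(Mt)|^2 / |1 - e(t)|^2, and each such square equals 2 (1 - cos),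
    so the numerator is at most 4. *)
Lemma fej_far M (delta t : R) : (0 < M)%N -> 0 < delta <= 2^-1 ->
  (forall m : int, delta <= `|t - m%:~R|) ->
  fej M t <= 2 / (1 - cos (2 * pi * delta)) / M%:R ^+ 2.
Proof.
move=> M0 hd far; have ct := cos_lattice_far hd far; have /andP[d0 d2] := hd.
have p0 := pi_gt0 R.
have cd : cos (2 * pi * delta) < 1.
  rewrite -[ltRHS](@cos0 R) ltr_cos ?in_itv /= ?lexx ?pi_ge0 ?mulr_gt0 //=.
  by rewrite !mulr_ge0 ?pi_ge0 ?(ltW d0) //= mulrAC ler_piMl ?pi_ge0 //; lra.
rewrite /fej mulrC ler_pM2r; last by rewrite invr_gt0 exprn_gt0 // ltr0n.
have geo : (1 - ex t) * \sum_(l < M) ex (l%:R * t) = 1 - ex (M%:R * t).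
  elim: M {M0} => [|M IH]; first by rewrite big_ord0 mulr0 mul0r ex0 subrr.
  rewrite big_ord_recr /= mulrDr IH.
  have -> : ex (M.+1%:R * t) = ex (M%:R * t) * ex t by rewrite -exD -[M.+1]addn1 (natrD _ M 1) mulrDl mul1r.
  ring.
have nrm (z : R) : cnorm (1 - ex z) ^+ 2 = 2 * (1 - cos (2 * pi * z)).
  rewrite /cnorm /ex /= sqr_sqrtr ?addr_ge0 ?sqr_ge0 //.
  have := cos2Dsin2 (2 * pi * z); move: (cos _) (sin _) => c s h.
  rewrite [LHS](_ : _ = 1 - 2 * c + (c ^+ 2 + s ^+ 2)); last by ring.
  by rewrite h; ring.
have := congr1 (fun z => cnorm z ^+ 2) geo; rewrite cnormM exprMn !nrm.
move: (cnorm _ ^+ 2) (sqr_ge0 (cnorm (\sum_(l < M) ex (l%:R * t)))) => S S0 E.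
rewrite ler_pdivlMr ?subr_gt0 //.
have c1 := cos_geN1 (2 * pi * (M%:R * t)).
have : (1 - cos (2 * pi * delta)) * S <= (1 - cos (2 * pi * t)) * S by rewrite ler_wpM2r // lerD2l lerN2.
by move: E c1; lra.
Qed.

Section Kernel.
Variable n : nat.
Implicit Types (y : 'I_n -> R).

Definition fejn M y (j : {ffun 'I_n -> 'I_M}) : R := \prod_i fej M (y i - (j i)%:R / M%:R).

Lemma fejn_ge0 M y (j : {ffun 'I_n -> 'I_M}) : 0 <= fejn y j.
Proof. by apply: prodr_ge0 => i _; exact: fej_ge0. Qed.

Lemma fejn_sum M y : (0 < M)%N -> \sum_(j : {ffun 'I_n -> 'I_M}) fejn y j = 1.
Proof.
move=> M0; rewrite -(bigA_distr_bigA (fun i (j : 'I_M) => fej M (y i - j%:R / M%:R))) /=.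
by rewrite big1 // => i _; exact: fej_sum.
Qed.

(** Some coordinate i is far: over it the M terms are O(M^-2) each, while the other coordinates sum
    to 1. *)
Lemma fejn_far M y (delta : R) : (0 < M)%N -> 0 < delta <= 2^-1 ->
  \sum_(j : {ffun 'I_n -> 'I_M} | ~~ [forall i, `[< exists m : int, `|y i - (j i)%:R / M%:R - m%:~R| < delta >]]) fejn y j
   <= n%:R * (2 / (1 - cos (2 * pi * delta))) / M%:R.
Proof.
move=> M0 hd; pose near i (x : 'I_M) := `[< exists m : int, `|y i - x%:R / M%:R - m%:~R| < delta >].
have Mr : M%:R != 0 :> R by rewrite pnatr_eq0 -lt0n.
apply: (@le_trans _ _ (\sum_i \sum_(j : {ffun 'I_n -> 'I_M} | ~~ near i (j i)) fejn y j)).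
  under [leRHS]eq_bigr => i _ do rewrite big_mkcond.
  rewrite [leLHS]big_mkcond exchange_big /=; apply: ler_sum => j _.
  have ge0 i : 0 <= (if ~~ near i (j i) then fejn y j else 0) by case: ifP => // _; exact: fejn_ge0.
  case: ifP => [|_]; last by apply: sumr_ge0 => i _; exact: ge0.
  rewrite negb_forall => /existsP[i hi]; rewrite (bigD1 i) //= /near hi lerDl.
  by apply: sumr_ge0 => i' _; exact: ge0.
have -> : n%:R * (2 / (1 - cos (2 * pi * delta))) / M%:R = \sum_(i < n) (2 / (1 - cos (2 * pi * delta)) / M%:R).
  by rewrite sumr_const card_ord -(mulr_natl (_ / _)) -mulrA.
apply: ler_sum => i _.
pose Q (i' : 'I_n) (x : 'I_M) := (i' == i) ==> ~~ near i x.
have -> : \sum_(j : {ffun 'I_n -> 'I_M} | ~~ near i (j i)) fejn y j =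
   \prod_(i' < n) \sum_(x < M | Q i' x) fej M (y i' - x%:R / M%:R).
  rewrite (bigA_distr_big_dep (fun i' x => Q i' x) (fun i' (x : 'I_M) => fej M (y i' - x%:R / M%:R))) /=.
  apply: eq_bigl => j; apply/idP/familyP => [h i'|/(_ i)].
    by apply/implyP => /eqP ->.
  by move=> /implyP; apply.
rewrite (bigD1 i) //= [X in _ * X]big1 => [|i' ii']; last first.
  by rewrite (eq_bigl xpredT) ?fej_sum // => x; rewrite /Q (negPf ii').
rewrite mulr1; apply: le_trans (_ : \sum_(x < M) (2 / (1 - cos (2 * pi * delta)) / M%:R ^+ 2) <= _); last first.
  by rewrite sumr_const card_ord -(mulr_natl (_ / _)) le_eqVlt; apply/orP; left; apply/eqP; move: (2 / _) => w; field.
rewrite big_mkcond; apply: ler_sum => x _; rewrite /Q eqxx /=; case: ifP => [/asboolPn h|_].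
  by apply: fej_far => // m; rewrite leNgt; apply/negP => hm; apply: h; exists m.
by rewrite divr_ge0 ?exprn_ge0 // divr_ge0 // subr_ge0 cos_le1.
Qed.

Lemma prod_ex (f : 'I_n -> R) : \prod_i ex (f i) = ex (\sum_i f i) :> R[i].
Proof. by elim/big_rec2: _ => [|i x z _ ->]; rewrite ?ex0 // exD. Qed.

Definition fsub M (l l' : {ffun 'I_n -> 'I_M}) : 'I_n -> int := fun i => (l i)%:Z - (l' i)%:Z.

Lemma fejnE M y (j : {ffun 'I_n -> 'I_M}) : (fejn y j)%:C = (M%:R ^+ n ^+ 2)^-1 *
  \sum_(l : {ffun 'I_n -> 'I_M}) \sum_(l' : {ffun 'I_n -> 'I_M})
     ex (\sum_i (fsub l l' i)%:~R * (y i - (j i)%:R / M%:R)).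
Proof.
rewrite rmorph_prod /= (eq_bigr (fun i => (M%:R ^+ 2)^-1 * \sum_(ll : 'I_M * 'I_M)
   ex ((ll.1%:R - ll.2%:R) * (y i - (j i)%:R / M%:R)))) => [|i _]; last first.
  by rewrite fejE; congr (_ * _); rewrite pair_big.
rewrite big_split /= prodr_const card_ord exprVn -exprM mulnC exprM; congr (_ * _).
rewrite (bigA_distr_bigA (fun i (ll : 'I_M * 'I_M) => ex ((ll.1%:R - ll.2%:R) * (y i - (j i)%:R / M%:R)))) /=.
rewrite pair_big /=.
rewrite (reindex (fun ll : {ffun 'I_n -> 'I_M} * {ffun 'I_n -> 'I_M} => [ffun i => (ll.1 i, ll.2 i)])) /=.
  apply: eq_bigr => -[l l'] _ /=; rewrite prod_ex; congr ex; apply: eq_bigr => i _.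
  by rewrite !ffunE /= /fsub intrB -!pmulrn.
exists (fun f => ([ffun i => (f i).1], [ffun i => (f i).2])) => [[l l'] _|f _] /=.
  by congr pair; apply/ffunP => i; rewrite !ffunE.
by apply/ffunP => i; rewrite !ffunE; case: (f i).
Qed.

(** In the double sum over l and l' the M^n diagonal terms give the expected density M^-n, and every
    other pair gives an exponential sum of nonzero frequency l - l'. The factor M^(-2n) in front of
    these is bounded by 1. *)
Lemma fejn_sols M m c (j : {ffun 'I_n -> 'I_M}) : (0 < M)%N -> (0 < m)%N ->
  `|\sum_(a : {ffun 'I_n -> 'I_m}) (m %| sqs (fun i => a i) + c)%N%:R * fejn (fun i => (a i)%:R / m%:R) j
     - (M%:R ^+ n)^-1 * (qcount n m c)%:R|
  <= \sum_(l : {ffun 'I_n -> 'I_M}) \sum_(l' : {ffun 'I_n -> 'I_M} | l' != l) cnorm (Sg R m c (fsub l l')).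
Proof.
move=> M0 m0; set A := \sum_a _.
have Mn : (M%:R ^+ n : R[i]) != 0 by rewrite expf_neq0 // pnatr_eq0 -lt0n.
pose B (l l' : {ffun 'I_n -> 'I_M}) : R[i] := ex (- \sum_i (fsub l l' i)%:~R * ((j i)%:R / M%:R)) * Sg R m c (fsub l l').
have E : A%:C = (M%:R ^+ n ^+ 2)^-1 * \sum_(l : {ffun 'I_n -> 'I_M}) \sum_(l' : {ffun 'I_n -> 'I_M}) B l l'.
  rewrite /A rmorph_sum /= (eq_bigr (fun a : {ffun 'I_n -> 'I_m} => (M%:R ^+ n ^+ 2)^-1 *
    \sum_(l : {ffun 'I_n -> 'I_M}) \sum_(l' : {ffun 'I_n -> 'I_M}) (m %| sqs (fun i => a i) + c)%N%:R *
     ex (\sum_i (fsub l l' i)%:~R * ((a i)%:R / m%:R - (j i)%:R / M%:R)))); last first.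
    move=> a _; rewrite rmorphM /= rmorph_nat fejnE mulrCA; congr (_ * _).
    by rewrite mulr_sumr; apply: eq_bigr => l _; rewrite mulr_sumr.
  rewrite -mulr_sumr exchange_big /=; congr (_ * _); apply: eq_bigr => l _.
  rewrite exchange_big /=; apply: eq_bigr => l' _; rewrite /B /Sg mulr_sumr; apply: eq_bigr => a _.
  rewrite mulrCA; congr (_ * _); rewrite -exD; congr ex.
  rewrite /zdot rmorph_sum /= mulr_suml addrC -sumrB; apply: eq_bigr => i _.
  by rewrite mulrBr rmorphM /= -pmulrn mulrA.
have D : (A - (M%:R ^+ n)^-1 * (qcount n m c)%:R)%:C = (M%:R ^+ n ^+ 2)^-1 *
    \sum_(l : {ffun 'I_n -> 'I_M}) \sum_(l' : {ffun 'I_n -> 'I_M} | l' != l) B l l'.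
  rewrite rmorphB /= E (eq_bigr (fun l => (qcount n m c)%:R + \sum_(l' : {ffun 'I_n -> 'I_M} | l' != l) B l l')).
    rewrite big_split /= sumr_const card_ffun !card_ord mulrDr addrAC rmorphM /= fmorphV rmorphXn /= !rmorph_nat.
    rewrite -(mulr_natl (qcount n m c)%:R) natrX.
    by rewrite (_ : _ - _ = 0) ?add0r //; field.
  move=> l _; rewrite (bigD1 l) //=; congr (_ + _); rewrite /B big1 => [|i _]; last by rewrite /fsub subrr mul0r.
  rewrite oppr0 ex0 mul1r /Sg /qcount natr_sum; apply: eq_bigr => a _.
  by rewrite /zdot big1 ?mul0r ?ex0 ?mulr1 // => i _; rewrite /fsub subrr mul0r.
have cM : cnorm (M%:R : R[i]) = M%:R.
  have -> : (M%:R : R[i]) = (M%:R)%:C by rewrite rmorph_nat.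
  by rewrite cnorm_real ger0_norm.
rewrite -cnorm_real D cnormM.
apply: (@le_trans _ _ (cnorm (\sum_(l : {ffun 'I_n -> 'I_M}) \sum_(l' : {ffun 'I_n -> 'I_M} | l' != l) B l l'))).
  rewrite ler_piMl ?cnorm_ge0 // cnormV !cnormX cM.
  rewrite invf_le1 ?exprn_gt0 ?ltr0n //.
  by rewrite !exprn_ege1 // ler1n.
apply: le_trans (cnorm_sum _ _ _) _; apply: ler_sum => l _.
apply: le_trans (cnorm_sum _ _ _) _; apply: ler_sum => l' _.
by rewrite /B cnormM cnorm_ex mul1r.
Qed.

End Kernel.

End Fejer.

(** * Replacing Phi by its mean *)

Section Equidistribution.
Variable R : realType.

(** The chord of the convex function (1 + 2 eta)^n between eta = 0 and eta = 1. *)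
Lemma pow_lin_le (eta : R) n : 0 < eta <= 1 -> (1 + eta + eta ^+ 2) ^+ n <= 1 + eta * (3 ^+ n - 1).
Proof.
move=> /andP[e0 e1]; apply: (@le_trans _ _ ((1 + 2 * eta) ^+ n)).
  have e2 : eta ^+ 2 <= eta by rewrite expr2 ler_piMl // ltW.
  apply: lerXn2r; rewrite ?nnegrE ?addr_ge0 ?sqr_ge0 ?mulr_ge0 ?(ltW e0) //; lra.
elim: n => [|n IH]; first by rewrite !expr0 subrr mulr0 addr0.
have h3 : 1 <= 3 ^+ n :> R by rewrite exprn_ege1 // ler1n.
rewrite !exprS; apply: (@le_trans _ _ ((1 + 2 * eta) * (1 + eta * (3 ^+ n - 1)))).
  by rewrite ler_pM2l //; lra.
move: (3 ^+ n) h3 => t h3; have : 0 <= eta * (1 - eta) * (t - 1).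
  by rewrite !mulr_ge0 ?(ltW e0) ?subr_ge0.
nra.
Qed.

Section Weyl.
Variables (n e : nat) (lam : R) (mu : 'I_n -> R).
Hypothesis n0 : (0 < n)%N.
Hypothesis e0 : (0 < e)%N.
Hypothesis lam0 : 0 < lam.

Let V : R := (lam ^+ n)^-1 * Vol R n (n + n).

Definition aff (y : 'I_n -> R) (i : 'I_n) : R := lam * y i + mu i.

Definition Ssum (s : R) (b : nat) : R := \sum_(a : {ffun 'I_n -> 'I_(e * b)})
  (e * b %| sqs (fun i => a i) + b ^ 2)%N%:R * Phi lam s (aff (fun i => (a i)%:R / (e * b)%:R)).

Lemma Ssum_ge0 s b : n%:R <= s -> 0 <= Ssum s b.
Proof.
move=> ns; apply: sumr_ge0 => a _; rewrite mulr_ge0 //.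
by have [C _ [_ h _]] := @Phi_spec R n lam n0 lam0; case/andP: (h s (aff (fun i => (a i)%:R / (e * b)%:R)) ns).
Qed.

(** Closeness modulo Z^n suffices, since Phi is periodic. *)
Lemma Phi_near C (y z : 'I_n -> R) (delta eta : R) :
  (forall th : 'I_n -> R, 0 <= Phi lam n%:R th <= C) ->
  0 < eta <= 1 -> n%:R * lam * delta <= eta ->
  (forall i, exists m : int, `|y i - z i - m%:~R| < delta) ->
  `|Phi lam n%:R (aff y) - Phi lam n%:R (aff z)| <= eta * 3 ^+ n * C.
Proof.
move=> HC /andP[eta0 eta1] hd near.
pose m i := projT1 (cid (near i)).
have hm i : `|y i - z i - (m i)%:~R| < delta by rewrite /m; case: (cid (near i)).
rewrite -(@Phi_per R n lam n%:R (aff z) m); set z' := (fun i => _).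
have d0 : 0 <= delta by apply: le_trans (ltW (hm (Ordinal n0))); exact: normr_ge0.
have cl : \sum_i (aff y i - z' i) ^+ 2 <= eta ^+ 2.
  apply: (@le_trans _ _ ((n%:R * lam * delta) ^+ 2)); last first.
    by rewrite lerXn2r ?nnegrE ?mulr_ge0 ?(ltW lam0) ?(ltW eta0).
  apply: (@le_trans _ _ (\sum_(i < n) (lam * delta) ^+ 2)).
    apply: ler_sum => i _; rewrite /z' /aff (_ : _ - _ = lam * (y i - z i - (m i)%:~R)); last by ring.
    rewrite !exprMn ler_wpM2l ?sqr_ge0 // -(real_normK (num_real (y i - _ - _))).
    by rewrite lerXn2r ?nnegrE // ltW.
  rewrite sumr_const card_ord -(mulr_natl (_ ^+ 2)) -mulrA (exprMn 2 n%:R) ler_wpM2r ?sqr_ge0 //.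
  by rewrite -natrX ler_nat -{1}(expn1 n) leq_pexp2l.
have cl' : \sum_i (z' i - aff y i) ^+ 2 <= eta ^+ 2.
  by rewrite (eq_bigr (fun i => (aff y i - z' i) ^+ 2)) // => i _; rewrite -opprB sqrrN.
have h1 := @Phi_close R n lam n0 lam0 _ _ _ eta0 cl.
have h2 := @Phi_close R n lam n0 lam0 _ _ _ eta0 cl'.
have e01 : 0 < eta <= 1 by rewrite eta0.
have q := pow_lin_le n e01.
have /andP[a0 aC] := HC (aff y); have /andP[b0 bC] := HC z'.
move: h1 h2 q a0 aC b0 bC; move: (Phi _ _ (aff y)) (Phi _ _ z') => A B h1 h2 q a0 aC b0 bC.
have C0 : 0 <= C := le_trans a0 aC.
have h3 : 1 <= 3 ^+ n :> R by rewrite exprn_ege1 // ler1n.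
have q2 (x : R) : 0 <= x -> x <= C -> (1 + eta + eta ^+ 2) ^+ n * x <= x + eta * 3 ^+ n * C.
  move=> x0 xC; apply: (@le_trans _ _ ((1 + eta * (3 ^+ n - 1)) * x)); first by rewrite ler_wpM2r.
  have t0 : 0 <= eta * 3 ^+ n by rewrite mulr_ge0 ?exprn_ge0 ?ltW.
  have := ler_wpM2l t0 xC; have := mulr_ge0 (ltW eta0) x0.
  move=> p1 p2; rewrite [leLHS](_ : _ = x + eta * 3 ^+ n * x - eta * x); last by ring.
  by move: p1 p2; move: (eta * 3 ^+ n * C) (eta * 3 ^+ n * x) (eta * x) => c d f; lra.
have := q2 A a0 aC; have := q2 B b0 bC; rewrite ler_norml => r1 r2.
by apply/andP; split; lra.
Qed.

Lemma Phi_fejer C M (y : 'I_n -> R) (delta eta : R) : (0 < M)%N ->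
  (forall th : 'I_n -> R, 0 <= Phi lam n%:R th <= C) ->
  0 < eta <= 1 -> n%:R * lam * delta <= eta -> 0 < delta <= 2^-1 ->
  `|Phi lam n%:R (aff y) - \sum_(j : {ffun 'I_n -> 'I_M}) fejn y j * Phi lam n%:R (aff (fun i => (j i)%:R / M%:R))|
   <= eta * 3 ^+ n * C + C * (n%:R * (2 / (1 - cos (2 * pi * delta))) / M%:R).
Proof.
move=> M0 HC eta01 hd d01; have /andP[eta0 _] := eta01.
have C0 : 0 <= C by have /andP[h1 h2] := HC (aff y); exact: le_trans h2.
pose near (j : {ffun 'I_n -> 'I_M}) := [forall i, `[< exists m : int, `|y i - (j i)%:R / M%:R - m%:~R| < delta >]].
have -> : Phi lam n%:R (aff y) = \sum_(j : {ffun 'I_n -> 'I_M}) fejn y j * Phi lam n%:R (aff y).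
  by rewrite -mulr_suml fejn_sum // mul1r.
rewrite -sumrB.
apply: le_trans (ler_norm_sum _ _ _) _.
under eq_bigr => j _ do rewrite -mulrBr normrM (ger0_norm (fejn_ge0 y j)).
rewrite (bigID near) /=; apply: lerD.
  apply: (@le_trans _ _ (\sum_(j : {ffun 'I_n -> 'I_M} | near j) fejn y j * (eta * 3 ^+ n * C))).
    apply: ler_sum => j /forallP hj; rewrite ler_wpM2l ?fejn_ge0 //.
    by apply: Phi_near hd _ => // i; have /asboolP := hj i.
  rewrite -mulr_suml ler_piMl ?mulr_ge0 ?exprn_ge0 ?(ltW eta0) //.
  rewrite -[leRHS](fejn_sum y M0) [leLHS]big_mkcond; apply: ler_sum => j _.
  by case: ifP => // _; exact: fejn_ge0.
apply: (@le_trans _ _ (\sum_(j : {ffun 'I_n -> 'I_M} | ~~ near j) fejn y j * C)).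
  apply: ler_sum => j _; rewrite ler_wpM2l ?fejn_ge0 //.
  have osc (u v : R) : 0 <= u <= C -> 0 <= v <= C -> `|u - v| <= C.
    by move=> /andP[? ?] /andP[? ?]; rewrite ler_norml; apply/andP; split; lra.
  exact: osc (HC _) (HC _).
by rewrite -mulr_suml mulrC ler_wpM2l // fejn_far.
Qed.

Definition Serr M (b : nat) : R := \sum_(l : {ffun 'I_n -> 'I_M})
  \sum_(l' : {ffun 'I_n -> 'I_M} | l' != l) cnorm (Sg R (e * b) (b ^ 2) (fsub l l')).

Lemma Ssum_approx (eps : R) : 0 < eps -> exists M : nat, exists2 C, 0 <= C &
  forall s b, n%:R <= s -> (0 < b)%N ->
  `|Ssum s b - V * (Nb n e b)%:R| <= (eps + (s - n%:R) * C) * (Nb n e b)%:R + C * Serr M b.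
Proof.
move=> eps0; have [C C0 [_ HC Hd]] := @Phi_spec R n lam n0 lam0.
have {}HC th := HC n%:R th (lexx _).
have [C' C'0 Hm] := @Phi_mean R n lam n0 lam0 mu.
have h3 : 0 < 3 ^+ n :> R by rewrite exprn_gt0.
(* Makes the oscillation of Phi between near points, eta 3^n C, at most eps / 3. *)
pose eta := Num.min 1 (eps / 3 / (3 ^+ n * (C + 1))).
have C1 : 0 < C + 1 by rewrite ltr_wpDl.
have eta0 : 0 < eta by rewrite lt_min ltr01 /= !divr_gt0 // mulr_gt0.
have eta1 : eta <= 1 by rewrite ge_min lexx.
have etaC : eta * 3 ^+ n * C <= eps / 3.
  apply: (@le_trans _ _ (eta * (3 ^+ n * (C + 1)))).
    by rewrite -mulrA ler_pM2l // ler_pM2l // lerDl.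
  by rewrite -ler_pdivlMr ?mulr_gt0 // ge_min lexx orbT.
have nl : 0 < n%:R * lam by rewrite mulr_gt0 // ltr0n.
pose delta := eta / (n%:R * lam + 2).
have d0 : 0 < delta by rewrite divr_gt0 // addr_gt0.
have d01 : 0 < delta <= 2^-1.
  by rewrite d0 /= ler_pdivrMr ?addr_gt0 //; lra.
have hd : n%:R * lam * delta <= eta.
  by rewrite mulrC /delta mulrAC ler_pdivrMr ?addr_gt0 // ler_pM2l // lerDl.
pose Kd := C * (n%:R * (2 / (1 - cos (2 * pi * delta)))).
(* Large enough for the mass of the kernel far from its centre, for the error of the Riemann sum and
   for the condition lam <= M. *)
pose M := (Num.truncn (`|Kd| * 3 / eps) + Num.truncn (C' * 3 / eps) + Num.truncn lam).+3.
have tr (x : R) : 0 <= x -> x <= (Num.truncn x).+1%:R by move=> x0; have /andP[_ /ltW] := truncn_itv x0.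
have M0 : (0 < M)%N by [].
have Mr : 0 < M%:R :> R by rewrite ltr0n.
have MK : Kd / M%:R <= eps / 3.
  apply: (@le_trans _ _ (`|Kd| / M%:R)); first by rewrite ler_pM2r ?invr_gt0 // ler_norm.
  rewrite ler_pdivrMr // mulrC -ler_pdivrMr ?divr_gt0 // invf_div mulrA.
  apply: le_trans (tr _ _) _; first by rewrite !mulr_ge0 // invr_ge0 ltW.
  by rewrite ler_nat /M; clear; move: (Num.truncn _) (Num.truncn _) (Num.truncn _) => i j l; lia.
have MC : C' / M%:R <= eps / 3.
  rewrite ler_pdivrMr // mulrC -ler_pdivrMr ?divr_gt0 // invf_div mulrA.
  apply: le_trans (tr _ _) _; first by rewrite !mulr_ge0 // invr_ge0 ltW.
  by rewrite ler_nat /M; clear; move: (Num.truncn _) (Num.truncn _) (Num.truncn _) => i j l; lia.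
have Ml : lam <= M%:R.
  by apply: le_trans (tr _ (ltW lam0)) _; rewrite ler_nat /M; clear; move: (Num.truncn _) (Num.truncn _) (Num.truncn _) => i j l; lia.
have {Hm} := Hm M Ml; set mean := _ * \sum_j _ => Hm.
exists M, (C + C * (M ^ n)%:R) => [|s b ns b0]; first by rewrite addr_ge0 // mulr_ge0.
have m0 : (0 < e * b)%N by rewrite muln_gt0 e0.
have S0 : 0 <= Serr M b by apply: sumr_ge0 => l _; apply: sumr_ge0 => l' _; exact: cnorm_ge0.
pose N := (Nb n e b)%:R : R; have N0 : 0 <= N by [].
pose ind (a : {ffun 'I_n -> 'I_(e * b)}) : R := (e * b %| sqs (fun i => a i) + b ^ 2)%N%:R.
have indE : \sum_a ind a = N by rewrite /N /Nb /qcount natr_sum.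
have ind0 a : 0 <= ind a by [].
pose pt (a : {ffun 'I_n -> 'I_(e * b)}) (i : 'I_n) : R := (a i)%:R / (e * b)%:R.
pose A (j : {ffun 'I_n -> 'I_M}) : R := \sum_a ind a * fejn (pt a) j.
pose F (j : {ffun 'I_n -> 'I_M}) : R := Phi lam n%:R (aff (fun i => (j i)%:R / M%:R)).
have s1 : `|Ssum s b - Ssum n%:R b| <= (s - n%:R) * C * N.
  rewrite /Ssum -sumrB; apply: le_trans (ler_norm_sum _ _ _) _.
  rewrite -indE mulr_sumr; apply: ler_sum => a _; rewrite -mulrBr normrM ger0_norm //.
  rewrite [leRHS]mulrC ler_wpM2l //; have /andP[h1 h2] := Hd s (aff (pt a)) ns.
  by rewrite ler_norml; apply/andP; split; move: h1 h2; rewrite /pt; lra.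
have s2 : `|Ssum n%:R b - \sum_j F j * A j| <= (eps / 3 + eps / 3) * N.
  have -> : \sum_j F j * A j = \sum_a ind a * \sum_j fejn (pt a) j * F j.
    under eq_bigr => j _ do rewrite mulr_sumr.
    rewrite exchange_big /=; apply: eq_bigr => a _; rewrite mulr_sumr; apply: eq_bigr => j _; ring.
  rewrite /Ssum -sumrB; apply: le_trans (ler_norm_sum _ _ _) _.
  rewrite -indE mulr_sumr; apply: ler_sum => a _; rewrite -mulrBr normrM ger0_norm //.
  rewrite [leRHS]mulrC ler_wpM2l //.
  apply: le_trans (@Phi_fejer C M (pt a) delta eta M0 HC _ hd d01) _; first by rewrite eta0.
  by apply: lerD etaC _; apply: le_trans MK; rewrite /Kd (mulrA C).
have s3 : `|\sum_j F j * A j - mean * N| <= C * (M ^ n)%:R * Serr M b.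
  have -> : mean * N = \sum_j F j * ((M%:R ^+ n)^-1 * N).
    by rewrite /mean -mulr_suml; rewrite mulrAC mulrC.
  rewrite -sumrB; apply: le_trans (ler_norm_sum _ _ _) _.
  apply: (@le_trans _ _ (\sum_(j : {ffun 'I_n -> 'I_M}) C * Serr M b)); last first.
    by rewrite sumr_const card_ffun !card_ord -(mulr_natl (_ * _)) mulrCA mulrA.
  apply: ler_sum => j _; rewrite -mulrBr normrM; have /andP[h1 h2] := HC (aff (fun i => (j i)%:R / M%:R)).
  apply: ler_pM => //; first by rewrite ger0_norm.
  exact: (@fejn_sols R n M (e * b) (b ^ 2) j M0 m0).
have s4 : `|mean * N - V * N| <= eps / 3 * N.
  by rewrite -mulrBl normrM (ger0_norm N0) ler_wpM2r //; apply: le_trans Hm MC.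
have t1 : 0 <= (s - n%:R) * (C * (M ^ n)%:R) * N by rewrite !mulr_ge0 ?subr_ge0.
have t2 : 0 <= C * Serr M b by rewrite mulr_ge0.
rewrite -/N (_ : Ssum s b - V * N = (Ssum s b - Ssum n%:R b) + (Ssum n%:R b - \sum_j F j * A j) +
  (\sum_j F j * A j - mean * N) + (mean * N - V * N)); last by ring.
apply: le_trans (ler_normD _ _) _; apply: (@le_trans _ _ ((s - n%:R) * C * N + (eps / 3 + eps / 3) * N +
   C * (M ^ n)%:R * Serr M b + eps / 3 * N)).
  apply: lerD s4; apply: le_trans (ler_normD _ _) _; apply: lerD s3.
  by apply: le_trans (ler_normD _ _) _; apply: lerD s1 s2.
rewrite -subr_ge0 (_ : _ - _ = (s - n%:R) * (C * (M ^ n)%:R) * N + C * Serr M b); last by field.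
exact: addr_ge0.
Qed.

Lemma Serr_esum M : exists2 K : R, 0 <= K & forall s, n%:R < s ->
  (\esum_(b in [set b | (0 < b)%N]) (Serr M b * b%:R `^ (- s))%:E <= (K * zeta s)%:E)%E.
Proof.
have H (l l' : {ffun 'I_n -> 'I_M}) : exists K : R, l' != l -> 0 <= K /\ forall s, n%:R < s ->
  (\esum_(b in [set b | (0 < b)%N]) (cnorm (Sg R (e * b) (b ^ 2) (fsub l l')) * b%:R `^ (- s))%:E <= (K * zeta s)%:E)%E.
  have [->|ll'] := eqVneq l' l; first by exists 0.
  have [i hi] : exists i, fsub l l' i != 0.
    apply/existsP; apply: contraR ll'; rewrite negb_exists => /forallP h.
    apply/eqP/ffunP => i; apply: val_inj; have := h i; rewrite negbK subr_eq0 => /eqP [E].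
    by rewrite /= E.
  by have [K K0 HK] := @Sg_sum_le R n e (fsub l l') i e0 hi; exists K.
pose K l l' := projT1 (cid (H l l')).
have HK l l' : l' != l -> 0 <= K l l' /\ forall s, n%:R < s ->
  (\esum_(b in [set b | (0 < b)%N]) (cnorm (Sg R (e * b) (b ^ 2) (fsub l l')) * b%:R `^ (- s))%:E <= (K l l' * zeta s)%:E)%E.
  by rewrite /K; case: (cid (H l l')).
exists (\sum_l \sum_(l' | l' != l) K l l') => [|s ns].
  by apply: sumr_ge0 => l _; apply: sumr_ge0 => l' /HK[].
have g0 l l' b : (0 <= (cnorm (Sg R (e * b) (b ^ 2) (@fsub n M l l')) * b%:R `^ (- s))%:E)%E.
  by rewrite lee_fin mulr_ge0 ?cnorm_ge0 ?powR_ge0.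
rewrite (eq_esum (b := fun b => (\sum_(l : {ffun 'I_n -> 'I_M}) \sum_(l' : {ffun 'I_n -> 'I_M} | l' != l)
   (cnorm (Sg R (e * b) (b ^ 2) (fsub l l')) * b%:R `^ (- s))%:E)%E)); last first.
  move=> b _; rewrite /Serr mulr_suml -sumEFin; apply: eq_bigr => l _.
  by rewrite mulr_suml -sumEFin.
rewrite esum_sum => [|b l _ _]; last by apply: sume_ge0.
rewrite mulr_suml -sumEFin; apply: lee_sum => l _.
rewrite esum_sum // mulr_suml -sumEFin; apply: lee_sum => l' ll'.
by have [_] := HK l l' ll'; apply.
Qed.

End Weyl.

(** X stays bounded near a, so the error has upper limit at most a multiple of eps, and eps is
    arbitrary. *)
Lemma cvg_dominated (X Y : R -> R) (a V w : R) :
  X s @[s --> a^'+] --> w ->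
  (forall s, a < s -> 0 <= X s) ->
  (forall eps, 0 < eps -> exists2 C, 0 <= C & forall s, a < s ->
     `|Y s - V * X s| <= (eps + (s - a) * C) * X s + (s - a) * C) ->
  Y s @[s --> a^'+] --> w * V.
Proof.
move=> Xw X0 HY; apply/cvgrPdist_lt => eps eps0.
have w1 : 0 < `|w| + 1 by rewrite ltr_wpDl.
pose e1 := eps / 4 / (`|w| + 1); have e10 : 0 < e1 by rewrite !divr_gt0.
have [C C0 HC] := HY e1 e10.
pose e2 := eps / 4 / ((C + 1) * (`|w| + 1 + 1)).
have e20 : 0 < e2 by rewrite !divr_gt0 // mulr_gt0 // ltr_wpDl // addr_ge0 // ltW.
pose e3 := Num.min 1 (eps / 4 / (`|V| + 1)).
have e30 : 0 < e3 by rewrite lt_min ltr01 /= !divr_gt0 // ltr_wpDl.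
near=> s.
have as' : a < s by near: s; exact: nbhs_right_gt.
have sa : s - a < e2.
  rewrite ltrBlDl; near: s; apply: nbhs_right_lt; by rewrite ltrDl.
have hX : `|w - X s| < e3 by near: s; move/cvgrPdist_lt : Xw; apply.
have := HC s as'; have x0 := X0 s as'; move: hX; rewrite lt_min => /andP[hX1 hX2] hC.
have xw : X s <= `|w| + 1.
  have := ler_norm w; move: hX1; rewrite ltr_norml => /andP[h1 h2]; lra.
have b1 : e1 * X s <= eps / 4.
  by apply: le_trans (_ : e1 * (`|w| + 1) <= _); [rewrite ler_pM2l|rewrite /e1 divfK ?gt_eqF].
have b2 : (s - a) * C * X s + (s - a) * C <= eps / 4.
  apply: (@le_trans _ _ (e2 * ((C + 1) * (`|w| + 1 + 1)))); last first.
    by rewrite /e2 divfK // gt_eqF // mulr_gt0 ?ltr_wpDl // addr_ge0 // ltW.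
  rewrite -{2}[(s - a) * C]mulr1 -mulrDr -mulrA ler_pM ?subr_ge0 ?(ltW as') ?(ltW sa) //.
    by rewrite mulr_ge0 // addr_ge0.
  by rewrite ler_pM ?addr_ge0 // ?lerD2r // lerDl.
have b3 : `|V * (w - X s)| <= eps / 4.
  rewrite normrM; apply: (@le_trans _ _ ((`|V| + 1) * (eps / 4 / (`|V| + 1)))).
    by rewrite ler_pM // ?lerDl // ltW.
  by rewrite mulrC divfK // gt_eqF // ltr_wpDl.
rewrite (_ : w * V - Y s = V * (w - X s) - (Y s - V * X s)); last by ring.
apply: le_lt_trans (ler_normB _ _) _.
have : `|Y s - V * X s| <= eps / 4 + eps / 4.
  apply: le_trans hC _; rewrite mulrDl -addrA; exact: lerD.
by move: b3; lra.
Unshelve. all: by end_near.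
Qed.

(** Summed against b^-s, [Ssum_approx] gives V D(s) with relative error eps + O(s - n) and an
    additional error O(zeta(s)); the factor (s - n) / zeta(s) turns the latter into O(s - n). *)
Lemma lattice_limit (n e : nat) (lam : R) (mu : 'I_n -> R) (Dr : R -> R) (w : R) :
  (0 < n)%N -> (0 < e)%N -> 0 < lam ->
  (forall s, n%:R < s -> Dser n e s = (Dr s)%:E) ->
  (s - n%:R) * Dr s / zeta s @[s --> n%:R^'+] --> w ->
  exists P : R -> R,
   (forall s, n%:R < s -> (\esum_(b in [set b | (0 < b)%N]) (Ssum e lam mu s b * b%:R `^ (- s))%:E = (P s)%:E)%E) /\
   (s - n%:R) * P s / zeta s @[s --> n%:R^'+] --> w * ((lam ^+ n)^-1 * Vol R n (n + n)).
Proof.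
move=> n0 e0 lam0 HD Hw; set V := _ * Vol R n _.
pose U s := (\esum_(b in [set b | (0 < b)%N]) (Ssum e lam mu s b * b%:R `^ (- s))%:E)%E.
have z1 (s : R) : n%:R < s -> 1 <= zeta s.
  by move=> ns; apply: zeta_ge1; apply: le_lt_trans ns; rewrite ler1n.
have nb0 s b : (0%R <= ((Nb n e b)%:R * b%:R `^ (- s))%:E :> \bar R)%E by rewrite lee_fin mulr_ge0 ?powR_ge0.
have se0 (M : nat) s (b : nat) : (0%R <= (Serr n e M b * b%:R `^ (- s))%:E :> \bar R)%E.
  rewrite lee_fin mulr_ge0 ?powR_ge0 //; apply: sumr_ge0 => l _; apply: sumr_ge0 => l' _; exact: cnorm_ge0.
have V0 : 0 <= V.
  have [C _ HC] := @Phi_mean R n lam n0 lam0 mu.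
  rewrite mulr_ge0 ?invr_ge0 ?exprn_ge0 ?(ltW lam0) // VolE; last by rewrite -[X in (X < _)%N]addn0 ltn_add2l.
  by rewrite !mulr_ge0 ?invr_ge0 ?exprn_ge0 ?sqrtr_ge0 ?(ltW (hgam_gt0 _ _)) // ltW // hgam_gt0 // addn_gt0 n0.
have HS (eps : R) : 0 < eps -> exists M : nat, exists2 C, 0 <= C & forall s b, n%:R <= s -> (0 < b)%N ->
    `|Ssum e lam mu s b - V * (Nb n e b)%:R| <= (eps + (s - n%:R) * C) * (Nb n e b)%:R + C * Serr n e M b.
  exact: (@Ssum_approx n e lam mu n0 e0 lam0).
move: V V0 HS => V V0 HS.
have D0 s : n%:R < s -> 0 <= Dr s.
  by move=> ns; rewrite -lee_fin -HD //; apply: esum_ge0.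
have key eps : 0 < eps -> exists2 C, 0 <= C & forall s, n%:R < s ->
   (U s <= (V * Dr s + ((eps + (s - n%:R) * C) * Dr s + C * zeta s))%:E)%E /\
   ((V * Dr s)%:E <= U s + ((eps + (s - n%:R) * C) * Dr s + C * zeta s)%:E)%E.
  move=> eps0; have [M [C C0 HC]] := HS eps eps0.
  have [K K0 HK] := @Serr_esum n e e0 M.
  exists (C + C * K) => [|s ns]; first by rewrite addr_ge0 // mulr_ge0.
  have ns' := ltW ns; have sn : 0 <= s - n%:R by rewrite subr_ge0.
  have cD (c : R) : 0 <= c -> (\esum_(b in [set b | (0 < b)%N]) (c%:E * ((Nb n e b)%:R * b%:R `^ (- s))%:E) = (c * Dr s)%:E)%E.
    by move=> c0; rewrite esumZl ?lee_fin // -/(Dser n e s) HD.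
  have q0 : 0 <= eps + (s - n%:R) * C by rewrite addr_ge0 ?mulr_ge0 // ltW.
  have cS : (\esum_(b in [set b | (0 < b)%N]) (C%:E * (Serr n e M b * b%:R `^ (- s))%:E) <= (C * K * zeta s)%:E)%E.
    by rewrite esumZl ?lee_fin // -mulrA EFinM lee_wpmul2l ?lee_fin // HK.
  have qn b : (0%R <= (eps + (s - n%:R) * C)%:E * ((Nb n e b)%:R * b%:R `^ (- s))%:E :> \bar R)%E.
    by apply: mule_ge0; rewrite ?lee_fin // -lee_fin.
  have Cs b : (0%R <= C%:E * (Serr n e M b * b%:R `^ (- s))%:E :> \bar R)%E.
    by apply: mule_ge0; rewrite ?lee_fin // -lee_fin.
  have Vn b : (0%R <= V%:E * ((Nb n e b)%:R * b%:R `^ (- s))%:E :> \bar R)%E.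
    by apply: mule_ge0; rewrite ?lee_fin // -lee_fin.
  have err : (\esum_(b in [set b | (0 < b)%N]) ((eps + (s - n%:R) * C)%:E * ((Nb n e b)%:R * b%:R `^ (- s))%:E +
      C%:E * (Serr n e M b * b%:R `^ (- s))%:E)
      <= ((eps + (s - n%:R) * (C + C * K)) * Dr s + (C + C * K) * zeta s)%:E)%E.
    rewrite esumD => [|b _|b _]; [|exact: qn|exact: Cs].
    rewrite cD // EFinD; apply: leeD.
      rewrite lee_fin ler_wpM2r ?D0 // lerD2l ler_wpM2l // lerDl mulr_ge0 //.
    apply: le_trans cS _; rewrite lee_fin ler_wpM2r ?(le_trans ler01 (z1 s ns)) // lerDr //.
  have pw b : 0 <= b%:R `^ (- s) :> R by exact: powR_ge0.
  split.
    rewrite EFinD; apply: le_trans (leeD2l _ err); rewrite -cD // -esumD => [|b _|b _]; last 2 first.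
    - exact: Vn.
    - by rewrite adde_ge0.
    apply: le_esum => b b0; rewrite -!EFinM -!EFinD lee_fin.
    have := HC s b ns' b0; rewrite ler_norml => /andP[_ h].
    have := ler_wpM2r (pw b) h; move: (Ssum e lam mu s b) ((Nb n e b)%:R) (Serr n e M b) (b%:R `^ _) ((s - n%:R) * C) => v a nb p c; lra.
  apply: le_trans (leeD2l _ err); rewrite -cD // -esumD => [|b _|b _]; last 2 first.
  - by rewrite lee_fin mulr_ge0 ?powR_ge0 // Ssum_ge0.
  - by rewrite adde_ge0.
  apply: le_esum => b b0; rewrite -!EFinM -!EFinD lee_fin.
  have := HC s b ns' b0; rewrite ler_norml => /andP[h _].
  have := ler_wpM2r (pw b) h; move: (Ssum e lam mu s b) ((Nb n e b)%:R) (Serr n e M b) (b%:R `^ _) ((s - n%:R) * C) => v a nb p c; lra.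
have fin s : n%:R < s -> U s = (fine (U s))%:E.
  move=> ns; rewrite fineK // ge0_fin_numE; last by apply: esum_ge0 => b _; rewrite lee_fin mulr_ge0 ?powR_ge0 // Ssum_ge0 // ltW.
  by have [C _ /(_ s ns) [h _]] := key 1 ltr01; apply: le_lt_trans h (ltry _).
exists (fun s => fine (U s)); split; first by move=> s ns; rewrite -fin.
apply: (cvg_dominated (X := fun s => (s - n%:R) * Dr s / zeta s)) => // [s ns|eps eps0].
  by rewrite divr_ge0 ?(le_trans ler01 (z1 s ns)) // mulr_ge0 ?D0 // subr_ge0 ltW.
have [C C0 HC] := key eps eps0; exists C => // s ns.
have [] := HC s ns; rewrite (fin s ns) lee_fin -EFinD lee_fin; move: (fine (U s)) => u h1 h2.
have zs := lt_le_trans ltr01 (z1 s ns); have sn : 0 <= s - n%:R by rewrite subr_ge0 ltW.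
have h : `|u - V * Dr s| <= (eps + (s - n%:R) * C) * Dr s + C * zeta s.
  by rewrite ler_norml; apply/andP; split; lra.
rewrite /= [X in `|X|](_ : _ = ((s - n%:R) / zeta s) * (u - V * Dr s)); last by field; rewrite gt_eqF.
have q : 0 <= (s - n%:R) / zeta s by rewrite divr_ge0 // ltW.
rewrite normrM ger0_norm //; apply: le_trans (ler_wpM2l q h) _.
by rewrite le_eqVlt; apply/orP; left; apply/eqP; field; rewrite gt_eqF.
Qed.

End Equidistribution.

(** * Parametrisation of the cone *)

Section Coordinates.
Variable n : nat.

(** In the splitting v = (a, x, m), [ai] embeds the first n coordinates, [xi_] is the position of x
    and [ord_max] that of m. *)
Definition ai (i : 'I_n) : 'I_n.+2 := widen_ord (leqnSn n.+1) (widen_ord (leqnSn n) i).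
Definition xi_ : 'I_n.+2 := widen_ord (leqnSn n.+1) ord_max.

Lemma sum_coords (V : nmodType) (F : 'I_n.+2 -> V) :
  \sum_j F j = \sum_i F (ai i) + F xi_ + F ord_max.
Proof. by rewrite !big_ord_recr. Qed.

Lemma coordP (P : 'I_n.+2 -> Prop) : (forall i, P (ai i)) -> P xi_ -> P ord_max -> forall j, P j.
Proof.
move=> Pa Px Pm j; case: (ltnP j n.+1) => [jn1|jn1]; last first.
  by rewrite (_ : j = ord_max) //; apply: val_inj => /=; have := ltn_ord j; lia.
case: (ltnP j n) => jn; first by rewrite (_ : j = ai (Ordinal jn)) //; exact: val_inj.
by rewrite (_ : j = xi_) //; apply: val_inj => /=; lia.
Qed.

Definition vec (a : 'I_n -> int) (x m : int) : 'rV[int]_n.+2 :=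
  \row_j (if insub (j : nat) is Some i then a i else if j == n :> nat then x else m).

Lemma vec_a a x m i : vec a x m 0 (ai i) = a i.
Proof. by rewrite mxE /= insubT //= => h; congr a; exact: val_inj. Qed.

Lemma vec_x a x m : vec a x m 0 xi_ = x.
Proof. by rewrite mxE /= insubF ?ltnn // eqxx. Qed.

Lemma vec_m a x m : vec a x m 0 ord_max = m.
Proof. by rewrite mxE /= insubF ?ltnNge ?leqnSn // gtn_eqF. Qed.

Lemma vec_eta (v : 'rV[int]_n.+2) : v = vec (fun i => v 0 (ai i)) (v 0 xi_) (v 0 ord_max).
Proof.
apply/rowP; apply: coordP => [i||]; first by rewrite vec_a.
  by rewrite vec_x.
by rewrite vec_m.
Qed.

Lemma vec_inj a a' x x' m m' : vec a x m = vec a' x' m' -> [/\ a =1 a', x = x' & m = m'].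
Proof.
move=> E; split=> [i||].
- by rewrite -(vec_a a x m i) E vec_a.
- by rewrite -(vec_x a x m) E vec_x.
- by rewrite -(vec_m a x m) E vec_m.
Qed.

End Coordinates.

(** * Isometries of the quadratic form *)

Section Isometry.
Variables (R : realType) (n d : nat).
Hypothesis d0 : (0 < d)%N.

Lemma QformE (v : 'rV[R]_n.+2) :
  Qform d v = \sum_i v 0 (ai i) ^+ 2 + v 0 (xi_ n) ^+ 2 - d%:R ^+ 2 * v 0 ord_max ^+ 2.
Proof. by rewrite /Qform big_ord_recr. Qed.

Let dr : d%:R != 0 :> R. Proof. by rewrite pnatr_eq0 -lt0n. Qed.

Let Jd : 'rV[R]_n.+2 := \row_j (if j == ord_max then - d%:R ^+ 2 else 1).
Let Ji : 'rV[R]_n.+2 := \row_j (if j == ord_max then - (d%:R ^+ 2)^-1 else 1).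

Lemma JdK : diag_mx Jd *m diag_mx Ji = 1%:M.
Proof.
rewrite mulmx_diag -diag_const_mx; congr diag_mx; apply/rowP => j; rewrite !mxE.
by case: ifP => _; rewrite ?mulr1 // mulrNN divff // expf_neq0.
Qed.

Lemma Qform_mx (v : 'rV[R]_n.+2) : Qform d v = (v *m diag_mx Jd *m v^T) 0 0.
Proof.
rewrite QformE mxE sum_coords; congr (_ + _ + _).
- apply: eq_bigr => i _; rewrite mul_mx_diag !mxE ifF ?mulr1 //.
  by apply/negbTE; rewrite -val_eqE /= neq_ltn; have := ltn_ord i; lia.
- by rewrite mul_mx_diag !mxE ifF ?mulr1 // -val_eqE /= ltn_eqF.
- by rewrite mul_mx_diag !mxE eqxx; ring.
Qed.

Lemma sym_form_eq0 (N : 'M[R]_n.+2) : N^T = N ->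
  (forall v : 'rV[R]_n.+2, (v *m N *m v^T) 0 0 = 0) -> N = 0.
Proof.
move=> NT N0.
have e (i j : 'I_n.+2) : ((delta_mx 0 i : 'rV[R]_n.+2) *m N *m (delta_mx 0 j : 'rV[R]_n.+2)^T) 0 0 = N i j.
  by rewrite trmx_delta -rowE -colE !mxE.
apply/matrixP => i j; rewrite [RHS]mxE.
have Nij : N j i = N i j by rewrite -{1}NT mxE.
have := N0 (delta_mx 0 i + delta_mx 0 j).
have Dl (u u' w : 'rV[R]_n.+2) : ((u + u') *m N *m w^T) 0 0 = (u *m N *m w^T) 0 0 + (u' *m N *m w^T) 0 0.
  by rewrite !mulmxDl mxE.
have Dr (u w w' : 'rV[R]_n.+2) : (u *m N *m (w + w')^T) 0 0 = (u *m N *m w^T) 0 0 + (u *m N *m w'^T) 0 0.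
  by rewrite linearD /= mulmxDr mxE.
rewrite Dl !Dr !e.
have := N0 (delta_mx 0 i); have := N0 (delta_mx 0 j); rewrite !e Nij => -> ->; lra.
Qed.

(** From g J g^T = J one gets a right inverse J g^T J^-1 of g, which is also a left inverse; the
    last diagonal entry of that product is the relation on the last column. *)
Lemma isometry_col (g : 'M[R]_n.+2) : (forall v, Qform d (v *m g) = Qform d v) ->
  g ord_max ord_max ^+ 2 = 1 + d%:R ^+ 2 * (\sum_i g (ai i) ord_max ^+ 2 + g (xi_ n) ord_max ^+ 2).
Proof.
move=> hg.
have gJ : g *m diag_mx Jd *m g^T = diag_mx Jd.
  apply/eqP; rewrite -subr_eq0; apply/eqP; apply: sym_form_eq0.
    by rewrite linearB /= !trmx_mul trmxK tr_diag_mx mulmxA.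
  move=> v; have := hg v; rewrite !Qform_mx => E.
  rewrite mulmxBr mulmxBl mxE [X in _ + X]mxE -E trmx_mul !mulmxA subrr //.
have E1 : g *m (diag_mx Jd *m g^T *m diag_mx Ji) = 1%:M by rewrite !mulmxA gJ JdK.
have := mulmx1C E1 => /matrixP /(_ ord_max ord_max).
rewrite !mxE eqxx sum_coords.
have h j : (diag_mx Jd *m g^T *m diag_mx Ji) ord_max j = - d%:R ^+ 2 * g j ord_max * Ji 0 j.
  by rewrite mul_mx_diag mxE mul_diag_mx !mxE eqxx.
rewrite !h !mxE eqxx (ifF _ _ (_ : (xi_ n == ord_max) = false)); last by rewrite -val_eqE /= ltn_eqF.
rewrite (eq_bigr (fun i => - d%:R ^+ 2 * g (ai i) ord_max ^+ 2)) => [|i _]; last first.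
  rewrite h mxE ifF ?mulr1 -?mulrA -?expr2 //.
  by apply/negbTE; rewrite -val_eqE /= neq_ltn; have := ltn_ord i; lia.
rewrite -mulr_sumr => H; rewrite mulrDr.
have {}H : - d%:R ^+ 2 * (\sum_i g (ai i) ord_max ^+ 2) - d%:R ^+ 2 * g (xi_ n) ord_max ^+ 2 + g ord_max ord_max ^+ 2 = 1.
  by rewrite -[RHS]H mulr1; field.
by move: H; lra.
Qed.

Lemma eucl_norm_cone (g : 'M[R]_n.+2) (v : 'rV[R]_n.+2) :
  (forall v, Qform d (v *m g) = Qform d v) -> Qform d v = 0 ->
  eucl_norm (v *m g) = Num.sqrt (1 + d%:R ^+ 2) * `|(v *m g) 0 ord_max|.
Proof.
move=> hg v0; have := hg v; rewrite v0 QformE => E.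
rewrite /eucl_norm sum_coords.
have -> : \sum_i (v *m g) 0 (ai i) ^+ 2 + (v *m g) 0 (xi_ n) ^+ 2 + (v *m g) 0 ord_max ^+ 2 =
   (1 + d%:R ^+ 2) * (v *m g) 0 ord_max ^+ 2 by lra.
by rewrite sqrtrM ?sqrtr_sqr // addr_ge0 ?sqr_ge0.
Qed.

End Isometry.

(** * The chart of the cone and the lattice sum *)

Section ConeSum.
Variables (R : realType) (n d : nat) (c : 'I_n.+2 -> R).
Hypothesis d0 : (0 < d)%N.
Hypothesis c0 : 0 < c ord_max.
Hypothesis cE : c ord_max ^+ 2 = 1 + d%:R ^+ 2 * (\sum_i c (ai i) ^+ 2 + c (xi_ n) ^+ 2).
Local Notation zvec n := {ffun 'I_n -> int}.

Definition wf (v : 'rV[int]_n.+2) : R := \sum_j (v 0 j)%:~R * c j.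

Definition cone : set 'rV[int]_n.+2 :=
  [set v | \sum_i v 0 (ai i) ^+ 2 + v 0 (xi_ n) ^+ 2 = d%:Z ^+ 2 * v 0 ord_max ^+ 2 /\ 0 < v 0 ord_max].

(** The form w takes the value 2 d beta on (0, d, 1), the ray b = 0 of the cone. [clam] and [cmu]
    are the scale and the shift that appear on completing the square. *)
Definition cbeta : R := (c ord_max / d%:R + c (xi_ n)) / 2.
Local Notation beta := cbeta.
Definition clam : R := 4 * d%:R ^+ 2 * beta.
Definition cmu (i : 'I_n) : R := d%:R * c (ai i).

Let dr : 0 < d%:R :> R. Proof. by rewrite ltr0n. Qed.

(** The relation [cE] forces |d c_x| < c_m. *)
Lemma beta_gt0 : 0 < beta.
Proof.
rewrite /cbeta divr_gt0 // -(pmulr_rgt0 _ dr) mulrDr mulrCA divff ?gt_eqF // mulr1.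
have h : (d%:R * c (xi_ n)) ^+ 2 < c ord_max ^+ 2.
  rewrite cE exprMn mulrDr addrA ltrDr ltr_pwDl // mulr_ge0 ?sqr_ge0 //.
  by apply: sumr_ge0 => i _; exact: sqr_ge0.
have : `|d%:R * c (xi_ n)| < c ord_max.
  by rewrite -(ltr_pXn2r (n := 2)) ?nnegrE ?(ltW c0) // real_normK ?num_real.
by rewrite ltr_norml => /andP[h1 h2]; lra.
Qed.

Lemma clam_gt0 : 0 < clam.
Proof. by apply: mulr_gt0 beta_gt0; rewrite mulr_gt0 // exprn_gt0. Qed.

Lemma den_neq0 (b : nat) : (0 < b)%N -> (2 * d * b)%N%:Z != 0.
Proof. by move=> b0; rewrite eqz_nat -lt0n !muln_gt0 d0. Qed.

(* With b = d m - x and b' = d m + x the cone is |a|^2 = b b', and completing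
   the square in a turns the linear form w into (b / lam) (1 + |lam a/(2db) + mu|^2). *)
Lemma wf_chart (b : nat) (a : 'I_n -> int) (m : int) : (0 < b)%N ->
  \sum_i a i ^+ 2 + b%:Z ^+ 2 = (2 * d * b)%N%:Z * m ->
  wf (vec a (d%:Z * m - b%:Z) m) =
   b%:R / clam * (1 + \sum_i (clam * ((a i)%:~R / (2 * d * b)%:R) + cmu i) ^+ 2).
Proof.
move=> b0 hm; have br : 0 < b%:R :> R by rewrite ltr0n.
have B0 := beta_gt0.
rewrite /wf sum_coords vec_x vec_m.
under eq_bigr => i _ do rewrite vec_a.
have E : (\sum_i (a i)%:~R ^+ 2 + b%:R ^+ 2 : R) = 2 * d%:R * b%:R * m%:~R.
  have := congr1 (fun z : int => z%:~R : R) hm.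
  rewrite intrD intrM rmorphXn rmorph_sum -!pmulrn !natrM => <-.
  by congr (_ + _); apply: eq_bigr => i _; rewrite rmorphXn.
have S2 : \sum_i (clam * ((a i)%:~R / (2 * d * b)%:R) + cmu i) ^+ 2 =
   (2 * d%:R * beta / b%:R) ^+ 2 * (\sum_i (a i)%:~R ^+ 2) +
   (4 * d%:R ^+ 2 * beta / b%:R) * (\sum_i (a i)%:~R * c (ai i)) + d%:R ^+ 2 * \sum_i c (ai i) ^+ 2.
  rewrite !mulr_sumr -!big_split /=; apply: eq_bigr => i _.
  rewrite /clam /cmu !natrM; field; by rewrite !gt_eqF.
have mE : m%:~R = (\sum_i (a i)%:~R ^+ 2 + b%:R ^+ 2) / (2 * d%:R * b%:R) :> R.
  by rewrite E mulrC mulKf // !mulf_neq0 ?gt_eqF.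
rewrite S2 rmorphB rmorphM /= -!pmulrn mE.
have : c ord_max ^+ 2 = 1 + d%:R ^+ 2 * (\sum_i c (ai i) ^+ 2 + c (xi_ n) ^+ 2) by exact: cE.
have -> : c (xi_ n) = 2 * beta - c ord_max / d%:R by rewrite /cbeta; field; rewrite gt_eqF.
move: B0 br dr; rewrite /clam; clear; move: beta (c ord_max) (\sum_i _ * c _) (\sum_i _ ^+ 2) (\sum_i _ ^+ 2) (b%:R) (d%:R).
move=> t u L G A B D t0 B0 D0 H.
have tn : t != 0 by rewrite gt_eqF.
have Bn : B != 0 by rewrite gt_eqF.
have Dn : D != 0 by rewrite gt_eqF.
have AE : A = (4 * t * u / D - 4 * t ^+ 2 - (D ^+ 2)^-1).
  apply: (mulfI (expf_neq0 2 Dn)).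
  have : D ^+ 2 * (2 * t - u / D) ^+ 2 = 4 * t ^+ 2 * D ^+ 2 - 4 * t * u * D + u ^+ 2 by field.
  have -> : D ^+ 2 * (4 * t * u / D - 4 * t ^+ 2 - (D ^+ 2)^-1) = 4 * t * u * D - 4 * t ^+ 2 * D ^+ 2 - 1 by field.
  move: H; rewrite mulrDr; lra.
by rewrite AE; field; rewrite tn Bn Dn.
Qed.

Lemma wf_axis (m : int) : wf (vec (fun=> 0) (d%:Z * m) m) = 2 * d%:R * beta * m%:~R.
Proof.
rewrite /wf sum_coords vec_x vec_m big1 => [|i _]; last by rewrite vec_a mul0r.
by rewrite rmorphM /= -pmulrn /cbeta; field; rewrite gt_eqF.
Qed.

Let chart_dom : set (nat * zvec n) := [set ba : nat * zvec n | (0 < ba.1)%N /\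
  ((2 * d * ba.1)%N%:Z %| \sum_i (ba.2 : zvec n) i ^+ 2 + ba.1%:Z ^+ 2)%Z].

Let chart (ba : nat * zvec n) : 'rV[int]_n.+2 :=
  let m := ((\sum_i (ba.2 : zvec n) i ^+ 2 + ba.1%:Z ^+ 2) %/ (2 * d * ba.1)%N%:Z)%Z in
  vec ba.2 (d%:Z * m - ba.1%:Z) m.

Let axis : set 'rV[int]_n.+2 := [set v | v 0 (xi_ n) = d%:Z * v 0 ord_max].

Lemma sqr_sum_eq0 (I : finType) (F : I -> int) : \sum_i F i ^+ 2 = 0 -> forall i, F i = 0.
Proof.
move=> /eqP; rewrite psumr_eq0 => [/allP h i|i _]; last exact: sqr_ge0.
by apply/eqP; have := h i (mem_index_enum i); rewrite sqrf_eq0.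
Qed.

(** Here m is recovered from (b, a) by 2 d b m = |a|^2 + b^2. Conversely x^2 <= (d m)^2 on the cone,
    so b = d m - x is positive off the ray b = 0. *)
Lemma chart_bij : set_bij chart_dom (cone `&` ~` axis) chart.
Proof.
have key (b : nat) (a : zvec n) : chart_dom (b, a) -> exists2 m : int,
    \sum_i a i ^+ 2 + b%:Z ^+ 2 = (2 * d * b)%N%:Z * m & chart (b, a) = vec a (d%:Z * m - b%:Z) m.
  move=> [/= b0 /dvdzP [q hq]]; exists q; first by rewrite hq mulrC.
  by rewrite /chart /= hq mulzK // den_neq0.
split.
- move=> [b a] hba; have [b0 _] := hba; have [m hm ->] := key b a hba.
  have h : \sum_i a i ^+ 2 = (2 * d * b)%N%:Z * m - b%:Z ^+ 2 by rewrite -hm addrK.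
  split; rewrite /cone /axis /= !vec_x !vec_m; last by move=> /= in b0 *; lia.
  split.
    under eq_bigr => i _ do rewrite vec_a.
    by rewrite h !PoszM; ring.
  have : 0 < (2 * d * b)%N%:Z * m.
    by rewrite -hm ltr_wpDl ?sumr_ge0 ?exprn_gt0 // => i _; exact: sqr_ge0.
  by rewrite pmulr_rgt0 // ltz_nat !muln_gt0 d0.
- move=> [b a] [b' a'] hba hba'; move/set_mem: hba => hba; move/set_mem: hba' => hba'.
  have [m hm ->] := key b a hba; have [m' hm' ->] := key b' a' hba'.
  move=> /vec_inj[ha hx hmm]; have bb : b = b' by move: hx; rewrite hmm => /addrI /oppr_inj [].
  by rewrite bb; congr pair; apply/ffunP.
- move=> v [[hv vm] vx]; set x := v 0 (xi_ n) in hv vx; set m := v 0 ord_max in hv vm vx.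
  have xle : x ^+ 2 <= (d%:Z * m) ^+ 2.
    by rewrite exprMn -hv lerDr sumr_ge0 // => i _; exact: sqr_ge0.
  have dm : 0 <= d%:Z * m by rewrite mulr_ge0 // ltW.
  have xle' : x <= d%:Z * m by move: xle; clear -dm; nia.
  have bp : 0 < d%:Z * m - x by rewrite subr_gt0 lt_neqAle xle' andbT; apply/eqP.
  pose b := `|(d%:Z * m - x)%R|%N.
  have bE : b%:Z = d%:Z * m - x by rewrite /b gez0_abs // ltW.
  have b0 : (0 < b)%N by rewrite -ltz_nat bE.
  pose a : zvec n := [ffun i => v 0 (ai i)].
  have aE : \sum_i a i ^+ 2 + b%:Z ^+ 2 = m * (2 * d * b)%N%:Z.
    have -> : \sum_i a i ^+ 2 = d%:Z ^+ 2 * m ^+ 2 - x ^+ 2.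
      by rewrite -hv addrK; apply: eq_bigr => i _; rewrite ffunE.
    by rewrite !PoszM bE; ring.
  have dom : chart_dom (b, a) by split => //=; rewrite aE dvdz_mull.
  exists (b, a) => //; have [m' hm' ->] := key b a dom.
  have -> : m' = m.
    by apply: (mulfI (den_neq0 b0)); rewrite -hm' aE mulrC.
  rewrite [v in RHS]vec_eta bE -/x -/m; congr vec; last by ring.
  by apply/funext => i; rewrite ffunE.
Qed.

Lemma axis_bij : set_bij [set t : nat | (0 < t)%N] (cone `&` axis) (fun t => vec (fun=> 0) (d%:Z * t%:Z) t%:Z).
Proof.
split.
- move=> t /= t0; rewrite /cone /axis /= !vec_x !vec_m; split=> //; split=> //.
  by rewrite big1 ?add0r ?exprMn // => i _; rewrite vec_a expr0n.
- by move=> t t' _ _ /vec_inj[_ _ []].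
- move=> v [[hv vm] vx]; exists `|(v 0 ord_max)%R|%N; first by rewrite /= absz_gt0 gt_eqF.
  rewrite [RHS]vec_eta gez0_abs ?(ltW vm) // -vx; congr vec; apply/funext => i.
  apply/esym/(@sqr_sum_eq0 _ (fun i => v 0 (ai i))).
  move: hv; rewrite vx exprMn -[RHS]add0r => /addIr; exact.
Qed.

Lemma wf_gt0 v : cone v -> 0 < wf v.
Proof.
move=> cv; case: (pselect (axis v)) => hv.
  have : (cone `&` axis) v by [].
  have [_ _ s] := axis_bij; move=> /s[t t0 <-]; rewrite wf_axis -pmulrn; apply: mulr_gt0; last by rewrite ltr0n.
  by apply: mulr_gt0 beta_gt0; rewrite mulr_gt0.
have : (cone `&` ~` axis) v by [].
have [_ _ s] := chart_bij; move=> /s[[b a] [/= b0 /dvdzP [q hq]] <-].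
rewrite /chart /= hq mulzK ?den_neq0 //.
rewrite wf_chart // ?hq 1?mulrC // mulr_gt0 //.
  by rewrite ltr_pwDl // sumr_ge0 // => i _; exact: sqr_ge0.
by rewrite divr_gt0 ?clam_gt0 // ltr0n.
Qed.

Lemma dvdz_vec_mod (b : nat) (j : 'I_n -> nat) (k : 'I_n -> int) :
  ((2 * d * b)%N%:Z %| \sum_i ((j i)%:Z + (2 * d * b)%N%:Z * k i) ^+ 2 + b%:Z ^+ 2)%Z =
  (2 * d * b %| sqs j + b ^ 2)%N.
Proof.
have sq : (sqs j + b ^ 2)%N%:Z = \sum_i (j i)%:Z ^+ 2 + b%:Z ^+ 2.
  rewrite /sqs -natz natrD natr_sum natrX natz; congr (_ + _).
  by apply: eq_bigr => i _; rewrite natrX natz.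
have E : \sum_i ((j i)%:Z + (2 * d * b)%N%:Z * k i) ^+ 2 + b%:Z ^+ 2 =
  (sqs j + b ^ 2)%N%:Z + (2 * d * b)%N%:Z * \sum_i (2 * (j i)%:Z * k i + (2 * d * b)%N%:Z * k i ^+ 2).
  rewrite sq addrAC; congr (_ + _).
  by rewrite mulr_sumr -big_split /=; apply: eq_bigr => i _; ring.
by rewrite E rpredDr ?dvdz_mulr // dvdzE.
Qed.

(** For fixed b, a runs through j + 2db k with j a solution modulo 2db; the sum over k is Phi at the
    shifted point. The ray b = 0 gives a multiple of zeta(s), which is a bounded term after division
    by zeta(s). *)
Lemma cone_esum (s : R) : (0 < n)%N -> n%:R < s -> (\esum_(v in cone) (wf v `^ (- s))%:E =
   (clam `^ s)%:E * (\esum_(b in [set b | (0 < b)%N]) (Ssum (2 * d) clam cmu s b * b%:R `^ (- s))%:E)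
   + ((2 * d%:R * beta) `^ (- s) * zeta s)%:E)%E.
Proof.
move=> n0 ns; have ns' := ltW ns; have s1 : 1 < s by apply: le_lt_trans ns; rewrite ler1n.
have l0 := clam_gt0; have b0' := beta_gt0.
have tb : 0 <= 2 * d%:R * beta by apply: mulr_ge0 (ltW b0'); rewrite mulr_ge0.
rewrite (esumID axis) => [|v _]; last by rewrite lee_fin powR_ge0.
rewrite addeC; congr (_ + _)%E; last first.
  rewrite (@reindex_esum R _ _ _ _ _ _ axis_bij) EFinM -zeta_esum // -esumZl ?lee_fin ?powR_ge0 //.
  apply: eq_esum => t t0; rewrite wf_axis -EFinM -pmulrn powRM ?tb //.
rewrite (@reindex_esum R _ _ _ _ _ _ chart_bij).
rewrite -esumZl ?lee_fin ?powR_ge0 // => [|b]; last by rewrite lee_fin mulr_ge0 ?powR_ge0 // Ssum_ge0.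
have -> : chart_dom = [set b : nat | (0 < b)%N] `*`` (fun b => [set a : zvec n | ((2 * d * b)%N%:Z %| \sum_i a i ^+ 2 + b%:Z ^+ 2)%Z]).
  by apply/seteqP; split=> -[b a].
rewrite -(@esum_esum R nat (zvec n) _ _ (fun b a => (wf (chart (b, a)) `^ (- s))%:E)); last first.
  by move=> b a _ _; rewrite lee_fin powR_ge0.
apply: eq_esum => b b0; have m0 : (0 < 2 * d * b)%N by rewrite !muln_gt0 d0.
rewrite (esum_mkcond _ _) /=.
rewrite (@esum_zmod R n (2 * d * b) _ m0) => [|k]; last by case: ifP => _; rewrite ?lee_fin ?powR_ge0.
rewrite -EFinM mulrCA /Ssum mulr_suml -sumEFin; apply: eq_bigr => j _.
set P : bool := (2 * d * b %| _)%N.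
rewrite (eq_esum (b := fun k : zvec n => ((P%:R * (clam `^ s * b%:R `^ (- s)))%:E *
   (Pterm clam s (aff clam cmu (fun i => (j i)%:R / (2 * d * b)%:R)) k)%:E)%E)).
  rewrite esumZl ?lee_fin ?mulr_ge0 ?powR_ge0 // => [|k]; last by rewrite lee_fin powR_ge0.
  by rewrite PhiE // -EFinM; congr EFin; ring.
move=> k _; set a := [ffun i => _].
have aE : (((2 * d * b)%N%:Z %| \sum_i a i ^+ 2 + b%:Z ^+ 2)%Z) = P.
  rewrite /P -(dvdz_vec_mod b (fun i => j i) k); congr (_ %| _ + _)%Z.
  by apply: eq_bigr => i _; rewrite ffunE.
have -> : (a \in [set a : zvec n | ((2 * d * b)%N%:Z %| \sum_i a i ^+ 2 + b%:Z ^+ 2)%Z]) = P.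
  by rewrite -aE; apply/idP/idP => [/set_mem|/mem_set].
case: P aE => aE; last by rewrite !mul0r mul0e.
rewrite mul1r -EFinM; congr EFin.
have /dvdzP [q hq] := aE.
have hq' : \sum_i a i ^+ 2 + b%:Z ^+ 2 = (2 * d * b)%N%:Z * q by rewrite hq mulrC.
rewrite /chart /= hq mulzK ?den_neq0 // (wf_chart b0 hq').
rewrite /Pterm.
have -> : \sum_i (clam * ((a i)%:~R / (2 * d * b)%:R) + cmu i) ^+ 2 =
   znorm clam (aff clam cmu (fun i => (j i)%:R / (2 * d * b)%:R)) k.
  apply: eq_bigr => i _; congr (_ ^+ 2); rewrite ffunE intrD intrM -!pmulrn /aff.
  have : (2 * d * b)%:R != 0 :> R by rewrite pnatr_eq0 -lt0n.
  by move: (2 * d * b)%:R => M M0; field.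
rewrite powRM ?addr_ge0 ?znorm_ge0 ?divr_ge0 ?(ltW l0) // powRM ?invr_ge0 ?(ltW l0) //.
rewrite -powR_inv1 ?(ltW l0) // -powRrM mulN1r opprK; ring.
Qed.

End ConeSum.

From mathcomp Require Import finmap.

#[local] Existing Instance summability.totally_filter.

(** * Unconditional sums and primitive vectors *)

Section UnconditionalSum.
Variable R : realType.

Lemma fset_sum_le (I : choiceType) (f : I -> R) (A B : {fset I}) : (forall i, 0 <= f i) ->
  (A `<=` B)%fset -> \sum_(i <- A) f i <= \sum_(i <- B) f i.
Proof.
move=> f0 AB; rewrite -lee_fin -!sumEFin.
apply: (@lee_sum_nneg_subfset R I A B xpredT (fun i => (f i)%:E)) => //.
  by apply/fsubsetP.
by move=> i _ _; rewrite lee_fin.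
Qed.

(** For nonnegative terms the finite partial sums increase along inclusion, so they converge to
    their supremum. *)
Lemma sum_esum (I : choiceType) (f : I -> R) (T : R) : (forall i, 0 <= f i) ->
  (\esum_(i in [set: I]) (f i)%:E = T%:E)%E ->
  summability.sum (fun i => (f i)%:C : R[i]^o) = T%:C.
Proof.
move=> f0 fT; apply: (cvg_lim (@norm_hausdorff _ _)); apply/cvgrPdist_lt => e e0.
have eE : e = (complex.Re e)%:C.
  by move: e0; rewrite ltcE /= => /andP[/eqP h _]; case: e h => x y /= ->.
have r0 : 0 < complex.Re e by move: e0; rewrite ltcE /= => /andP[].
have psE (B : {fset I}) : summability.partial_sum (fun i => (f i)%:C : R[i]^o) B = (\sum_(i <- B) f i)%:C.
  by rewrite /summability.partial_sum rmorph_sum big_seq_fsetE.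
have le (B : {fset I}) : \sum_(i <- B) f i <= T.
  rewrite -lee_fin -fT -sumEFin; apply: seq_le_esum => //; exact: fset_uniq.
have [A hA] : exists A : {fset I}, T - complex.Re e < \sum_(i <- A) f i.
  apply: contrapT => h.
  have : (\esum_(i in [set: I]) (f i)%:E <= (T - complex.Re e)%:E)%E.
    apply: esum_fsum_le => X fX _; rewrite fsbig_finite //= sumEFin lee_fin leNgt.
    by apply/negP => hX; apply: h; exists (fset_set X).
  by rewrite fT lee_fin; lra.
exists A => // B /= AB; rewrite psE -rmorphB /= cnormE cnorm_real eE ltcR.
have h1 := fset_sum_le f0 AB; have h2 := le B.
by rewrite ger0_norm ?subr_ge0 //; lra.
Qed.

End UnconditionalSum.

Section PrimitiveVectors.
Variable n : nat.
Implicit Types v : 'rV[int]_n.+2.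

(** Dividing by it gives the unique primitive vector of which v is a positive integral multiple. *)
Definition content v : nat := (\big[gcdn/0%N]_(j < n.+2) `|v 0%R j|)%N.

Lemma contentZ (t : nat) v : content (t%:Z *: v) = (t * content v)%N.
Proof.
rewrite /content (big_morph (muln t) (muln_gcdr t) (muln0 t)).
by apply: eq_bigr => j _; rewrite mxE abszM absz_nat.
Qed.

Lemma content_dvd v j : ((content v)%:Z %| v 0%R j)%Z.
Proof. by rewrite dvdzE /=; apply: (@biggcdn_inf _ j). Qed.

Lemma content_gt0 v j : v 0 j != 0 -> (0 < content v)%N.
Proof.
rewrite lt0n; apply: contraNneq => h; have := content_dvd v j.
by rewrite h dvd0z.
Qed.

Variables (R : realType) (d : nat) (c : 'I_n.+2 -> R).

Lemma coneZ (t : nat) v : (0 < t)%N -> cone d (t%:Z *: v) <-> cone d v.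
Proof.
move=> t0; have t2 : (t%:Z ^+ 2 : int) != 0 by rewrite expf_neq0 // eqz_nat -lt0n.
rewrite /cone /= !mxE pmulr_rgt0 ?ltz_nat //.
under eq_bigr => i _ do rewrite mxE exprMn.
rewrite -mulr_sumr !exprMn -mulrDr (mulrCA (d%:Z ^+ 2)).
by split=> -[h1 h2]; split=> //; [apply: (mulfI t2)|rewrite h1].
Qed.

Lemma wfZ (t : nat) v : wf c (t%:Z *: v) = t%:R * wf c v.
Proof.
by rewrite /wf mulr_sumr; apply: eq_bigr => j _; rewrite mxE intrM -pmulrn mulrA.
Qed.

Lemma primitive_bij : set_bij ([set t : nat | (0 < t)%N] `*` (cone d `&` [set v : 'rV[int]_n.+2 | primitive v]))
  (cone d) (fun tv : nat * 'rV[int]_n.+2 => tv.1%:Z *: tv.2).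
Proof.
have pE v : primitive v = (content v == 1%N) by [].
split.
- by move=> [t v] [/= t0 [cv _]]; apply/coneZ.
- move=> [t v] [t' v'] /set_mem [/= t0 [cv pv]] /set_mem [/= t'0 [cv' pv']] E.
  have tt : t = t'.
    have := congr1 content E; rewrite !contentZ.
    by move: pv pv'; rewrite !pE => /eqP -> /eqP ->; rewrite !muln1.
  rewrite tt in E *; congr pair; apply/rowP => j.
  have := congr1 (fun u : 'rV[int]_n.+2 => u 0 j) E; rewrite !mxE => /mulfI; apply.
  by rewrite eqz_nat -lt0n.
- move=> v cv; have vm : v 0 ord_max != 0 by case: cv => _ h; rewrite gt_eqF.
  have t0 := content_gt0 vm; pose u : 'rV[int]_n.+2 := \row_j (v 0%R j %/ content v)%Z.
  have uv : (content v)%:Z *: u = v.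
    by apply/rowP => j; rewrite !mxE mulrC divzK // content_dvd.
  exists (content v, u) => //=; split=> //; split; first by apply/(coneZ u t0); rewrite uv.
  rewrite /= pE -(eqn_pmul2l t0) -contentZ uv muln1 //.
Qed.

Lemma cone_esum_primitive (s : R) : (forall v, cone d v -> 0 < wf c v) -> 1 < s ->
  (\esum_(v in cone d) (wf c v `^ (- s))%:E =
   (zeta s)%:E * \esum_(v in cone d `&` [set v | primitive v]) (wf c v `^ (- s))%:E)%E.
Proof.
move=> w0 s1; rewrite -zeta_esum // -esum_pair => [|i|j]; try by rewrite lee_fin powR_ge0.
rewrite (@reindex_esum R _ _ _ _ _ _ primitive_bij); apply: eq_esum => -[t v] [/= t0 [cv _]].
by rewrite wfZ powRM ?(ltW (w0 _ _)) // EFinM.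
Qed.

End PrimitiveVectors.

(** * The right limit of the Eisenstein series and the residue *)

Section RightLimit.
Variables (R : realType) (n d : nat).
Hypothesis n0 : (0 < n)%N.
Hypothesis d0 : (0 < d)%N.

Lemma cpow_real (x s : R) : cpow x s%:C = (x `^ s)%:C.
Proof. by rewrite /cpow /= mul0r cos0 sin0 mulr1. Qed.

Lemma light_coneE (v : 'rV[int]_n.+2) : light_cone d (map_mx intr v : 'rV[R]_n.+2) <-> cone d v.
Proof.
rewrite /light_cone /cone /= QformE !mxE ltr0z.
have -> : \sum_i (map_mx intr v : 'rV[R]_n.+2) 0 (ai i) ^+ 2 + (v 0 (xi_ n))%:~R ^+ 2 - d%:R ^+ 2 * (v 0 ord_max)%:~R ^+ 2 =
  (\sum_i v 0 (ai i) ^+ 2 + v 0 (xi_ n) ^+ 2 - d%:Z ^+ 2 * v 0 ord_max ^+ 2)%:~R.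
  rewrite intrB intrD intrM rmorph_sum !rmorphXn /= -pmulrn; congr (_ + _ - _).
  by apply: eq_bigr => i _; rewrite mxE rmorphXn.
split=> [[_ /eqP h h0]|[h h0]].
  by split=> //; apply/eqP; rewrite -subr_eq0 -(intr_eq0 R).
split=> //; last by rewrite h subrr.
apply/eqP => /rowP /(_ ord_max); rewrite !mxE => /eqP; rewrite intr_eq0 => /eqP h1.
by rewrite h1 in h0.
Qed.

(** The factor (1 + d^2)^(s/2) cancels the norm factor on the cone. In the limit lam^s cancels the
    lam^-n of the mean of Phi, which is why the residue no longer depends on g. *)
Lemma eisenstein_right_limit (g : 'M[R]_n.+2) (Dr : R -> R) (w : R) :
  (forall v, Qform d (v *m g) = Qform d v) ->
  (forall s, n%:R < s -> Dser n (2 * d) s = (Dr s)%:E) ->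
  (s - n%:R) * Dr s / zeta s @[s --> n%:R^'+] --> w ->
  exists Er : R -> R, (forall s, n%:R < s -> eisenstein_series d g s%:C = (Er s)%:C) /\
    (s - n%:R) * Er s @[s --> n%:R^'+] --> w * Vol R n (n + n).
Proof.
move=> hg HD Hw.
(* The last column of g with the sign that makes its last entry positive; on the cone only the
   absolute value of the last coordinate of v g enters. *)
pose c (j : 'I_n.+2) := Num.sg (g ord_max ord_max) * g j ord_max.
have gE := isometry_col d0 hg.
have g0 : g ord_max ord_max != 0.
  rewrite -sqrf_eq0 gE gt_eqF // ltr_wpDr // mulr_ge0 ?sqr_ge0 // addr_ge0 ?sqr_ge0 //.
  by apply: sumr_ge0 => i _; exact: sqr_ge0.
have sg1 : Num.sg (g ord_max ord_max) ^+ 2 = 1 by rewrite sqr_sg g0.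
have c0 : 0 < c ord_max by rewrite /c -normrEsg normr_gt0.
have cE : c ord_max ^+ 2 = 1 + d%:R ^+ 2 * (\sum_i c (ai i) ^+ 2 + c (xi_ n) ^+ 2).
  rewrite /c !exprMn sg1 !mul1r gE; congr (1 + _ * (_ + _)).
  by apply: eq_bigr => i _; rewrite exprMn sg1 mul1r.
have l0 := clam_gt0 d0 c0 cE; have b0 := beta_gt0 d0 c0 cE; have w0 := wf_gt0 d0 c0 cE.
have e0 : (0 < 2 * d)%N by rewrite muln_gt0.
have [P [PE Pl]] := @lattice_limit R n (2 * d) (clam d c) (cmu d c) Dr w n0 e0 l0 HD Hw.
have dd : 0 < Num.sqrt (1 + d%:R ^+ 2) :> R by rewrite sqrtr_gt0 ltr_pwDl // sqr_ge0.
have z1 (s : R) : n%:R < s -> 1 <= zeta s.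
  by move=> ns; apply: zeta_ge1; apply: le_lt_trans ns; rewrite ler1n.
have tb : 0 < 2 * d%:R * cbeta d c by apply: mulr_gt0 b0; rewrite mulr_gt0 // ltr0n.
pose Er s := clam d c `^ s * (P s / zeta s) + (2 * d%:R * cbeta d c) `^ (- s).
exists Er; split=> [s ns|].
  have s1 : 1 < s by apply: le_lt_trans ns; rewrite ler1n.
  have zs : 0 < zeta s := lt_le_trans ltr01 (z1 s ns).
  have prim : (\esum_(v in cone d `&` [set v | primitive v]) (wf c v `^ (- s))%:E = (Er s)%:E)%E.
    have := cone_esum_primitive w0 s1; rewrite (cone_esum d0 c0 cE n0 ns) PE //.
    rewrite -EFinM -EFinD.
    (* The left side is finite and zeta(s) is positive, so the primitive sum must be finite. *)
    case: (\esum_(v in _) _)%E => [x||].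
    - rewrite -EFinM => -[h]; congr EFin; apply: (mulfI (lt0r_neq0 zs)); rewrite -h /Er.
      by field; rewrite gt_eqF.
    - by rewrite gt0_muley ?lte_fin.
    - by rewrite gt0_muleNy ?lte_fin.
  pose f (v : 'rV[int]_n.+2) := if v \in cone_lattice R d then (Num.sqrt (1 + d%:R ^+ 2) * wf c v) `^ (- s) else 0.
  have f0 v : 0 <= f v by rewrite /f; case: ifP => // _; exact: powR_ge0.
  have sE : (s%:C / 2%:R) = (s / 2)%:C by rewrite rmorphM fmorphV rmorph_nat.
  rewrite /eisenstein_series sE cpow_real.
  have -> : (fun v : 'rV[int]_n.+2 => (if v \in cone_lattice R d
     then cpow (eucl_norm (map_mx intr v *m g)) (- s%:C) else 0) : R[i]^o) = (fun v => (f v)%:C : R[i]^o).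
    apply/funext => v; rewrite /f; case: ifP => [/set_mem [pv lv]|_] //.
    rewrite -rmorphN cpow_real; congr ((_ `^ _)%:C).
    have cv := (light_coneE v).1 lv.
    rewrite (eucl_norm_cone hg); last by case: lv.
    congr (_ * _); rewrite -[RHS]gtr0_norm ?w0 //.
    have -> : wf c v = Num.sg (g ord_max ord_max) * (map_mx intr v *m g) 0 ord_max.
      by rewrite /wf mxE mulr_sumr; apply: eq_bigr => j _; rewrite mxE /c mulrCA.
    by rewrite normrM normr_sg g0 mul1r.
  rewrite (@sum_esum R _ f ((Num.sqrt (1 + d%:R ^+ 2)) `^ (- s) * Er s)) //; last first.
    rewrite EFinM -prim -esumZl ?lee_fin ?powR_ge0 //; last by move=> v; rewrite lee_fin powR_ge0.
    rewrite [RHS]esum_mkcond; apply: eq_esum => v _; rewrite /f.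
    have -> : (v \in cone_lattice R d) = (v \in cone d `&` [set v | primitive v]).
      apply/idP/idP => /set_mem [h1 h2]; apply/mem_set; first by split => //; apply/light_coneE.
      by split => //; apply/light_coneE.
    case: ifP => // /set_mem [cv _].
    by rewrite powRM ?(ltW dd) ?(ltW (w0 _ _)).
  rewrite -rmorphM /=; congr (_%:C); rewrite mulrA.
  have e1 : 0 < 1 + d%:R ^+ 2 :> R by rewrite ltr_pwDl // sqr_ge0.
  rewrite -powR12_sqrt ?(ltW e1) // -powRrM -powRD ?(gt_eqF e1) ?implybT //.
  by rewrite (_ : s / 2 + _ = 0) ?powRr0 ?mul1r //; field.
rewrite /Er.
have -> : (fun s => (s - n%:R) * (clam d c `^ s * (P s / zeta s) + (2 * d%:R * cbeta d c) `^ (- s))) =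
  (fun s => clam d c `^ s * ((s - n%:R) * P s / zeta s) + (s - n%:R) * (2 * d%:R * cbeta d c) `^ (- s)).
  by apply/funext => s; rewrite mulrDr; congr (_ + _); ring.
have -> : w * Vol R n (n + n) = clam d c `^ n%:R * (w * ((clam d c ^+ n)^-1 * Vol R n (n + n))) + 0 * (2 * d%:R * cbeta d c) `^ (- n%:R).
  rewrite mul0r addr0 powR_mulrn ?(ltW l0) //; field.
  by rewrite expf_neq0 // gt_eqF.
have cid : (s : R) @[s --> n%:R^'+] --> (n%:R : R) by apply: cvg_at_right_filter; exact: cvg_id.
apply: cvgD.
  apply: cvgM Pl; exact: powR_cvg.
apply: cvgM; last exact: powRN_cvg.
rewrite -[X in _ --> X](subrr n%:R); apply: cvgB => //; exact: cvg_cst.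
Qed.

End RightLimit.

Theorem theorem4p3 (R : realType) (n d : nat)
  (hn : (1 <= n)%N) (hd : (1 <= d)%N) (hodd : odd d) (hsf : squarefree d)
  (g : 'M[R]_n.+2) (hg : G_Q d g)
  (E : R[i]^o -> R[i]^o) (hE : is_eisenstein_continuation d g E) :
  is_residue E (n%:R : R[i]^o)
    (omegaQ R n * \prod_(p <- primes d) epsilon n p (n%:R : R))%:C.
Proof.
have gQ v : Qform d (v *m g) = Qform d v.
  by have [_ ->] := connected_component_sub hg.
have [merE EE] := hE.
have [Dr [DE Dl]] := @Dser_limit R n d hn hd hodd hsf.
have [Er [ErE El]] := eisenstein_right_limit hn hd gQ DE Dl.
apply: residue_of_right_limit; first exact: merE.
have -> : omegaQ R n * \prod_(p <- primes d) epsilon n p (n%:R : R) =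
   (\prod_(p <- primes d) epsilon n p (n%:R : R)) *
    ((2 ^+ n + tau R n 0 / 2 - 1 + sgm R n) / (1 - (2 ^+ n)^-1)) * kap R n * Vol R n (n + n).
  by rewrite omegaQE // /Tfac; ring.
move: El; set w := _ * Vol R n _ => El e e0.
move/cvgrPdist_lt : El => /(_ e e0) [del /= del0 hdel].
exists del => // x /andP[x0 xd].
have ns : n%:R < n%:R + x by rewrite ltrDl.
have nC : (n%:R : R[i]) + x%:C = (n%:R + x)%:C by rewrite rmorphD rmorph_nat.
have -> : x%:C * E (n%:R + x%:C) - w%:C = (x * Er (n%:R + x) - w)%:C.
  have -> : E (n%:R + x%:C) = (Er (n%:R + x))%:C by rewrite nC EE // ErE.
  by rewrite -(rmorphM (real_complex R)) -(rmorphB (real_complex R)).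
rewrite cnorm_real distrC.
have /= := hdel (n%:R + x); rewrite opprD addrA subrr add0r normrN gtr0_norm //.
by rewrite (_ : n%:R + x - n%:R = x) ?[n%:R + x]addrC ?addrK //; apply; rewrite // addrC.
Qed.
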